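(* Let $T>0$ and let $u$ be a weak solution of the incompressible Euler equations on $D_+\times[0,T]$, where $D_+=\mathbb{T}^2\times[0,\infty)$. Assume that $u$ satisfies (i) the bulk condition $$\lim_{|y|\to 0}\frac{1}{|y|}\int_0^T\int_{D_{>|y|}}|u(x+y,t)-u(x,t)|^3\,\mathrm{d}x\,\mathrm{d}t=0 \qquad (y\in\mathbb{R}^3),$$ where $D_{>s}:=\{x=(x_1,x_2,x_3)\in\mathbb{T}^2\times\mathbb{R}: x_3>s\}$; and (ii) continuity near the boundary: $u\in L^3(0,T;C^0(\mathbb{T}^2\times[0,\delta]))$ for some $\delta>0$. Then $u$ conserves energy on $[0,T]$, i.e. $\|u(t)\|_{L^2(D_+)}=\|u(0)\|_{L^2(D_+)}$ for all $t\in[0,T]$.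
   Context: $\mathbb{T}^2$ is the two-dimensional torus, $\mathbb{R}_+=[0,\infty)$, $D_+=\mathbb{T}^2\times\mathbb{R}_+$, with boundary $\partial D_+=\mathbb{T}^2\times\{0\}$ and outer normal $n$ (so $\phi\cdot n=0$ on $\partial D_+$ means $\phi_3=0$ there). For vector fields $f,g$ and matrix fields $F,G$, $\langle f,g\rangle_{\Omega}=\int_\Omega f_ig_i\,\mathrm{d}x$ and $\langle F:G\rangle_\Omega=\int_\Omega F_{ij}G_{ij}\,\mathrm{d}x$ (summation convention). $\mathcal{S}(D_+)$ is the space of (here $\mathbb{R}^3$-valued) functions $\phi\in C^\infty(D_+)$ with $\sup_{x\in D_+}|\partial^\alpha\phi||x_3|^\beta<\infty$ for all integers $\beta\ge 0$ and all multi-indices $\alpha$ in $(x_1,x_2,x_3)$; $\mathcal{S}(D_+\times[0,T])$ is the space of $\phi\in C^\infty(D_+\times[0,T])$ with $\sup_{(x,t)\in D_+\times[0,T]}|\partial^\alpha\phi||x_3|^\beta<\infty$ for all integers $\beta\ge0$ and all multi-indices $\alpha$ in $(x_1,x_2,x_3,t)$. $\mathcal{S}_{n,\sigma}(D_+)=\{\phi\in\mathcal{S}(D_+):\nabla\cdot\phi=0,\ \phi\cdot n=0\text{ on }\partial D_+\}$, and $H_\sigma(D_+)$ is the completion of $\mathcal{S}_{n,\sigma}(D_+)$ in the $L^2(D_+)$ norm. $\mathcal{S}_{n,\sigma}(D_+\times[0,T])=\{\psi\in\mathcal{S}(D_+\times[0,T]):\nabla\cdot\psi(\cdot,t)=0,\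 \psi(\cdot,t)\cdot n=0\text{ on }\partial D_+\ \forall t\in[0,T]\}$. $C_{\mathrm w}([0,T];H_\sigma(D_+))$ is the set of functions $u:[0,T]\to H_\sigma(D_+)$ such that $t\mapsto\langle u(t),\phi\rangle_{D_+}$ is continuous for every $\phi\in L^2(D_+)$. Weak solution: a vector-valued $u\in C_{\mathrm w}([0,T];H_\sigma(D_+))$ such that $$\langle u(t),\psi(t)\rangle_{D_+}-\langle u(0),\psi(0)\rangle_{D_+}-\int_0^t\langle u(\tau),\partial_t\psi(\tau)\rangle_{D_+}\,\mathrm{d}\tau=\int_0^t\langle u(\tau)\otimes u(\tau):\nabla\psi(\tau)\rangle_{D_+}\,\mathrm{d}\tau$$ for every $t\in[0,T]$ and all $\psi\in\mathcal{S}_{n,\sigma}(D_+\times[0,T])$. *)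

(* Defs.v *)
From HB Require Import structures.
From mathcomp Require Import all_boot all_order all_algebra.
From mathcomp Require Import all_classical all_reals all_analysis.

Set Implicit Arguments.
Unset Strict Implicit.
Unset Printing Implicit Defensive.

Import Order.TTheory GRing.Theory Num.Theory numFieldNormedType.Exports.

Local Open Scope classical_set_scope.
Local Open Scope ring_scope.

(* R^3, used both for points and for vector values.  The library norm [`|x|]
   on it is the maximum norm; the Euclidean one is [enorm].  The convertible
   type [mE3] carries the Borel sigma-algebra in the form on which
   [lebesgue_measure] is defined. *)
Notation E3 R := (R * R * R)%type.
Notation mE3 R :=
  (measurableTypeR R * measurableTypeR R * measurableTypeR R)%type.

Section Space.
Context {R : realType}.
Implicit Types (x y : E3 R) (i j : 'I_3).

Definition component x i : R := tnth [tuple x.1.1; x.1.2; x.2] i.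

Definition unit_vec i : E3 R :=
  ((i == 0 :> nat)%N%:R, (i == 1 :> nat)%N%:R, (i == 2 :> nat)%N%:R).

Definition dot x y : R := \sum_(i < 3) component x i * component y i.

Definition enorm x : R := Num.sqrt (dot x x).

Definition tensor x y : 'M[R]_3 := \matrix_(i, j) (component x i * component y j).

Definition frobenius (A B : 'M[R]_3) : R :=
  \sum_(i < 3) \sum_(j < 3) A i j * B i j.

Definition volume : {measure set (mE3 R) -> \bar R} :=
  (@lebesgue_measure R \x @lebesgue_measure R \x @lebesgue_measure R)%E.

(* The torus is T^2 = (R/Z)^2.  A subset of T^2 x R is a set of points that is
   invariant under unit horizontal translations, a function on it is a
   function on this set that is 1-periodic in x_1 and x_2, and its integrals
   are taken over the fundamental cell [0,1)^2. *)
Definition cell (D : set (E3 R)) : set (E3 R) :=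
  [set x | [/\ 0 <= x.1.1 < 1, 0 <= x.1.2 < 1 & D x]].

Definition torus_periodic {W : Type} (D : set (E3 R))
    (f : E3 R -> W) : Prop :=
  forall x, D x -> f (x + unit_vec 0) = f x /\ f (x + unit_vec 1) = f x.

Definition Dplus : set (E3 R) := [set x | 0 <= x.2].

Definition above (s : R) : set (E3 R) := [set x | s < x.2].

Definition slab (delta : R) : set (E3 R) := [set x | 0 <= x.2 <= delta].

End Space.

Section Smooth.
Context {R : realType} {V W : normedModType R}.
Implicit Types (D : set V) (f : V -> W) (v x : V).

Definition quotient_within f v x (h : R) : W := h^-1 *: (f (x + h *: v) - f x).

(* The increments that keep [x + h v] in [D]: at points of the boundary of
   [D] partial derivatives are one-sided. *)
Definition increments D v x : set_system R :=
  within [set h | D (x + h *: v)] (0 : R)^'.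

Definition partial D v f : V -> W :=
  fun x => lim (quotient_within f v x @ increments D v x).

(* [partials D [:: v1; ...; vk] f] = d_v1 ... d_vk f *)
Definition partials D (s : seq V) f : V -> W := foldr (partial D) f s.

(* C^infty(D), up to the boundary of D: for the family of coordinate directions
   [b], all iterated partial derivatives exist and are continuous on D. *)
Definition smooth_on {I : Type} (b : I -> V) D f : Prop :=
  forall s : seq I,
    {within D, continuous (partials D (map b s) f)} /\
    forall i x, D x ->
      cvg (quotient_within (partials D (map b s) f) (b i) x
             @ increments D (b i) x).

End Smooth.

Section TestFunctions.
Context {R : realType}.
Implicit Types (phi : E3 R -> E3 R) (psi : E3 R * R -> E3 R).

(* A multi-index is given by a word of coordinate directions, listed with
   multiplicity; the order is immaterial for smooth functions. *)
Definition schwartz phi : Prop :=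
  [/\ torus_periodic Dplus phi,
      smooth_on unit_vec Dplus phi
    & forall (alpha : seq 'I_3) (beta : nat), exists M : R,
        forall x, Dplus x ->
          enorm (partials Dplus (map unit_vec alpha) phi x) * `|x.2| ^+ beta <= M].

Definition divergence phi (x : E3 R) : R :=
  \sum_(i < 3) component (partial Dplus (unit_vec i) phi x) i.

(* On the boundary x_3 = 0 the outer normal is (0,0,-1). *)
Definition schwartz_n_sigma phi : Prop :=
  [/\ schwartz phi,
      forall x, Dplus x -> divergence phi x = 0
    & forall x, x.2 = 0 -> (phi x).2 = 0].

Definition cylinder (T : R) : set (E3 R * R) :=
  [set z | Dplus z.1 /\ 0 <= z.2 <= T].

(* [Some i] is the direction of x_i, [None] that of t. *)
Definition st_unit_vec (i : option 'I_3) : E3 R * R :=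
  if i is Some j then (unit_vec j, 0) else (0, 1).

Definition schwartz_st (T : R) psi : Prop :=
  [/\ forall t, 0 <= t <= T -> torus_periodic Dplus (fun x => psi (x, t)),
      smooth_on st_unit_vec (cylinder T) psi
    & forall (alpha : seq (option 'I_3)) (beta : nat), exists M : R,
        forall z, cylinder T z ->
          enorm (partials (cylinder T) (map st_unit_vec alpha) psi z)
            * `|z.1.2| ^+ beta <= M].

Definition schwartz_st_n_sigma (T : R) psi : Prop :=
  schwartz_st T psi /\
  forall t, 0 <= t <= T ->
    (forall x, Dplus x -> divergence (fun y => psi (y, t)) x = 0) /\
    (forall x, x.2 = 0 -> (psi (x, t)).2 = 0).

Definition dt (T : R) psi (t : R) : E3 R -> E3 R :=
  fun x => partial (cylinder T) (st_unit_vec None) psi (x, t).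

Definition gradient phi (x : E3 R) : 'M[R]_3 :=
  \matrix_(i, j) component (partial Dplus (unit_vec i) phi x) j.

End TestFunctions.

Section FunctionSpaces.
Context {R : realType}.
Implicit Types (D : set (E3 R)) (f g : E3 R -> E3 R).
Implicit Types (F G : E3 R -> 'M[R]_3) (u v : R -> E3 R -> E3 R).

Definition inner D f g : R := \int[volume]_(x in cell D) dot (f x) (g x).

Definition inner_mx D F G : R :=
  \int[volume]_(x in cell D) frobenius (F x) (G x).

Definition L2norm D f : \bar R :=
  ((\int[volume]_(x in cell D) (enorm (f x) ^+ 2)%:E) `^ 2^-1)%E.

Definition in_L2 D f : Prop :=
  [/\ torus_periodic D f,
      forall i, measurable_fun (D : set (mE3 R)) (fun x => component (f x) i)
    & (L2norm D f < +oo)%E].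

(* Elements of L^2 are handled through representatives; the completion
   H_sigma is the closure of the test functions in L^2(D_+). *)
Definition H_sigma f : Prop :=
  in_L2 Dplus f /\
  forall eps : R, 0 < eps -> exists phi, schwartz_n_sigma phi /\
    (L2norm Dplus (f \- phi)%R < eps%:E)%E.

Definition Cw_H_sigma (T : R) u : Prop :=
  (forall t, 0 <= t <= T -> H_sigma (u t)) /\
  forall phi, in_L2 Dplus phi ->
    {within `[0, T], continuous (fun t => inner Dplus (u t) phi)}.

Definition weak_solution (T : R) u : Prop :=
  Cw_H_sigma T u /\
  forall t psi, 0 <= t <= T -> schwartz_st_n_sigma T psi ->
    let psi_ tau := fun x => psi (x, tau) in
    inner Dplus (u t) (psi_ t) - inner Dplus (u 0) (psi_ 0)
      - \int[lebesgue_measure]_(tau in `[0, t])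
          inner Dplus (u tau) (dt T psi tau)
    = \int[lebesgue_measure]_(tau in `[0, t])
        inner_mx Dplus (fun x => tensor (u tau x) (u tau x))
                       (gradient (psi_ tau)).

Definition in_C0 D f : Prop :=
  torus_periodic D f /\ {within D, continuous f}.

Definition C0norm D f : \bar R := ereal_sup [set (enorm (f x))%:E | x in D].

Definition C0_simple D v : Prop :=
  exists (n : nat) (A : 'I_n -> set R) (c : 'I_n -> E3 R -> E3 R),
    [/\ forall i, measurable (A i), forall i, in_C0 D (c i)
      & forall t x, v t x = \sum_(i < n) \1_(A i) t *: c i x].

Definition C0_strongly_measurable (T : R) D v : Prop :=
  exists s : nat -> R -> E3 R -> E3 R,
    (forall n, C0_simple D (s n)) /\
    {ae lebesgue_measure, forall t, 0 <= t <= T ->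
       C0norm D (v t \- s n t) @[n --> \oo] --> 0%E}.

(* Bochner space L^3(0,T;C^0(D)) *)
Definition in_L3_C0 (T : R) D v : Prop :=
  [/\ forall t, 0 <= t <= T -> in_C0 D (v t),
      C0_strongly_measurable T D v
    & (\int[lebesgue_measure]_(t in `[0%R, T]) (C0norm D (v t) `^ 3) < +oo)%E].

Definition continuous_near_boundary (T delta : R) u : Prop :=
  exists v, in_L3_C0 T (slab delta) v /\
    {ae lebesgue_measure, forall t, 0 <= t <= T ->
       {ae volume, forall x, slab delta x -> u t x = v t x}}.

Definition bulk_average (T : R) u (y : E3 R) : \bar R :=
  (((enorm y)^-1)%:E *
   \int[lebesgue_measure]_(t in `[0%R, T])
     \int[volume]_(x in cell (above (enorm y)))
       (enorm (u t (x + y)%R - u t x) ^+ 3)%:E)%E.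

Definition bulk_condition (T : R) u : Prop :=
  bulk_average T u y @[y --> (0 : E3 R)^'] --> 0%E.

End FunctionSpaces.

(* Main.v *)
(* Reflect u across x_3 = 0, the normal component becoming odd: the extension W
   to T^2 x R is divergence free, and its mollification at scale e by an even
   kernel is an admissible test field.  Hence <u, K_e u> changes at the rate of
   the flux of W through scale e, and by the Duchon-Robert identity this flux is
   at most 1/e times an average of the cubes of the increments W(x - y) - W(x),
   |y| <= e.

   For |x_3| > 3e these cubes integrate to o(e) by the bulk condition.  In the
   layer |x_3| <= 3e, whose volume is O(e), u is continuous up to the boundary.
   The divergence constraint, mollified at a boundary point, would be of order
   1/e if the normal component did not vanish there, so W is continuous across
   x_3 = 0 and the increments tend to 0 uniformly, for almost every time.
   Dominated convergence in time, with the cube of the C^0 norm as majorant,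
   disposes of the layer.

   The identity is applied to the bounded field obtained from W by mollifying at
   a second scale d <= e, for which |.|^3 is controlled by Jensen's inequality;
   d is chosen depending on e. *)
Require Import Defs.
From HB Require Import structures.
From mathcomp Require Import all_boot all_order all_algebra.
From mathcomp Require Import all_classical all_reals all_analysis.
From mathcomp Require Import measurable_realfun.
From mathcomp Require Import ring lra.
Import Order.TTheory GRing.Theory Num.Theory numFieldNormedType.Exports.

Local Open Scope classical_set_scope.
Local Open Scope ring_scope.

Set Implicit Arguments.
Unset Strict Implicit.
Unset Printing Implicit Defensive.

(** * The measure of T^2 x R *)

Section Preserving.
Context {R : realType}.

(** Three obstacles shape the proof. At each time [u] is measurable in space, but joint
    measurability in space and time is not given: it is recovered from weak continuity, for
    mollified fields, as a limit of functions that are constant on small time intervals. The time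
    integrals in the two regularity hypotheses are accordingly lower integrals and enter through
    monotonicity only. Test fields must decay rapidly in x_3, which the mollified reflected field
    does not. For a fixed kernel every term of the weak formulation is continuous in the test field
    for the L^2 norm, so density of the Schwartz fields in H_sigma closes this gap. The field is
    only square-integrable, so the cubes of its increments may have infinite integral. Jensen's
    inequality is therefore stated in the extended reals, and boundedness is what allows the cubic
    expression to be expanded and integrated term by term. The kernel is explicit because two
    constants matter: the L^1 norm of its gradient is at most C/e, and its normal derivative
    integrated over the lower half space is at least 1/(C e), with one C for all scales. *)

Definition preserving d (X : measurableType d) (m : set X -> \bar R)
    (g : X -> X) : Prop :=
  measurable_fun setT g /\ forall A, measurable A -> m (g @^-1` A) = m A.

Lemma preserving_id d (X : measurableType d) (m : set X -> \bar R) :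
  preserving m id.
Proof. by split. Qed.

(** Rectangles determine the product measure, and on a rectangle the image measure splits into the
    two given factors. *)
Lemma preserving_pair d1 d2 (X : measurableType d1) (Y : measurableType d2)
    (m1 : {sigma_finite_measure set X -> \bar R})
    (m2 : {sigma_finite_measure set Y -> \bar R}) (g : X -> X) (h : Y -> Y) :
  preserving m1 g -> preserving m2 h ->
  preserving (m1 \x m2)%E (fun z => (g z.1, h z.2)).
Proof.
move=> [mg pg] [mh ph].
have mgh : measurable_fun setT (fun z : X * Y => (g z.1, h z.2)).
  by apply: measurable_fun_pair; apply: measurableT_comp.
split=> // A mA.
pose gh_m := isMeasurableFun.Build _ _ _ _ _ mgh.
pose gh : {mfun _ >-> _} := HB.pack (fun z : X * Y => (g z.1, h z.2)) gh_m.
have := @product_measure_unique _ _ _ _ R m1 m2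
   (pushforward (m1 \x m2)%E gh).
rewrite /pushforward /= => H; symmetry; apply: H => // B C mB mC.
have mgB : measurable (g @^-1` B) by rewrite -(setTI (g @^-1` B)); exact: mg.
have mhC : measurable (h @^-1` C) by rewrite -(setTI (h @^-1` C)); exact: mh.
by rewrite -pg// -ph// -product_measure1E.
Qed.

Section Transfer.
Context d (X : measurableType d) (m : {measure set X -> \bar R}) (g : X -> X).
Hypothesis pg : preserving m g.

Lemma preserving_ge0_integral (f : X -> \bar R) : measurable_fun setT f ->
  (forall x, 0%E <= f x)%E -> (\int[m]_x f (g x) = \int[m]_x f x)%E.
Proof.
case: pg => mg pgA mf f0.
have /= := @ge0_integral_pushforward _ _ _ _ _ g mg m setT f measurableT mf (fun y _ => f0 y).
rewrite preimage_setT => <-.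
by apply: eq_measure_integral => A mA _; exact: pgA.
Qed.

Lemma preserving_integrable (f : X -> R) : measurable_fun setT f ->
  m.-integrable setT (EFin \o f) -> m.-integrable setT (EFin \o (f \o g)).
Proof.
move=> mf /integrableP[_ fi]; apply/integrableP; split.
  by apply/measurable_EFinP; apply: measurableT_comp => //; case: pg.
pose F x := (`|(f x)%:E|)%E.
have mF : measurable_fun setT F by apply: measurableT_comp => //; exact/measurable_EFinP.
by rewrite (preserving_ge0_integral mF) ?/F// => x; exact: abse_ge0.
Qed.

Lemma preserving_Rintegral (f : X -> R) : measurable_fun setT f ->
  m.-integrable setT (EFin \o f) -> \int[m]_x f (g x) = \int[m]_x f x.
Proof.
move=> mf fi; case: (pg) => mg pgA; rewrite /Rintegral; congr fine.
have /= := @integral_pushforward _ _ _ _ _ g mg m setT (EFin \o f).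
rewrite preimage_setT => <-//; last 2 first.
- exact/measurable_EFinP.
- exact: preserving_integrable.
by apply: eq_measure_integral => A mA _; exact: pgA.
Qed.

End Transfer.
End Preserving.

Section UnitCircle.
Context {R : realType}.
Local Notation leb := (@lebesgue_measure R).

Lemma preserving_shift (a : R) : preserving leb (fun x => x + a).
Proof.
have mg : measurable_fun setT ((fun x => x + a) : measurableTypeR R -> measurableTypeR R).
  by apply: measurable_funD.
split=> // A mA.
pose gm := isMeasurableFun.Build _ _ _ _ _ mg.
pose g : {mfun _ >-> _} := HB.pack ((fun x => x + a) : measurableTypeR R -> measurableTypeR R) gm.
have := @lebesgue_measure_unique R (pushforward leb g).
rewrite /pushforward /= => H; symmetry; apply: H => // _ [[x y]] _ <-.
have E : (fun z : R => z + a) @^-1` `]x, y] = `]x - a, y - a]%classic.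
  by apply/seteqP; split=> z; rewrite /= !in_itv/= ltrBlDr lerBrDr.
rewrite -[RHS]/(leb ((fun z : R => z + a) @^-1` `]x, y])) E.
rewrite /= !lebesgue_measure_itv/= !lte_fin ltrD2r.
by case: ifP => // _; rewrite -!EFinB; congr EFin; ring.
Qed.

Lemma unit_itv_fin : (leb (`[0%R, 1%R[ : set (measurableTypeR R)) < +oo)%E.
Proof. by rewrite lebesgue_measure_itv/= lte_fin ltr01 -EFinB ltry. Qed.

(** The circle is all of R with a measure concentrated on [[0, 1[], so periodic functions keep their
    domain. The price is that translations and the reflection act through [frac]. *)
Definition circle_measure : set (measurableTypeR R) -> \bar R :=
  @mfrestr _ (measurableTypeR R) R `[0%R, 1%R[%classic leb (measurable_itv `[0%R, 1%R[) unit_itv_fin.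

HB.instance Definition _ := FiniteMeasure.on circle_measure.

Definition frac (x : R) : R := x - (Num.floor x)%:~R.

Lemma frac_ge0 x : 0 <= frac x.
Proof. by rewrite /frac subr_ge0 floor_le. Qed.

Lemma frac_lt1 x : frac x < 1.
Proof. by have := floorD1_gt x; rewrite intrD /frac ltrBlDl. Qed.

Lemma frac_eq (x y : R) (k : int) : 0 <= y < 1 -> x = y + k%:~R -> frac x = y.
Proof.
move=> /andP[y0 y1] ->; rewrite /frac (@floor_def _ _ k) ?addrK//.
by rewrite intrD lerDr y0 addrC ltrD2l.
Qed.

Lemma frac_int x : exists k : int, frac x = x + k%:~R.
Proof. by exists (- Num.floor x); rewrite /frac intrN. Qed.

Lemma measurable_frac : measurable_fun setT (frac : measurableTypeR R -> measurableTypeR R).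
Proof.
apply: measurable_funB => //; apply: nondecreasing_measurable => //.
by move=> x y xy; rewrite ler_int le_floor.
Qed.

(** Dropping the endpoint 0 prepares the reflection: on the open interval [frac (- x)] is [1 - x],
    whereas at 0 it is 0. *)
Lemma circle_measureE (A : set (measurableTypeR R)) : measurable A ->
  circle_measure A = leb (A `&` `]0%R, 1%R[).
Proof.
move=> mA; rewrite /circle_measure /mfrestr /mrestr -(@setU1itv _ _ (BLeft 1) 0 false) ?bnd_simp//.
rewrite setIUr measureU//; last 3 first.
- exact: measurableI.
- by apply: measurableI.
- apply/seteqP; split=> // x [[_ /= ->] [_]] /=.
  by rewrite in_itv/= ltxx.
rewrite [X in (X + _)%E](_ : _ = 0%E) ?add0e//.
apply/eqP; rewrite eq_le measure_ge0 andbT -(lebesgue_measure_set1 0).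
apply: le_measure => [||x []//]; rewrite inE//; exact: measurableI.
Qed.

Lemma circle_preserving_shift (a : R) :
  preserving circle_measure (fun x => frac (x + a)).
Proof.
have mg : measurable_fun setT ((fun x => frac (x + a)) : measurableTypeR R -> measurableTypeR R).
  by apply: measurableT_comp; [exact: measurable_frac|exact: measurable_funD].
split=> // A mA.
pose b := frac a.
have b0 : 0 <= b by exact: frac_ge0.
have b1 : b < 1 by exact: frac_lt1.
have Eab x : frac (x + a) = frac (x + b).
  have h := frac_ge0 (x + b); have h1 := frac_lt1 (x + b).
  rewrite [LHS](@frac_eq _ (frac (x + b)) (Num.floor (x + b) + Num.floor a)) ?h ?h1//.
  by rewrite /frac /b /frac intrD; ring.
rewrite /circle_measure /mfrestr /mrestr.
(* A rotation by b is the translation by b on [0, 1 - b[ and by b - 1 on [1 - b, 1[; the two images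
   [b, 1[ and [0, b[ tile the circle. *)
have -> : (fun x => frac (x + a)) @^-1` A `&` `[0, 1[ =
  ((fun x => x + b) @^-1` (A `&` `[b, 1[)) `|`
  ((fun x => x + (b - 1)) @^-1` (A `&` `[0, b[)).
  apply/seteqP; split=> x /=.
    rewrite !in_itv/= Eab => -[Ax /andP[x0 x1]].
    have [h|h] := ltP (x + b) 1.
      left; move: Ax; rewrite (@frac_eq _ (x + b) 0) ?addr0//; last lra.
      by move=> Ax; split=> //; lra.
    right; move: Ax; rewrite (@frac_eq _ (x + (b - 1)) 1) //; last by ring.
      by move=> Ax; split=> //; lra.
    lra.
  rewrite !in_itv/= Eab => -[[Ax /andP[h1 h2]]|[Ax /andP[h1 h2]]].
    rewrite (@frac_eq _ (x + b) 0) ?addr0//; last lra.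
    by split=> //; lra.
  rewrite (@frac_eq _ (x + (b - 1)) 1) //; last by ring.
    by split=> //; lra.
  lra.
have mI (c d : R) : measurable (A `&` `[c, d[ : set (measurableTypeR R)).
  by apply: measurableI.
have ms (c : R) (B : set (measurableTypeR R)) : measurable B ->
    measurable ((fun x => x + c) @^-1` B : set (measurableTypeR R)).
  by move=> mB; rewrite -(setTI (_ @^-1` B)); apply: measurable_funD.
rewrite measureU; [|exact: ms|exact: ms|]; last first.
  apply/seteqP; split=> // x /= []; rewrite !in_itv/= => -[_ h1] [_ h2].
  lra.
transitivity (leb (A `&` `[b, 1%R[) + leb (A `&` `[0%R, b[))%E.
  by congr (_ + _)%E; [exact: (preserving_shift b).2|exact: (preserving_shift (b - 1)).2].
rewrite -measureU; [|exact: mI|exact: mI|]; last first.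
  apply/seteqP; split=> // x /= []; rewrite !in_itv/= => -[_ h1] [_ h2].
  lra.
congr (leb _); apply/seteqP; split=> x /=; rewrite !in_itv/=.
  by case=> -[Ax h]; split=> //; lra.
move=> [Ax h]; have [bx|bx] := leP b x; [left|right]; split=> //; lra.
Qed.

Lemma circle_preserving_opp : preserving circle_measure (fun x => frac (- x)).
Proof.
have mg : measurable_fun setT ((fun x => frac (- x)) : measurableTypeR R -> measurableTypeR R).
  by apply: measurableT_comp; [exact: measurable_frac|].
split=> // A mA.
rewrite !circle_measureE//; last by rewrite -(setTI (_ @^-1` A)); exact: mg.
have mB : measurable (A `&` `]0, 1[ : set (measurableTypeR R)).
  by apply: measurableI.
have mB1 : measurable ((fun x => x + 1) @^-1` (A `&` `]0, 1[) : set (measurableTypeR R)).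
  by rewrite -(setTI (_ @^-1` _)); apply: measurable_funD.
rewrite -[RHS](preserving_shift 1).2// -[RHS]lebesgue_measureN//.
rewrite /pushforward; congr (leb _); apply/seteqP; split=> x /=; rewrite !in_itv/=.
  move=> [Ax h]; move: Ax; rewrite (@frac_eq _ (- x + 1) (-1)) //; last by rewrite intrN; ring.
    by move=> Ax; split=> //; lra.
  lra.
move=> [Ax h]; rewrite (@frac_eq _ (- x + 1) (-1)) //; last by rewrite intrN; ring.
  by split=> //; lra.
lra.
Qed.

End UnitCircle.

Section Torus.
Context {R : realType}.
Local Notation leb := (@lebesgue_measure R).

Definition circle2_measure : set (measurableTypeR R * measurableTypeR R)%type -> \bar R :=
  (@circle_measure R \x @circle_measure R)%E.

HB.instance Definition _ := Measure.on circle2_measure.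

Lemma circle2_fin : fin_num_fun circle2_measure.
Proof.
apply: lty_fin_num_fun.
have E : circle2_measure setT = (@circle_measure R setT * @circle_measure R setT)%E.
  by rewrite /circle2_measure -setXTT; exact: product_measure1E.
rewrite -[X in (X < _)%E]/(circle2_measure setT) E.
by apply: lte_mul_pinfty => //; [exact: fin_num_measure|rewrite -ge0_fin_numE// fin_num_measure].
Qed.

HB.instance Definition _ := Measure_isFinite.Build _ _ _ circle2_measure circle2_fin.

Definition torus_measure : set (mE3 R) -> \bar R := (circle2_measure \x leb)%E.

HB.instance Definition _ := Measure.on torus_measure.

Lemma torus_sigma_finite : sigma_finite setT torus_measure.
Proof.
have [F TF Foo] := sigma_finiteT leb.
exists (fun n => setT `*` F n).
  by apply/seteqP; split=> // -[x y] _; have : setT y by []; rewrite TF => -[n _ Fn]; exists n.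
move=> k; have [mF Fk] := Foo k; split; first exact: measurableX.
rewrite /torus_measure product_measure1E//; apply: lte_mul_pinfty => //.
exact: fin_num_measure.
Qed.

HB.instance Definition _ := Measure_isSigmaFinite.Build _ _ _ torus_measure torus_sigma_finite.

Local Notation mu := torus_measure.

Lemma integral_mrestr d (X : measurableType d) (m : {measure set X -> \bar R})
    (E : set X) (mE : measurable E) (f : X -> \bar R) : measurable_fun setT f ->
  (\int[mrestr m mE]_x f x = \int[m]_(x in E) f x)%E.
Proof.
move=> mf.
have ge0 (g : X -> \bar R) : measurable_fun setT g -> (forall x, 0 <= g x)%E ->
    (\int[mrestr m mE]_x g x = \int[m]_(x in E) g x)%E.
  move=> mg g0.
  have mE' : mrestr m mE (~` E) = 0%E by rewrite /mrestr setICl measure0.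
  rewrite [LHS](@ge0_negligible_integral _ _ _ _ _ (~` E))//; last exact: measurableC.
  rewrite setTD setCK; apply: eq_measure_integral => A mA AE.
  by rewrite /= /mrestr setIidl.
rewrite [LHS]integralE [RHS]integralE; congr (_ - _)%E; apply: ge0 => //.
- exact: measurable_funepos.
- exact: measurable_funeneg.
Qed.

Let unit_cell : set (mE3 R) := (`[0, 1[ `*` `[0, 1[) `*` setT.

Let measurable_unit_cell : measurable unit_cell.
Proof. by apply: measurableX => //; apply: measurableX. Qed.

Lemma torus_measureE (A : set (mE3 R)) : measurable A ->
  mu A = volume (A `&` unit_cell).
Proof.
move=> mA.
have := @product_measure_unique _ _ _ _ R circle2_measure leb (mrestr volume measurable_unit_cell).
apply=> // B C mB mC.
have mQ : measurable (`[0, 1[ `*` `[0, 1[ : set (measurableTypeR R * measurableTypeR R)).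
  by apply: measurableX.
transitivity (volume ((B `&` (`[0, 1[ `*` `[0, 1[)) `*` C)).
  congr (volume _); apply/seteqP; split=> -[[x y] z] /=; rewrite !in_itv/=.
    by move=> [[Bx Cz] [h1 _]].
  by move=> [[Bx h1] Cz].
transitivity ((leb \x leb)%E (B `&` (`[0%R, 1%R[ `*` `[0%R, 1%R[)) * leb C)%E.
  by apply: product_measure1E => //; apply: measurableI.
congr (_ * _)%E.
have := @product_measure_unique _ _ _ _ R circle_measure circle_measure (mrestr (leb \x leb)%E mQ).
move=> H; symmetry; apply: H => // B1 B2 mB1 mB2.
by rewrite /= /mrestr -setXI; apply: product_measure1E; exact: measurableI.
Qed.

(** The integrals of the statement run over a fundamental cell, which is not translation invariant;
    [torus_measure] is, once functions are periodic. All later integrals use the latter. *)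
Lemma volume_torus (D : set (mE3 R)) (f : mE3 R -> \bar R) : measurable D ->
  measurable_fun D f ->
  (\int[volume]_(x in cell D) f x = \int[mu]_(x in D) f x)%E.
Proof.
move=> mD mf.
have -> : cell D = unit_cell `&` D.
  apply/seteqP; split=> x; rewrite /unit_cell /cell /= !in_itv/=.
    by case=> h1 h2 h3.
  by case=> -[[h1 h2] _] h3.
transitivity (\int[volume]_(x in unit_cell) (f \_ D) x)%E.
  exact: integral_mkcondr.
transitivity (\int[mu]_x (f \_ D) x)%E; last exact/esym/integral_mkcond.
transitivity (\int[mrestr volume measurable_unit_cell]_x (f \_ D) x)%E.
  apply/esym/integral_mrestr; by case: (measurable_restrictT f mD) => H _; apply: H.
by apply: eq_measure_integral => A mA _; exact/esym/torus_measureE.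
Qed.

End Torus.

(** * Integration and Fubini for real-valued functions *)

Section IntegralTools.
Context d (X : measurableType d) (R : realType) (m : {measure set X -> \bar R}).
Implicit Types f g : X -> R.

Definition integ f := m.-integrable setT (EFin \o f).

Lemma integ_meas f : integ f -> measurable_fun setT f.
Proof. by move=> /integrableP[/measurable_EFinP]. Qed.

Lemma le_integ f g : measurable_fun setT f -> (forall x, `|f x| <= g x) ->
  integ g -> integ f.
Proof.
move=> mf fg; apply: le_integrable => //; first exact/measurable_EFinP.
by move=> x _ /=; rewrite lee_fin (le_trans (fg x)) ?ler_norm.
Qed.

Lemma integD f g : integ f -> integ g -> integ (fun x => f x + g x).
Proof. by move=> fi gi; have := integrableD measurableT fi gi. Qed.

Lemma integN f : integ f -> integ (fun x => - f x).
Proof. by move=> fi; have := integrableN fi. Qed.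

Lemma integB f g : integ f -> integ g -> integ (fun x => f x - g x).
Proof. by move=> fi gi; apply: integD => //; exact: integN. Qed.

Lemma integZ k f : integ f -> integ (fun x => k * f x).
Proof. by move=> fi; have := integrableZl measurableT k fi. Qed.

Lemma integ_norm f : integ f -> integ (fun x => `|f x|).
Proof. by move=> fi; have := integrable_norm fi. Qed.

Lemma integ0 : integ (fun _ => 0).
Proof. exact: integrable0. Qed.

Lemma integ_sum (I : Type) (s : seq I) (h : I -> X -> R) :
  (forall i, integ (h i)) -> integ (fun x => \sum_(i <- s) h i x).
Proof.
move=> hi; elim: s => [|i s IH].
  by under eq_fun do rewrite big_nil; exact: integ0.
by under eq_fun do rewrite big_cons; exact: integD.
Qed.

Lemma Rint_sum (I : Type) (s : seq I) (h : I -> X -> R) :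
  (forall i, integ (h i)) ->
  \int[m]_x (\sum_(i <- s) h i x) = \sum_(i <- s) \int[m]_x h i x.
Proof.
move=> hi; elim: s => [|i s IH].
  under eq_Rintegral do rewrite big_nil.
  by rewrite big_nil /Rintegral integral0.
under eq_Rintegral do rewrite big_cons.
rewrite RintegralD//; first by rewrite IH big_cons.
  exact: hi.
exact: integ_sum.
Qed.

Lemma Rint_le f g : integ f -> integ g -> (forall x, f x <= g x) ->
  \int[m]_x f x <= \int[m]_x g x.
Proof. by move=> fi gi fg; apply: le_Rintegral. Qed.

Lemma Rint_norm f : integ f -> `|\int[m]_x f x| <= \int[m]_x `|f x|.
Proof. by move=> fi; apply: le_normr_Rintegral. Qed.

Lemma Rint_norm_le f g : integ f -> integ g -> (forall x, `|f x| <= g x) ->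
  `|\int[m]_x f x| <= \int[m]_x g x.
Proof.
move=> fi gi fg; apply: (le_trans (Rint_norm fi)).
by apply: Rint_le => //; exact: integ_norm.
Qed.

Lemma integ_ge0_lty f : measurable_fun setT f -> (forall x, 0 <= f x) ->
  (\int[m]_x (f x)%:E < +oo)%E -> integ f.
Proof.
move=> mf f0 foo; apply/integrableP; split; first exact/measurable_EFinP.
by under eq_integral do rewrite /= ger0_norm//.
Qed.

Lemma Rint_fineK f : integ f -> (\int[m]_x f x)%:E = (\int[m]_x (f x)%:E)%E.
Proof. by move=> fi; rewrite /Rintegral fineK//; apply: integrable_fin_num. Qed.

Lemma integM_bounded f g (C : R) : measurable_fun setT g ->
  (forall x, `|g x| <= C) -> integ f -> integ (fun x => f x * g x).
Proof.
move=> mg gC fi; have C0 (x : X) : 0 <= C by exact: le_trans (normr_ge0 _) (gC x).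
apply: (@le_integ _ (fun x => C * `|f x|)).
- by apply: measurable_funM => //; exact: integ_meas.
- by move=> x; rewrite normrM mulrC ler_wpM2r.
- exact/integZ/integ_norm.
Qed.

Lemma integ_indic (A : set X) : measurable A -> (m A < +oo)%E -> integ \1_A.
Proof.
move=> mA Aoo; apply: integ_ge0_lty => //.
by rewrite integral_indic// setIT.
Qed.

Lemma Rint_indic (A : set X) : measurable A -> (\int[m]_x \1_A x) = fine (m A).
Proof. by move=> mA; rewrite /Rintegral integral_indic// setIT. Qed.

(* No measurability is required of [g]: the integral of a nonnegative function is a lower integral. *)
Lemma ge0_le_lower_integral (D : set X) (f g : X -> \bar R) :
  (forall x, D x -> 0 <= f x)%E -> (forall x, D x -> f x <= g x)%E ->
  (\int[m]_(x in D) f x <= \int[m]_(x in D) g x)%E.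
Proof.
move=> f0 fg.
have g0 x : D x -> (0 <= g x)%E by move=> Dx; exact: le_trans (f0 x Dx) (fg x Dx).
rewrite !ge0_integralE//; apply: le_ereal_sup => _ [h hf <-].
exists h => // x; apply: le_trans (hf x) _; rewrite /patch; case: ifPn => // /set_mem.
exact: fg.
Qed.

End IntegralTools.

Section RFubini.
Context d1 d2 (X : measurableType d1) (Y : measurableType d2) (R : realType).
Variables (m1 : {sigma_finite_measure set X -> \bar R})
          (m2 : {sigma_finite_measure set Y -> \bar R}).
Implicit Types F : X -> Y -> R.

Definition meas2 F := measurable_fun setT (fun z : X * Y => F z.1 z.2).
Definition integ2 F := integ (m1 \x m2)%E (fun z : X * Y => F z.1 z.2).

Lemma meas2_l F y : meas2 F -> measurable_fun setT (F ^~ y).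
Proof. by move=> mF; apply: (@measurableT_comp _ _ _ _ _ _ (fun z : X * Y => F z.1 z.2) _ (fun x => (x, y))). Qed.

Lemma meas2_r F x : meas2 F -> measurable_fun setT (F x).
Proof. by move=> mF; apply: (@measurableT_comp _ _ _ _ _ _ (fun z : X * Y => F z.1 z.2) _ (pair x)). Qed.

Lemma integ2_le F h : meas2 F -> (forall x, integ m2 (F x)) -> integ m1 h ->
  (forall x, \int[m2]_y `|F x y| <= h x) -> integ2 F.
Proof.
move=> mF Fi hi Fh; apply/integrable12ltyP; first exact/measurable_EFinP.
apply: (@le_lt_trans _ _ (\int[m1]_x (h x)%:E)%E); last exact: integrable_lty.
apply: ge0_le_lower_integral => [x _|x _]; first exact: integral_ge0.
by rewrite -[leLHS](Rint_fineK (integ_norm (Fi x))) lee_fin.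
Qed.

Lemma integ2_Rint_l F : integ2 F -> (forall x, integ m2 (F x)) ->
  integ m1 (fun x => \int[m2]_y F x y).
Proof.
move=> iF Fi; have := integrable_fubini_F iF; rewrite /fubini_F.
apply: eq_integrable => // x _.
by rewrite /= -(Rint_fineK (Fi x)).
Qed.

Lemma RFubini F : integ2 F -> (forall x, integ m2 (F x)) ->
  (forall y, integ m1 (F ^~ y)) ->
  \int[m1]_x (\int[m2]_y F x y) = \int[m2]_y (\int[m1]_x F x y).
Proof.
move=> iF Fi Fi'; rewrite {1 3}/Rintegral; congr fine.
under eq_integral do rewrite (Rint_fineK (Fi _)).
under [RHS]eq_integral do rewrite (Rint_fineK (Fi' _)).
exact: (Fubini iF).
Qed.

Lemma measurable_Rint_l F : meas2 F -> (forall x, integ m2 (F x)) ->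
  measurable_fun setT (fun x => \int[m2]_y F x y).
Proof.
move=> mF Fi.
pose G (z : X * Y) := (F z.1 z.2)%:E.
have mG : measurable_fun setT G by exact/measurable_EFinP.
have mp : measurable_fun setT (fun x => \int[m2]_y (G^\+ (x, y)))%E.
  refine (@measurable_fun_fubini_tonelli_F _ _ _ _ _ m2 (G^\+)%E _ _) => //.
  exact: measurable_funepos.
have mn : measurable_fun setT (fun x => \int[m2]_y (G^\- (x, y)))%E.
  refine (@measurable_fun_fubini_tonelli_F _ _ _ _ _ m2 (G^\-)%E _ _) => //.
  exact: measurable_funeneg.
apply: measurableT_comp; first exact: fine_measurable.
have E : (fun x => \int[m2]_y (F x y)%:E)%E =
    (fun x => \int[m2]_y (G^\+ (x, y)) - \int[m2]_y (G^\- (x, y)))%E.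
  apply/funext => x; rewrite [LHS]integralE.
  by congr (_ - _)%E; apply: eq_integral => y _; rewrite ?funeposE ?funenegE.
by rewrite -[fun x => _]/(fun x => \int[m2]_y (F x y)%:E)%E E; exact: (emeasurable_funB mp mn).
Qed.

End RFubini.

Section RFubiniSwap.
Context d1 d2 (X : measurableType d1) (Y : measurableType d2) (R : realType).
Variables (m1 : {sigma_finite_measure set X -> \bar R})
          (m2 : {sigma_finite_measure set Y -> \bar R}).
Implicit Types F : X -> Y -> R.

Lemma meas2_swap F : meas2 F -> meas2 (fun y x => F x y).
Proof.
move=> mF; apply: (@measurableT_comp _ _ _ _ _ _ (fun z : X * Y => F z.1 z.2) _
  (fun z : Y * X => (z.2, z.1))) => //; exact: measurable_fun_pair.
Qed.

Lemma integ2_swap F : integ2 m1 m2 F -> integ2 m2 m1 (fun y x => F x y).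
Proof.
move=> iF; have mF : meas2 F := integ_meas iF.
apply/integrable12ltyP; first by apply/measurable_EFinP; exact: meas2_swap.
by apply/(@integrable21ltyP _ _ _ _ _ m1 m2 (fun z => (F z.1 z.2)%:E)) => //; exact/measurable_EFinP.
Qed.

Lemma integ2_Rint_r F : integ2 m1 m2 F -> (forall y, integ m1 (F ^~ y)) ->
  integ m2 (fun y => \int[m1]_x F x y).
Proof. by move=> iF Fi; apply: (integ2_Rint_l (integ2_swap iF)). Qed.

End RFubiniSwap.

(** * Joint measurability of functions continuous in one real variable *)

Section Caratheodory.
Context {R : realType}.

Lemma truncation_cvg (t : R) :
  (fun n : nat => (Num.floor (n.+1%:R * t))%:~R / n.+1%:R : R) @ \oo --> t.
Proof.
apply/cvgrPdist_le => e e0; near=> n.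
have n0 : 0 < n.+1%:R :> R by [].
rewrite (_ : t - _ = (n.+1%:R * t - (Num.floor (n.+1%:R * t))%:~R) / n.+1%:R); last first.
  by rewrite mulrBl mulrAC divff ?mul1r// gt_eqF.
rewrite normrM normfV (@ger0_norm _ n.+1%:R)// ler_pdivrMr// ler_norml.
have /andP[h1 h2] := floor_itv (n.+1%:R * t).
rewrite intrD in h2.
have h3 : 1 <= e * n.+1%:R.
  rewrite -ler_pdivrMl// mulr1 (@le_trans _ _ n%:R) ?ler_nat//.
  near: n; exact: nbhs_infty_ger.
by apply/andP; split; lra.
Unshelve. all: by end_near. Qed.

(** Sampling the first variable at the grid of mesh 1/(n+1) gives functions that are measurable on
    countably many rectangles; continuity in that variable makes them converge. For paths that are
    weakly continuous in time this is the only source of joint measurability. *)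
Lemma caratheodory_measurable d (X : measurableType d)
    (f : R -> X -> R) :
  (forall x, continuous (f ^~ x)) -> (forall t, measurable_fun setT (f t)) ->
  measurable_fun setT (fun z : measurableTypeR R * X => f z.1 z.2).
Proof.
move=> cf mf.
have H := @measurable_fun_cvg _ (measurableTypeR R * X)%type R setT
  (fun n z => f ((Num.floor (n.+1%:R * (z.1 : R)))%:~R / n.+1%:R) z.2)
  (fun z => f z.1 z.2).
apply: H => [n|[t x] _ /=]; last first.
  have h := @cvg_comp _ _ _ _ (f ^~ x) _ _ _ (@truncation_cvg t) (cf x t).
  exact: h.
move=> _ B mB; rewrite setTI.
pose fl (z : measurableTypeR R * X) := Num.floor (n.+1%:R * z.1 : R).
rewrite (_ : _ @^-1` _ = \bigcup_(k in [set: int])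
   ((fun t : measurableTypeR R => Num.floor (n.+1%:R * t : R)) @^-1` [set k] `*`
     (f (k%:~R / n.+1%:R) @^-1` B))); last first.
  apply/seteqP; split=> [[t x] /= h|[t x] /= [k _ [/= <-]]//].
  by exists (Num.floor (n.+1%:R * t)).
apply: countable_bigcupT_measurable => // k; apply: measurableX; last first.
  by rewrite -(setTI (_ @^-1` _)); exact: mf.
rewrite (_ : _ @^-1` _ = `[k%:~R / n.+1%:R, (k + 1)%:~R / n.+1%:R[%classic)//.
apply/seteqP; split=> t /=; rewrite in_itv/= ler_pdivrMr// ltr_pdivlMr// mulrC.
  by move=> <-; exact: floor_itv.
exact: floor_def.
Qed.

End Caratheodory.

(** * Integration of periodic functions on T^2 x R *)

Section TorusIntegral.
Context {R : realType}.
Local Notation mu := (@torus_measure R).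
Implicit Types (f g : E3 R -> R) (x y z : E3 R).

Definition meas f : Prop := measurable_fun setT (f : mE3 R -> R).
Definition intg f : Prop := integ mu (f : mE3 R -> R).
Definition tint f : R := \int[mu]_x f x.

Lemma intg_meas f : intg f -> meas f. Proof. exact: integ_meas. Qed.

Lemma meas_cst (c : R) : meas (fun=> c). Proof. exact: measurable_cst. Qed.
Lemma measD f g : meas f -> meas g -> meas (fun x => f x + g x).
Proof. exact: measurable_funD. Qed.
Lemma measB f g : meas f -> meas g -> meas (fun x => f x - g x).
Proof. exact: measurable_funB. Qed.
Lemma measM f g : meas f -> meas g -> meas (fun x => f x * g x).
Proof. exact: measurable_funM. Qed.
Lemma measN f : meas f -> meas (fun x => - f x).
Proof. by move=> mf; apply: measurableT_comp. Qed.
Lemma meas_norm f : meas f -> meas (fun x => `|f x|).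
Proof. by move=> mf; apply: measurableT_comp. Qed.
Lemma measX f n : meas f -> meas (fun x => f x ^+ n).
Proof. exact: measurable_funX. Qed.
Lemma measZ (c : R) f : meas f -> meas (fun x => c * f x).
Proof. by apply: measM; exact: meas_cst. Qed.
Lemma meas_sum (I : Type) (s : seq I) (h : I -> E3 R -> R) :
  (forall i, meas (h i)) -> meas (fun x => \sum_(i <- s) h i x).
Proof.
move=> hi; elim: s => [|i s IH].
  by under eq_fun do rewrite big_nil; exact: meas_cst.
by under eq_fun do rewrite big_cons; exact: measD.
Qed.

Lemma eq_intg f g : f =1 g -> intg f -> intg g.
Proof. by move=> /funext ->. Qed.
Lemma eq_tint f g : f =1 g -> tint f = tint g.
Proof. by move=> /funext ->. Qed.
Lemma le_intg f g : meas f -> (forall x, `|f x| <= g x) -> intg g -> intg f.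
Proof. exact: le_integ. Qed.
Lemma intg0 : intg (fun=> 0). Proof. exact: integ0. Qed.
Lemma intgD f g : intg f -> intg g -> intg (fun x => f x + g x).
Proof. exact: integD. Qed.
Lemma intgB f g : intg f -> intg g -> intg (fun x => f x - g x).
Proof. exact: integB. Qed.
Lemma intgN f : intg f -> intg (fun x => - f x).
Proof. exact: integN. Qed.
Lemma intgZ k f : intg f -> intg (fun x => k * f x).
Proof. exact: integZ. Qed.
Lemma intg_norm f : intg f -> intg (fun x => `|f x|).
Proof. exact: integ_norm. Qed.
Lemma intg_sum (I : Type) (s : seq I) (h : I -> E3 R -> R) :
  (forall i, intg (h i)) -> intg (fun x => \sum_(i <- s) h i x).
Proof. exact: integ_sum. Qed.
Lemma intgM_bounded f g (C : R) : meas g -> (forall x, `|g x| <= C) -> intg f ->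
  intg (fun x => f x * g x).
Proof. exact: integM_bounded. Qed.

Lemma tintD f g : intg f -> intg g -> tint (fun x => f x + g x) = tint f + tint g.
Proof. by move=> fi gi; apply: RintegralD. Qed.
Lemma tintB f g : intg f -> intg g -> tint (fun x => f x - g x) = tint f - tint g.
Proof. by move=> fi gi; apply: RintegralB. Qed.
Lemma tintZ k f : intg f -> tint (fun x => k * f x) = k * tint f.
Proof. by move=> fi; apply: RintegralZl. Qed.
Lemma tintN f : intg f -> tint (fun x => - f x) = - tint f.
Proof.
move=> fi; rewrite -mulN1r -tintZ//; apply: eq_tint => x; by rewrite mulN1r.
Qed.
Lemma tint0 : tint (fun=> 0) = 0.
Proof. by rewrite /tint /Rintegral integral0. Qed.
Lemma tint_sum (I : Type) (s : seq I) (h : I -> E3 R -> R) :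
  (forall i, intg (h i)) ->
  tint (fun x => \sum_(i <- s) h i x) = \sum_(i <- s) tint (h i).
Proof. exact: Rint_sum. Qed.
Lemma le_tint f g : intg f -> intg g -> (forall x, f x <= g x) -> tint f <= tint g.
Proof. exact: Rint_le. Qed.
Lemma tint_ge0 f : (forall x, 0 <= f x) -> 0 <= tint f.
Proof. by move=> f0; apply: Rintegral_ge0. Qed.
Lemma tint_norm_le f g : intg f -> intg g -> (forall x, `|f x| <= g x) ->
  `|tint f| <= tint g.
Proof. exact: Rint_norm_le. Qed.

Lemma measurable_triple d (X : measurableType d) (g1 g2 g3 : X -> R) f :
  measurable_fun setT g1 -> measurable_fun setT g2 -> measurable_fun setT g3 ->
  meas f -> measurable_fun setT (fun w : X => f (g1 w, g2 w, g3 w)).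
Proof.
move=> m1 m2 m3 mf.
apply: (@measurableT_comp _ _ _ _ _ _ (f : mE3 R -> R) _
  (fun w : X => (g1 w, g2 w, g3 w) : mE3 R)) => //.
by apply: measurable_fun_pair => //; exact: measurable_fun_pair.
Qed.

Let m11 : measurable_fun setT (fun x : mE3 R => x.1.1 : R).
Proof. exact: measurableT_comp. Qed.
Let m12 : measurable_fun setT (fun x : mE3 R => x.1.2 : R).
Proof. exact: measurableT_comp. Qed.
Let m2 : measurable_fun setT (fun x : mE3 R => x.2 : R).
Proof. exact: measurable_snd. Qed.

Lemma meas_coord : [/\ meas (fun x => x.1.1), meas (fun x => x.1.2) & meas (fun x => x.2)].
Proof. by split. Qed.

Lemma meas_affine f (a b : E3 R) : meas f ->
  meas (fun x => f (a.1.1 * x.1.1 + b.1.1, a.1.2 * x.1.2 + b.1.2, a.2 * x.2 + b.2)).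
Proof.
by move=> mf; apply: (measurable_triple (X := mE3 R)) => //; apply: measD;
  try (apply: measZ; by []); exact: meas_cst.
Qed.

Lemma meas_shift f y : meas f -> meas (fun x => f (x + y)).
Proof.
move=> /(meas_affine (1, 1, 1) y); rewrite /meas/=; under eq_fun do rewrite !mul1r.
by [].
Qed.

Lemma meas_sub f y : meas f -> meas (fun x => f (y - x)).
Proof.
move=> /(meas_affine (-1, -1, -1) y); congr measurable_fun; apply/funext => -[[a b] c].
by case: y => [[y1 y2] y3] /=; congr f; rewrite !mulN1r ![- _ + _]addrC.
Qed.

Definition refl x : E3 R := (x.1.1, x.1.2, - x.2).

Lemma reflK : involutive refl.
Proof. by move=> [[a b] c]; rewrite /refl/= opprK. Qed.

Lemma reflD x y : refl (x + y) = refl x + refl y.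
Proof. by case: x => [[a b] c]; case: y => [[a' b'] c']; rewrite /refl/= opprD. Qed.

Lemma reflN x : refl (- x) = - refl x.
Proof. by []. Qed.

Lemma meas_refl f : meas f -> meas (fun x => f (refl x)).
Proof.
move=> /(meas_affine (1, 1, -1) 0); rewrite /meas/=; under eq_fun do rewrite !mul1r !addr0 mulN1r.
by [].
Qed.

(** The sigma-algebra here is a product of three Borel ones rather than the one generated by the
    open sets of R^3; freezing one coordinate after the other reduces to continuity in a single
    variable. *)
Lemma continuous_meas f : continuous f -> meas f.
Proof.
move=> cf.
have cpair (T1 T2 : topologicalType) (a : T1) : continuous (fun t : T2 => (a, t)).
  by move=> t; apply: cvg_pair; [exact: cvg_cst|exact: cvg_id].
have cpair' (T1 T2 : topologicalType) (a : T1) : continuous (fun t : T2 => (t, a)).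
  by move=> t; apply: cvg_pair; [exact: cvg_id|exact: cvg_cst].
pose F (t : R) (z : measurableTypeR R * measurableTypeR R) := f (z.1, z.2, t).
have mF : measurable_fun setT
    (fun z : measurableTypeR R * (measurableTypeR R * measurableTypeR R) => F z.1 z.2).
  apply: caratheodory_measurable => [z|t].
    by move=> t; apply: (@continuous_comp _ _ _ (pair (z.1, z.2)) f); [exact: cpair|exact: cf].
  refine (@caratheodory_measurable R _ (measurableTypeR R) (fun s (r : measurableTypeR R) => f (s, r, t)) _ _) => [y|s].
    move=> s; apply: (@continuous_comp _ _ _ (fun s : R => (s, y, t)) f); last exact: cf.
    apply: (@continuous_comp _ _ _ (fun s : R => (s, y)) (fun w => (w, t))); last exact: cpair'.
    exact: cpair'.
  apply: continuous_measurable_fun => y.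
  apply: (@continuous_comp _ _ _ (fun y : R => (s, y, t)) f); last exact: cf.
  apply: (@continuous_comp _ _ _ (fun y : R => (s, y)) (fun w => (w, t))); last exact: cpair'.
  exact: cpair.
pose G (w : mE3 R) : measurableTypeR R * (measurableTypeR R * measurableTypeR R) :=
  (w.2, (w.1.1, w.1.2)).
have mG : measurable_fun setT G.
  by apply: measurable_fun_pair => //; exact: measurable_fun_pair.
have := measurableT_comp mF mG; congr measurable_fun.
by apply/funext => -[[a b] c].
Qed.

(** Arbitrary integer shifts in both directions at once, because [frac] subtracts an unspecified
    integer. *)
Definition periodic {W : Type} (f : E3 R -> W) : Prop :=
  forall x (k l : int), f (x + (k%:~R, l%:~R, 0)) = f x.

Lemma torus_periodicP {W : Type} (f : E3 R -> W) : torus_periodic setT f -> periodic f.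
Proof.
move=> pf.
have p0 x : f (x + unit_vec 0) = f x by case: (pf x I).
have p1 x : f (x + unit_vec 1) = f x by case: (pf x I).
have u0 : unit_vec 0 = (1, 0, 0) :> E3 R by [].
have u1 : unit_vec 1 = (0, 1, 0) :> E3 R by [].
have q0 x (k : nat) : f (x + (k%:R, 0, 0)) = f x.
  elim: k => [|k IH]; first by rewrite (_ : (_, _, _) = 0) ?addr0.
  rewrite -[RHS]IH -[RHS]p0; congr f; rewrite -addrA u0; congr (_ + (_, _, _));
   by rewrite /= ?addr0// -natr1.
have q1 x (k : nat) : f (x + (0, k%:R, 0)) = f x.
  elim: k => [|k IH]; first by rewrite (_ : (_, _, _) = 0) ?addr0.
  rewrite -[RHS]IH -[RHS]p1; congr f; rewrite -addrA u1; congr (_ + (_, _, _));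
   by rewrite /= ?addr0// -natr1.
have r0 x (k : int) : f (x + (k%:~R, 0, 0)) = f x.
  case: k => k; first exact: q0.
  rewrite -(q0 _ k.+1) -addrA; congr f; rewrite -[RHS]addr0; congr (_ + (_, _, _));
   by rewrite /= ?addr0// NegzE intrN addNr.
have r1 x (k : int) : f (x + (0, k%:~R, 0)) = f x.
  case: k => k; first exact: q1.
  rewrite -(q1 _ k.+1) -addrA; congr f; rewrite -[RHS]addr0; congr (_ + (_, _, _));
   by rewrite /= ?addr0// NegzE intrN addNr.
move=> x k l; rewrite -[RHS](r0 _ k) -[RHS](r1 _ l) -addrA; congr (f (_ + (_, _, _)));
 by rewrite /= ?addr0 ?add0r.
Qed.

Lemma periodic_shift {W : Type} (f : E3 R -> W) y : periodic f -> periodic (fun x => f (x + y)).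
Proof. by move=> pf x k l; rewrite addrAC pf. Qed.

Lemma periodic_sub {W : Type} (f : E3 R -> W) y : periodic f -> periodic (fun x => f (y - x)).
Proof.
move=> pf x k l; rewrite opprD addrA -[RHS](pf _ (- k) (- l)).
by congr (f (_ + (_, _, _))); rewrite /= ?intrN ?oppr0.
Qed.

Lemma periodic_refl {W : Type} (f : E3 R -> W) : periodic f -> periodic (fun x => f (refl x)).
Proof. by move=> pf x k l; rewrite reflD -[RHS](pf _ k l) /refl/= oppr0. Qed.

Lemma torus_preserving_shift y :
  preserving mu (fun x => (frac (x.1.1 + y.1.1), frac (x.1.2 + y.1.2), x.2 + y.2)).
Proof.
have h : preserving circle2_measure _ := @preserving_pair R _ _ _ _ circle_measure
  circle_measure _ _ (circle_preserving_shift y.1.1) (circle_preserving_shift y.1.2).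
exact: (preserving_pair h (preserving_shift y.2)).
Qed.

Lemma torus_preserving_opp :
  preserving mu (fun x => (frac (- x.1.1), frac (- x.1.2), - x.2)).
Proof.
have h : preserving circle2_measure _ := @preserving_pair R _ _ _ _ circle_measure
  circle_measure _ _ circle_preserving_opp circle_preserving_opp.
have h' : preserving (@lebesgue_measure R) -%R; last exact: (preserving_pair h h').
split=> [|A mA]; first exact: oppr_measurable.
exact: lebesgue_measureN.
Qed.

Lemma torus_preserving_refl :
  preserving mu refl.
Proof.
have h : preserving circle2_measure _ := @preserving_pair R _ _ _ _ circle_measure
  circle_measure _ _ (preserving_id (@circle_measure R)) (preserving_id (@circle_measure R)).
have h' : preserving (@lebesgue_measure R) -%R; last exact: (preserving_pair h h').
split=> [|A mA]; first exact: oppr_measurable.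
exact: lebesgue_measureN.
Qed.

Lemma periodic_frac {W : Type} (f : E3 R -> W) (a b c : R) : periodic f ->
  f (frac a, frac b, c) = f (a, b, c).
Proof.
move=> pf; have [k ->] := frac_int a; have [l ->] := frac_int b.
by rewrite -[RHS](pf _ k l); congr f; congr (_, _, _); rewrite /= addr0.
Qed.

Lemma periodic_shiftE {W : Type} (f : E3 R -> W) y : periodic f ->
  f \o (fun x => (frac (x.1.1 + y.1.1), frac (x.1.2 + y.1.2), x.2 + y.2)) =
  (fun x => f (x + y)).
Proof. by move=> pf; apply/funext => x /=; rewrite periodic_frac. Qed.

Lemma periodic_oppE {W : Type} (f : E3 R -> W) : periodic f ->
  f \o (fun x => (frac (- x.1.1), frac (- x.1.2), - x.2)) = (fun x => f (- x)).
Proof. by move=> pf; apply/funext => x /=; rewrite periodic_frac. Qed.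

Lemma tint_shift f y : periodic f -> intg f -> tint (fun x => f (x + y)) = tint f.
Proof.
move=> pf fi; rewrite -(periodic_shiftE y pf).
exact: (preserving_Rintegral (torus_preserving_shift y) (intg_meas fi) fi).
Qed.

Lemma intg_shift f y : periodic f -> intg f -> intg (fun x => f (x + y)).
Proof.
move=> pf fi; rewrite -(periodic_shiftE y pf).
exact: (preserving_integrable (torus_preserving_shift y) (intg_meas fi) fi).
Qed.

Lemma tint_opp f : periodic f -> intg f -> tint (fun x => f (- x)) = tint f.
Proof.
move=> pf fi; rewrite -(periodic_oppE pf).
exact: (preserving_Rintegral torus_preserving_opp (intg_meas fi) fi).
Qed.

Lemma intg_opp f : periodic f -> intg f -> intg (fun x => f (- x)).
Proof.
move=> pf fi; rewrite -(periodic_oppE pf).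
exact: (preserving_integrable torus_preserving_opp (intg_meas fi) fi).
Qed.

Lemma tint_sub f y : periodic f -> intg f -> tint (fun x => f (y - x)) = tint f.
Proof.
move=> pf fi.
have pf' := periodic_shift (f := f) y pf.
rewrite -[RHS](tint_shift y pf fi) -[RHS](tint_opp pf' (intg_shift y pf fi)).
by apply: eq_tint => x; rewrite addrC.
Qed.

Lemma intg_sub f y : periodic f -> intg f -> intg (fun x => f (y - x)).
Proof.
move=> pf fi; have pf' := periodic_shift (f := f) y pf.
by apply: eq_intg (intg_opp pf' (intg_shift y pf fi)) => x; rewrite addrC.
Qed.

Lemma tint_refl f : intg f -> tint (fun x => f (refl x)) = tint f.
Proof. move=> fi; exact: (preserving_Rintegral torus_preserving_refl (intg_meas fi) fi). Qed.

Lemma intg_refl f : intg f -> intg (fun x => f (refl x)).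
Proof. move=> fi; exact: (preserving_integrable torus_preserving_refl (intg_meas fi) fi). Qed.

Lemma ge0_integral_shift (f : E3 R -> \bar R) y : periodic f ->
  measurable_fun setT (f : mE3 R -> \bar R) -> (forall x, 0 <= f x)%E ->
  (\int[mu]_x f ((x : E3 R) + y)%R = \int[mu]_x f x)%E.
Proof.
move=> pf mf f0; rewrite -(preserving_ge0_integral (torus_preserving_shift y) mf f0).
by rewrite -[in LHS](periodic_shiftE y pf).
Qed.

Definition tmeas2 (F : E3 R -> E3 R -> R) : Prop :=
  @meas2 _ _ (mE3 R) (mE3 R) R F.
Definition tintg2 (F : E3 R -> E3 R -> R) : Prop :=
  @integ2 _ _ (mE3 R) (mE3 R) R mu mu F.

Lemma tmeas2_l f : meas f -> tmeas2 (fun x _ => f x).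
Proof. by move=> mf; apply: (@measurableT_comp _ _ _ _ _ _ (f : mE3 R -> R) _ fst). Qed.
Lemma tmeas2_r f : meas f -> tmeas2 (fun _ x => f x).
Proof. by move=> mf; apply: (@measurableT_comp _ _ _ _ _ _ (f : mE3 R -> R) _ snd). Qed.
Lemma tmeas2M F G : tmeas2 F -> tmeas2 G -> tmeas2 (fun x y => F x y * G x y).
Proof. exact: measurable_funM. Qed.
Lemma tmeas2D F G : tmeas2 F -> tmeas2 G -> tmeas2 (fun x y => F x y + G x y).
Proof. exact: measurable_funD. Qed.

Let mm (h : mE3 R -> R) : measurable_fun setT h ->
  measurable_fun setT (fun z : mE3 R * mE3 R => h z.1).
Proof. by move=> mh; apply: measurableT_comp. Qed.
Let mm' (h : mE3 R -> R) : measurable_fun setT h ->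
  measurable_fun setT (fun z : mE3 R * mE3 R => h z.2).
Proof. by move=> mh; apply: measurableT_comp. Qed.

Lemma tmeas2_sub f : meas f -> tmeas2 (fun x y => f (x - y)).
Proof.
by move=> mf; apply: (measurable_triple (X := (mE3 R * mE3 R)%type)) => //;
  apply: measurable_funB; first [exact: (mm m11)|exact: (mm m12)|exact: (mm m2)|exact: (mm' m11)|exact: (mm' m12)|exact: (mm' m2)].
Qed.
Lemma tmeas2_swap F : tmeas2 F -> tmeas2 (fun x y => F y x).
Proof. exact: meas2_swap. Qed.

Lemma tintg2_le F h : tmeas2 F -> (forall x, intg (F x)) -> intg h ->
  (forall x, tint (fun y => `|F x y|) <= h x) -> tintg2 F.
Proof. exact: integ2_le. Qed.
Lemma tintg2_l F : tintg2 F -> (forall x, intg (F x)) -> intg (fun x => tint (F x)).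
Proof. exact: integ2_Rint_l. Qed.
Lemma tintg2_r F : tintg2 F -> (forall y, intg (F ^~ y)) -> intg (fun y => tint (F ^~ y)).
Proof. exact: integ2_Rint_r. Qed.
Lemma tint_Fubini F : tintg2 F -> (forall x, intg (F x)) -> (forall y, intg (F ^~ y)) ->
  tint (fun x => tint (F x)) = tint (fun y => tint (F ^~ y)).
Proof. exact: RFubini. Qed.
Lemma meas_tint_l F : tmeas2 F -> (forall x, intg (F x)) -> meas (fun x => tint (F x)).
Proof. exact: measurable_Rint_l. Qed.

Lemma tintg2_swap F : tintg2 (fun y x => F x y) -> tintg2 F.
Proof. exact: integ2_swap. Qed.

End TorusIntegral.

(** * Square-integrable functions and mollifiers *)

Section SquareIntegrable.
Context {R : realType}.
Implicit Types (f g : E3 R -> R) (x y z : E3 R).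

Definition sqi f : Prop := meas f /\ intg (fun x => f x ^+ 2).

Definition norm2 f : R := Num.sqrt (tint (fun x => f x ^+ 2)).

Lemma norm2_ge0 f : 0 <= norm2 f. Proof. exact: sqrtr_ge0. Qed.

Lemma norm2_sqr f : norm2 f ^+ 2 = tint (fun x => f x ^+ 2).
Proof. by rewrite sqr_sqrtr// tint_ge0// => x; exact: sqr_ge0. Qed.

Lemma normM_le_sqr (a b : R) : `|a * b| <= a ^+ 2 + b ^+ 2.
Proof.
rewrite normrM -(real_normK (num_real a)) -(real_normK (num_real b)).
have := normr_ge0 a; have := normr_ge0 b; nra.
Qed.

Lemma sqi_intgM f g : sqi f -> sqi g -> intg (fun x => f x * g x).
Proof.
move=> [mf fi] [mg gi]; apply: (@le_intg _ _ (fun x => f x ^+ 2 + g x ^+ 2)).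
- exact: measM.
- by move=> x; exact: normM_le_sqr.
- exact: intgD.
Qed.

Lemma le_sqi f g : meas f -> (forall x, `|f x| <= `|g x|) -> sqi g -> sqi f.
Proof.
move=> mf fg [mg gi]; split=> //; apply: (@le_intg _ _ (fun x => g x ^+ 2)) => //.
  exact: measX.
move=> x; rewrite normrX -[leRHS]real_normK ?num_real//.
by rewrite lerXn2r ?nnegrE.
Qed.

Lemma sqiD f g : sqi f -> sqi g -> sqi (fun x => f x + g x).
Proof.
move=> sf sg; split; first exact: (measD sf.1 sg.1).
apply: (@le_intg _ _ (fun x => 2 * f x ^+ 2 + 2 * g x ^+ 2)).
- by apply: measX; exact: (measD sf.1 sg.1).
- by move=> x; rewrite ger0_norm ?sqr_ge0//; have := sqr_ge0 (f x - g x); nra.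
- by apply: intgD; apply: intgZ; [exact: sf.2|exact: sg.2].
Qed.

Lemma sqiZ k f : sqi f -> sqi (fun x => k * f x).
Proof.
move=> [mf fi]; split; first exact: measZ.
by apply: eq_intg (intgZ (k ^+ 2) fi) => x; rewrite exprMn.
Qed.

Lemma sqiN f : sqi f -> sqi (fun x => - f x).
Proof.
move=> [mf fi]; split; first exact: measN.
by apply: eq_intg fi => x; rewrite sqrrN.
Qed.

Lemma sqiB f g : sqi f -> sqi g -> sqi (fun x => f x - g x).
Proof. by move=> sf sg; apply: sqiD => //; exact: sqiN. Qed.

Lemma sqi_norm f : sqi f -> sqi (fun x => `|f x|).
Proof. by move=> sf; apply: (le_sqi _ _ sf) => [|x]; [exact: (meas_norm sf.1)|rewrite normr_id]. Qed.

Lemma sqiM_bounded f g (C : R) : meas g -> (forall x, `|g x| <= C) -> sqi f ->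
  sqi (fun x => f x * g x).
Proof.
move=> mg gC sf; apply: (@le_sqi _ (fun x => C * f x)).
- exact: measM sf.1 mg.
- move=> x; have C0 : 0 <= C by exact: le_trans (normr_ge0 _) (gC x).
  by rewrite !normrM (ger0_norm C0) mulrC ler_wpM2r.
- exact: sqiZ.
Qed.

Lemma sqi_bounded_intg f (C : R) : (forall x, `|f x| <= C) -> intg f -> sqi f.
Proof.
move=> fC fi; split; first exact: intg_meas.
by apply: (intgM_bounded (intg_meas fi) fC fi).
Qed.

(* The discriminant of t |-> int (f - t g)^2 *)
Lemma cauchy_schwarz f g : sqi f -> sqi g ->
  `|tint (fun x => f x * g x)| <= norm2 f * norm2 g.
Proof.
move=> sf sg; have fgi := sqi_intgM sf sg.
set b := tint _.
suff : b ^+ 2 <= norm2 f ^+ 2 * norm2 g ^+ 2.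
  rewrite -exprMn -[X in X <= _]real_normK ?num_real//.
  by rewrite ler_pXn2r// nnegrE// mulr_ge0// norm2_ge0.
rewrite !norm2_sqr; set a := tint _; set c := tint _.
have a0 : 0 <= a by apply: tint_ge0 => x; exact: sqr_ge0.
have c0 : 0 <= c by apply: tint_ge0 => x; exact: sqr_ge0.
have H t : 0 <= a - 2 * t * b + t ^+ 2 * c.
  rewrite -!tintZ//; [|exact: sg.2].
  rewrite -tintB//; [|exact: sf.2|exact: intgZ].
  rewrite -tintD; [|by apply: intgB; [exact: sf.2|exact: intgZ]|by apply: intgZ; exact: sg.2].
  apply: tint_ge0 => x; rewrite (_ : _ + _ = (f x - t * g x) ^+ 2) ?sqr_ge0//; ring.
have [c0'|c0'] := eqVneq c 0.
  have [->|b0] := eqVneq b 0; first by rewrite c0'; lra.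
  (* With c = 0 the inequality is affine in t, and this t gives its right-hand side the value -1. *)
  have := H ((a + 1) / (2 * b)); rewrite c0' mulr0 addr0.
  rewrite (_ : 2 * _ * b = a + 1); last by field.
  lra.
have cp : 0 < c by rewrite lt_def c0' c0.
have := H (b / c).
rewrite (_ : a - _ + _ = (a * c - b ^+ 2) / c); last by field.
by rewrite pmulr_lge0 ?invr_gt0// subr_ge0.
Qed.

Lemma norm2D f g : sqi f -> sqi g -> norm2 (fun x => f x + g x) <= norm2 f + norm2 g.
Proof.
move=> sf sg; rewrite -(ler_pXn2r (n := 2))// ?nnegrE ?addr_ge0 ?norm2_ge0//.
rewrite norm2_sqr (_ : tint _ = tint (fun x => (f x ^+ 2 + 2 * (f x * g x)) + g x ^+ 2)); last first.
  by apply: eq_tint => x; ring.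
rewrite tintD; [|by apply: intgD; [exact: sf.2|exact/intgZ/sqi_intgM]|exact: sg.2].
rewrite tintD; [|exact: sf.2|exact/intgZ/sqi_intgM].
rewrite tintZ; [|exact: sqi_intgM]; rewrite -!norm2_sqr.
have := cauchy_schwarz sf sg; have := ler_norm (tint (fun x => f x * g x)); lra.
Qed.

Lemma norm2Z k f : sqi f -> norm2 (fun x => k * f x) = `|k| * norm2 f.
Proof.
move=> sf; rewrite /norm2 (_ : tint _ = k ^+ 2 * tint (fun x => f x ^+ 2)).
  by rewrite sqrtrM ?sqr_ge0// sqrtr_sqr.
by rewrite -tintZ; [apply: eq_tint => x; ring|exact: sf.2].
Qed.

Lemma norm2B f g : norm2 (fun x => f x - g x) = norm2 (fun x => g x - f x).
Proof. by rewrite /norm2; congr Num.sqrt; apply: eq_tint => x; ring. Qed.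

Lemma le_norm2 f g : sqi f -> sqi g -> (forall x, `|f x| <= `|g x|) -> norm2 f <= norm2 g.
Proof.
move=> sf sg fg; apply: ler_wsqrtr; apply: le_tint; [exact: sf.2|exact: sg.2|].
move=> x; rewrite -[leLHS]real_normK ?num_real// -[leRHS]real_normK ?num_real//.
by rewrite lerXn2r ?nnegrE.
Qed.

Lemma sqi_shift f y : periodic f -> sqi f -> sqi (fun x => f (x + y)).
Proof.
move=> pf [mf fi]; split; first exact: meas_shift.
by apply: (@intg_shift _ (fun x => f x ^+ 2)) => // x k l; rewrite pf.
Qed.

Lemma norm2_shift f y : periodic f -> sqi f -> norm2 (fun x => f (x + y)) = norm2 f.
Proof.
move=> pf [mf fi]; congr Num.sqrt.
by apply: (@tint_shift _ (fun x => f x ^+ 2)) => // x k l; rewrite pf.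
Qed.

Lemma sqi_refl f : sqi f -> sqi (fun x => f (refl x)).
Proof.
move=> [mf fi]; split; first exact: meas_refl.
exact: (@intg_refl _ (fun x => f x ^+ 2)).
Qed.

Lemma sqi0 : sqi (fun=> 0).
Proof. by split; [exact: meas_cst|apply: eq_intg (@intg0 R) => x; rewrite expr0n]. Qed.

(** T^2 x R has infinite measure, so square-integrable functions need not be integrable; strips have
    measure equal to their height and serve as the cutoffs for Cauchy-Schwarz. *)
Definition strip (a b : R) x : R := \1_(`[a, b]%classic : set R) x.2.

Lemma stripE a b x : strip a b x = ((a <= x.2 <= b)%R)%:R.
Proof. by rewrite /strip indicE mem_setE in_itv. Qed.

Let Dstrip a b : set (mE3 R) := setT `*` `[a, b]%classic.

Lemma strip_indic a b : strip a b = \1_(Dstrip a b).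
Proof.
apply/funext => x; rewrite stripE indicE /Dstrip; congr (nat_of_bool _)%:R.
apply/idP/idP => [h|]; first by rewrite inE/=; split=> //; rewrite /= in_itv.
by rewrite inE => -[_ /=]; rewrite in_itv.
Qed.

Lemma circle2_measureT : @circle2_measure R setT = 1%E.
Proof.
transitivity (@circle_measure R setT * @circle_measure R setT)%E.
  by rewrite /circle2_measure -setXTT; exact: product_measure1E.
by rewrite circle_measureE// setTI lebesgue_measure_itv/= lte_fin ltr01 sube0 mule1.
Qed.

Lemma measure_strip a b : (torus_measure (Dstrip a b) = (Num.max (b - a) 0)%:E)%E.
Proof.
rewrite /torus_measure /Dstrip product_measure1E//.
rewrite -[X in (X * _)%E]/(circle2_measure setT) circle2_measureT.
rewrite mul1e; transitivity (lebesgue_measure (`[a, b]%classic : set (measurableTypeR R))) => //.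
rewrite lebesgue_measure_itv/= lte_fin; case: ifPn => [ab|].
  by rewrite -EFinB; congr EFin; apply/esym/max_idPl; lra.
by rewrite -leNgt => ba; congr EFin; apply/esym/max_idPr; lra.
Qed.

Lemma intg_strip a b : intg (strip a b).
Proof.
rewrite strip_indic; apply: integ_indic; first exact: measurableX.
by rewrite [X in (X < _)%E]measure_strip ltry.
Qed.

Lemma tint_strip a b : a <= b -> tint (strip a b) = b - a.
Proof.
move=> ab; rewrite strip_indic /tint Rint_indic; last exact: measurableX.
by rewrite [X in fine X]measure_strip/=; apply/max_idPl; lra.
Qed.

Lemma meas_strip a b : meas (strip a b).
Proof. by apply: intg_meas; exact: intg_strip. Qed.

Lemma intg_bounded_strip f (C a b : R) : meas f -> (forall x, `|f x| <= C) ->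
  (forall x, ~~ (a <= x.2 <= b) -> f x = 0) -> intg f.
Proof.
move=> mf fC f0; apply: (@le_intg _ _ (fun x => C * strip a b x)) => //.
  move=> x; rewrite stripE; have [h|h]/= := boolP (a <= x.2 <= b); last by rewrite (f0 x)// normr0 mulr0.
  by rewrite mulr1.
exact/intgZ/intg_strip.
Qed.

End SquareIntegrable.

(** * A smooth bump with explicit derivatives *)

Section ExpBump.
Context {R : realType}.
Implicit Types (P Q : {poly R}) (x s t : R).

Lemma exprn_le_expR n s : 0 <= s -> s ^+ n <= n`!%:R * expR s.
Proof.
move=> s0; case: n => [|n]; first by rewrite expr0 fact0 mul1r -expR0 ler_expR.
rewrite -ler_pdivrMl ?ltr0n ?fact_gt0// mulrC.
by apply: le_trans (expR_ge1Dxn n s0); rewrite lerDr.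
Qed.

Lemma horner_le_expR P : exists2 C : R, 0 <= C & forall s, 0 <= s -> `|P.[s]| <= C * expR s.
Proof.
exists (\sum_(i < size P) `|P`_i| * i`!%:R).
  by apply: sumr_ge0 => i _; rewrite mulr_ge0.
move=> s s0; rewrite horner_coef; apply: (le_trans (ler_norm_sum _ _ _)).
rewrite mulr_suml; apply: ler_sum => i _; rewrite normrM -mulrA ler_wpM2l//.
by rewrite ger0_norm ?exprn_ge0// exprn_le_expR.
Qed.

(** The functions P(1/x) exp(-1/x), extended by 0, are closed under differentiation: the derivative
    replaces P by X^2 (P - P'). All derivatives of the bump thus stay explicit, and smoothness
    becomes a statement about one family. *)
Definition ebump P x : R := if 0 < x then P.[x^-1] * expR (- x^-1) else 0.

Definition ebump_deriv P : {poly R} := 'X^2 * (P - P^`()).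

Lemma ebumpXM P x : ebump ('X * P) x = x^-1 * ebump P x.
Proof. by rewrite /ebump; case: ifPn => h; rewrite ?mulr0// hornerM hornerX mulrA. Qed.

(** The exponential beats any polynomial in s = 1/x, so one more power of 1/x can be paid for by
    |x|. Applied to ['X * P] it shows that the difference quotient of [ebump P] at 0 tends to 0. *)
Lemma ebump_le P : exists2 C : R, 0 <= C & forall x, `|ebump P x| <= C * `|x|.
Proof.
have [C C0 HC] := horner_le_expR ('X * P); exists C => // x.
rewrite /ebump; case: ifPn => [x0|_]; last by rewrite normr0 mulr_ge0.
rewrite (gtr0_norm x0) -ler_pdivrMr// normrM (gtr0_norm (expR_gt0 _)).
have := HC x^-1; rewrite invr_ge0 ltW// => /(_ isT).
rewrite hornerM hornerX normrM gtr0_norm ?invr_gt0// => h.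
rewrite expRN mulrAC ler_pdivrMr ?expR_gt0//.
by rewrite mulrC.
Qed.

Lemma is_derive_cvg (f : R -> R) x l :
  (h^-1 * (f (h + x) - f x)) @[h --> (0 : R)^'] --> l -> is_derive x 1 f l.
Proof.
move=> H.
have H' : h^-1 *: (f (h *: (1 : R) + x) - f x) @[h --> (0 : R)^'] --> l.
  rewrite [X in X @ _ --> _](_ : _ = (fun h => h^-1 * (f (h + x) - f x)))//.
  by apply/funext => h; rewrite /GRing.scale/= mulr1.
apply: DeriveDef; first by apply/cvg_ex; exists l.
exact/cvg_lim.
Qed.

Lemma is_derive_ebump P x : is_derive x 1 (ebump P) (ebump (ebump_deriv P) x).
Proof.
have [x0|x0|<-] := ltgtP 0 x.
- pose g (y : R) := P.[y^-1] * expR (- y^-1).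
  apply: (@near_eq_is_derive _ _ _ g).
    near=> y; rewrite /g /ebump ifT//; near: y; exact: lt_nbhsr.
  have dV : is_derive x (1:R) (fun y : R => y^-1) (- x ^- 2).
    have := @is_deriveV R id x 1 1; rewrite gt_eqF// => /(_ isT _) /is_derive_eq.
    by apply; rewrite /GRing.scale/= mulr1.
  have dP := is_derive1_comp (is_derive_poly P x^-1) dV.
  have dN : is_derive x (1 : R) (fun y : R => - y^-1) (- - x ^- 2) by exact: is_deriveN.
  have dE := @is_derive1_comp R expR (fun y : R => - y^-1) x (expR (- x^-1)) _ (is_derive_expR _) dN.
  have := is_deriveM dP dE => /is_derive_eq; apply.
  rewrite /ebump x0 /ebump_deriv hornerM hornerXn hornerD hornerN /GRing.scale/= exprVn.
  by rewrite opprK; ring.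
- apply: (@near_eq_is_derive _ _ _ (cst 0)).
    near=> y; rewrite /ebump ifF//; apply/negbTE; rewrite -leNgt ltW//.
    by near: y; exact: lt_nbhsl.
  by rewrite /ebump ifF; [exact: is_derive_cst|apply/negbTE; rewrite -leNgt ltW].
- have -> : ebump (ebump_deriv P) 0 = 0 by rewrite /ebump ltxx.
  apply: is_derive_cvg.
  have [C C0 HC] := ebump_le ('X * P).
  apply/cvgrPdist_le => e e0; near=> h.
  rewrite addr0 {2}/ebump ltxx subr0 -ebumpXM sub0r normrN (le_trans (HC h))//.
  apply: (@le_trans _ _ ((C + 1) * `|h|)); first by rewrite ler_wpM2r// lerDl.
  rewrite -ler_pdivlMl ?ltr_wpDl// mulrC.
  by near: h; apply: dnbhs0_le; rewrite divr_gt0// ltr_wpDl.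
Unshelve. all: by end_near. Qed.

Definition bump_eval (l : seq ({poly R} * {poly R})) s : R :=
  \sum_(pq <- l) ebump pq.1 (1 + s) * ebump pq.2 (1 - s).

(** Leibniz' rule on each product; the sign of the second term comes from differentiating 1 - s. *)
Definition bump_step (l : seq ({poly R} * {poly R})) :=
  flatten [seq [:: (ebump_deriv pq.1, pq.2); (pq.1, - ebump_deriv pq.2)] | pq <- l].

(* n-th derivative of exp(-1/(1+s)) exp(-1/(1-s)), extended by 0 outside ]-1,1[ *)
Definition bump n : R -> R := bump_eval (iter n bump_step [:: (1, 1)]).

Lemma ebumpN P x : ebump (- P) x = - ebump P x.
Proof. by rewrite /ebump hornerN; case: ifPn => _; rewrite ?oppr0// mulNr. Qed.

Lemma is_derive_bump_eval l s : is_derive s 1 (bump_eval l) (bump_eval (bump_step l) s).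
Proof.
elim: l => [|[P Q] l IH].
  rewrite /bump_eval big_nil (_ : (fun _ => _) = cst 0); first exact: is_derive_cst.
  by apply/funext => t; rewrite big_nil.
rewrite {2}/bump_eval /bump_step/= !big_cons -/(bump_step l) -/(bump_eval (bump_step l) s).
rewrite (_ : bump_eval _ = ((fun t => ebump P (1 + t)) * (fun t => ebump Q (1 - t))) + bump_eval l); last first.
  by apply/funext => t; rewrite /bump_eval big_cons.
rewrite addrA; apply: is_deriveD => //.
have d1 : is_derive s (1:R) (fun t => 1 + t) 1.
  have := is_deriveD (is_derive_cst (1:R) (s:R) (1:R)) (is_derive_id (s:R) (1:R)).
  by rewrite add0r.
have d2 : is_derive s (1:R) (fun t => 1 - t) (-1).
  have := is_deriveB (is_derive_cst (1:R) (s:R) (1:R)) (is_derive_id (s:R) (1:R)).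
  by rewrite sub0r.
have e1 := @is_derive1_comp R (ebump P) (fun t => 1 + t) s _ _ (is_derive_ebump P _) d1.
have e2 := @is_derive1_comp R (ebump Q) (fun t => 1 - t) s _ _ (is_derive_ebump Q _) d2.
have := is_deriveM e1 e2 => /is_derive_eq; apply.
by rewrite /= ebumpN /GRing.scale/=; ring.
Qed.

Lemma is_derive_bump n s : is_derive s 1 (bump n) (bump n.+1 s).
Proof. exact: is_derive_bump_eval. Qed.

Lemma bump_eval_supp l s : 1 <= `|s| -> bump_eval l s = 0.
Proof.
move=> s1; rewrite /bump_eval big1// => pq _; rewrite /ebump.
case: ltP => h1; last by rewrite mul0r.
case: ltP => h2; last by rewrite mulr0.
suff : `|s| < 1 by rewrite ltNge s1.
by rewrite ltr_norml; apply/andP; split; lra.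
Qed.

Lemma bump_supp n s : 1 <= `|s| -> bump n s = 0.
Proof. exact: bump_eval_supp. Qed.

Lemma bump_eval_le l : exists2 C : R, 0 <= C & forall s, `|bump_eval l s| <= C.
Proof.
elim: l => [|[P Q] l [C C0 HC]].
  by exists 0 => // s; rewrite /bump_eval big_nil normr0.
have [A A0 HA] := ebump_le P; have [B B0 HB] := ebump_le Q.
exists (A * 2 * (B * 2) + C); first by rewrite addr_ge0// !mulr_ge0.
move=> s; have [s1|s1] := leP 1 `|s|.
  by rewrite bump_eval_supp// normr0 addr_ge0// !mulr_ge0.
rewrite /bump_eval big_cons (le_trans (ler_normD _ _))// lerD//; last exact: HC.
move: s1; rewrite ltr_norml => /andP[s1 s2].
rewrite normrM ler_pM//=.
  by rewrite (le_trans (HA _))// ler_wpM2l// ger0_norm; lra.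
by rewrite (le_trans (HB _))// ler_wpM2l// ger0_norm; lra.
Qed.

Lemma bump_le n : exists2 C : R, 0 <= C & forall s, `|bump n s| <= C.
Proof. exact: bump_eval_le. Qed.

Lemma bump0E s : bump 0 s = ebump 1 (1 + s) * ebump 1 (1 - s).
Proof. by rewrite /bump /bump_eval/= big_cons big_nil addr0. Qed.

Lemma bump1E s : bump 1 s = ebump 'X^2 (1 + s) * ebump 1 (1 - s) - ebump 1 (1 + s) * ebump 'X^2 (1 - s).
Proof.
rewrite /bump /bump_eval/= !big_cons big_nil addr0 /= ebumpN mulrN.
by rewrite /ebump_deriv -[X in _ - X^`()]polyC1 derivC subr0 mulr1.
Qed.

Lemma ebump_ge0 P x : (forall y, 0 <= y -> 0 <= P.[y]) -> 0 <= ebump P x.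
Proof.
move=> P0; rewrite /ebump; case: ifPn => // x0.
by rewrite mulr_ge0 ?expR_ge0// P0// invr_ge0 ltW.
Qed.

Lemma bump_ge0 s : 0 <= bump 0 s.
Proof. by rewrite bump0E mulr_ge0// ebump_ge0// => y _; rewrite hornerE. Qed.

Lemma bump_even s : bump 0 (- s) = bump 0 s.
Proof. by rewrite !bump0E opprK mulrC. Qed.

Lemma bump0_le1 s : bump 0 s <= 1.
Proof.
have H x : 0 <= ebump 1 x <= 1.
  rewrite ebump_ge0/=; last by move=> y _; rewrite hornerE.
  rewrite /ebump; case: ifPn => // x0; rewrite hornerE mul1r expR_le1 oppr_le0 invr_ge0; exact: ltW.
rewrite bump0E; have /andP[a0 a1] := H (1 + s); have /andP[b0 b1] := H (1 - s).
exact: mulr_ile1.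
Qed.

(* Both factors are at least exp(-2) for |s| <= 1/2. *)
Lemma bump0_ge s : `|s| <= 2^-1 -> expR (- 4) <= bump 0 s.
Proof.
rewrite ler_norml => /andP[s1 s2].
have H x : 2^-1 <= x -> expR (- 2) <= ebump 1 x.
  move=> x2; have x0 : 0 < x by lra.
  rewrite /ebump x0 hornerE mul1r ler_expR lerN2 -[leRHS]invrK.
  by rewrite lef_pV2// posrE// invr_gt0.
rewrite bump0E (_ : - 4 = - 2 + - 2) ?expRD; last by lra.
by apply: ler_pM; rewrite ?expR_ge0//; apply: H; lra.
Qed.

Lemma ebump1 x : 0 < x -> ebump 1 x = expR (- x^-1).
Proof. by move=> x0; rewrite /ebump x0 hornerC mul1r. Qed.

Lemma ebumpX2 x : 0 < x -> ebump 'X^2 x = x^-1 ^+ 2 * expR (- x^-1).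
Proof. by move=> x0; rewrite /ebump x0 hornerXn. Qed.

Lemma bump1_le0 s : 0 <= s -> bump 1 s <= 0.
Proof.
move=> s0; rewrite bump1E subr_le0.
have [s1|s1] := ltP s 1; last first.
  have E P : ebump P (1 - s) = 0 by rewrite /ebump ifF//; apply/negbTE; rewrite -leNgt; lra.
  by rewrite !E !mulr0.
rewrite !ebumpX2 ?ebump1; [|lra..].
set a := expR _; set b := expR _.
rewrite (_ : _ * a * b = a * b * (1 + s)^-1 ^+ 2); last by ring.
rewrite (_ : a * (_ * b) = a * b * (1 - s)^-1 ^+ 2); last by ring.
rewrite ler_wpM2l ?mulr_ge0 ?expR_ge0//.
have h : (1 + s)^-1 <= (1 - s)^-1 by rewrite lef_pV2 ?posrE; lra.
by rewrite ler_pXn2r// nnegrE invr_ge0; lra.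
Qed.

(** The derivative is minus the bump times 4 s / (1 - s^2)^2, a factor at least 1 when s >= 1/4.
    This quantitative slope is the origin of the lower bound [mol_trace]. *)
Lemma bump1_le s : 4^-1 <= s <= 2^-1 -> bump 1 s <= - (expR (- 4)).
Proof.
move=> /andP[s1 s2]; rewrite bump1E.
have h1 : 0 < 1 + s by lra.
have h2 : 0 < 1 - s by lra.
have := @bump0_ge s; rewrite ger0_norm; last lra.
move=> /(_ s2); rewrite bump0E.
rewrite !ebumpX2// !ebump1// => E.
set a := expR (- (1 + s)^-1) in E *; set b := expR (- (1 - s)^-1) in E *.
have -> : (1 + s)^-1 ^+ 2 * a * b - a * ((1 - s)^-1 ^+ 2 * b) =
   - (a * b * ((1 - s)^-1 ^+ 2 - (1 + s)^-1 ^+ 2)) by ring.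
rewrite lerN2 (le_trans E)// ler_peMr ?mulr_ge0 ?expR_ge0//.
have -> : (1 - s)^-1 ^+ 2 - (1 + s)^-1 ^+ 2 = 4 * s / ((1 - s) ^+ 2 * (1 + s) ^+ 2).
  by field; rewrite !gt_eqF.
rewrite ler_pdivlMr; last by rewrite mulr_gt0// exprn_gt0.
have h3 : (1 - s) * (1 + s) <= 1 by nra.
have h4 : 0 <= (1 - s) * (1 + s) by apply: mulr_ge0; lra.
rewrite mul1r -exprMn expr2 (le_trans (mulr_ile1 h4 h4 h3 h3))//; lra.
Qed.

Lemma is_derive_lipschitz (f f' : R -> R) (C : R) : (forall s : R, is_derive s 1 f (f' s)) ->
  (forall s, `|f' s| <= C) -> forall s h : R, `|f (s + h) - f s| <= C * `|h|.
Proof.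
move=> df Hf.
have cf : continuous f.
  by move=> s; apply/differentiable_continuous/derivable1_diffP; case: (df s).
have H (s h : R) : 0 <= h -> `|f (s + h) - f s| <= C * `|h|.
  move=> h0; have [||c _ ->] := @MVT_segment R f f' s (s + h) _ (fun x _ => df x).
  - by rewrite lerDl.
  - exact: continuous_subspaceT.
  - by rewrite addrAC subrr add0r normrM ler_wpM2r.
move=> s h; have [h0|h0] := leP 0 h; first exact: H.
by have := H (s + h) (- h); rewrite addrK normrN distrC; apply; lra.
Qed.

(** The mean value theorem is applied to the remainder f(s + r) - r f'(s), whose derivative is at
    most C |r|; the factor 1/2 of Taylor's formula is given up. Such quadratic bounds replace
    differentiation under the integral sign later on. *)
Lemma is_derive_taylor (f f' f'' : R -> R) (C : R) : (forall s : R, is_derive s 1 f (f' s)) ->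
  (forall s : R, is_derive s 1 f' (f'' s)) -> (forall s, `|f'' s| <= C) ->
  forall s h : R, `|f (s + h) - f s - h * f' s| <= C * h ^+ 2.
Proof.
move=> df df' Hf s h.
have C0 : 0 <= C by exact: le_trans (normr_ge0 _) (Hf 0).
have lip := is_derive_lipschitz df' Hf.
pose g (r : R) := f (s + r) - r * f' s.
have dg (r : R) : is_derive r 1 g (f' (s + r) - f' s).
  have d1 : is_derive r (1:R) (fun t => s + t) 1.
    have := is_deriveD (is_derive_cst (s:R) (r:R) (1:R)) (is_derive_id (r:R) (1:R)).
    by rewrite add0r.
  have e1 := @is_derive1_comp R f (fun t => s + t) r _ _ (df _) d1.
  have e2 := is_deriveM (is_derive_id (r:R) (1:R)) (is_derive_cst (f' s : R) (r:R) (1:R)).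
  have := is_deriveB e1 e2 => /is_derive_eq; apply.
  by rewrite /GRing.scale/=; ring.
have cg : continuous g.
  by move=> r; apply/differentiable_continuous/derivable1_diffP; case: (dg r).
have E : f (s + h) - f s - h * f' s = g h - g 0.
  by rewrite /g addr0 mul0r subr0; ring.
have key c : `|c| <= `|h| -> `|(f' (s + c) - f' s) * h| <= C * h ^+ 2.
  move=> ch; rewrite normrM -[h ^+ 2]real_normK ?num_real// expr2 mulrA ler_wpM2r//.
  by rewrite (le_trans (lip _ _))// ler_wpM2l.
rewrite E; have [h0|h0] := leP 0 h.
  have [//||c cI ->] := @MVT_segment R g _ 0 h _ (fun x _ => dg x).
    exact: continuous_subspaceT.
  move: cI; rewrite in_itv/= => /andP[c0 ch].
  by rewrite subr0; apply: key; rewrite !ger0_norm.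
have [||c cI] := @MVT_segment R g _ h 0 _ (fun x _ => dg x).
- exact: ltW.
- exact: continuous_subspaceT.
rewrite sub0r => E'; rewrite -normrN opprB E' mulrN normrN; apply: key.
move: cI; rewrite in_itv/= => /andP[c0 ch].
by rewrite !ler0_norm ?lerN2// ltW.
Qed.

End ExpBump.

Lemma ord3P (P : 'I_3 -> Prop) : P 0 -> P 1 -> P 2 -> forall i, P i.
Proof.
move=> p0 p1 p2 [[|[|[|//]]] hi].
- by rewrite (_ : Ordinal hi = 0)//; apply: val_inj.
- by rewrite (_ : Ordinal hi = 1)//; apply: val_inj.
- by rewrite (_ : Ordinal hi = 2)//; apply: val_inj.
Qed.

(** * Periodic mollifiers at scale e *)

Section Mollifier.
Context {R : realType}.
Implicit Types (x y z : E3 R) (s : seq 'I_3).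

(* [K s] is the iterated partial derivative of the kernel [K [::]] along the word [s]. *)
Record mollifier (C e : R) (K : seq 'I_3 -> E3 R -> R) : Prop := Mollifier {
  mol_periodic : forall s, periodic (K s);
  mol_bound : forall s, exists M, forall x, `|K s x| <= M;
  mol_lip : forall s i, exists M, forall x (h : R),
    `|K s (x + h *: unit_vec i) - K s x| <= M * `|h|;
  mol_taylor : forall s i, exists M, forall x (h : R),
    `|K s (x + h *: unit_vec i) - K s x - h * K (i :: s) x| <= M * h ^+ 2;
  mol_supp : forall s x, K s x != 0 -> exists k l : int,
    [/\ `|x.1.1 + k%:~R| <= e, `|x.1.2 + l%:~R| <= e & `|x.2| <= e];
  mol_even : forall x, K [::] (- x) = K [::] x;
  mol_refl : forall x, K [::] (refl x) = K [::] x;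
  mol_ge0 : forall x, 0 <= K [::] x;
  mol_tint : tint (K [::]) = 1;
  mol_grad : forall i, tint (fun x => `|K [:: i] x|) <= C / e;
  mol_trace : C^-1 / e <= tint (fun x => ((x.2 <= 0)%R)%:R * K [:: 2] x)
}.

Definition box (a1 b1 a2 b2 a3 b3 : R) x : R :=
  ([&& a1 <= frac x.1.1 <= b1, a2 <= frac x.1.2 <= b2 & a3 <= x.2 <= b3])%:R.

Lemma lebesgue_measure_segment (a b : R) : a <= b ->
  lebesgue_measure (`[a, b]%classic : set (measurableTypeR R)) = (b - a)%:E.
Proof.
move=> ab; rewrite lebesgue_measure_itv/= lte_fin; case: ifPn => [_|].
  by rewrite EFinB.
rewrite -leNgt => ba; have -> : b - a = 0 by apply/eqP; rewrite subr_eq0 eq_le ba ab.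
by [].
Qed.

Lemma circle_measure_itv (a b : R) : 0 < a -> a <= b -> b < 1 ->
  circle_measure (frac @^-1` `[a, b]) = (b - a)%:E.
Proof.
move=> a0 ab b1.
have [_ /(_ `[a, b]%classic)] := @circle_preserving_shift R 0.
have -> : (fun x : R => frac (x + 0)) = frac by apply/funext => x; rewrite addr0.
move=> ->//; rewrite circle_measureE//.
have -> : `[a, b]%classic `&` `]0, 1[%classic = `[a, b]%classic.
  apply/seteqP; split=> [t []//|t /=]; rewrite !in_itv/= => h; split=> //; lra.
exact: lebesgue_measure_segment.
Qed.

Lemma box_intg (a1 b1 a2 b2 a3 b3 : R) : 0 < a1 -> a1 <= b1 -> b1 < 1 ->
  0 < a2 -> a2 <= b2 -> b2 < 1 -> a3 <= b3 ->
  intg (box a1 b1 a2 b2 a3 b3) /\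
  tint (box a1 b1 a2 b2 a3 b3) = (b1 - a1) * (b2 - a2) * (b3 - a3).
Proof.
move=> a10 ab1 b11 a20 ab2 b21 ab3.
have mfr (a b : R) : measurable (frac @^-1` `[a, b] : set (measurableTypeR R)).
  by rewrite -(setTI (_ @^-1` _)); exact: measurable_frac.
pose B : set (mE3 R) := (frac @^-1` `[a1, b1] `*` frac @^-1` `[a2, b2]) `*` `[a3, b3]%classic.
have mB : measurable B by apply: measurableX => //; exact: measurableX.
have -> : box a1 b1 a2 b2 a3 b3 = \1_B.
  apply/funext => x; rewrite indicE; congr (nat_of_bool _)%:R.
  apply/idP/idP => [/and3P[h1 h2 h3]|].
    by rewrite inE /B/= !in_itv/=.
  by rewrite inE /B/= !in_itv/= => -[[-> ->] ->].
have mu2 : circle2_measure (frac @^-1` `[a1, b1] `*` frac @^-1` `[a2, b2]) =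
    ((b1 - a1) * (b2 - a2))%:E.
  transitivity (circle_measure (frac @^-1` `[a1, b1]) * circle_measure (frac @^-1` `[a2, b2]))%E.
    exact: product_measure1E.
  by rewrite !circle_measure_itv.
have muB : torus_measure B = ((b1 - a1) * (b2 - a2) * (b3 - a3))%:E.
  transitivity (circle2_measure (frac @^-1` `[a1, b1] `*` frac @^-1` `[a2, b2]) *
     lebesgue_measure (`[a3, b3]%classic : set (measurableTypeR R)))%E.
    by apply: product_measure1E => //; exact: measurableX.
  by rewrite mu2 lebesgue_measure_segment.
split; first by apply: integ_indic => //; rewrite [X in (X < _)%E]muB ltry.
by rewrite /tint Rint_indic// [X in fine X]muB.
Qed.

Lemma norm_mul3_le (a b d A B D : R) : `|a| <= A -> `|b| <= B -> `|d| <= D ->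
  `|a * b * d| <= A * B * D.
Proof. by move=> hA hB hD; rewrite !normrM !ler_pM// mulr_ge0. Qed.

(** The bounded factor [a] stands for the product of the two one-dimensional factors of the kernel
    that are not being differentiated. *)
Lemma derive_lipschitz_taylor (f f' f'' : R -> R) (M : R) : (forall t : R, is_derive t 1 f (f' t)) ->
  (forall t : R, is_derive t 1 f' (f'' t)) ->
  (exists2 A : R, 0 <= A & forall t, `|f' t| <= A) -> (exists2 A : R, 0 <= A & forall t, `|f'' t| <= A) ->
  0 <= M -> exists N : R, forall (t h a : R), `|a| <= M ->
    `|(f (t + h) - f t) * a| <= N * `|h| /\ `|(f (t + h) - f t - h * f' t) * a| <= N * h ^+ 2.
Proof.
move=> df df' [A A0 HA] [B B0 HB] M0; exists (A * M + B * M) => t h a aM; split.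
  rewrite normrM (le_trans (ler_pM _ _ (is_derive_lipschitz df HA t h) aM))//.
  by rewrite mulrAC ler_wpM2r// lerDl mulr_ge0.
rewrite normrM (le_trans (ler_pM _ _ (is_derive_taylor df df' HB t h) aM))//.
by rewrite mulrAC ler_wpM2r ?sqr_ge0// lerDr mulr_ge0.
Qed.

Section Construction.
Variable e : R.
Hypothesis (e0 : 0 < e) (e4 : e <= 4^-1).

(** The factor e^-n makes [profV n.+1] exactly the derivative of [profV n]. [profP] periodizes by
    moving t into [-1/2, 1/2[; since e <= 1/4 the supports of the lattice copies do not meet. *)
Definition profV n (t : R) : R := e ^- n * bump n (t / e).
Definition profP n (t : R) : R := profV n (frac (t + 2^-1) - 2^-1).

Lemma profV_der n (t : R) : is_derive t 1 (profV n) (profV n.+1 t).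
Proof.
have d1 : is_derive t (1:R) (fun t : R => t / e) e^-1.
  have := is_deriveM (is_derive_id (t:R) (1:R)) (is_derive_cst (e^-1 : R) (t:R) (1:R)).
  by move=> /is_derive_eq; apply; rewrite /GRing.scale/= mulr0 add0r mulr1.
have d2 := @is_derive1_comp R (bump n) (fun t => t / e) t _ _ (is_derive_bump n _) d1.
have := is_deriveM (is_derive_cst (e ^- n : R) (t:R) (1:R)) d2.
move=> /is_derive_eq; apply; rewrite /GRing.scale/= mulr0 addr0 /profV.
by rewrite exprS invfM; ring.
Qed.

Lemma profV_supp n t : e <= `|t| -> profV n t = 0.
Proof.
move=> et; rewrite /profV bump_supp ?mulr0// normrM normfV (gtr0_norm e0).
by rewrite ler_pdivlMr// mul1r.
Qed.

Lemma profV_le n : exists2 M : R, 0 <= M & forall t, `|profV n t| <= M.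
Proof.
have [M M0 HM] := @bump_le R n; exists (e ^- n * M).
  by rewrite mulr_ge0// invr_ge0 exprn_ge0// ltW.
have en : 0 <= e ^- n by rewrite invr_ge0 exprn_ge0// ltW.
by move=> t; rewrite /profV normrM (ger0_norm en) ler_wpM2l.
Qed.

(** The radius 3/4 exceeds 1/2, so around every t a single integer k serves in a whole
    neighbourhood, and derivatives can be read off from [profV]. At distances between 1/2 and 3/4
    both sides vanish because e <= 1/4. *)
Lemma profP_near n (t : R) (k : int) : `|t - k%:~R| < 3 / 4 -> profP n t = profV n (t - k%:~R).
Proof.
move=> tk; rewrite /profP.
have [h1 h2] := (frac_ge0 (t + 2^-1), frac_lt1 (t + 2^-1)).
move: (tk); rewrite ltr_norml => /andP[h3 h4].
have [h|h] := boolP (- 2^-1 <= t - k%:~R < 2^-1).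
  rewrite (@frac_eq _ _ (t - k%:~R + 2^-1) k); last by ring.
    by rewrite addrK.
  lra.
rewrite [RHS]profV_supp; last first.
  by rewrite (le_trans e4)// ler_normr; move: h; rewrite negb_and -!ltNge; lra.
apply: profV_supp; rewrite (le_trans e4)//.
move: h; rewrite negb_and -ltNge -leNgt => /orP[h5|h5].
  have -> : frac (t + 2^-1) = t + 2^-1 - k%:~R + 1.
    apply: (@frac_eq _ _ _ (k - 1)); first by apply/andP; split; lra.
    by rewrite intrB; ring.
  by rewrite ger0_norm; lra.
have -> : frac (t + 2^-1) = t + 2^-1 - k%:~R - 1.
  apply: (@frac_eq _ _ _ (k + 1)); first by apply/andP; split; lra.
  by rewrite intrD; ring.
by rewrite ler0_norm; lra.
Qed.

Lemma profP_der n (t : R) : is_derive t 1 (profP n) (profP n.+1 t).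
Proof.
pose k := Num.floor (t + 2^-1).
have [h1 h2] := (frac_ge0 (t + 2^-1), frac_lt1 (t + 2^-1)).
rewrite /frac -/k in h1 h2.
have tk : `|t - k%:~R| < 3 / 4 by rewrite ltr_norml; apply/andP; split; lra.
pose g (r : R) := profV n (r - k%:~R).
apply: (@near_eq_is_derive _ _ _ g).
  near=> t'; apply/esym/profP_near.
  have : `|t - t'| < 4^-1.
    by near: t'; apply: (@cvgr_dist_lt _ _ _ _ _ id t) => //; exact: cvg_id.
  rewrite !ltr_norml => /andP[? ?]; apply/andP; split; lra.
rewrite (profP_near _ tk).
have d1 : is_derive t (1:R) (fun t : R => t - k%:~R) 1.
  have := is_deriveB (is_derive_id (t:R) (1:R)) (is_derive_cst (k%:~R : R) (t:R) (1:R)).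
  by rewrite subr0.
have := @is_derive1_comp R (profV n) (fun t => t - k%:~R) t _ _ (profV_der n _) d1.
by rewrite mulr1.
Unshelve. all: by end_near. Qed.

Lemma profP_le n : exists2 M : R, 0 <= M & forall t, `|profP n t| <= M.
Proof. by have [M M0 HM] := profV_le n; exists M => // t; exact: HM. Qed.

Lemma profP_per n (t : R) (k : int) : profP n (t + k%:~R) = profP n t.
Proof.
rewrite /profP; congr (profV n (_ - _)).
apply: (@frac_eq _ _ _ (k + Num.floor (t + 2^-1))).
  by rewrite frac_ge0 frac_lt1.
by rewrite /frac intrD; ring.
Qed.

Lemma profV_even t : profV 0 (- t) = profV 0 t.
Proof. by rewrite /profV mulNr bump_even. Qed.

Lemma profP_even t : profP 0 (- t) = profP 0 t.
Proof.
pose k := Num.floor (t + 2^-1).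
have [h1 h2] := (frac_ge0 (t + 2^-1), frac_lt1 (t + 2^-1)).
rewrite /frac -/k in h1 h2.
rewrite (@profP_near _ t k); last by rewrite ltr_norml; apply/andP; split; lra.
rewrite (@profP_near _ (- t) (- k)); last by rewrite ltr_norml intrN; apply/andP; split; lra.
by rewrite intrN -profV_even; congr (profV 0 _); ring.
Qed.

Lemma profV_cont n : continuous (profV n).
Proof. by move=> t; apply/differentiable_continuous/derivable1_diffP; case: (profV_der n t). Qed.
Lemma profP_cont n : continuous (profP n).
Proof. by move=> t; apply/differentiable_continuous/derivable1_diffP; case: (profP_der n t). Qed.

(** A word enters the kernel only through its letter counts, so mixed derivatives commute by
    construction. *)
Definition kn1 s := count_mem (0 : 'I_3) s.
Definition kn2 s := count_mem (1 : 'I_3) s.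
Definition kn3 s := count_mem (2 : 'I_3) s.

Definition kern s x : R := profP (kn1 s) x.1.1 * profP (kn2 s) x.1.2 * profV (kn3 s) x.2.

Lemma kern_per s : periodic (kern s).
Proof. by move=> x k l; rewrite /kern /= addr0 !profP_per. Qed.

Lemma kern_bound s : exists2 M : R, 0 <= M & forall x, `|kern s x| <= M.
Proof.
have [A A0 HA] := profP_le (kn1 s); have [B B0 HB] := profP_le (kn2 s); have [D D0 HD] := profV_le (kn3 s).
exists (A * B * D); first by rewrite !mulr_ge0.
by move=> x; exact: norm_mul3_le.
Qed.

Lemma kern_lip_taylor s i : exists N : R, forall x (h : R),
    `|kern s (x + h *: unit_vec i) - kern s x| <= N * `|h| /\
    `|kern s (x + h *: unit_vec i) - kern s x - h * kern (i :: s) x| <= N * h ^+ 2.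
Proof.
have [A A0 HA] := profP_le (kn1 s); have [B B0 HB] := profP_le (kn2 s); have [D D0 HD] := profV_le (kn3 s).
move: i; apply: ord3P.
- have [N HN] := @derive_lipschitz_taylor _ _ _ (B * D) (profP_der (kn1 s)) (profP_der _) (profP_le _) (profP_le _) (mulr_ge0 B0 D0).
  exists N => x h.
  have [] := HN x.1.1 h (profP (kn2 s) x.1.2 * profV (kn3 s) x.2); first by rewrite normrM ler_pM.
  rewrite /kern /kn1 /kn2 /kn3/= /GRing.scale/= !mulr1 !mulr0 !addr0 !mulrBl !mulrA => h1 h2.
  by split.
- have [N HN] := @derive_lipschitz_taylor _ _ _ (A * D) (profP_der (kn2 s)) (profP_der _) (profP_le _) (profP_le _) (mulr_ge0 A0 D0).
  exists N => x h.
  have [] := HN x.1.2 h (profP (kn1 s) x.1.1 * profV (kn3 s) x.2); first by rewrite normrM ler_pM.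
  rewrite /kern /kn1 /kn2 /kn3/= /GRing.scale/= !mulr1 !mulr0 !addr0 => h1 h2.
  split; [move: h1|move: h2]; congr (`|_| <= _); ring.
- have [N HN] := @derive_lipschitz_taylor _ _ _ (A * B) (profV_der (kn3 s)) (profV_der _) (profV_le _) (profV_le _) (mulr_ge0 A0 B0).
  exists N => x h.
  have [] := HN x.2 h (profP (kn1 s) x.1.1 * profP (kn2 s) x.1.2); first by rewrite normrM ler_pM.
  rewrite /kern /kn1 /kn2 /kn3/= /GRing.scale/= !mulr1 !mulr0 !addr0 => h1 h2.
  split; [move: h1|move: h2]; congr (`|_| <= _); ring.
Qed.

Lemma profP_supp n t : profP n t != 0 -> `|frac (t + 2^-1) - 2^-1| <= e.
Proof. by move=> h; rewrite leNgt; apply: contra h => h; rewrite /profP profV_supp// ltW. Qed.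

(** The horizontal shift by 1/2 moves the support into the interior of the cell, where it is an
    honest box and does not wrap around. *)
Definition ksupp := box (2^-1 - e) (2^-1 + e) (2^-1 - e) (2^-1 + e) (- e) e.
Definition khalf : E3 R := (2^-1, 2^-1, 0).

Lemma kern_suppS s x : kern s x != 0 -> ksupp (x + khalf) = 1.
Proof.
rewrite /kern (mulf_eq0 (profP (kn1 s) x.1.1 * profP (kn2 s) x.1.2)) (mulf_eq0 (profP (kn1 s) x.1.1)).
rewrite !negb_or => /andP[/andP[p1 p2] p3].
have := profP_supp p1; have := profP_supp p2.
have h3 : `|x.2| <= e by rewrite leNgt; apply: contra p3 => h; rewrite profV_supp// ltW.
rewrite !ler_norml /ksupp /box /= addr0 => /andP[a1 a2] /andP[b1 b2].
move: h3; rewrite ler_norml => ->; rewrite andbT.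
by rewrite (_ : _ && _ = true)//; apply/andP; split; apply/andP; split; lra.
Qed.

Lemma kern_supp s x : kern s x != 0 -> exists k l : int,
    [/\ `|x.1.1 + k%:~R| <= e, `|x.1.2 + l%:~R| <= e & `|x.2| <= e].
Proof.
rewrite /kern (mulf_eq0 (profP (kn1 s) x.1.1 * profP (kn2 s) x.1.2)) (mulf_eq0 (profP (kn1 s) x.1.1)).
rewrite !negb_or => /andP[/andP[p1 p2] p3].
have := profP_supp p1; have := profP_supp p2.
have h3 : `|x.2| <= e by rewrite leNgt; apply: contra p3 => h; rewrite profV_supp// ltW.
have [k ->] := frac_int (x.1.1 + 2^-1); have [l ->] := frac_int (x.1.2 + 2^-1).
have E (t c : R) : t + 2^-1 + c - 2^-1 = t + c by ring.
by rewrite !E => b a; exists k, l.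
Qed.

Lemma ksupp_box : intg ksupp /\ tint ksupp = 8 * e ^+ 3.
Proof.
move: (e0) (e4) => e0' e4'.
have [|||||||h1 h2] := @box_intg (2^-1 - e) (2^-1 + e) (2^-1 - e) (2^-1 + e) (- e) e; try lra.
by split=> //; rewrite h2; ring.
Qed.

Lemma box_periodic (a1 b1 a2 b2 a3 b3 : R) : periodic (box a1 b1 a2 b2 a3 b3).
Proof.
move=> x k l; rewrite /box /= addr0.
have H (t : R) (j : int) : frac (t + j%:~R) = frac t.
  apply: (@frac_eq _ _ _ (j + Num.floor t)); first by rewrite frac_ge0 frac_lt1.
  by rewrite /frac intrD; ring.
by rewrite !H.
Qed.

Lemma kern_meas s : meas (kern s).
Proof.
have [m1 m2 m3] := @meas_coord R.
apply: measM; first apply: measM.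
- by apply: (measurableT_comp (continuous_measurable_fun (@profP_cont _))) m1.
- by apply: (measurableT_comp (continuous_measurable_fun (@profP_cont _))) m2.
- by apply: (measurableT_comp (continuous_measurable_fun (@profV_cont _))) m3.
Qed.

Lemma kern_intg s : intg (kern s).
Proof.
have [M M0 HM] := kern_bound s.
apply: (@le_intg _ _ (fun x => M * ksupp (x + khalf))); first exact: kern_meas.
  move=> x; have [->|kn] := eqVneq (kern s x) 0; last by rewrite (kern_suppS kn) mulr1.
  by rewrite normr0 mulr_ge0.
by apply: intgZ; apply: intg_shift; [exact: box_periodic|exact: ksupp_box.1].
Qed.

Definition kc4 : R := expR (- 4).
Lemma kc4_gt0 : 0 < kc4. Proof. exact: expR_gt0. Qed.

Lemma kern_ge0 x : 0 <= kern [::] x.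
Proof. by rewrite /kern /profP /profV/= expr0 invr1 !mul1r !mulr_ge0// bump_ge0. Qed.

Lemma kern_even x : kern [::] (- x) = kern [::] x.
Proof. by rewrite /kern /= !profP_even profV_even. Qed.

Lemma kern_refl x : kern [::] (refl x) = kern [::] x.
Proof. by rewrite /kern /= profV_even. Qed.

Definition kmass := tint (kern [::]).

Lemma kmass_le : kmass <= 8 * e ^+ 3.
Proof.
rewrite -(ksupp_box.2) -(@tint_shift _ ksupp khalf); [|exact: box_periodic|exact: ksupp_box.1].
apply: le_tint; first exact: kern_intg.
  by apply: intg_shift; [exact: box_periodic|exact: ksupp_box.1].
move=> x; have [->|kn] := eqVneq (kern [::] x) 0; first by rewrite /ksupp /box.
rewrite (kern_suppS kn) /kern /profP /profV/= expr0 invr1 !mul1r.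
by rewrite !mulr_ile1// ?mulr_ge0 ?bump_ge0 ?bump0_le1.
Qed.

Lemma profP0_ge t : 0 <= frac (t + 2^-1) - 2^-1 <= e / 2 -> kc4 <= profP 0 t.
Proof.
move=> /andP[h1 h2]; rewrite /profP /profV expr0 invr1 mul1r; apply: bump0_ge.
rewrite ger0_norm; last by rewrite divr_ge0// ltW.
by rewrite ler_pdivrMr//; lra.
Qed.

(** On the box [0, e/2]^3, of volume e^3 / 8, each of the three factors is at least exp(-4). *)
Lemma kmass_ge : kc4 ^+ 3 * e ^+ 3 / 8 <= kmass.
Proof.
move: (e0) (e4) => e0' e4'.
pose B := box 2^-1 (2^-1 + e / 2) 2^-1 (2^-1 + e / 2) 0 (e / 2).
have [|||||||h1 h2] := @box_intg 2^-1 (2^-1 + e / 2) 2^-1 (2^-1 + e / 2) 0 (e / 2); try lra.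
have := @tint_shift _ B khalf (@box_periodic _ _ _ _ _ _) h1; rewrite h2 => E.
have -> : kc4 ^+ 3 * e ^+ 3 / 8 = tint (fun x => kc4 ^+ 3 * B (x + khalf)).
  rewrite tintZ ?E; last by apply: intg_shift => //; exact: box_periodic.
  by field.
apply: le_tint; [by apply/intgZ/intg_shift => //; exact: box_periodic|exact: kern_intg|].
move=> x; rewrite /B /box /= addr0.
have [/and3P[/andP[a1 a2] /andP[b1 b2] /andP[d1 d2]]|_] := boolP [&& 2^-1 <= frac (x.1.1 + 2^-1) <= 2^-1 + e / 2,
   2^-1 <= frac (x.1.2 + 2^-1) <= 2^-1 + e / 2 & 0 <= x.2 <= e / 2]; last first.
  by rewrite mulr0 kern_ge0.
rewrite mulr1 (_ : kc4 ^+ 3 = kc4 * kc4 * kc4); last by ring.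
have c4 := ltW kc4_gt0.
have p1 : kc4 <= profP 0 x.1.1 by apply: profP0_ge; rewrite subr_ge0 lerBlDl; apply/andP; split.
have p2 : kc4 <= profP 0 x.1.2 by apply: profP0_ge; rewrite subr_ge0 lerBlDl; apply/andP; split.
apply: ler_pM; [by rewrite mulr_ge0|by []|by apply: ler_pM|].
rewrite -[profV _ _]/(profV 0 x.2) /profV expr0 invr1 mul1r; apply: bump0_ge.
rewrite ger0_norm; last by rewrite divr_ge0// ltW.
by rewrite ler_pdivrMr// mulrC.
Qed.

Lemma kmass_gt0 : 0 < kmass.
Proof.
apply: lt_le_trans kmass_ge; have := kc4_gt0 => c40.
by rewrite divr_gt0// mulr_gt0// exprn_gt0.
Qed.

Lemma trace_box : intg (box 2^-1 (2^-1 + e / 2) 2^-1 (2^-1 + e / 2) (- (e / 2)) (- (e / 4))) /\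
  tint (box 2^-1 (2^-1 + e / 2) 2^-1 (2^-1 + e / 2) (- (e / 2)) (- (e / 4))) =
  (2^-1 + e / 2 - 2^-1) * (2^-1 + e / 2 - 2^-1) * (- (e / 4) - - (e / 2)).
Proof. by move: (e0) (e4) => e0' e4'; apply: box_intg; lra. Qed.

(** One constant must serve twice. The gradient is at most B1 / e on a support of volume 8 e^3,
    divided by a mass of at least exp(-4)^3 e^3 / 8: this gives 64 B1 / exp(-4)^3. The half-space
    integral of the normal derivative is at least exp(-4)^3 / e on a box of volume e^3 / 16, divided
    by a mass of at most 8 e^3: this gives exp(-4)^3 / 128, and B1 >= 1 lets both fit. *)
Lemma mollifier_existsC (B1 : R) : 1 <= B1 -> (forall t : R, `|bump 1 t| <= B1) ->
  exists kern, mollifier (128 * B1 / expR (- 4) ^+ 3) e kern.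
Proof.
move=> B11 HB; have B10 : 0 < B1 by exact: lt_le_trans B11.
have m0 := kmass_gt0; have c40 := kc4_gt0; have ki := kern_intg.
have kg := kern_ge0; have km := kern_meas; have sb := ksupp_box.1.
have nm c : `|kmass^-1 * c| = kmass^-1 * `|c| by rewrite normrM gtr0_norm// invr_gt0.
have m'0 : 0 <= kmass^-1 by rewrite invr_ge0 ltW.
exists (fun s x => kmass^-1 * kern s x); split.
- by move=> s x k l; rewrite kern_per.
- move=> s; have [M M0 HM] := kern_bound s; exists (kmass^-1 * M) => x.
  by rewrite nm ler_wpM2l.
- move=> s i; have [N HN] := kern_lip_taylor s i; exists (kmass^-1 * N) => x h.
  rewrite -mulrBr nm -mulrA ler_wpM2l//.
  by case: (HN x h).
- move=> s i; have [N HN] := kern_lip_taylor s i; exists (kmass^-1 * N) => x h.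
  rewrite -mulrBr mulrCA -mulrBr nm -mulrA ler_wpM2l//.
  by case: (HN x h).
- move=> s x; rewrite mulf_eq0 negb_or => /andP[_]; exact: kern_supp.
- by move=> x; rewrite kern_even.
- by move=> x; rewrite kern_refl.
- by move=> x; rewrite mulr_ge0// invr_ge0 ltW.
- by rewrite tintZ// mulVf// gt_eqF.
- move=> i.
  have HK x : `|kern [:: i] x| <= B1 / e * ksupp (x + khalf).
    have [->|kn] := eqVneq (kern [:: i] x) 0.
      by rewrite normr0 mulr_ge0// divr_ge0// ltW.
    rewrite (kern_suppS kn) mulr1.
    have b0 (t : R) : `|profV 0 t| <= 1.
      by rewrite /profV expr0 invr1 mul1r ger0_norm ?bump_ge0// bump0_le1.
    have b1 (t : R) : `|profV 1 t| <= B1 / e.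
      have e'0 : 0 < e^-1 by rewrite invr_gt0.
      by rewrite /profV expr1 normrM (gtr0_norm e'0) mulrC ler_wpM2r// ltW.
    have p0 (t : R) : `|profP 0 t| <= 1 by exact: b0.
    have p1 (t : R) : `|profP 1 t| <= B1 / e by exact: b1.
    move: (i); apply: ord3P.
    + by rewrite -[leRHS]mulr1 -[X in _ <= X * _]mulr1; apply: norm_mul3_le; [exact: p1|exact: p0|exact: b0].
    + by rewrite -[leRHS]mulr1 -[X in _ <= X * _]mul1r; apply: norm_mul3_le; [exact: p0|exact: p1|exact: b0].
    + by rewrite -[leRHS]mul1r -[X in _ <= X * _]mulr1; apply: norm_mul3_le; [exact: p0|exact: p0|exact: b1].
  apply: (@le_trans _ _ (tint (fun x => kmass^-1 * (B1 / e * ksupp (x + khalf))))).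
    apply: le_tint.
    + by apply/intg_norm/intgZ.
    + by do 2 apply: intgZ; apply: intg_shift; [exact: box_periodic|exact: ksupp_box.1].
    + by move=> x; rewrite nm ler_wpM2l.
  have hS : intg (fun x => ksupp (x + khalf)).
    by apply: intg_shift; [exact: box_periodic|exact: ksupp_box.1].
  rewrite tintZ; last exact: intgZ.
  rewrite tintZ// tint_shift; [|exact: box_periodic|exact: ksupp_box.1].
  rewrite ksupp_box.2 -/kc4 ler_pdivrMl// [leRHS]mulrA ler_pdivlMr//.
  have h : 1 <= 8 / (kc4 ^+ 3 * e ^+ 3) * kmass.
    have := kmass_ge; rewrite ler_pdivrMr// => hm.
    by rewrite mulrAC ler_pdivlMr ?mulr_gt0 ?exprn_gt0// mul1r [leRHS]mulrC.
  have E : B1 / e * (8 * e ^+ 3) * e = 8 * B1 * e ^+ 3 by field; rewrite gt_eqF.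
  rewrite E.
  apply: (@le_trans _ _ (8 * B1 * e ^+ 3 * (8 / (kc4 ^+ 3 * e ^+ 3) * kmass))).
    by rewrite ler_peMr// !mulr_ge0// ?exprn_ge0// ltW.
  have -> : 8 * B1 * e ^+ 3 * (8 / (kc4 ^+ 3 * e ^+ 3) * kmass) = kmass * (64 * B1 / kc4 ^+ 3).
    by field; rewrite !gt_eqF ?exprn_gt0.
  apply: ler_wpM2l; first exact: ltW.
  apply: ler_wpM2r; first by rewrite invr_ge0 exprn_ge0// ltW.
  lra.
(* The normal derivative is nonnegative for x_3 <= 0, because the slope of the bump is odd and
   nonpositive on the right. Hence the integral may be bounded below on the box where x_3 lies
   between -e/2 and -e/4, the range of [bump1_le]. *)
- pose B := box 2^-1 (2^-1 + e / 2) 2^-1 (2^-1 + e / 2) (- (e / 2)) (- (e / 4)).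
  have [h1 h2] := trace_box.
  have := @tint_shift _ B khalf (@box_periodic _ _ _ _ _ _) h1; rewrite h2 => E.
  have b0 (t : R) : 0 <= profV 0 t by rewrite /profV expr0 invr1 mul1r bump_ge0.
  have bump1_odd (t : R) : bump 1 (- t) = - bump 1 t.
    by rewrite !bump1E opprK; ring.
  have mh : meas (fun x => (x.2 <= 0)%R%:R : R).
    have -> : (fun x : E3 R => (x.2 <= 0)%R%:R) = \1_([set x : mE3 R | x.2 <= 0]) :> (_ -> R).
      apply/funext => x; rewrite indicE; congr (nat_of_bool _)%:R.
      by apply/idP/idP; rewrite inE.
    apply: measurable_indic.
    have [_ _ m3] := @meas_coord R.
    have := m3 measurableT `]-oo, 0]%classic (measurable_itv _); rewrite setTI.
    by congr measurable; apply/seteqP; split=> x /=; rewrite in_itv.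
  have hK : intg (fun x => (x.2 <= 0)%R%:R * (kmass^-1 * kern [:: 2] x)).
    apply: (@le_intg _ _ (fun x => `|kmass^-1 * kern [:: 2] x|)).
    + exact: measM mh (measZ _ (@kern_meas _)).
    + by move=> x; case: (x.2 <= 0); rewrite ?mul1r// mul0r normr0.
    + exact/intg_norm/intgZ.
  apply: (@le_trans _ _ (tint (fun x => kmass^-1 * (kc4 ^+ 3 / e * B (x + khalf))))); last first.
    apply: le_tint => //.
      by do 2 apply: intgZ; apply: intg_shift => //; exact: box_periodic.
    move=> x; have [x0|x0] := leP x.2 0; last first.
      rewrite mul0r /B /box/= addr0 [X in _ && (_ && X)](_ : _ = false) ?andbF ?mulr0//.
      apply/negbTE; rewrite negb_and -!ltNge; apply/orP; right.
      by apply: lt_trans x0; rewrite oppr_lt0 divr_gt0.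
    rewrite mul1r; apply: ler_wpM2l => //.
    have V1 t : t <= 0 -> 0 <= profV 1 t.
      move=> t0; rewrite /profV -[t]opprK mulNr bump1_odd mulrN oppr_ge0 mulr_ge0_le0//.
        by rewrite invr_ge0 expr1 ltW.
      by rewrite bump1_le0// divr_ge0 ?oppr_ge0// ltW.
    have K0 : 0 <= kern [:: 2] x.
      by apply: mulr_ge0; [apply: mulr_ge0; exact: b0|exact: V1].
    rewrite /B /box/= addr0.
    have [/and3P[/andP[a1 a2] /andP[d1 d2] /andP[f1 f2]]|_] := boolP [&& 2^-1 <= frac (x.1.1 + 2^-1) <= 2^-1 + e / 2,
      2^-1 <= frac (x.1.2 + 2^-1) <= 2^-1 + e / 2 & - (e / 2) <= x.2 <= - (e / 4)]; last first.
      by rewrite mulr0.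
    rewrite mulr1 (_ : kc4 ^+ 3 / e = kc4 * kc4 * (kc4 / e)); last by ring.
    have c4' := ltW kc4_gt0; have e' := ltW e0.
    have p1 : kc4 <= profP 0 x.1.1 by apply: profP0_ge; rewrite subr_ge0 lerBlDl; apply/andP; split.
    have p2 : kc4 <= profP 0 x.1.2 by apply: profP0_ge; rewrite subr_ge0 lerBlDl; apply/andP; split.
    apply: ler_pM; [by rewrite mulr_ge0|by rewrite divr_ge0|by apply: ler_pM|].
    rewrite -[profV _ _]/(profV 1 x.2).
    rewrite /profV expr1 mulrC; apply: ler_wpM2l; first by rewrite invr_ge0 ltW.
    rewrite -[x.2]opprK mulNr bump1_odd lerNr; apply: bump1_le.
    by apply/andP; split; [rewrite ler_pdivlMr// mulrC lerNr|rewrite ler_pdivrMr// mulrC lerNl].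
  rewrite tintZ; last by apply: intgZ; apply: intg_shift => //; exact: box_periodic.
  rewrite tintZ ?E; last by apply: intg_shift => //; exact: box_periodic.
  rewrite invfM invfM !invrK -/kc4 ler_pdivlMl//.
  have -> : kc4 ^+ 3 / e * ((2^-1 + e / 2 - 2^-1) * (2^-1 + e / 2 - 2^-1) * (- (e / 4) - - (e / 2))) =
     kc4 ^+ 3 * e ^+ 2 / 16 by field; rewrite gt_eqF.
  apply: (@le_trans _ _ (8 * e ^+ 3 * (128^-1 / B1 * kc4 ^+ 3 / e))).
    apply: ler_wpM2r; last exact: kmass_le.
    by rewrite divr_ge0 ?mulr_ge0 ?exprn_ge0 ?invr_ge0// ltW.
  have -> : 8 * e ^+ 3 * (128^-1 / B1 * kc4 ^+ 3 / e) = kc4 ^+ 3 * e ^+ 2 / 16 * B1^-1.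
    by field; rewrite !gt_eqF.
  apply: ler_piMr; last by rewrite invf_le1.
  repeat apply: mulr_ge0; rewrite ?invr_ge0 ?exprn_ge0//; exact: ltW.
Qed.

End Construction.

Lemma mollifier_exists : exists2 C : R, 0 < C & forall e : R, 0 < e -> e <= 4^-1 ->
  exists K, mollifier C e K.
Proof.
have [B1 _ HB] := @bump_le R 1.
have B10 : 0 < `|B1| + 1 by rewrite ltr_wpDl.
exists (128 * (`|B1| + 1) / expR (- 4) ^+ 3).
  by rewrite divr_gt0 ?mulr_gt0 ?exprn_gt0 ?expR_gt0.
move=> e e0 e4; apply: (mollifier_existsC e0 e4); first by rewrite lerDr.
by move=> t; rewrite (le_trans (HB t))// (le_trans (ler_norm _))// lerDl.
Qed.

End Mollifier.

Section PointNorm.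
Context {R : realType}.
Implicit Types (x y : E3 R).

Lemma norm_coord x : [/\ `|x.1.1| <= `|x|, `|x.1.2| <= `|x| & `|x.2| <= `|x|].
Proof.
have -> : `|x| = Num.max (Num.max `|x.1.1| `|x.1.2|) `|x.2| by [].
by split; rewrite !le_max lexx ?orbT.
Qed.

Lemma unit_vec_steps x (a b c : R) :
  x + (a, b, c) = x + a *: unit_vec 0 + b *: unit_vec 1 + c *: unit_vec 2.
Proof.
case: x => -[x1 x2] x3; rewrite /unit_vec /=.
congr (_, _, _); rewrite /= /GRing.scale/= ?mulr1 ?mulr0 ?addr0 //.
Qed.

Lemma coord_lipschitz (f : E3 R -> R) :
  (forall i, exists M, forall x (h : R), `|f (x + h *: unit_vec i) - f x| <= M * `|h|) ->
  exists2 L : R, 0 <= L & forall x y, `|f (x + y) - f x| <= L * `|y|.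
Proof.
move=> H; have [A HA] := H 0; have [B HB] := H 1; have [D HD] := H 2.
have nn M i : (forall x (h : R), `|f (x + h *: unit_vec i) - f x| <= M * `|h|) -> 0 <= M.
  by move=> /(_ 0 1); rewrite normr1 mulr1; exact: le_trans.
have A0 := nn _ _ HA; have B0 := nn _ _ HB; have D0 := nn _ _ HD.
exists (A + B + D); first by rewrite !addr_ge0.
move=> x y; have [y1 y2 y3] := norm_coord y.
have E : x + y = x + y.1.1 *: unit_vec 0 + y.1.2 *: unit_vec 1 + y.2 *: unit_vec 2.
  by rewrite -unit_vec_steps; case: (y) => -[].
rewrite E; set x1 := x + _ *: _; set x2 := x1 + _.
have -> : f (x2 + y.2 *: unit_vec 2) - f x =
    (f (x2 + y.2 *: unit_vec 2) - f x2) + (f x2 - f x1) + (f x1 - f x) by ring.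
apply: (le_trans (ler_normD _ _)); apply: (le_trans (lerD (ler_normD _ _) (lexx _))).
have h1 := le_trans (HA x y.1.1) (ler_wpM2l A0 y1).
have h2 := le_trans (HB x1 y.1.2) (ler_wpM2l B0 y2).
have h3 := le_trans (HD x2 y.2) (ler_wpM2l D0 y3).
rewrite !mulrDl; move: h1 h2 h3; rewrite -/x1 -/x2.
set p := `|f x1 - _|; set q := `|f x2 - _|; set r := `|f (x2 + _) - _|; lra.
Qed.

Lemma lipschitz_continuous (V W : normedModType R) (f : V -> W) (L : R) :
  (forall x y : V, `|f (x + y) - f x| <= L * `|y|) -> continuous f.
Proof.
move=> fL x; apply/cvgrPdist_le => e e0.
have L1 : 0 < `|L| + 1 by rewrite ltr_wpDl.
near=> y.
have := fL x (y - x); rewrite (addrC x) subrK (distrC (f y)) => h; apply: (le_trans h).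
apply: (@le_trans _ _ ((`|L| + 1) * `|y - x|)).
  by rewrite ler_wpM2r// (le_trans (ler_norm _))// lerDl.
rewrite -ler_pdivlMl// mulrC distrC ltW//.
by near: y; apply: (@cvgr_dist_lt _ _ _ _ _ id x) => //; rewrite divr_gt0.
Unshelve. all: by end_near. Qed.

End PointNorm.

(** * Convolution with a mollifier *)

Section Convolution.
Context {R : realType}.
Implicit Types (x y z : E3 R) (s : seq 'I_3) (f g : E3 R -> R).

Definition pl2 f : Prop := periodic f /\ sqi f.

Lemma pl2D f g : pl2 f -> pl2 g -> pl2 (fun x => f x + g x).
Proof. by move=> [pf sf] [pg sg]; split; [move=> x k l; rewrite pf pg|exact: sqiD]. Qed.
Lemma pl2Z k f : pl2 f -> pl2 (fun x => k * f x).
Proof. by move=> [pf sf]; split; [move=> x ? ?; rewrite pf|exact: sqiZ]. Qed.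

Section Fixed.
Variables (C e : R) (K : seq 'I_3 -> E3 R -> R).

Definition conv s f x : R := tint (fun z => K s (x - z) * f z).

Hypothesis mK : mollifier C e K.
Hypothesis e0 : 0 < e.

Lemma mol_lipschitz s : exists2 L : R, 0 <= L & forall x y, `|K s (x + y) - K s x| <= L * `|y|.
Proof. by apply: coord_lipschitz => i; exact: (mol_lip mK). Qed.

Lemma mol_continuous s : continuous (K s).
Proof. by have [L _ HL] := mol_lipschitz s; exact: (@lipschitz_continuous _ _ _ _ L). Qed.

Lemma mol_meas s : meas (K s).
Proof. by apply: continuous_meas; exact: mol_continuous. Qed.

Lemma mol_supp3 s x : ~~ (- e <= x.2 <= e) -> K s x = 0.
Proof.
move=> h; apply/eqP; apply: contraNT h => /(mol_supp mK)[_ [_ [_ _]]].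
by rewrite ler_norml.
Qed.

Lemma mol_intg s : intg (K s).
Proof.
have [M HM] := mol_bound mK s.
by apply: (intg_bounded_strip (mol_meas s) HM) => x; exact: mol_supp3.
Qed.

Lemma mol_sqi s : sqi (K s).
Proof. by have [M HM] := mol_bound mK s; exact: sqi_bounded_intg HM (mol_intg s). Qed.

Lemma mol_sub_sqi s x : sqi (fun z => K s (x - z)).
Proof.
split; first exact: meas_sub (mol_meas s).
by apply: (@intg_sub _ (fun z => K s z ^+ 2) x); [move=> z k l; rewrite (mol_periodic mK)|exact: (mol_sqi s).2].
Qed.

Lemma mol_sub_norm2 s x : norm2 (fun z => K s (x - z)) = norm2 (K s).
Proof.
congr Num.sqrt; apply: (@tint_sub _ (fun z => K s z ^+ 2) x); last exact: (mol_sqi s).2.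
by move=> z k l; rewrite (mol_periodic mK).
Qed.

Lemma conv_intg s f x : sqi f -> intg (fun z => K s (x - z) * f z).
Proof. by move=> sf; apply: sqi_intgM => //; exact: mol_sub_sqi. Qed.

Lemma conv_le s f x : sqi f -> `|conv s f x| <= norm2 (K s) * norm2 f.
Proof. by move=> sf; rewrite -(mol_sub_norm2 s x); apply: cauchy_schwarz => //; exact: mol_sub_sqi. Qed.

Lemma convB s f g x : sqi f -> sqi g -> conv s (fun z => f z - g z) x = conv s f x - conv s g x.
Proof.
move=> sf sg; rewrite /conv -tintB; [|exact: conv_intg..].
by apply: eq_tint => z; rewrite mulrBr.
Qed.

Lemma conv_periodic s f : periodic (conv s f).
Proof.
move=> x k l; apply: eq_tint => z; congr (_ * _).
by rewrite addrAC (mol_periodic mK).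
Qed.

(** Cauchy-Schwarz against a strip of height 4, whose indicator has L^2 norm 2. A kernel of radius e
    <= 1 moved by an increment of size at most 1 stays within distance 2 of x_3, so differences of
    kernels gain a factor [N] uniformly in x. *)
Let strip_bound (D : E3 R -> R) f x (N : R) : meas D -> sqi f -> e <= 1 -> 0 <= N ->
  (forall z, `|D z| <= N) -> (forall z, ~~ (x.2 - 2 <= z.2 <= x.2 + 2) -> D z = 0) ->
  `|tint (fun z => D z * f z)| <= N * (2 * norm2 f).
Proof.
move=> mD sf e1 N0 DN D0; set a := x.2 - 2; set b := x.2 + 2.
have ab : a <= b by rewrite /a /b; lra.
have ss : sqi (strip a b).
  apply: (@sqi_bounded_intg _ _ 1); last exact: intg_strip.
  by move=> z; rewrite stripE; case: (_ <= _ <= _); rewrite ?normr1 ?normr0.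
have nS : norm2 (strip a b) = 2.
  rewrite /norm2 (_ : tint _ = 2 ^+ 2); first by rewrite sqrtr_sqr ger0_norm.
  rewrite (_ : 2 ^+ 2 = b - a); last by rewrite /a /b; ring.
  rewrite -(tint_strip ab); apply: eq_tint => z; rewrite stripE.
  by case: (_ <= _ <= _); rewrite ?expr1n ?expr0n.
have sD : sqi D.
  apply: (@le_sqi _ _ (fun z => N * strip a b z)) => //; last exact: sqiZ.
  move=> z; rewrite stripE; have [h|h] := boolP (a <= z.2 <= b).
    by rewrite mulr1 (ger0_norm N0).
  by rewrite D0// !normr0 mulr0 normr0.
apply: (le_trans (cauchy_schwarz sD sf)).
rewrite mulrA ler_wpM2r ?norm2_ge0// -nS -{1}(ger0_norm N0) -norm2Z//.
apply: le_norm2 => //; first exact: sqiZ.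
move=> z; rewrite stripE; have [h|h] := boolP (a <= z.2 <= b).
  by rewrite mulr1 (ger0_norm N0).
by rewrite D0// !normr0.
Qed.

Let far (h z : E3 R) x : e <= 1 -> `|h| <= 1 -> ~~ (x.2 - 2 <= z.2 <= x.2 + 2) ->
  forall s, K s (x - z) = 0 /\ K s (x + h - z) = 0.
Proof.
move=> e1 h1 hz s; have [_ _] := norm_coord h; move=> h3.
have {}h3 := le_trans h3 h1; move: h3; rewrite ler_norml => /andP[h3 h4].
by split; apply: mol_supp3; apply: contra hz => /= /andP[a b]; apply/andP; split; lra.
Qed.

Lemma conv_lipschitz1 s : e <= 1 -> exists2 L : R, 0 <= L & forall f, sqi f -> forall x y, `|y| <= 1 ->
  `|conv s f (x + y) - conv s f x| <= L * norm2 f * `|y|.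
Proof.
move=> e1; have [L L0 HL] := mol_lipschitz s; exists (2 * L); first by rewrite mulr_ge0.
move=> f sf x y y1; rewrite /conv -tintB; [|exact: conv_intg..].
rewrite (_ : tint _ = tint (fun z => (K s (x + y - z) - K s (x - z)) * f z)); last first.
  by apply: eq_tint => z; rewrite mulrBl.
rewrite (_ : 2 * L * _ * _ = L * `|y| * (2 * norm2 f)); last by ring.
apply: (@strip_bound _ _ x) => //.
- by apply: measB; apply: meas_sub; exact: mol_meas.
- by rewrite mulr_ge0.
- by move=> z; rewrite addrAC; exact: HL.
- by move=> z hz; have [-> ->] := far e1 y1 hz s; rewrite subrr.
Qed.

Lemma conv_taylor1 s i : e <= 1 -> exists2 M : R, 0 <= M & forall f, sqi f -> forall x (h : R), `|h| <= 1 ->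
  `|conv s f (x + h *: unit_vec i) - conv s f x - h * conv (i :: s) f x| <= M * norm2 f * h ^+ 2.
Proof.
move=> e1; have [M HM] := mol_taylor mK s i.
have M0 : 0 <= M by have := HM 0 1; rewrite expr1n mulr1; exact: le_trans.
exists (2 * M); first by rewrite mulr_ge0.
move=> f sf x h h1.
have hv : `|h *: unit_vec i : E3 R| <= 1.
  have -> : h *: unit_vec i = (h * (unit_vec i).1.1, h * (unit_vec i).1.2, h * (unit_vec i).2) :> E3 R by [].
  rewrite /Num.norm/= !ge_max /unit_vec /= !normrM.
  by do ?[apply/andP; split]; case: (_ == _); rewrite ?normr1 ?mulr1 ?normr0 ?mulr0.
rewrite /conv -tintB; [|exact: conv_intg..]; rewrite -tintZ; last exact: conv_intg.
rewrite -tintB; [|by apply: intgB; exact: conv_intg|by apply: intgZ; exact: conv_intg].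
rewrite (_ : tint _ = tint (fun z => (K s (x + h *: unit_vec i - z) - K s (x - z) - h * K (i :: s) (x - z)) * f z)); last first.
  by apply: eq_tint => z; ring.
rewrite (_ : 2 * M * _ * _ = M * h ^+ 2 * (2 * norm2 f)); last by ring.
apply: (@strip_bound _ _ x) => //.
- by apply: measB; [apply: measB; apply: meas_sub; exact: mol_meas|apply: measZ; apply: meas_sub; exact: mol_meas].
- by rewrite mulr_ge0// sqr_ge0.
- by move=> z; rewrite [x + _ - z]addrAC; exact: HM.
- move=> z hz; have [-> ->] := far e1 hv hz s; have [-> _] := far e1 hv hz (i :: s).
  by rewrite mulr0 !subr0.
Qed.

Lemma conv_continuous s f : e <= 1 -> sqi f -> continuous (conv s f).
Proof.
move=> e1 sf; have [L L0 HL] := conv_lipschitz1 s e1.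
apply: (@lipschitz_continuous _ _ _ _ (L * norm2 f + 2 * (norm2 (K s) * norm2 f))) => x y.
have [y1|y1] := leP `|y| 1.
  rewrite (le_trans (HL f sf x y y1))// ler_wpM2r// lerDl.
  by rewrite !mulr_ge0 ?norm2_ge0.
rewrite (le_trans (ler_normB _ _))//.
apply: (@le_trans _ _ (2 * (norm2 (K s) * norm2 f) * 1)).
  by rewrite mulr1 mulrDl !mul1r lerD// conv_le.
by rewrite ler_pM ?mulr_ge0 ?norm2_ge0 ?ler_wpDl ?mulr_ge0 ?norm2_ge0// ltW.
Qed.

Lemma conv_meas s f : e <= 1 -> sqi f -> meas (conv s f).
Proof. by move=> e1 sf; apply: continuous_meas; exact: conv_continuous. Qed.

(** Evenness is recorded for the kernel alone. Expanding it at x and at -x with opposite steps gives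
    the same increment, so the first-order terms agree up to O(h^2); dividing by h transfers the
    symmetry to the gradient. *)
Lemma mol_grad_odd i x : K [:: i] (- x) = - K [:: i] x.
Proof.
have [M HM] := mol_taylor mK [::] i.
apply/eqP; rewrite -subr_eq0 opprK; apply/eqP.
set a := _ + _; have H (h : R) : 0 < h -> `|a| <= 2 * M * h.
  move=> h0; rewrite -(ler_pM2r h0) -[X in `|_| * X](gtr0_norm h0) -normrM.
  have h1 := HM (- x) h; have h2 := HM x (- h).
  rewrite (mol_even mK) in h1.
  have E : - x + h *: unit_vec i = - (x + (- h) *: unit_vec i).
    by rewrite opprD scaleNr opprK.
  rewrite E (mol_even mK) sqrrN in h1 h2.
  set A := K [::] _ in h1 h2; set B := K [::] x in h1 h2.
  have -> : a * h = (A - B - - h * K [:: i] x) - (A - B - h * K [:: i] (- x)).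
    by rewrite /a; ring.
  rewrite (le_trans (ler_normB _ _))// (le_trans (lerD h2 h1))//.
  by rewrite le_eqVlt; apply/orP; left; apply/eqP; ring.
apply/eqP; rewrite -normr_eq0 eq_le normr_ge0 andbT.
apply/ler_addgt0Pl => d d0; rewrite addr0.
have M1 : 0 < 2 * `|M| + 1 by rewrite ltr_wpDl// mulr_ge0.
rewrite (le_trans (H (d / (2 * `|M| + 1)) _)) ?divr_gt0//.
rewrite mulrA ler_pdivrMr// mulrC ler_wpM2l// ?ltW//.
by have := ler_norm M; lra.
Qed.

Lemma conv_refl f (sg : R) x : sqi f -> (forall z, f (refl z) = sg * f z) ->
  conv [::] f (refl x) = sg * conv [::] f x.
Proof.
move=> sf fs; rewrite /conv -(tint_refl (conv_intg [::] _ sf)) -tintZ; last exact: conv_intg.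
apply: eq_tint => z; rewrite fs -reflN -reflD (mol_refl mK); ring.
Qed.

Lemma conv_yform s f x : pl2 f -> conv s f x = tint (fun y => K s y * f (x - y)).
Proof.
move=> [pf sf]; rewrite /conv -[RHS](@tint_sub _ (fun y => K s y * f (x - y)) x).
- by apply: eq_tint => z; rewrite subKr.
- by move=> z k l; rewrite (mol_periodic mK) (@periodic_sub _ _ f x pf).
- apply: sqi_intgM; first exact: mol_sqi.
  split; first exact: meas_sub sf.1.
  apply: (@intg_sub _ (fun z => f z ^+ 2) x); last exact: sf.2.
  by move=> z k l; rewrite pf.
Qed.

Lemma mol_tmeas2 s f : meas f -> tmeas2 (fun x z => K s (x - z) * f z).
Proof. by move=> mf; apply: tmeas2M; [apply: tmeas2_sub; exact: mol_meas|exact: tmeas2_r]. Qed.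

Lemma conv_intg_prod s f g : e <= 1 -> sqi f -> intg g -> intg (fun x => g x * conv s f x).
Proof.
move=> e1 sf gi; apply: (@intgM_bounded _ _ _ (norm2 (K s) * norm2 f)) => //.
  exact: conv_meas.
by move=> x; exact: conv_le.
Qed.

(* Jensen for the probability kernel *)
Lemma conv_sqr_le f x : sqi f -> conv [::] f x ^+ 2 <= tint (fun z => K [::] (x - z) * f z ^+ 2).
Proof.
move=> sf; set m := conv _ _ _.
have [M HM] := mol_bound mK [::].
have i2 : intg (fun z => K [::] (x - z) * f z ^+ 2).
  apply: (eq_intg _ (intgM_bounded (meas_sub x (mol_meas [::])) (fun z => HM (x - z)) sf.2)) => z.
  exact: mulrC.
have i0 : intg (fun z => K [::] (x - z)).
  by apply: intg_sub; [exact: (mol_periodic mK)|exact: mol_intg].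
have t0 : tint (fun z => K [::] (x - z)) = 1.
  by rewrite tint_sub; [exact: (mol_tint mK)|exact: (mol_periodic mK)|exact: mol_intg].
have i1 := conv_intg [::] x sf.
have : 0 <= tint (fun z => K [::] (x - z) * f z ^+ 2 - (2 * m) * (K [::] (x - z) * f z) + m ^+ 2 * K [::] (x - z)).
  apply: tint_ge0 => z; rewrite (_ : _ + _ = K [::] (x - z) * (f z - m) ^+ 2); last by ring.
  by rewrite mulr_ge0 ?sqr_ge0// (mol_ge0 mK).
rewrite tintD; [|by apply: intgB => //; exact: intgZ|exact: intgZ].
rewrite tintB; [|by []|exact: intgZ].
rewrite (tintZ _ i1) (tintZ _ i0) t0 -/(conv [::] f x) -/m; lra.
Qed.

(** Integrate Jensen's inequality in x and exchange the integrals: the kernel has mass 1 in either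
    variable. *)
Lemma conv_sqi f : e <= 1 -> sqi f -> sqi (conv [::] f) /\ norm2 (conv [::] f) <= norm2 f.
Proof.
move=> e1 sf; have [M HM] := mol_bound mK [::].
pose F x z := K [::] (x - z) * f z ^+ 2.
have Fx x : intg (F x).
  apply: (eq_intg _ (intgM_bounded (meas_sub x (mol_meas [::])) (fun z => HM (x - z)) sf.2)) => z.
  exact: mulrC.
have Kz z : intg (fun x => K [::] (x - z)).
  by apply: (@intg_shift _ (K [::])); [exact: (mol_periodic mK)|exact: mol_intg].
have Fz z : intg (F ^~ z).
  by apply: (eq_intg _ (intgZ (f z ^+ 2) (Kz z))) => x; exact: mulrC.
have tFz z : tint (F ^~ z) = f z ^+ 2.
  rewrite (_ : tint _ = tint (fun x => f z ^+ 2 * K [::] (x - z))); last first.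
    by apply: eq_tint => x; exact: mulrC.
  rewrite tintZ// (@tint_shift _ (K [::])) ?(mol_tint mK) ?mulr1//.
    exact: (mol_periodic mK).
  exact: mol_intg.
have F0 x z : 0 <= F x z by rewrite mulr_ge0 ?sqr_ge0// (mol_ge0 mK).
have mF : tmeas2 F by apply: mol_tmeas2; apply: measX; exact: sf.1.
have F2 : tintg2 F.
  apply: (tintg2_swap _).
  apply: (@tintg2_le _ _ (fun z => f z ^+ 2)).
  - exact: tmeas2_swap.
  - by [].
  - exact: sf.2.
  - move=> z; rewrite -(tFz z); apply: le_tint => //; first exact: intg_norm.
    by move=> x; rewrite ger0_norm.
have iF := tintg2_l F2 Fx.
have sc : sqi (conv [::] f).
  split; first exact: conv_meas.
  apply: (le_intg _ _ iF); first by apply: measX; exact: conv_meas.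
  by move=> x; rewrite ger0_norm ?sqr_ge0//; exact: conv_sqr_le.
split=> //; apply: ler_wsqrtr.
rewrite (_ : tint (fun x => f x ^+ 2) = tint (fun x => tint (F x))); last first.
  by rewrite (tint_Fubini F2)//; apply: eq_tint => z; rewrite tFz.
by apply: le_tint => //; [exact: sc.2|move=> x; exact: conv_sqr_le].
Qed.

Lemma conv_pl2 f : e <= 1 -> pl2 f -> pl2 (conv [::] f).
Proof. by move=> e1 [pf sf]; split; [exact: conv_periodic|exact: (conv_sqi e1 sf).1]. Qed.

(** The kernel is even, so exchanging the integrals exchanges the roles of f and g. Absolute
    convergence follows from convolving |f|, which is again square-integrable. *)
Lemma conv_adjoint f g : e <= 1 -> sqi f -> sqi g ->
  tint (fun x => conv [::] f x * g x) = tint (fun x => f x * conv [::] g x).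
Proof.
move=> e1 sf sg.
pose F x z := K [::] (x - z) * (f z * g x).
have nn h : sqi h -> norm2 (fun z => `|h z|) = norm2 h.
  by move=> sh; congr Num.sqrt; apply: eq_tint => z; rewrite real_normK ?num_real.
have Fx x : intg (F x).
  by apply: (eq_intg _ (intgZ (g x) (conv_intg [::] x sf))) => z; rewrite /F; ring.
have symK x z : K [::] (x - z) = K [::] (z - x) by rewrite -(mol_even mK) opprB.
have Fz z : intg (F ^~ z).
  apply: (eq_intg _ (intgZ (f z) (conv_intg [::] z sg))) => x; rewrite /F (symK x z); ring.
have sn := sqi_norm sf; have [sc _] := conv_sqi e1 sn.
have F2 : tintg2 F.
  apply: (@tintg2_le _ _ (fun x => conv [::] (fun z => `|f z|) x * `|g x|)).
  - rewrite /F; apply: tmeas2M; first by apply: tmeas2_sub; exact: mol_meas.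
    by apply: tmeas2M; [apply: tmeas2_r; exact: sf.1|apply: tmeas2_l; exact: sg.1].
  - exact: Fx.
  - by apply: sqi_intgM => //; exact: sqi_norm.
  - move=> x; rewrite /conv mulrC -tintZ; last exact: conv_intg.
    apply: le_tint; [by apply: intg_norm|by apply: intgZ; exact: conv_intg|].
    move=> z; rewrite /F !normrM (ger0_norm (mol_ge0 mK _)).
    by rewrite le_eqVlt; apply/orP; left; apply/eqP; ring.
transitivity (tint (fun x => tint (F x))).
  apply: eq_tint => x; rewrite mulrC /conv -tintZ; last exact: conv_intg.
  by apply: eq_tint => z; rewrite /F; ring.
rewrite (tint_Fubini F2)//; apply: eq_tint => z.
rewrite /conv -tintZ; last exact: conv_intg.
by apply: eq_tint => x; rewrite /F (symK x z); ring.
Qed.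

(* The support consists of lattice copies of a small box, which periodic
   functions do not distinguish. *)
Lemma mol_supp_reduce s y : K s y != 0 -> exists y' : E3 R,
  [/\ `|y'.1.1| <= e, `|y'.1.2| <= e, `|y'.2| <= e &
     forall (W : Type) (f : E3 R -> W), periodic f -> forall x,
       f (x + y) = f (x + y') /\ f (x - y) = f (x - y')].
Proof.
move=> /(mol_supp mK)[k [l [h1 h2 h3]]].
exists (y + (k%:~R, l%:~R, 0)); split=> //; first by rewrite /= addr0.
move=> W f pf x; rewrite addrA pf; split=> //.
by rewrite opprD addrA -[RHS](pf _ k l) addrNK.
Qed.

Lemma conv_near_le f x (d : R) : pl2 f ->
  (forall y : E3 R, `|y.1.1| <= e -> `|y.1.2| <= e -> `|y.2| <= e -> `|f (x - y) - f x| <= d) ->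
  `|conv [::] f x - f x| <= d.
Proof.
move=> pf fd; have ff : intg (fun y => K [::] y * f (x - y)).
  apply: sqi_intgM; first exact: mol_sqi.
  split; first exact: meas_sub pf.2.1.
  apply: (@intg_sub _ (fun z => f z ^+ 2) x); last exact: pf.2.2.
  by move=> z k l; rewrite pf.1.
rewrite conv_yform// -[X in _ - X]mulr1 -(mol_tint mK) -tintZ; last exact: mol_intg.
rewrite -tintB//; last by apply: intgZ; exact: mol_intg.
rewrite -[leRHS]mulr1 -(mol_tint mK) -tintZ; last exact: mol_intg.
apply: tint_norm_le; [by apply: intgB => //; apply: intgZ; exact: mol_intg|by apply: intgZ; exact: mol_intg|].
move=> y; rewrite [f x * _]mulrC -mulrBr normrM (ger0_norm (mol_ge0 mK _)) [leRHS]mulrC.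
have [->|/mol_supp_reduce[y' [a b c E]]] := eqVneq (K [::] y) 0; first by rewrite !mul0r.
by rewrite ler_wpM2l ?(mol_ge0 mK)// (E _ f pf.1 x).2; exact: fd.
Qed.

End Fixed.

(** Translations commute with convolution. With it, both the divergence constraint and measurability
    in time pass from a field to its mollification at the second scale. *)
Lemma conv_comm C e K C' e' K' s f x : mollifier C e K -> mollifier C' e' K' -> e <= 1 -> e' <= 1 -> pl2 f ->
  conv K s (conv K' [::] f) x = tint (fun y => K' [::] y * conv K s f (x - y)).
Proof.
move=> mK mK' e1 e1' pf.
have [pf' sf] := pf.
pose F z y := K s (x - z) * (K' [::] y * f (z - y)).
have fsub z : sqi (fun y => f (z - y)).
  split; first exact: meas_sub sf.1.
  apply: (@intg_sub _ (fun y => f y ^+ 2) z); last exact: sf.2.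
  by move=> y k l; rewrite pf'.
have fsh y : sqi (fun z => f (z - y)) by apply: (@sqi_shift _ f) => //.
have Fz z : intg (F z).
  by apply: intgZ; apply: sqi_intgM; [exact: (mol_sqi mK' [::])|exact: fsub].
have Fy y : intg (F ^~ y).
  apply: (eq_intg _ (intgZ (K' [::] y) (conv_intg mK s x (fsh y)))) => z; rewrite /F; ring.
have F2 : tintg2 F.
  apply: (@tintg2_le _ _ (fun z => norm2 (K' [::]) * norm2 f * `|K s (x - z)|)).
  - apply: tmeas2M; first by apply: tmeas2_l; apply: meas_sub; exact: (mol_meas mK).
    by apply: tmeas2M; [apply: tmeas2_r; exact: (mol_meas mK')|apply: tmeas2_sub; exact: sf.1].
  - exact: Fz.
  - apply: intgZ; apply: intg_norm; apply: intg_sub; [exact: (mol_periodic mK)|exact: (mol_intg mK)].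
  - move=> z; have iy : intg (fun y => `|K' [::] y| * `|f (z - y)|).
      by apply: sqi_intgM; apply: sqi_norm => //; exact: (mol_sqi mK').
    rewrite (_ : tint _ = `|K s (x - z)| * tint (fun y => `|K' [::] y| * `|f (z - y)|)); last first.
      by rewrite -tintZ//; apply: eq_tint => y; rewrite !normrM.
    rewrite mulrC ler_wpM2r//.
    have := cauchy_schwarz (sqi_norm (mol_sqi mK' [::])) (sqi_norm (fsub z)).
    have nn h : norm2 (fun z => `|h z|) = norm2 h.
      by congr Num.sqrt; apply: eq_tint => w; rewrite real_normK ?num_real.
    rewrite !nn (_ : norm2 (fun y => f (z - y)) = norm2 f).
      by apply: le_trans; exact: ler_norm.
    congr Num.sqrt; apply: (@tint_sub _ (fun y => f y ^+ 2) z); last exact: sf.2.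
    by move=> y k l; rewrite pf'.
transitivity (tint (fun z => tint (F z))).
  apply: eq_tint => z; rewrite (conv_yform mK')// -tintZ//.
  by apply: sqi_intgM => //; exact: (mol_sqi mK').
rewrite (tint_Fubini F2)//; apply: eq_tint => y.
transitivity (K' [::] y * conv K s (fun z => f (z - y)) x).
  rewrite /conv -tintZ; first by apply: eq_tint => z; rewrite /F; ring.
  exact: (conv_intg mK).
congr (_ * _).
rewrite (conv_yform mK); last by split; [exact: (@periodic_shift _ _ f)|].
rewrite (conv_yform mK)//; apply: eq_tint => z; congr (_ * f _).
by rewrite addrAC.
Qed.

End Convolution.

(** * Reflection across the boundary *)

Section HalfSpace.
Context {R : realType}.
Local Notation mu := (@torus_measure R).
Implicit Types (h : E3 R -> R) (x y : E3 R) (i j : 'I_3).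

Lemma plane_null : {ae mu, forall x, (x : E3 R).2 != 0}.
Proof.
exists (setT `*` [set 0]); split.
- exact: measurableX.
- rewrite /torus_measure product_measure1E//.
  rewrite [X in (_ * X)%E](_ : _ = 0%E) ?mule0//.
  exact: lebesgue_measure_set1.
- by move=> [[a b] c]/= /negP; rewrite negbK => /eqP ->.
Qed.

(** The sign in the odd extension vanishes on the boundary plane, so identities between a field and
    its extension hold only off this null set. *)
Lemma eq_tint_off h h' : meas h -> meas h' -> (forall x, x.2 != 0 -> h x = h' x) -> tint h = tint h'.
Proof.
move=> mh mh' hh; rewrite /tint /Rintegral; congr fine.
apply: ae_eq_integral => //; [exact/measurable_EFinP|exact/measurable_EFinP|].
by apply: negligibleS plane_null => x; apply: contra_not => x0 _; rewrite /= hh.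
Qed.

Lemma eq_intg_off h h' : meas h' -> (forall x, x.2 != 0 -> h x = h' x) -> intg h -> intg h'.
Proof.
move=> mh' hh /integrableP[mh hoo]; apply/integrableP; split; first exact/measurable_EFinP.
rewrite (_ : (\int[_]_(x in _) _ = \int[mu]_x `|(EFin \o h) x|)%E)//.
apply: ae_eq_integral => //.
- by apply: measurableT_comp => //; exact/measurable_EFinP.
- exact: measurableT_comp.
- by apply: negligibleS plane_null => x; apply: contra_not => x0 _; rewrite /= hh.
Qed.

Definition absr x : E3 R := (x.1.1, x.1.2, `|x.2|).

Lemma absr_Dplus x : Dplus (absr x). Proof. exact: normr_ge0. Qed.
Lemma absr_id x : 0 <= x.2 -> absr x = x.
Proof. by case: x => [[a b] c] /= c0; rewrite /absr/= ger0_norm. Qed.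
Lemma absr_refl x : absr (refl x) = absr x. Proof. by rewrite /absr/refl/= normrN. Qed.

Lemma measurable_absr : measurable_fun setT (absr : mE3 R -> mE3 R).
Proof.
apply: measurable_fun_pair; first by apply: measurable_fun_pair; apply: measurableT_comp.
by apply: measurableT_comp.
Qed.

Lemma measurable_Dplus : measurable (Dplus : set (mE3 R)).
Proof.
rewrite (_ : Dplus = setT `*` `[0, +oo[%classic); first exact: measurableX.
by apply/seteqP; split=> x /=; rewrite /Dplus/= in_itv/= andbT; [split|case].
Qed.

Lemma meas_absr h : measurable_fun (Dplus : set (mE3 R)) (h : mE3 R -> R) -> meas (fun x => h (absr x)).
Proof.
move=> mh; apply: (@measurable_comp _ _ _ (mE3 R) (mE3 R) R Dplus h setT absr) => //.
- exact: measurable_Dplus.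
- by move=> _ [x _ <-]; exact: absr_Dplus.
- exact: measurable_absr.
Qed.

Lemma absr_meas h : meas (fun x => h (absr x)) -> measurable_fun (Dplus : set (mE3 R)) (h : mE3 R -> R).
Proof.
move=> mh; apply: (@eq_measurable_fun _ _ (mE3 R) R Dplus (fun x => h (absr x))).
  by move=> x; rewrite inE => x0; rewrite absr_id.
exact: measurable_funTS.
Qed.

Let half h x : R := (0 < x.2)%R%:R * h (absr x).

Let half_split h x : x.2 != 0 -> h (absr x) = half h x + half h (refl x).
Proof.
move=> x0; rewrite /half absr_refl /=.
by case: ltgtP x0 => //= x0 _; rewrite oppr_gt0 ?x0 ?mul1r ?mul0r ?addr0 ?ltNge ?ltW// ?mul1r ?mul0r ?add0r ?addr0.
Qed.

Let mhalf h : meas (fun x => h (absr x)) -> meas (half h).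
Proof.
move=> mh; apply: measM => //.
apply: (measurableT_comp (f := fun b : bool => b%:R : R)) => //.
by apply: measurable_fun_ltr => //; exact: measurable_snd.
Qed.

Let half_le h x : `|half h x| <= `|h (absr x)|.
Proof. by rewrite /half; case: (_ < _); rewrite ?mul1r ?mul0r ?normr0. Qed.

Let restrictE h : meas (fun x => h (absr x)) ->
  (\int[volume]_(x in cell Dplus) (h x)%:E = \int[mu]_x (half h x)%:E)%E.
Proof.
move=> mh; have mh' := absr_meas mh.
have mE : measurable_fun (Dplus : set (mE3 R)) (fun x : mE3 R => (h x)%:E).
  exact/measurable_EFinP.
transitivity (\int[mu]_(x in (Dplus : set (mE3 R))) (h x)%:E)%E.
  exact: (volume_torus measurable_Dplus mE).
rewrite integral_mkcond; apply: ae_eq_integral => //.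
- exact/(measurable_restrictT _ measurable_Dplus).
- apply/measurable_EFinP; exact: mhalf.
- apply: negligibleS plane_null => x; apply: contra_not => x0 _; rewrite /patch /half.
  case: (ltgtP 0 (x : E3 R).2) => x0'; last by move: x0; rewrite /= -x0' eqxx.
    by rewrite mem_set ?mul1r ?absr_id// ?/Dplus/= ltW.
  by rewrite memNset ?mul0r// /Dplus/= leNgt x0'.
Qed.

Let half_intg h : intg (fun x => h (absr x)) -> intg (half h).
Proof.
move=> hi; apply: (le_intg (mhalf (intg_meas hi)) _ (intg_norm hi)) => x.
exact: half_le.
Qed.

Let tint_half h : intg (fun x => h (absr x)) -> tint (half h) = 2^-1 * tint (fun x => h (absr x)).
Proof.
move=> hi; have mh := intg_meas hi; have ih := half_intg hi.
rewrite (@eq_tint_off (fun x => h (absr x)) (fun x => half h x + half h (refl x)))//; last exact: half_split.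
  by rewrite tintD//; [rewrite tint_refl//; lra|exact: intg_refl].
by apply: measD; [exact: mhalf|apply: meas_refl; exact: mhalf].
Qed.

Lemma half_ereal h : intg (fun x => h (absr x)) ->
  (\int[volume]_(x in cell Dplus) (h x)%:E = (2^-1 * tint (fun x => h (absr x)))%:E)%E.
Proof.
move=> hi; rewrite restrictE; last exact: intg_meas.
by rewrite -(Rint_fineK (half_intg hi)) -(tint_half hi).
Qed.

Lemma half_integral h : intg (fun x => h (absr x)) ->
  \int[volume]_(x in cell Dplus) h x = 2^-1 * tint (fun x => h (absr x)).
Proof. by move=> hi; rewrite [in LHS]/Rintegral half_ereal. Qed.

Lemma half_lty h : measurable_fun (Dplus : set (mE3 R)) (h : mE3 R -> R) ->
  (forall x, 0 <= h x) ->
  (\int[volume]_(x in cell Dplus) (h x)%:E < +oo)%E -> intg (fun x => h (absr x)).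
Proof.
move=> mh h0; have mh' := meas_absr mh; rewrite restrictE// => hoo.
have ih : intg (half h).
  by apply: integ_ge0_lty => //; [exact: mhalf|move=> x; rewrite /half mulr_ge0].
apply: (@eq_intg_off (fun x => half h x + half h (refl x))) => //.
  by move=> x x0; rewrite -half_split.
by apply: intgD => //; exact: intg_refl.
Qed.

End HalfSpace.

(** * Even and odd extension of vector fields *)

Section Extension.
Context {R : realType}.
Implicit Types (f g : E3 R -> E3 R) (x y : E3 R) (i j : 'I_3) (v w : 'I_3 -> E3 R -> R).

Definition parity i : R := if i == 2 then -1 else 1.

Lemma parity_sqr i : parity i * parity i = 1.
Proof. by rewrite /parity; case: ifP => _; rewrite ?mulrNN mulr1. Qed.

(** The value 0 of [Num.sg] at 0 makes the parity rule [wtN] hold at every point, the boundary plane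
    included, so that symmetry never needs an almost-everywhere qualifier. *)
Definition wt i (c : R) : R := if i == 2 then Num.sg c else 1.

Lemma wtN i c : wt i (- c) = parity i * wt i c.
Proof. by rewrite /wt /parity; case: ifP => _; rewrite ?sgrN ?mulN1r ?mul1r. Qed.
Lemma wt_pos i c : 0 < c -> wt i c = 1.
Proof. by move=> c0; rewrite /wt; case: ifP => // _; rewrite gtr0_sg. Qed.
Lemma wt_sqr i c : c != 0 -> wt i c * wt i c = 1.
Proof. by move=> c0; rewrite /wt; case: ifP => _; rewrite ?mulr1// -expr2 sqr_sg c0. Qed.
Lemma wt_le i c : `|wt i c| <= 1.
Proof. by rewrite /wt; case: ifP => _; rewrite ?normr1// normr_sg; case: (_ != _). Qed.

Lemma meas_wt i : meas (fun x => wt i x.2).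
Proof.
rewrite /wt; have [i2|i2] := boolP (i == 2); last exact: meas_cst.
apply: (@measurableT_comp _ _ _ _ _ _ (Num.sg : R -> R) _ (fun x : mE3 R => x.2)) => //.
have -> : Num.sg = (fun c : R => (0 < c)%R%:R - (c < 0)%R%:R) :> (R -> R).
  by apply/funext => c; rewrite /Num.sg; case: ltgtP => _; rewrite ?subr0 ?sub0r ?subrr.
by apply: measurable_funB; apply: (measurableT_comp (f := fun b : bool => b%:R : R)) => //;
  apply: measurable_fun_ltr.
exact: measurable_snd.
Qed.

(* Even extension of the tangential components, odd extension of the normal one. *)
Definition ext f i x : R := wt i x.2 * component (f (absr x)) i.

Definition vec v x : E3 R := (v 0 x, v 1 x, v 2 x).

(** The class of extensions of L^2 fields on the half space, by [ext_sym] and [vec_ext]; unlike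
    fields on the half space it is stable under mollification. *)
Definition sym v : Prop :=
  forall i, pl2 (v i) /\ forall x, v i (refl x) = parity i * v i x.

Lemma component_vec v x i : component (vec v x) i = v i x.
Proof. by move: i; apply: ord3P. Qed.

Lemma component_inj x y : (forall i, component x i = component y i) -> x = y.
Proof.
by case: x => [[a b] c]; case: y => [[a' b'] c'] E; congr (_, _, _);
  [exact: (E 0)|exact: (E 1)|exact: (E 2)].
Qed.

Lemma componentD x y i : component (x + y) i = component x i + component y i.
Proof. by move: i; apply: ord3P. Qed.
Lemma componentB x y i : component (x - y) i = component x i - component y i.
Proof. by move: i; apply: ord3P. Qed.
Lemma componentZ k x i : component (k *: x) i = k * component x i.
Proof. by move: i; apply: ord3P. Qed.

Lemma component_le x i : `|component x i| <= enorm x.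
Proof.
rewrite -sqrtr_sqr ler_wsqrtr// /dot (bigD1 i)//= expr2 lerDl.
by apply: sumr_ge0 => j _; exact: sqr_ge0.
Qed.

Lemma dot_ge0 x : 0 <= dot x x.
Proof. by apply: sumr_ge0 => j _; exact: sqr_ge0. Qed.

Lemma enorm_sqr x : enorm x ^+ 2 = dot x x.
Proof. by rewrite sqr_sqrtr// dot_ge0. Qed.

Lemma enorm_ge0 x : 0 <= enorm x. Proof. exact: sqrtr_ge0. Qed.

Lemma ext_refl f i x : ext f i (refl x) = parity i * ext f i x.
Proof. by rewrite /ext absr_refl /= wtN mulrA. Qed.

Lemma extB f g i x : ext (f \- g) i x = ext f i x - ext g i x.
Proof. by rewrite /ext componentB mulrBr. Qed.

Lemma ext_pos f i x : 0 < x.2 -> ext f i x = component (f x) i.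
Proof. by move=> x0; rewrite /ext wt_pos// mul1r absr_id// ltW. Qed.

Lemma torus_periodic_absr f : torus_periodic Dplus f -> periodic (fun x => f (absr x)).
Proof.
move=> pf; apply: torus_periodicP => x _.
have E i : (i == 0) || (i == 1) -> absr (x + unit_vec i) = absr x + unit_vec i.
  by case: (x) => -[a b] c; case/orP => /eqP ->; rewrite /absr/unit_vec/=; congr (_, _, _); rewrite /= !addr0.
by rewrite !E//; exact: pf (absr_Dplus x).
Qed.

Lemma ext_periodic f i : torus_periodic Dplus f -> periodic (ext f i).
Proof.
move=> /torus_periodic_absr pf x k l; rewrite /ext.
by rewrite (pf x k l) /= addr0.
Qed.

Lemma ext_meas f i : measurable_fun (Dplus : set (mE3 R)) (fun x => component (f x) i) -> meas (ext f i).
Proof.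
move=> mf; apply: measM; first exact: meas_wt.
exact: (meas_absr (h := fun x => component (f x) i)).
Qed.

Lemma L2norm_lty f : (L2norm Dplus f < +oo)%E ->
  (\int[volume]_(x in cell Dplus) (enorm (f x) ^+ 2)%:E < +oo)%E.
Proof.
rewrite /L2norm; move: (integral _ _ _) => [r||] //=; rewrite ?ltry ?ltNyr//.
by rewrite invr_eq0 pnatr_eq0/= ltxx.
Qed.

Lemma ext_pl2 f i : in_L2 Dplus f -> pl2 (ext f i).
Proof.
move=> [pf mf /L2norm_lty foo].
have me : measurable_fun (Dplus : set (mE3 R)) (fun x => enorm (f x) ^+ 2).
  under eq_fun do rewrite enorm_sqr.
  by apply: measurable_sum => j; apply: measurable_funM; exact: mf.
split; first exact: ext_periodic.
split; first exact: ext_meas.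
have i2 := half_lty me (fun x => sqr_ge0 _) foo.
apply: (le_intg _ _ i2); first by apply: measX; exact: ext_meas.
move=> x; rewrite ger0_norm ?sqr_ge0// /ext exprMn.
rewrite -[leRHS]mul1r ler_pM ?sqr_ge0//.
  by rewrite -real_normK ?num_real// expr_le1// wt_le.
by rewrite -real_normK ?num_real// lerXn2r ?nnegrE ?enorm_ge0// component_le.
Qed.

Lemma ext_sym f : in_L2 Dplus f -> sym (ext f).
Proof. by move=> fL i; split; [exact: ext_pl2|move=> x; exact: ext_refl]. Qed.

Definition ip v w : R := \sum_(i < 3) tint (fun x => v i x * w i x).

Lemma dot_ext f g x : x.2 != 0 -> \sum_i ext f i x * ext g i x = dot (f (absr x)) (g (absr x)).
Proof.
move=> x0; apply: eq_bigr => i _.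
by rewrite /ext mulrACA wt_sqr// mul1r.
Qed.

Lemma dot_meas f g : in_L2 Dplus f -> in_L2 Dplus g -> meas (fun x => dot (f (absr x)) (g (absr x))).
Proof.
move=> [_ mf _] [_ mg _].
apply: (meas_absr (h := fun x => dot (f x) (g x))).
by apply: measurable_sum => j; apply: measurable_funM; [exact: mf|exact: mg].
Qed.

Lemma dot_intg f g : in_L2 Dplus f -> in_L2 Dplus g -> intg (fun x => dot (f (absr x)) (g (absr x))).
Proof.
move=> fL gL; apply: (@eq_intg_off _ (fun x => \sum_i ext f i x * ext g i x)).
- exact: dot_meas.
- by move=> x x0; rewrite dot_ext.
- by apply: intg_sum => i; apply: sqi_intgM; [exact: (ext_pl2 i fL).2|exact: (ext_pl2 i gL).2].
Qed.

Lemma tint_dot f g : in_L2 Dplus f -> in_L2 Dplus g ->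
  tint (fun x => dot (f (absr x)) (g (absr x))) = ip (ext f) (ext g).
Proof.
move=> fL gL.
have im i : intg (fun x => ext f i x * ext g i x).
  by apply: sqi_intgM; [exact: (ext_pl2 i fL).2|exact: (ext_pl2 i gL).2].
rewrite /ip -tint_sum//; apply: eq_tint_off; first exact: dot_meas.
  by apply: intg_meas; apply: intg_sum.
by move=> x x0; rewrite dot_ext.
Qed.

(** The product of two extensions is even in x_3 because the signs square to 1, and the half space
    carries half of its integral. *)
Lemma inner_ext f g : in_L2 Dplus f -> in_L2 Dplus g -> inner Dplus f g = 2^-1 * ip (ext f) (ext g).
Proof.
move=> fL gL; rewrite -tint_dot// /inner.
exact: (half_integral (h := fun x => dot (f x) (g x)) (dot_intg fL gL)).
Qed.

Definition sqnorm v : R := \sum_(i < 3) norm2 (v i) ^+ 2.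

Lemma ip_sqnorm v : ip v v = sqnorm v.
Proof. by apply: eq_bigr => i _; rewrite norm2_sqr; apply: eq_tint => x; rewrite expr2. Qed.

Lemma L2norm_ext f : in_L2 Dplus f -> L2norm Dplus f = (Num.sqrt (2^-1 * sqnorm (ext f)))%:E.
Proof.
move=> fL; rewrite /L2norm.
under eq_integral do rewrite enorm_sqr.
rewrite (half_ereal (h := fun x => dot (f x) (f x)) (dot_intg fL fL)).
by rewrite tint_dot// ip_sqnorm poweR_EFin powR12_sqrt ?mulr_ge0// ?invr_ge0// sumr_ge0// => i _; rewrite sqr_ge0.
Qed.

Lemma vec_ext v i x : sym v -> ext (vec v) i x = v i x.
Proof.
move=> sv; rewrite /ext component_vec.
have [x0|x0] := leP 0 x.2.
  rewrite absr_id//; move: x0; rewrite le_eqVlt => /orP[/eqP x0|x0]; last by rewrite wt_pos// mul1r.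
  rewrite /wt; case: eqP => [i2|]; last by rewrite mul1r.
  (* On the plane oddness forces the normal component to vanish, in agreement with the sign 0. *)
  have := (sv i).2 x; rewrite /parity i2 eqxx mulN1r -x0 sgr0 mul0r.
  have -> : refl x = x by case: x x0 => [[a b] c]/= <-; rewrite /refl/= oppr0.
  by lra.
have -> : absr x = refl x by rewrite /absr /refl ltr0_norm.
by rewrite (sv i).2 -[x.2]opprK wtN wt_pos ?oppr_gt0// mulr1 mulrA parity_sqr mul1r.
Qed.

Lemma vec_in_L2 v : sym v -> in_L2 Dplus (vec v).
Proof.
move=> sv.
have pv x i : v i (x + unit_vec 0) = v i x /\ v i (x + unit_vec 1) = v i x.
  have := (sv i).1.1; rewrite /periodic => pv; split.
    by rewrite -[RHS](pv x 1 0).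
  by rewrite -[RHS](pv x 0 1).
have mc i : measurable_fun (Dplus : set (mE3 R)) (fun x => component (vec v x) i).
  by under eq_fun do rewrite component_vec; apply: measurable_funTS; exact: (sv i).1.2.1.
have E x : x.2 != 0 -> \sum_i v i x ^+ 2 = enorm (vec v (absr x)) ^+ 2.
  move=> x0; rewrite enorm_sqr; apply: eq_bigr => i _.
  by rewrite -(vec_ext i x sv) /ext exprMn expr2 wt_sqr// mul1r.
have ie : intg (fun x => enorm (vec v (absr x)) ^+ 2).
  apply: (eq_intg_off _ E); last by apply: intg_sum => i; exact: (sv i).1.2.2.
  apply: (meas_absr (h := fun x => enorm (vec v x) ^+ 2)).
  under eq_fun do rewrite enorm_sqr.
  by apply: measurable_sum => j; apply: measurable_funM; exact: mc.
split=> //.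
- by move=> x _; split; rewrite /vec; congr (_, _, _); first [exact: (pv x _).1|exact: (pv x _).2].
- by rewrite /L2norm (half_ereal (h := fun x => enorm (vec v x) ^+ 2) ie) poweR_EFin ltry.
Qed.

End Extension.

Lemma Rint_dct_ae d (X : measurableType d) (R : realType) (m : {measure set X -> \bar R})
    (F : nat -> X -> R) (f g : X -> R) :
  (forall n, integ m (F n)) -> measurable_fun setT f -> integ m g ->
  {ae m, forall x, F n x @[n --> \oo] --> f x /\ forall n, `|F n x| <= g x} ->
  \int[m]_x F n x @[n --> \oo] --> \int[m]_x f x.
Proof.
move=> Fi mf gi H.
have [|||||fi _ L] := @dominated_convergence _ _ _ m setT measurableT
  (fun n x => (F n x)%:E) (fun x => (f x)%:E) (fun x => (g x)%:E).
- by move=> n; apply/measurable_EFinP; exact: integ_meas (Fi n).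
- exact/measurable_EFinP.
- by apply: filterS H => x [Fx _] _; apply/fine_cvgP; split; [exact: nearW|exact: Fx].
- exact: gi.
- by apply: filterS H => x [_ Fx] n _; rewrite /= lee_fin.
have fi' : integ m f by exact: fi.
move: L; rewrite -(Rint_fineK fi').
rewrite (_ : [sequence _]_n = EFin \o (fun n => \int[m]_x F n x)); first by move/fine_cvg.
by apply/funext => n /=; rewrite (Rint_fineK (Fi n)).
Qed.

Lemma Rint_dct d (X : measurableType d) (R : realType) (m : {measure set X -> \bar R})
    (F : nat -> X -> R) (f g : X -> R) :
  (forall n, measurable_fun setT (F n)) -> measurable_fun setT f ->
  {ae m, forall x, F n x @[n --> \oo] --> f x} ->
  integ m g -> (forall n x, `|F n x| <= g x) ->
  \int[m]_x F n x @[n --> \oo] --> \int[m]_x f x.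
Proof.
move=> mF mf Ff gi Fg; apply: (Rint_dct_ae _ mf gi).
  by move=> n; exact: le_integ (Fg n) gi.
by apply: filterS Ff => x Fx; split.
Qed.

(** * Extensions of Schwartz fields: Lipschitz bounds and divergence *)

Section LinearAnalysis.
Context {R : realType}.
Implicit Types (x y z : E3 R) (i j : 'I_3) (f g : E3 R -> R) (phi : E3 R -> E3 R).

Lemma tint_dct (F : nat -> E3 R -> R) f g :
  (forall n, meas (F n)) -> meas f -> intg g -> (forall n x, `|F n x| <= g x) ->
  (forall x, x.2 != 0 -> F n x @[n --> \oo] --> f x) ->
  tint (F n) @[n --> \oo] --> tint f.
Proof.
move=> mF mf gi Fg Ff; apply: Rint_dct => //; last exact: gi.
by apply: negligibleS (@plane_null R) => x; apply: contra_not => x0; exact: Ff.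
Qed.

Lemma quadratic_bound_eq0 (a M : R) : (forall h, 0 < h -> `|h * a| <= M * h ^+ 2) -> a = 0.
Proof.
move=> H; apply/eqP; rewrite -normr_eq0 eq_le normr_ge0 andbT.
apply/ler_addgt0Pl => d d0; rewrite addr0.
have M1 : 0 < `|M| + 1 by rewrite ltr_wpDl.
have h0 : 0 < d / (`|M| + 1) by rewrite divr_gt0.
have := H _ h0; rewrite normrM (gtr0_norm h0) expr2 mulrCA (ler_pM2l h0) => /le_trans; apply.
rewrite mulrA ler_pdivrMr// mulrC ler_wpM2l// ?ltW//.
by have := ler_norm M; lra.
Qed.

Lemma stepE (x y : E3 R) (h : R) :
  x + h *: y = (x.1.1 + h * y.1.1, x.1.2 + h * y.1.2, x.2 + h * y.2).
Proof. by []. Qed.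

Lemma cvg_sumr (T : Type) (F : set_system T) (FF : Filter F) (I : Type) (s : seq I)
    (q : I -> T -> R) (l : I -> R) : (forall p, q p @ F --> l p) ->
  (fun t => \sum_(p <- s) q p t) @ F --> \sum_(p <- s) l p.
Proof.
move=> ql; elim: s => [|p s IH].
  by under eq_fun do rewrite big_nil; rewrite big_nil; exact: cvg_cst.
by under eq_fun do rewrite big_cons; rewrite big_cons; apply: cvgD => //; exact: ql.
Qed.

Lemma refl_step x i (h : R) : refl x + h *: unit_vec i = refl (x + (parity i * h) *: unit_vec i).
Proof.
rewrite !stepE /refl/=; move: i; apply: ord3P; rewrite /parity /unit_vec/= !mulr0 !addr0 ?mul1r//.
by rewrite !mulr1 mulN1r opprB addrC.
Qed.

Section Kernel.
Variables (C e : R) (K : seq 'I_3 -> E3 R -> R).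
Hypothesis mK : mollifier C e K.

Lemma mol_grad_refl i x : K [:: i] (refl x) = parity i * K [:: i] x.
Proof.
have [M HM] := mol_taylor mK [::] i.
apply/eqP; rewrite -subr_eq0; apply/eqP.
apply: (@quadratic_bound_eq0 _ (2 * M)) => h h0.
have h1 := HM (refl x) h; have h2 := HM x (parity i * h).
rewrite refl_step !(mol_refl mK) in h1.
have E : (parity i * h) ^+ 2 = h ^+ 2 by rewrite exprMn expr2 parity_sqr mul1r.
rewrite E in h2.
set A := K [::] _ in h1 h2; set B := K [::] x in h1 h2.
have -> : h * (K [:: i] (refl x) - parity i * K [:: i] x) =
   (A - B - parity i * h * K [:: i] x) - (A - B - h * K [:: i] (refl x)) by ring.
rewrite (le_trans (ler_normB _ _))// (le_trans (lerD h2 h1))//.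
by rewrite le_eqVlt; apply/orP; left; apply/eqP; ring.
Qed.

Lemma conv_grad_refl i f (sg : R) x : sqi f -> (forall z, f (refl z) = sg * f z) ->
  conv K [:: i] f (refl x) = parity i * sg * conv K [:: i] f x.
Proof.
move=> sf fs; have ci := conv_intg mK [:: i] _ sf.
rewrite /conv -(tint_refl (ci _)) -tintZ; last exact: ci.
by apply: eq_tint => z; rewrite fs -reflN -reflD mol_grad_refl; ring.
Qed.

End Kernel.

Lemma component_lipschitz i (x y : E3 R) : `|component (x + y) i - component x i| <= 1 * `|y|.
Proof.
rewrite componentD addrC addKr mul1r; have [a b c] := norm_coord y.
by move: i; apply: ord3P.
Qed.

Lemma component_continuous i : continuous (fun x => component x i).
Proof. exact: (lipschitz_continuous (component_lipschitz i)). Qed.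

Lemma cvg_component (T : Type) (F : set_system T) (FF : Filter F) (q : T -> E3 R) (l : E3 R) i :
  q @ F --> l -> (fun t => component (q t) i) @ F --> component l i.
Proof. by move=> ql; apply: (cvg_comp q (fun x => component x i) ql); exact: component_continuous. Qed.

(** At points where D contains all small increments along v, the restricted filter is the punctured
    neighbourhood, and one-sided partial derivatives become ordinary ones. *)
Lemma increments_open (V W : normedModType R) (D : set V) (v x : V) (q : R -> W) (l : W) :
  (\forall h \near (0 : R), D (x + h *: v)) -> q @ increments D v x --> l -> q @ (0 : R)^' --> l.
Proof.
move=> Dn ql U /ql; rewrite /increments /within /= /nbhs/= => H.
rewrite /dnbhs /within /=; move: H; rewrite /dnbhs /within /= => H.
by apply: filterS2 Dn H => h Dh H h0; exact: H.
Qed.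

Lemma increments_seq (V W : normedModType R) (D : set V) (v x : V) (q : R -> W) (l : W) (k : nat -> R) :
  q @ increments D v x --> l -> k @ \oo --> (0 : R) -> (forall n, k n != 0) ->
  (\forall n \near \oo, D (x + k n *: v)) -> q (k n) @[n --> \oo] --> l.
Proof.
move=> ql k0 kn Dn U /ql; rewrite /increments /within /= /nbhs/= /dnbhs /within /= => H.
have := k0 _ H; rewrite /nbhs/= => H'.
by apply: filterS2 Dn H' => n Dh; apply => //; exact: kn.
Qed.

Lemma within_comp (U V W : topologicalType) (A : set U) (B : set V) (f : V -> W) (g : U -> V) :
  {within B, continuous f} -> continuous g -> (forall t, A t -> B (g t)) ->
  {within A, continuous (fun t => f (g t))}.
Proof.
move=> /subspace_continuousP cf cg AB; apply/subspace_continuousP => t At N /cf => /(_ (AB _ At)).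
rewrite /within /= => /cg; rewrite /nbhs/= => H.
by apply: filterS H => s H /AB; exact: H.
Qed.

Section SchwartzLipschitz.
Variable phi : E3 R -> E3 R.
Hypothesis sphi : schwartz_n_sigma phi.

Let bnd i : exists2 M : R, 0 <= M & forall x, Dplus x -> enorm (partial Dplus (unit_vec i) phi x) <= M.
Proof.
have [[_ _ dec] _ _] := sphi; have [M HM] := dec [:: i] 0.
have HM' x : Dplus x -> enorm (partial Dplus (unit_vec i) phi x) <= M.
  by move=> /HM; rewrite expr0 mulr1.
exists M => //; apply: le_trans (enorm_ge0 (partial Dplus (unit_vec i) phi 0)) (HM' _ _).
by rewrite /Dplus/=.
Qed.

Let derive_phi i x : Dplus x ->
  quotient_within phi (unit_vec i) x @ increments Dplus (unit_vec i) x --> partial Dplus (unit_vec i) phi x.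
Proof. by have [[_ sm _] _ _] := sphi; move=> Dx; exact: (sm [::]).2. Qed.

(** The mean value theorem along a segment in a positive coordinate direction: it stays in the half
    space, and at its points with t > 0 small increments of both signs are admissible, so the
    partial derivative there is two-sided. *)
Let step_lip i : exists2 M : R, 0 <= M & forall j x (h : R), Dplus x -> 0 < h -> 
  `|component (phi (x + h *: unit_vec i)) j - component (phi x) j| <= M * h.
Proof.
have [M M0 HM] := bnd i; exists M => // j x h Dx h0.
have Dxt (t : R) : 0 <= t -> Dplus (x + t *: unit_vec i).
  by move=> t0; rewrite /Dplus/= addr_ge0// mulr_ge0//.
pose g (t : R) := component (phi (x + t *: unit_vec i)) j.
pose dg (t : R) := component (partial Dplus (unit_vec i) phi (x + t *: unit_vec i)) j.
have step (t s : R) : x + t *: unit_vec i + s *: unit_vec i = x + (s + t) *: unit_vec i.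
  by rewrite -addrA -scalerDl [t + s]addrC.
have [t||] := @MVT R g dg 0 h h0.
- rewrite in_itv/= => /andP[t0 th].
  have lim : h^-1 *: (g (h + t) - g t) @[h --> (0:R)^'] --> dg t.
    pose q (s : R) := component (quotient_within phi (unit_vec i) (x + t *: unit_vec i) s) j.
    have -> : (fun s => s^-1 *: (g (s + t) - g t)) = q.
      by apply/funext => s; rewrite /q /quotient_within componentZ componentB step.
    apply: (@increments_open _ _ Dplus (unit_vec i) (x + t *: unit_vec i)).
      near=> s; rewrite step; apply: Dxt.
      suff : - t < s by lra.
      by near: s; apply: lt_nbhsr; lra.
    by apply: cvg_component; apply: derive_phi; apply: Dxt; exact: ltW.
  have E : (fun s : R => s^-1 *: (g (s *: (1:R) + t) - g t)) = (fun s => s^-1 *: (g (s + t) - g t)).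
    by apply/funext => s; rewrite [s *: 1]mulr1.
  apply: DeriveDef; first by rewrite /derivable E; apply: cvgP lim.
  by rewrite /derive E; apply/cvg_lim.
- have [[_ sm _] _ _] := sphi; have [cphi _] := sm [::].
  rewrite /g; apply: (@within_comp R (E3 R) R _ Dplus (fun x => component (phi x) j) (fun t => x + t *: unit_vec i)).
  + apply/subspace_continuousP => z Dz; apply: cvg_component.
    by move/subspace_continuousP : cphi; exact.
  + by move=> t; apply: cvgD; [exact: cvg_cst|apply: cvgZr_tmp; exact: cvg_id].
  + by move=> t /=; rewrite in_itv/= => /andP[t0 _]; exact: Dxt.
- move=> c; rewrite in_itv/= => /andP[c0 ch]; rewrite /g scale0r addr0 subr0 => ->.
  rewrite normrM (gtr0_norm h0); apply: ler_wpM2r; first exact: ltW.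
  by apply: (le_trans (component_le _ _)); apply: HM; apply: Dxt; exact: ltW.
Unshelve. all: by end_near. Qed.

Let phi_lip i : exists2 M : R, 0 <= M & forall j x (h : R), Dplus x -> Dplus (x + h *: unit_vec i) ->
  `|component (phi (x + h *: unit_vec i)) j - component (phi x) j| <= M * `|h|.
Proof.
have [M M0 HM] := step_lip i; exists M => // j x h Dx Dh.
have [h0|h0|h0] := ltgtP h 0.
- have := HM j _ (- h) Dh; rewrite scaleNr addrK oppr_gt0 distrC (ltr0_norm h0).
  exact.
- by rewrite (gtr0_norm h0); exact: HM.
- by rewrite h0 scale0r addr0 subrr normr0 mulr0.
Qed.

(** For points on opposite sides of 0 each value is bounded by M times the distance to 0, and the
    two distances add up to |c - d|. *)
Lemma sign_lipschitz (F : R -> R) (M : R) : 0 <= M -> F 0 = 0 ->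
  (forall c d, 0 <= c -> 0 <= d -> `|F c - F d| <= M * `|c - d|) ->
  forall c d, `|Num.sg c * F `|c| - Num.sg d * F `|d| | <= M * `|c - d|.
Proof.
move=> M0 F0 HF.
have F1 (c : R) : 0 <= c -> `|F c| <= M * c.
  by move=> c0; have := HF c 0 c0 (lexx _); rewrite F0 !subr0 (ger0_norm c0).
have pp (c d : R) : 0 <= c -> 0 <= d -> `|Num.sg c * F `|c| - Num.sg d * F `|d| | <= M * `|c - d|.
  move=> c0 d0; rewrite (ger0_norm c0) (ger0_norm d0).
  suff E (a : R) : 0 <= a -> Num.sg a * F a = F a by rewrite !E//; exact: HF.
  rewrite le_eqVlt => /orP[/eqP <-|a0]; first by rewrite sgr0 mul0r F0.
  by rewrite gtr0_sg// mul1r.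
have pn (c d : R) : 0 <= c -> d <= 0 -> `|Num.sg c * F `|c| - Num.sg d * F `|d| | <= M * `|c - d|.
  move=> c0 d0; rewrite (ger0_norm c0) (ler0_norm d0).
  apply: (le_trans (ler_normB _ _)); rewrite !normrM !normr_sg.
  have d1 : 0 <= - d by rewrite oppr_ge0.
  have h1 := F1 _ c0; have h2 := F1 _ d1.
  have -> : `|c - d| = c - d by apply: ger0_norm; lra.
  rewrite mulrBr; move: h1 h2; have := normr_ge0 (F c); have := normr_ge0 (F (- d)); rewrite mulrN.
  by case: (_ != _); case: (_ != _); rewrite ?mul1r ?mul0r /=; lra.
move=> c d; have [c0|c0] := leP 0 c; have [d0|d0] := leP 0 d.
- exact: pp.
- by apply: pn => //; exact: ltW.
- by rewrite distrC [`|c - d|]distrC; apply: pn => //; exact: ltW.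
- have := pp (- c) (- d); rewrite !sgrN (normrN c) (normrN d) !oppr_ge0 => h.
  rewrite -normrN -[`|c - d|]normrN !opprD !opprK.
  have := h (ltW c0) (ltW d0); rewrite !mulNr !opprK; exact.
Qed.

(** The condition that the normal component vanishes on the boundary is exactly what keeps its odd
    extension Lipschitz across the plane. The extension is in general no smoother than this, so its
    derivatives are avoided in favour of difference quotients. *)
Lemma ext_lipschitz i : exists2 M : R, 0 <= M & forall j x (h : R),
  `|ext phi j (x + h *: unit_vec i) - ext phi j x| <= M * `|h|.
Proof.
have [M M0 HM] := phi_lip i; exists M => // j x h.
have [i2|i2] := eqVneq i 2; last first.
  have E : absr (x + h *: unit_vec i) = absr x + h *: unit_vec i /\ (x + h *: unit_vec i).2 = x.2.
    move: i2; clear HM; move: i; apply: ord3P; rewrite !stepE /absr /unit_vec/= => // _;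
      by rewrite !mulr0 !addr0.
  rewrite /ext E.1 E.2 -mulrBr normrM.
  rewrite -[leRHS]mul1r ler_pM ?wt_le// HM//; first exact: absr_Dplus.
  by rewrite -E.1; exact: absr_Dplus.
subst i; case: x => -[a b] c.
have -> : (a, b, c) + h *: unit_vec 2 = (a, b, c + h).
  by rewrite stepE /unit_vec /= !mulr0 !addr0 mulr1.
pose F (t : R) := component (phi (a, b, t)) j.
have HF (s t : R) : 0 <= s -> 0 <= t -> `|F s - F t| <= M * `|s - t|.
  move=> s0 t0; have := HM j (a, b, t) (s - t) t0.
  have -> : (a, b, t) + (s - t) *: unit_vec 2 = (a, b, s).
    by rewrite stepE /unit_vec /= !mulr0 !addr0 mulr1 addrC subrK.
  by apply.
rewrite /ext /wt /absr /= -/(F _) -/(F _).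
have [j2|j2] := eqVneq j 2.
  have F0 : F 0 = 0 by rewrite /F j2; have [_ _ H] := sphi; exact: (H (a, b, 0)).
  by have := sign_lipschitz M0 F0 HF (c + h) c; rewrite (_ : c + h - c = h)//; ring.
rewrite !mul1r (le_trans (HF _ _ _ _))// ler_wpM2l// (le_trans (ler_dist_dist _ _))//.
by rewrite (_ : c + h - c = h)//; ring.
Qed.

Lemma ext_schwartz j x : Dplus x -> ext phi j x = component (phi x) j.
Proof.
rewrite /Dplus/= le_eqVlt => /orP[/eqP x0|x0]; last by rewrite ext_pos.
rewrite /ext /wt absr_id -?x0//; case: eqP => [->|_]; last by rewrite mul1r.
have [_ _ H] := sphi; rewrite -[component (phi x) 2]/((phi x).2) H//.
by rewrite mulr0.
Qed.

Lemma ext_continuous j : continuous (ext phi j).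
Proof.
have [|L _ HL] := @coord_lipschitz _ (ext phi j).
  by move=> i; have [M _ HM] := ext_lipschitz i; exists M => x h.
exact: (lipschitz_continuous HL).
Qed.

Lemma schwartz_measurable j : measurable_fun (Dplus : set (mE3 R)) (fun x => component (phi x) j).
Proof.
apply: (@eq_measurable_fun _ _ (mE3 R) R Dplus (ext phi j)).
  by move=> x; rewrite inE => Dx; rewrite ext_schwartz.
by apply: measurable_funTS; apply: continuous_meas; exact: ext_continuous.
Qed.

(** Below the plane, component i and a step in direction i both acquire the factor [parity i], and
    these cancel. Hence the divergence of the extension is the reflection of the divergence of
    phi. *)
Lemma ext_quotient_cvg i (z : E3 R) (k : nat -> R) : z.2 != 0 -> k @ \oo --> (0 : R) -> (forall n, k n != 0) ->
  (fun n => (k n)^-1 * (ext phi i (z + k n *: unit_vec i) - ext phi i z)) @ \oo -->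
    component (partial Dplus (unit_vec i) phi (absr z)) i.
Proof.
have pos (w : E3 R) (l : nat -> R) : 0 < w.2 -> l @ \oo --> (0 : R) -> (forall n, l n != 0) ->
    (fun n => (l n)^-1 * (ext phi i (w + l n *: unit_vec i) - ext phi i w)) @ \oo -->
      component (partial Dplus (unit_vec i) phi w) i.
  move=> w0 l0 ln.
  have near_pos : \forall n \near \oo, 0 < (w + l n *: unit_vec i).2.
    near=> n; rewrite /=.
    have : `|l n| < w.2 by near: n; apply: (@cvgr0_norm_lt _ _ _ _ _ l).
    rewrite ltr_norml => /andP[a b]; rewrite /GRing.scale/=.
    by case: (_ == _); rewrite ?mulr1 ?mulr0; lra.
  have Dw : Dplus w by exact: ltW.
  apply: (@cvg_trans _ ((fun n => component (quotient_within phi (unit_vec i) w (l n)) i) @ \oo)).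
    apply: near_eq_cvg; near=> n; rewrite /quotient_within componentZ componentB.
    by rewrite !ext_pos//; near: n.
  apply: cvg_component; apply: (increments_seq (derive_phi Dw) l0 ln).
  by apply: filterS near_pos => n; exact: ltW.
case: (ltgtP 0 z.2) => // z0 _ k0 kn; first by rewrite absr_id ?ltW//; exact: pos.
have rz : absr z = refl z by rewrite /absr /refl ltr0_norm.
pose l n := parity i * k n.
have l0 : l @ \oo --> (0 : R) by rewrite -(mulr0 (parity i)); apply: cvgMl_tmp.
have ln n : l n != 0 by rewrite mulf_neq0// /parity; case: ifP => _; rewrite ?oppr_eq0 oner_eq0.
have rz0 : 0 < (refl z).2 by rewrite /= oppr_gt0.
rewrite rz; apply: cvg_trans (pos (refl z) l rz0 l0 ln).
apply: near_eq_cvg; near=> n; rewrite refl_step !ext_refl -mulrBr /l mulrA parity_sqr mul1r.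
rewrite invfM mulrA [(parity i)^-1 * _]mulrC -[_ / _ * _]mulrA mulVf ?mulr1//.
by rewrite /parity; case: ifP => _; rewrite ?oppr_eq0 oner_eq0.
Unshelve. all: by end_near. Qed.

End SchwartzLipschitz.

Lemma eq_in_L2 (f g : E3 R -> E3 R) : (forall x, Dplus x -> f x = g x) -> in_L2 Dplus g -> in_L2 Dplus f.
Proof.
move=> fg [pg mg goo]; split.
- move=> x Dx; have [a b] := pg x Dx.
  by rewrite !fg// /Dplus/= addr0.
- move=> i; apply: (@eq_measurable_fun _ _ (mE3 R) R Dplus (fun x => component (g x) i)); last exact: mg.
  by move=> x; rewrite inE => Dx; rewrite fg.
- have -> : L2norm Dplus f = L2norm Dplus g; last exact: goo.
  congr (_ `^ _)%E; apply: eq_integral => x.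
  by rewrite inE => -[_ _ Dx]; rewrite fg.
Qed.

Section DivergenceFree.
Variables (C e : R) (K : seq 'I_3 -> E3 R -> R).
Hypothesis mK : mollifier C e K.
Hypothesis e0 : 0 < e.
Hypothesis e1 : e <= 1.

(** Translation invariance moves the difference quotients from the kernel onto the extension. There
    they are bounded by the Lipschitz constants and, off the plane, their sum tends to the
    divergence, which is 0; dominated convergence concludes. *)
Lemma schwartz_div_conv phi x : schwartz_n_sigma phi -> in_L2 Dplus phi ->
  \sum_(i < 3) conv K [:: i] (ext phi i) x = 0.
Proof.
move=> sphi pL.
have pl i : pl2 (ext phi i) by exact: ext_pl2.
pose k (n : nat) : R := n.+1%:R^-1.
have k_gt0 n : 0 < k n by rewrite invr_gt0.
have k_le1 n : `|k n| <= 1 by rewrite gtr0_norm// invf_le1// ler1n.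
have k0 : k @ \oo --> (0 : R) by exact: cvg_harmonic.
pose A n := \sum_(i < 3) (k n)^-1 * (conv K [::] (ext phi i) (x + k n *: unit_vec i) - conv K [::] (ext phi i) x).
pose F n z := K [::] (x - z) * \sum_(i < 3) (k n)^-1 * (ext phi i (z + k n *: unit_vec i) - ext phi i z).
have [M0 M00 HM0] := ext_lipschitz sphi 0.
have [M1 M10 HM1] := ext_lipschitz sphi 1.
have [M2 M20 HM2] := ext_lipschitz sphi 2.
have HM i : forall z (h : R), `|ext phi i (z + h *: unit_vec i) - ext phi i z| <= (M0 + M1 + M2) * `|h|.
  move=> z h; have hh := normr_ge0 h.
  move: i; apply: ord3P; [apply: (le_trans (HM0 _ _ _))|apply: (le_trans (HM1 _ _ _))|apply: (le_trans (HM2 _ _ _))];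
    rewrite ler_wpM2r//; lra.
have sh i (h : R) : pl2 (fun z => ext phi i (z + h *: unit_vec i)).
  by split; [exact: (@periodic_shift _ _ (ext phi i) _ (pl i).1)|exact: (@sqi_shift _ (ext phi i) _ (pl i).1 (pl i).2)].
have AF n : A n = tint (F n).
  have ip : forall i, intg (fun z => (k n)^-1 * (K [::] (x - z) * ext phi i (z + k n *: unit_vec i) - K [::] (x - z) * ext phi i z)).
    move=> i; apply: intgZ; apply: intgB; first exact: (conv_intg mK _ _ (sh i _).2).
    exact: (conv_intg mK _ _ (pl i).2).
  rewrite (_ : tint _ = tint (fun z => \sum_(i < 3) (k n)^-1 * (K [::] (x - z) * ext phi i (z + k n *: unit_vec i) - K [::] (x - z) * ext phi i z))); last first.
    by apply: eq_tint => z; rewrite /F mulr_sumr; apply: eq_bigr => i _; ring.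
  rewrite tint_sum//; apply: eq_bigr => i _; rewrite tintZ; last first.
    by apply: intgB; [exact: (conv_intg mK _ _ (sh i _).2)|exact: (conv_intg mK _ _ (pl i).2)].
  rewrite tintB; [|exact: (conv_intg mK _ _ (sh i _).2)|exact: (conv_intg mK _ _ (pl i).2)].
  congr (_ * (_ - _)).
  rewrite /conv -(@tint_shift _ (fun z => K [::] (x + k n *: unit_vec i - z) * ext phi i z) (k n *: unit_vec i)).
  - by apply: eq_tint => z; congr (K _ _ * _); rewrite opprD addrACA addrN addr0 //  addrAC.
  - move=> z p q; rewrite (pl i).1; congr (_ * _).
    by rewrite -[RHS](mol_periodic mK [::] _ (- p) (- q)) opprD addrA; congr (K _ (_ + (_, _, _))); rewrite /= ?intrN ?oppr0.
  - exact: (conv_intg mK _ _ (pl i).2).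
have A_lim : A @ \oo --> \sum_(i < 3) conv K [:: i] (ext phi i) x.
  rewrite /A; apply: cvg_sumr => i.
  have [M M00' HM'] := conv_taylor1 mK [::] i e1.
  apply: (@cvg_trans _ ((fun n => conv K [:: i] (ext phi i) x + ((k n)^-1 * (conv K [::] (ext phi i) (x + k n *: unit_vec i) - conv K [::] (ext phi i) x) - conv K [:: i] (ext phi i) x)) @ \oo)).
    by apply: near_eq_cvg; near=> n; rewrite addrC subrK.
  rewrite (_ : nbhs (conv _ _ _ _) = nbhs (conv K [:: i] (ext phi i) x + 0)); last by rewrite addr0.
  apply: cvgD; first exact: cvg_cst.
  apply/norm_cvg0P; apply: (@squeeze_cvgr _ _ _ _ (fun=> 0) (fun n => M * norm2 (ext phi i) * k n)).
  - near=> n; rewrite normr_ge0/=.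
    have := HM' _ (pl i).2 x (k n) (k_le1 n).
    set p := conv _ _ _ _ - conv _ _ _ _; set q := conv _ _ _ _ => h.
    have -> : (k n)^-1 * p - q = (k n)^-1 * (p - k n * q).
      by field; rewrite gt_eqF.
    rewrite normrM gtr0_norm ?invr_gt0// mulrC ler_pdivrMr//.
    by apply: (le_trans h); rewrite expr2 mulrA.
  - exact: cvg_cst.
  - by rewrite -(mulr0 (M * norm2 (ext phi i))); apply: cvgMl_tmp.
have F_lim : tint (F n) @[n --> \oo] --> tint (fun=> 0 : R).
  apply: (@tint_dct F _ (fun z => (3 * (M0 + M1 + M2)) * `|K [::] (x - z)|)).
  - move=> n; apply: measM; first by apply: meas_sub; exact: (mol_meas mK).
    apply: meas_sum => i; apply: measZ; apply: measB; first exact: (sh i _).2.1.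
    exact: (pl i).2.1.
  - exact: meas_cst.
  - by apply: intgZ; apply: intg_norm; apply: intg_sub; [exact: (mol_periodic mK)|exact: (mol_intg mK)].
  - move=> n z; rewrite /F normrM mulrC ler_wpM2r//.
    apply: (le_trans (ler_norm_sum _ _ _)).
    apply: (@le_trans _ _ (\sum_(i < 3) (M0 + M1 + M2))); last by rewrite sumr_const card_ord mulr_natl.
    apply: ler_sum => i _; rewrite normrM gtr0_norm ?invr_gt0//.
    rewrite mulrC ler_pdivrMr//; have := HM i z (k n); rewrite (gtr0_norm (k_gt0 n)).
    exact.
  - move=> z z0; rewrite -(mulr0 (K [::] (x - z))); apply: cvgMl_tmp.
    have [_ dv _] := sphi; have := dv (absr z) (absr_Dplus z); rewrite /divergence => E0.
    suff : (fun n => \sum_(i < 3) (k n)^-1 * (ext phi i (z + k n *: unit_vec i) - ext phi i z)) @ \oo -->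
        \sum_(i < 3) component (partial Dplus (unit_vec i) phi (absr z)) i by rewrite E0.
    by apply: cvg_sumr => i; apply: ext_quotient_cvg => // n; rewrite gt_eqF.
have : tint (F n) @[n --> \oo] --> \sum_(i < 3) conv K [:: i] (ext phi i) x.
  by rewrite (_ : (fun n => tint (F n)) = A)//; apply/funext => n; rewrite AF.
by rewrite tint0 in F_lim; move=> /(cvg_unique _ F_lim) <-.
Unshelve. all: by end_near. Qed.

Implicit Types u : E3 R -> E3 R.

Lemma ext_L2norm_lt u (d : R) i : in_L2 Dplus u -> (L2norm Dplus u < d%:E)%E -> norm2 (ext u i) <= 2 * d.
Proof.
move=> fL; rewrite L2norm_ext// lte_fin => fd.
have s0 : 0 <= sqnorm (ext u) by apply: sumr_ge0 => j _; exact: sqr_ge0.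
have d0 : 0 < d by apply: le_lt_trans fd; exact: sqrtr_ge0.
rewrite -(ler_pXn2r (n := 2)) ?nnegrE ?norm2_ge0//; last by rewrite mulr_ge0// ltW.
apply: (@le_trans _ _ (sqnorm (ext u))).
  by rewrite /sqnorm (bigD1 i)//= lerDl; apply: sumr_ge0 => j _; exact: sqr_ge0.
have : Num.sqrt (2^-1 * sqnorm (ext u)) ^+ 2 <= d ^+ 2.
  by apply: lerXn2r; rewrite ?nnegrE ?sqrtr_ge0 ?ltW.
rewrite sqr_sqrtr; last by rewrite mulr_ge0.
by rewrite exprMn; have := sqr_ge0 d; lra.
Qed.

(** Square integrability of phi is read off from that of f and of f - phi. *)
Lemma H_sigma_approx (f : E3 R -> E3 R) (d : R) : H_sigma f -> 0 < d -> exists phi,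
  [/\ schwartz_n_sigma phi, in_L2 Dplus phi & forall i, norm2 (fun x => ext f i x - ext phi i x) <= d].
Proof.
move=> [fL fa] d0; have [|phi [sphi fphi]] := fa (d / 2); first by rewrite divr_gt0.
exists phi.
have [pf mf _] := fL; have [[pp sm _] _ _] := sphi.
have mphi := schwartz_measurable sphi.
have dL : in_L2 Dplus (f \- phi).
  split; last exact: lt_trans fphi (ltry _).
  - by move=> x Dx; have [a b] := pf x Dx; have [a' b'] := pp x Dx; rewrite /= a b a' b'.
  - move=> j; under eq_fun do rewrite /= componentB.
    by apply: measurable_funB.
have E i x : ext (f \- phi) i x = ext f i x - ext phi i x by rewrite extB.
have pL : in_L2 Dplus phi.
  apply: (eq_in_L2 (g := vec (ext phi))).
    move=> x Dx; apply: component_inj => j; rewrite component_vec.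
    by rewrite ext_schwartz.
  apply: vec_in_L2 => j; split; last by move=> x; exact: ext_refl.
  split; first exact: ext_periodic.
  apply: (@le_sqi _ _ (fun x => ext f j x - ext (f \- phi) j x)).
  - by apply: ext_meas; exact: mphi.
  - by move=> x; rewrite E opprB addrCA subrr addr0.
  - by apply: sqiB; [exact: (ext_pl2 j fL).2|exact: (ext_pl2 j dL).2].
split=> // i; have -> : (fun x => ext f i x - ext phi i x) = ext (f \- phi) i by apply/funext => x; rewrite E.
by rewrite (le_trans (ext_L2norm_lt i dL fphi))// mulrC divfK.
Qed.

(** At a fixed point and for a fixed kernel, convolution is continuous for the L^2 norm, so the
    constraint passes to the completion. *)
Lemma H_sigma_div_conv (f : E3 R -> E3 R) x : H_sigma f -> \sum_(i < 3) conv K [:: i] (ext f i) x = 0.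
Proof.
move=> Hf; apply/eqP; rewrite -normr_eq0 eq_le normr_ge0 andbT.
pose N := \sum_(i < 3) norm2 (K [:: i]).
have N0 : 0 <= N by apply: sumr_ge0 => i _; exact: norm2_ge0.
apply/ler_addgt0Pl => d d0; rewrite addr0.
have d1 : 0 < d / (N + 1) by rewrite divr_gt0// ltr_wpDl.
have [phi [sphi pL fphi]] := H_sigma_approx Hf d1.
have -> : \sum_(i < 3) conv K [:: i] (ext f i) x =
    \sum_(i < 3) (conv K [:: i] (ext f i) x - conv K [:: i] (ext phi i) x).
  by rewrite sumrB (schwartz_div_conv x sphi pL) subr0.
have sf i : sqi (ext f i) by exact: (ext_pl2 i Hf.1).2.
have sp i : sqi (ext phi i) by exact: (ext_pl2 i pL).2.
apply: (le_trans (ler_norm_sum _ _ _)).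
apply: (@le_trans _ _ (N * (d / (N + 1)))).
  rewrite mulr_suml; apply: ler_sum => i _; rewrite -(convB mK)//.
  by rewrite (le_trans (conv_le mK _ _ _))//; [exact: sqiB|rewrite ler_wpM2l ?norm2_ge0].
rewrite mulrA ler_pdivrMr ?ltr_wpDl// mulrC; apply: ler_wpM2l; first exact: ltW.
by rewrite lerDl.
Qed.

End DivergenceFree.
End LinearAnalysis.

(** * Mollified fields as test functions *)

Section SmoothFamilies.
Context {R : realType}.

Lemma near0_norm_le (r : R) : 0 < r -> \forall h \near (0 : R), `|h| <= r.
Proof.
move=> r0; near=> h; rewrite ler_norml; apply/andP; split; apply: ltW; near: h.
  by apply: lt_nbhsr; rewrite oppr_lt0.
exact: lt_nbhsl.
Unshelve. all: by end_near. Qed.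

Section Abstract.
Variables (V W : normedModType R).
Implicit Types (D : set V) (v x : V).

(** Limits along an improper filter would determine nothing, so D must contain a half-open segment
    on one side of x. The sign is a parameter because at the final time of the cylinder only
    backward increments are available. *)
Lemma increments_proper D v x (sg r : R) : sg != 0 -> 0 < r ->
  (forall h, 0 < h -> h < r -> D (x + (sg * h) *: v)) -> ProperFilter (increments D v x).
Proof.
move=> sg0 r0 HD; apply: Build_ProperFilter.
rewrite /increments /within /dnbhs /= /within /= => /nbhs_ballP[d /= d0 H].
pose h := Num.min (r / 2) (d / (2 * `|sg|)).
have sgn : 0 < `|sg| by rewrite normr_gt0.
have h0 : 0 < h by rewrite lt_min !divr_gt0// mulr_gt0.
have hr : h < r by rewrite gt_min; apply/orP; left; rewrite ltr_pdivrMr//; lra.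
apply: (H (sg * h)) => //=.
- rewrite /ball/= sub0r normrN normrM (gtr0_norm h0).
  apply: (@le_lt_trans _ _ (`|sg| * (d / (2 * `|sg|)))).
    by apply: ler_wpM2l => //; rewrite ge_min lexx orbT.
  have -> : `|sg| * (d / (2 * `|sg|)) = d / 2 by field; rewrite gt_eqF.
  by lra.
- by rewrite mulf_neq0// gt_eqF.
- exact: HD.
Qed.

Lemma quotient_cvg D v x (P G : V -> W) (G' : W) (M : R) :
  (forall y, D y -> P y = G y) -> D x ->
  (forall h : R, `|h| <= 1 -> `|G (x + h *: v) - G x - h *: G'| <= M * h ^+ 2) ->
  quotient_within P v x @ increments D v x --> G'.
Proof.
move=> PG Dx HM; apply/cvgrPdist_le => d d0.
have M0 : 0 < `|M| + 1 by rewrite ltr_wpDl.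
have d1 : 0 < d / (`|M| + 1) by rewrite divr_gt0.
suff : \forall h \near (0 : R), h != 0 -> D (x + h *: v) -> `|G' - quotient_within P v x h| <= d by [].
near=> h => h0 Dh.
have h1 : `|h| <= 1 by near: h; exact: near0_norm_le.
have hd : `|h| <= d / (`|M| + 1) by near: h; exact: near0_norm_le.
have hp : 0 < `|h| by rewrite normr_gt0.
rewrite /quotient_within !PG// -normrN opprB.
rewrite -(scale1r G') -(mulVf h0) -scalerA -scalerBr normrZ normfV mulrC.
rewrite ler_pdivrMr//; apply: (le_trans (HM h h1)).
rewrite -real_normK ?num_real// expr2 mulrA; apply: ler_wpM2r; first exact: ltW.
apply: (@le_trans _ _ ((`|M| + 1) * `|h|)).
  by apply: ler_wpM2r => //; have := ler_norm M; lra.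
by rewrite mulrC -ler_pdivlMr.
Unshelve. all: by end_near. Qed.

(** A partial derivative at a point of D sees only values on D. If f agrees there with one member of
    a family defined on the whole space, and the family is linked by quadratic Taylor bounds,
    induction on the word identifies all iterated partials at once. *)
Lemma smooth_family (I : Type) (b : I -> V) D (f : V -> W) (G : seq I -> V -> W) :
  (forall x, D x -> f x = G [::] x) ->
  (forall s, continuous (G s)) ->
  (forall i x, D x -> ProperFilter (increments D (b i) x)) ->
  (forall s i x, D x -> exists M : R, forall h : R, `|h| <= 1 ->
     `|G s (x + h *: b i) - G s x - h *: G (i :: s) x| <= M * h ^+ 2) ->
  (forall s x, D x -> partials D (map b s) f x = G s x) /\ smooth_on b D f.
Proof.
move=> fG cG pD HG.
have PG s : forall x, D x -> partials D (map b s) f x = G s x.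
  elim: s => [|i s IH] x Dx; first exact: fG.
  have [M HM] := HG s i x Dx; have pf := pD i x Dx.
  by rewrite /= /partial; apply: cvg_lim (quotient_cvg IH Dx HM); exact: norm_hausdorff.
split=> // s; split.
  apply/subspace_continuousP => x Dx.
  suff : partials D (map b s) f @ within D (nbhs x) --> G s x by rewrite -(PG s x Dx).
  apply: (@cvg_trans _ (G s @ within D (nbhs x))); last exact: cvg_within_filter (cG s x).
  apply: near_eq_cvg; suff : \forall y \near x, D y -> G s y = partials D (map b s) f y by [].
  by apply: nearW => y Dy; rewrite PG.
move=> i x Dx; have [M HM] := HG s i x Dx.
by apply/cvg_ex; exists (G (i :: s) x); exact: quotient_cvg (PG s) Dx HM.
Unshelve. all: by end_near. Qed.

End Abstract.

Lemma increments_Dplus i x : Dplus x -> ProperFilter (increments Dplus (@unit_vec R i) x).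
Proof.
move=> Dx; apply: (@increments_proper _ _ _ _ 1 1); rewrite ?oner_eq0// => h h0 _.
by rewrite mul1r stepE /Dplus/=; apply: addr_ge0 => //; rewrite mulr_ge0// ltW.
Qed.

Lemma increments_cylinder T i z : 0 < T -> cylinder T z ->
  ProperFilter (increments (cylinder T) (@st_unit_vec R i) z).
Proof.
move=> T0 [Dz /andP[t0 tT]]; case: i => [i|].
  apply: (@increments_proper _ _ _ _ 1 1); rewrite ?oner_eq0// => h h0 _.
  rewrite mul1r; split=> /=; last by rewrite scaler0 addr0 t0.
  by rewrite /Dplus/=; apply: addr_ge0 => //; rewrite mulr_ge0// ltW.
have [tT'|tT'] := ltP z.2 T.
  apply: (@increments_proper _ _ _ _ 1 (T - z.2)); rewrite ?oner_eq0 ?subr_gt0// => h h0 hT.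
  rewrite mul1r; split=> /=; first by rewrite scaler0 addr0.
  by rewrite [h *: 1]mulr1; apply/andP; split; lra.
apply: (@increments_proper _ _ _ _ (-1) T); rewrite ?oppr_eq0 ?oner_eq0// => h h0 hT.
rewrite mulN1r; split=> /=; first by rewrite scaler0 addr0.
by rewrite [- h *: 1]mulr1; apply/andP; split; lra.
Qed.

Lemma norm_vec_le (p : E3 R) (M : R) : (forall i, `|component p i| <= M) -> `|p| <= M.
Proof.
move=> H; have -> : `|p| = Num.max (Num.max `|p.1.1| `|p.1.2|) `|p.2| by [].
by rewrite !ge_max (H 0) (H 1) (H 2).
Qed.

Lemma enorm_le_sum (p : E3 R) : enorm p <= \sum_(i < 3) `|component p i|.
Proof.
have s0 : 0 <= \sum_(i < 3) `|component p i| by apply: sumr_ge0.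
rewrite -(ler_pXn2r (n := 2)) ?nnegrE ?enorm_ge0// enorm_sqr /dot !big_ord_recl !big_ord0 !addr0.
set a := component _ _; set b := component _ _; set c := component _ _.
rewrite -!expr2 -(real_normK (num_real a)) -(real_normK (num_real b)) -(real_normK (num_real c)).
have := normr_ge0 a; have := normr_ge0 b; have := normr_ge0 c; nra.
Qed.

Lemma vec_continuous (v : 'I_3 -> E3 R -> R) : (forall i, continuous (v i)) -> continuous (vec v).
Proof.
by move=> cv x; exact: (cvg_pair (cvg_pair (cv 0 x) (cv 1 x)) (cv 2 x)).
Qed.

Section TestFields.
Variables (C e : R) (K : seq 'I_3 -> E3 R -> R).
Hypothesis mK : mollifier C e K.
Hypothesis e1 : e <= 1.
Variable v : 'I_3 -> E3 R -> R.
Hypothesis sv : sym v.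
Hypothesis div_v : forall x, \sum_(i < 3) conv K [:: i] (v i) x = 0.
Hypothesis dec_v : forall (beta : nat), exists M : R, forall j x, `|v j x| * `|x.2| ^+ beta <= M.

Definition smooth_field s : E3 R -> E3 R := vec (fun j => conv K s (v j)).

Let vs i : sqi (v i). Proof. exact: (sv i).1.2. Qed.

Lemma smooth_field_continuous s : continuous (smooth_field s).
Proof. by apply: vec_continuous => i; apply: (conv_continuous mK). Qed.

Lemma smooth_field_taylor s i : exists M : R, forall x (h : R), `|h| <= 1 ->
  `|smooth_field s (x + h *: unit_vec i) - smooth_field s x - h *: smooth_field (i :: s) x| <= M * h ^+ 2.
Proof.
have [M M0 HM] := conv_taylor1 mK s i e1.
exists (M * \sum_(j < 3) norm2 (v j)) => x h h1; apply: norm_vec_le => j.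
rewrite !componentB componentZ !component_vec (le_trans (HM _ (vs j) x h h1))//.
apply: ler_wpM2r; first exact: sqr_ge0.
apply: ler_wpM2l => //; rewrite (bigD1 j)//= lerDl.
by apply: sumr_ge0 => k _; exact: norm2_ge0.
Qed.

Lemma smooth_field_periodic s : torus_periodic Dplus (smooth_field s).
Proof.
move=> x _.
have pv i (k l : int) : conv K s (v i) (x + (k%:~R, l%:~R, 0)) = conv K s (v i) x by exact: (conv_periodic mK).
by split; [congr (_, _, _); exact: (pv _ 1 0)|congr (_, _, _); exact: (pv _ 0 1)].
Qed.

(** The kernel shifts x_3 by at most e <= 1, so |x_3| <= |z_3| + 1 under the integral and the weight
    can be moved onto the field. *)
Lemma conv_decay s (beta : nat) : exists M : R, forall x, enorm (smooth_field s x) * `|x.2| ^+ beta <= M.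
Proof.
have [M1 HM1] := dec_v beta; have [M0 HM0] := dec_v 0.
have M0' : 0 <= M0 by apply: le_trans (HM0 0 0); rewrite expr0 mulr1.
have M1' : 0 <= M1 by apply: le_trans (HM1 0 0); rewrite mulr_ge0.
pose M := 2 ^+ beta * (M0 + M1).
(* |z_3| + 1 is at most 2 or at most 2 |z_3|; hence the factor 2^beta and the two decay bounds, for
   the powers 0 and beta. *)
have vM j (z : E3 R) : `|v j z| * (`|z.2| + 1) ^+ beta <= M.
  have [z1|z1] := leP `|z.2| 1.
    apply: (@le_trans _ _ (M0 * 2 ^+ beta)).
      apply: ler_pM.
      - exact: normr_ge0.
      - by apply: exprn_ge0; rewrite addr_ge0.
      - by have := HM0 j z; rewrite expr0 mulr1.
      - by apply: lerXn2r; rewrite ?nnegrE ?addr_ge0//; lra.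
    by rewrite mulrC /M; apply: ler_wpM2l; rewrite ?exprn_ge0//; lra.
  apply: (@le_trans _ _ (`|v j z| * (2 * `|z.2|) ^+ beta)).
    apply: ler_wpM2l => //; apply: lerXn2r; rewrite ?nnegrE ?addr_ge0 ?mulr_ge0//; lra.
  rewrite exprMn mulrCA /M; apply: ler_wpM2l; first by rewrite exprn_ge0.
  by have := HM1 j z; lra.
exists (\sum_(j < 3) tint (fun z => `|K s z|) * M) => x.
apply: (@le_trans _ _ ((\sum_(j < 3) `|component (smooth_field s x) j|) * `|x.2| ^+ beta)).
  by apply: ler_wpM2r; rewrite ?exprn_ge0 ?enorm_le_sum.
rewrite !mulr_suml; apply: ler_sum => j _; rewrite component_vec.
have iK : intg (fun z => `|K s (x - z)|).
  by apply: intg_norm; apply: intg_sub; [exact: (mol_periodic mK)|exact: (mol_intg mK)].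
have tK : tint (fun z => `|K s (x - z)|) = tint (fun z => `|K s z|).
  apply: (@tint_sub _ (fun z => `|K s z|) x); last by apply: intg_norm; exact: (mol_intg mK).
  by move=> z k l; rewrite (mol_periodic mK).
rewrite -(ger0_norm (_ : 0 <= `|x.2| ^+ beta)) ?exprn_ge0// -normrM mulrC /conv.
have ic := conv_intg mK s x (vs j).
rewrite -tintZ// -tK mulrC -tintZ//.
apply: tint_norm_le; [exact: intgZ|exact: intgZ|move=> z].
have [hz|hz] := boolP (- e <= (x - z).2 <= e); last first.
  by rewrite (mol_supp3 mK s hz) mul0r mulr0 !normr0 mulr0.
rewrite !normrM (ger0_norm (_ : 0 <= `|x.2| ^+ beta)) ?exprn_ge0//.
rewrite mulrCA mulrC; apply: ler_wpM2r => //.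
apply: le_trans (vM j z); rewrite mulrC; apply: ler_wpM2l => //.
apply: lerXn2r; rewrite ?nnegrE ?addr_ge0//.
move: hz => /=; rewrite -ler_norml => hz.
have -> : x.2 = z.2 + (x.2 - z.2) by ring.
by rewrite (le_trans (ler_normD _ _))// lerD2l (le_trans hz).
Qed.

Lemma smooth_field_bottom x : x.2 = 0 -> (smooth_field [::] x).2 = 0.
Proof.
move=> x0; have := conv_refl mK x (vs 2) (sv 2).2.
have -> : refl x = x by case: x x0 => [[a b] c] /= ->; rewrite /refl/= oppr0.
by rewrite /parity eqxx mulN1r /=; lra.
Qed.

Lemma smooth_field_partial i x : Dplus x ->
  partial Dplus (unit_vec i) (smooth_field [::]) x = smooth_field [:: i] x.
Proof.
move=> Dx; have [] := @smooth_family _ _ 'I_3 unit_vec Dplus (smooth_field [::]) smooth_field.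
- by [].
- exact: smooth_field_continuous.
- exact: increments_Dplus.
- by move=> s j y _; have [M HM] := smooth_field_taylor s j; exists M => h; exact: HM.
- by move=> H _; exact: (H [:: i] x Dx).
Qed.

Lemma gradient_smooth_field i j x : Dplus x ->
  gradient (smooth_field [::]) x i j = conv K [:: i] (v j) x.
Proof. by move=> Dx; rewrite /gradient mxE smooth_field_partial// component_vec. Qed.

(** The test field is constant in time, so one letter [None] annihilates the whole word; otherwise
    [pmap id] recovers the spatial word. *)
Definition st_smooth_field (s : seq (option 'I_3)) (z : E3 R * R) : E3 R :=
  if None \in s then 0 else smooth_field (pmap id s) z.1.

Lemma st_smooth_family T : 0 < T ->
  (forall s z, cylinder T z ->
     partials (cylinder T) (map st_unit_vec s) (fun z => smooth_field [::] z.1) z = st_smooth_field s z) /\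
  smooth_on st_unit_vec (cylinder T) (fun z => smooth_field [::] z.1).
Proof.
move=> T0; apply: smooth_family.
- by [].
- move=> s; rewrite /st_smooth_field; have [_|_] := boolP (None \in s); first exact: cst_continuous.
  by move=> z; apply: (@continuous_comp _ _ _ fst (smooth_field _)); [exact: cvg_fst|exact: smooth_field_continuous].
- by move=> i z; exact: increments_cylinder.
- move=> s [i|] z _; rewrite /st_smooth_field in_cons/=.
    have [M HM] := smooth_field_taylor (pmap id s) i.
    case: ifP => _; last by exists M => h; exact: HM.
    by exists 0 => h _; rewrite scaler0 !subr0 normr0 mul0r.
  exists 0 => h _; case: ifP => _; rewrite scaler0 subr0 ?subr0 ?normr0 ?mul0r//.
  by rewrite /= ?scaler0 addr0 subrr normr0.
Qed.

Lemma smooth_field_test T : 0 < T -> schwartz_st_n_sigma T (fun z => smooth_field [::] z.1).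
Proof.
move=> T0; have [Hp Hs] := st_smooth_family T0; split.
  split=> //; first by move=> t _; exact: smooth_field_periodic.
  move=> s beta; have [M HM] := conv_decay (pmap id s) beta.
  have M0 : 0 <= M by apply: le_trans (HM 0); rewrite mulr_ge0 ?enorm_ge0 ?exprn_ge0.
  exists M => z Dz; rewrite Hp// /st_smooth_field; case: ifP => _; last exact: HM.
  rewrite /enorm /dot big1 ?sqrtr0 ?mul0r// => i _.
  by move: i; apply: ord3P; rewrite mul0r.
move=> t _; split=> [x Dx|x x0]; last exact: smooth_field_bottom.
rewrite /divergence -[RHS](div_v x); apply: eq_bigr => i _.
by rewrite (smooth_field_partial i Dx) component_vec.
Qed.

Lemma smooth_field_dt T t x : 0 < T -> 0 <= t <= T -> Dplus x ->
  dt T (fun z => smooth_field [::] z.1) t x = 0.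
Proof. by move=> T0 tT Dx; have [H _] := st_smooth_family T0; exact: (H [:: None] (x, t)). Qed.

End TestFields.

End SmoothFamilies.

(** * Boundedness of weakly continuous paths *)

Section GlidingHump.
Context {R : realType}.
Local Notation mu := (@torus_measure R).
Implicit Types (x y : E3 R) (g : E3 R -> R).

Section Series.
Variables (sg : R) (f : nat -> E3 R -> R).
Hypothesis sg1 : `|sg| = 1.
Hypothesis fpl : forall n, pl2 (f n).
Hypothesis fsg : forall n x, f n (refl x) = sg * f n x.
Hypothesis f1 : forall n, 1 <= norm2 (f n).

Let a n : R := (3 ^+ n)^-1.
Let xi n x : R := (norm2 (f n))^-1 * f n x.

Let f_gt0 n : 0 < norm2 (f n).
Proof. by apply: lt_le_trans (f1 n). Qed.

Let a_gt0 n : 0 < a n.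
Proof. by rewrite invr_gt0 exprn_gt0. Qed.

Let aS n : a n.+1 = a n / 3.
Proof. by rewrite /a exprS invfM mulrC. Qed.

Let xi_pl n : pl2 (xi n).
Proof. exact: pl2Z. Qed.

Let xi_norm n : norm2 (xi n) = 1.
Proof.
rewrite /xi (norm2Z _ (fpl n).2) gtr0_norm ?invr_gt0//.
by rewrite mulVf// gt_eqF.
Qed.

(** The n-th term is a normalized multiple of [f n] with weight 3^-n. The two candidate pairings
    with [f n] differ by 2 a_n |f_n|, so one of the two signs makes the pairing at least a_n |f_n|,
    whatever was summed before. *)
Fixpoint hump n x : R :=
  if n is m.+1 then
    if a m * norm2 (f m) <= `|tint (fun y => f m y * (hump m y + a m * xi m y))|
    then hump m x + a m * xi m x else hump m x - a m * xi m x
  else 0.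

Let hump_step n : exists2 s : R, `|s| = 1 & forall x, hump n.+1 x = hump n x + s * (a n * xi n x).
Proof.
have [h|h] := boolP (a n * norm2 (f n) <= `|tint (fun y => f n y * (hump n y + a n * xi n y))|).
  by exists 1; rewrite ?normr1// => x; rewrite /= h mul1r.
by exists (-1); rewrite ?normrN ?normr1// => x; rewrite /= (negbTE h) mulN1r.
Qed.

Let humpS n : (exists s : R, `|s| = 1 /\ forall x, hump n.+1 x = hump n x + s * (a n * xi n x)).
Proof. by have [s s1 H] := hump_step n; exists s. Qed.

Let hump_pl n : pl2 (hump n) /\ forall x, hump n (refl x) = sg * hump n x.
Proof.
elim: n => [|n [IH1 IH2]].
  by split=> [|x]; [split; [by []|exact: sqi0]|rewrite /= mulr0].
have [s [_ H]] := humpS n; rewrite (funext H); split.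
  by apply: pl2D => //; do 2 apply: pl2Z.
by move=> x; rewrite IH2 /xi fsg; ring.
Qed.

Let pair n g : sqi g -> intg (fun y => f n y * g y).
Proof. by move=> sg'; apply: sqi_intgM => //; exact: (fpl n).2. Qed.

Let hump_large n : a n * norm2 (f n) <= `|tint (fun y => f n y * hump n.+1 y)|.
Proof.
rewrite (eq_tint (g := fun y => if a n * norm2 (f n) <= `|tint (fun y => f n y * (hump n y + a n * xi n y))|
  then f n y * (hump n y + a n * xi n y) else f n y * (hump n y - a n * xi n y))); last first.
  by move=> y /=; case: (_ <= _).
have [h|] := boolP (a n * norm2 (f n) <= `|tint (fun y => f n y * (hump n y + a n * xi n y))|); first by [].
rewrite -ltNge => h.
have ih := pair n (hump_pl n).1.2; have ix := pair n (xi_pl n).2.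
have E : tint (fun y => f n y * xi n y) = norm2 (f n).
  rewrite (_ : tint _ = tint (fun y => (norm2 (f n))^-1 * f n y ^+ 2)); last by apply: eq_tint => y; rewrite /xi; ring.
  by rewrite tintZ -?norm2_sqr ?expr2 ?mulKf ?gt_eqF//; exact: (fpl n).2.2.
have Ep (s : R) : tint (fun y => f n y * (hump n y + s * (a n * xi n y))) = tint (fun y => f n y * hump n y) + s * (a n * norm2 (f n)).
  rewrite (eq_tint (g := fun y => f n y * hump n y + s * (a n * (f n y * xi n y)))); last by move=> y; ring.
  rewrite tintD//; last by do 2 apply: intgZ.
  by rewrite tintZ ?tintZ ?E//; exact: intgZ.
have E1 := Ep 1; have E2 := Ep (-1).
rewrite (_ : tint (fun y => f n y * (hump n y + a n * xi n y)) = tint (fun y => f n y * hump n y) + 1 * (a n * norm2 (f n))) in h; last first.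
  by rewrite -E1; apply: eq_tint => y; ring.
rewrite (_ : tint _ = tint (fun y => f n y * hump n y) + (-1) * (a n * norm2 (f n))); last first.
  by rewrite -E2; apply: eq_tint => y; ring.
have p : 0 < a n * norm2 (f n) by rewrite mulr_gt0.
move: h p; set t := tint _; set q := a n * _ => h p.
have [t0|t0] := leP 0 t; last by rewrite ler0_norm; lra.
by move: h; rewrite ger0_norm; lra.
Qed.

(** Later terms can undo the pairing by at most the sum of their weights. Since the weights decrease
    by the factor 3, subtracting a_(n+1), ..., a_(n+j) from a_n leaves exactly the mean of a_n and
    a_(n+j), hence more than half of a_n. *)
Let hump_tail n j : norm2 (f n) * (2^-1 * (a n + a (n + j)%N)) <= `|tint (fun y => f n y * hump (n.+1 + j)%N y)|.
Proof.
elim: j => [|j IH].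
  by rewrite !addn0 (le_trans _ (hump_large n))// mulrC le_eqVlt; apply/orP; left; apply/eqP; field.
rewrite !addnS; set m := (n.+1 + j)%N.
have [s [s1 H]] := humpS m; rewrite (eq_tint (g := fun y => f n y * hump m y + s * (a m * (f n y * xi m y)))); last first.
  by move=> y; rewrite H; ring.
have ih := pair n (hump_pl m).1.2; have ix := pair n (xi_pl m).2.
rewrite tintD//; last by do 2 apply: intgZ.
rewrite tintZ ?tintZ//; last exact: intgZ.
have cs := cauchy_schwarz (fpl n).2 (xi_pl m).2; rewrite xi_norm mulr1 in cs.
have h2 : `|s * (a m * tint (fun y => f n y * xi m y))| <= a m * norm2 (f n).
  by rewrite normrM s1 mul1r normrM (gtr0_norm (a_gt0 m)); apply: ler_wpM2l => //; exact: ltW.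
have := lerB_normD (tint (fun y => f n y * hump m y)) (s * (a m * tint (fun y => f n y * xi m y))).
have am : a m = a (n + j)%N / 3 by rewrite /m addSn aS.
move: IH; rewrite -/m => IH; rewrite aS.
have := a_gt0 (n + j)%N; move: h2 IH; rewrite am => h2 IH p.
have := f_gt0 n; nra.
Qed.

Let S n x : R := \sum_(k < n) a k * `|xi k x|.

Let S_sqi n : sqi (S n) /\ norm2 (S n) <= 2 - 3 / 2 * a n.
Proof.
elim: n => [|n [IH1 IH2]].
  have -> : S 0 = fun=> 0 by apply/funext => x; rewrite /S big_ord0.
  split; first exact: sqi0.
  have -> : norm2 (fun=> 0 : R) = 0.
    by rewrite /norm2 (eq_tint (g := fun=> 0)) ?tint0 ?sqrtr0// => x; rewrite expr0n.
  by rewrite /a expr0 invr1; lra.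
have -> : S n.+1 = (fun x => S n x + a n * `|xi n x|) by apply/funext => x; rewrite /S big_ord_recr.
have sx : sqi (fun x => `|xi n x|) by apply: sqi_norm; exact: (xi_pl n).2.
split; first by apply: sqiD => //; exact: sqiZ.
apply: (le_trans (norm2D IH1 (sqiZ _ sx))); rewrite norm2Z// (gtr0_norm (a_gt0 n)).
have -> : norm2 (fun x => `|xi n x|) = 1.
  by rewrite -(xi_norm n); congr Num.sqrt; apply: eq_tint => x; rewrite real_normK ?num_real.
rewrite mulr1 aS; have := a_gt0 n; lra.
Qed.

Let S_ge0 n x : 0 <= S n x.
Proof. by apply: sumr_ge0 => k _; rewrite mulr_ge0// ltW. Qed.

Let S_nd x : {homo S ^~ x : n m / (n <= m)%N >-> n <= m}.
Proof.
apply/nondecreasing_seqP => n; rewrite /S big_ord_recr/= lerDl.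
by rewrite mulr_ge0// ltW.
Qed.

(** Monotone convergence for the squares of the majorants [S n], whose norms stay below 2, makes
    this supremum integrable. Where it is finite the series of humps converges absolutely. *)
Let Dbar x : \bar R := ereal_sup (range (fun n => (S n x ^+ 2)%:E)).

Let eq_Dbar x y : (forall n, S n x = S n y) -> Dbar x = Dbar y.
Proof.
move=> E; rewrite /Dbar (_ : (fun n => (S n x ^+ 2)%:E) = (fun n => (S n y ^+ 2)%:E))//.
by apply/funext => n; rewrite E.
Qed.

Let Sbar_nd x : {homo (fun n => (S n x ^+ 2)%:E) : n m / (n <= m)%N >-> (n <= m)%E}.
Proof. by move=> n m nm; rewrite lee_fin lerXn2r ?nnegrE ?S_nd. Qed.

Let Dbar_cvg x : (S n x ^+ 2)%:E @[n --> \oo] --> Dbar x.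
Proof. exact: (ereal_nondecreasing_cvgn (@Sbar_nd x)). Qed.

Let mS n : measurable_fun setT (fun x : mE3 R => (S n x ^+ 2)%:E).
Proof. by apply/measurable_EFinP; apply: measX; exact: (S_sqi n).1.1. Qed.

Let Dbar_intg : mu.-integrable setT (Dbar : mE3 R -> \bar R).
Proof.
have mD : measurable_fun setT (Dbar : mE3 R -> \bar R).
  by apply: (emeasurable_fun_cvg _ _ mS) => x _; exact: Dbar_cvg.
apply/integrableP; split=> //.
have D0 x : (0 <= Dbar x)%E.
  by apply: le_trans (ereal_sup_ubound _); last (by exists 0%N); rewrite lee_fin sqr_ge0.
under eq_integral do rewrite gee0_abs//.
have := @cvg_monotone_convergence _ _ _ mu setT measurableT (fun n x => (S n x ^+ 2)%:E) mS.
move=> /(_ (fun n x _ => sqr_ge0 (S n x)) (fun x _ => @Sbar_nd x)).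
have -> : (fun x : mE3 R => limn (fun n => (S n x ^+ 2)%:E)) = Dbar.
  by apply/funext => x; apply/cvg_lim; [exact: ereal_hausdorff|exact: Dbar_cvg].
move=> H; apply: (@le_lt_trans _ _ 4%:E); last exact: ltry.
apply: (cvge_to_le H); apply: nearW => n.
rewrite -(Rint_fineK (S_sqi n).1.2) lee_fin -[X in X <= _]norm2_sqr.
have [_ h] := S_sqi n; have := norm2_ge0 (S n); have := a_gt0 n; nra.
Qed.

(** The exceptional set is invariant under lattice translations and under the reflection, so with
    the value 0 there g is periodic and has its parity at every point. The parity matters: weak
    continuity is only available against fields of the right symmetry. *)
Let g x : R := if Dbar x \is a fin_num then limn (hump ^~ x) else 0.

Let Dreal x : R := Num.sqrt (fine (Dbar x)).

Let S_le x : Dbar x \is a fin_num -> forall n, S n x <= Dreal x.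
Proof.
move=> fx n; rewrite -(ger0_norm (S_ge0 n x)) -sqrtr_sqr; apply: ler_wsqrtr.
by rewrite -lee_fin fineK//; apply: ereal_sup_ubound; exists n.
Qed.

Let hump_le n x : `|hump n x| <= S n x.
Proof.
elim: n => [|n IH]; first by rewrite /= normr0 S_ge0.
have [s [s1 ->]] := humpS n; rewrite /S big_ord_recr/=.
rewrite (le_trans (ler_normD _ _))// lerD//.
by rewrite normrM s1 mul1r normrM (gtr0_norm (a_gt0 n)).
Qed.

Let hump_cvg x : Dbar x \is a fin_num -> hump n x @[n --> \oo] --> g x.
Proof.
move=> fx; rewrite /g fx.
pose d n := hump n.+1 x - hump n x.
have hd n : hump n x = series d n.
  by rewrite /series /= telescope_sumr// subr0.
have -> : hump ^~ x = series d by apply/funext => n; exact: hd.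
apply: normed_cvg; apply: nondecreasing_is_cvgn.
  have -> : [normed series d] = (fun n => \sum_(k < n) `|d k|).
    by rewrite /normed_series_of; exact: seriesEord.
  by apply/nondecreasing_seqP => n; rewrite big_ord_recr/= lerDl.
exists (Dreal x) => _ [n _ <-]; apply: le_trans (S_le fx n).
rewrite /S (_ : [normed series d] n = \sum_(k < n) `|d k|); last first.
  by rewrite /normed_series_of; exact: big_mkord.
apply: ler_sum => k _.
have [s [s1 H]] := humpS k; rewrite /d H addrC addKr normrM s1 mul1r normrM.
by rewrite (gtr0_norm (a_gt0 k)).
Qed.

Let Dbar_refl x : Dbar (refl x) = Dbar x -> g (refl x) = sg * g x.
Proof.
move=> E; rewrite /g E; case: ifPn => [fx|_]; last by rewrite mulr0.
have -> : hump ^~ (refl x) = (fun n => sg * hump n x).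
  by apply/funext => n; exact: (hump_pl n).2.
apply: cvg_lim => //; apply: cvgMl_tmp.
by have := hump_cvg fx; rewrite /g fx.
Qed.

Let Dbar_ae : {ae mu, forall x, Dbar x \is a fin_num}.
Proof.
by have := integrable_ae measurableT Dbar_intg; apply: filterS => x; exact.
Qed.

Let fin_meas : measurable [set x : mE3 R | Dbar x \is a fin_num].
Proof.
have mD : measurable_fun setT (Dbar : mE3 R -> \bar R).
  by move/integrableP : Dbar_intg => [].
by have := emeasurable_fin_num measurableT mD; rewrite setTI.
Qed.

Let mg : meas g.
Proof.
apply: (@measurable_fun_cvg _ _ _ setT (fun n x => hump n x * \1_[set x : mE3 R | Dbar x \is a fin_num] x)).
  by move=> n; apply: measM; [exact: (hump_pl n).1.2.1|apply: measurable_indic; exact: fin_meas].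
move=> x _; rewrite indicE; have [fx|fx] := boolP (Dbar x \is a fin_num).
  by rewrite mem_set//; under eq_fun do rewrite mulr1; exact: hump_cvg.
rewrite memNset; last exact/negP.
by under eq_fun do rewrite mulr0; rewrite /g (negbTE fx); exact: cvg_cst.
Qed.

Let fine_ge0' x : 0 <= fine (Dbar x).
Proof.
apply: fine_ge0; apply: le_trans (ereal_sup_ubound _); last (by exists 0%N).
by rewrite lee_fin sqr_ge0.
Qed.

Let fine_intg : intg (fun x => fine (Dbar x)).
Proof.
apply: (@le_integrable _ _ _ _ _ _ _ _ _ _ Dbar_intg) => //.
  apply/measurable_EFinP; apply: (@measurableT_comp _ _ _ _ _ _ fine _ Dbar) => //.
  by move/integrableP : Dbar_intg => [].
by move=> x _ /=; case: (Dbar x) => [r||] //=; rewrite ?normr0 ?lee_fin ?leey.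
Qed.

Let g_le x : `|g x| <= Dreal x.
Proof.
have [fx|fx] := boolP (Dbar x \is a fin_num); last by rewrite /g (negbTE fx) normr0 sqrtr_ge0.
apply: (cvgr_to_le (cvg_norm (hump_cvg fx))); apply: nearW => n.
by rewrite (le_trans (hump_le _ _))// S_le.
Qed.

Let g_pl : pl2 g.
Proof.
have D_per x (k l : int) : Dbar (x + (k%:~R, l%:~R, 0)) = Dbar x.
  by apply: eq_Dbar => n; apply: eq_bigr => j _; rewrite (xi_pl j).1.
split.
  move=> x k l; rewrite /g D_per; case: ifP => // _.
  have -> : hump ^~ (x + (k%:~R, l%:~R, 0)) = hump ^~ x by apply/funext => n; exact: (hump_pl n).1.1.
  by [].
split; first exact: mg.
apply: (@le_intg _ _ (fun x => fine (Dbar x))); [exact: measX mg| |exact: fine_intg].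
move=> x; rewrite ger0_norm ?sqr_ge0// -(sqr_sqrtr (fine_ge0' x)).
rewrite -real_normK ?num_real//; apply: lerXn2r; rewrite ?nnegrE ?sqrtr_ge0//.
Qed.

Let Dreal_sqi : sqi Dreal.
Proof.
split; last by apply: (eq_intg _ fine_intg) => x; rewrite sqr_sqrtr ?fine_ge0'.
apply: (@measurableT_comp _ _ _ _ _ _ (@Num.sqrt R) _ (fun x : mE3 R => fine (Dbar x))).
  by apply: continuous_measurable_fun; exact: sqrt_continuous.
exact: intg_meas fine_intg.
Qed.

Lemma hump_limit : exists h, [/\ pl2 h, forall x, h (refl x) = sg * h x &
  forall n, 2^-1 * (3 ^+ n)^-1 * norm2 (f n) <= `|tint (fun y => f n y * h y)|].
Proof.
exists g; split; first exact: g_pl.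
  move=> x; apply: Dbar_refl; apply: eq_Dbar => n; apply: eq_bigr => j _.
  by rewrite /xi fsg !normrM sg1 mul1r.
move=> n; have L : tint (fun y => f n y * hump (n.+1 + m)%N y) @[m --> \oo] --> tint (fun y => f n y * g y).
  apply: (@Rint_dct_ae _ _ _ mu _ _ (fun y => `|f n y| * Dreal y)).
  - by move=> m; apply: pair; exact: (hump_pl _).1.2.
  - by apply: measM; [exact: (fpl n).2.1|exact: mg].
  - by apply: sqi_intgM => //; apply: sqi_norm; exact: (fpl n).2.
  - apply: negligibleS Dbar_ae => x; apply: contra_not => fx; split.
      apply: cvgMl_tmp; have := hump_cvg fx.
      by rewrite -(cvg_shiftn n.+1) /=; under eq_fun do rewrite addnC.
    by move=> m; rewrite normrM ler_wpM2l// (le_trans (hump_le _ _))// S_le.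
apply: (cvgr_to_ge (cvg_norm L)); apply: nearW => m.
apply: le_trans (hump_tail n m); rewrite mulrC; apply: ler_wpM2l; first exact: norm2_ge0.
by apply: ler_wpM2l => //; rewrite lerDl ltW.
Qed.

End Series.

(* Banach-Steinhaus: along times at which the norms blow up, the gliding hump
   is a single test function that contradicts weak continuity. *)
Lemma weakly_continuous_bounded (T sg : R) (f : R -> E3 R -> R) : 0 < T -> `|sg| = 1 ->
  (forall t, pl2 (f t)) -> (forall t x, f t (refl x) = sg * f t x) ->
  (forall g, pl2 g -> (forall x, g (refl x) = sg * g x) ->
     {within `[0, T], continuous (fun t => tint (fun x => f t x * g x))}) ->
  exists N : R, forall t, 0 <= t <= T -> norm2 (f t) <= N.
Proof.
move=> T0 sg1 fpl fsg fc; apply: contrapT => unb.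
have large (M : R) : exists t, 0 <= t <= T /\ M < norm2 (f t).
  apply: contrapT => h; apply: unb; exists M => t tT; rewrite leNgt.
  by apply/negP => h'; apply: h; exists t.
(* The power 3^n compensates the weight 3^-n in [hump_limit], and the factor n + 1 remains to make
   the pairings unbounded. *)
pose M (n : nat) : R := (n.+1%:R) * 3 ^+ n.
have /choice[t Ht] : forall n, exists t, 0 <= t <= T /\ M n < norm2 (f t) by move=> n; exact: large.
have M1 n : 1 <= M n.
  by rewrite /M -[leLHS]mulr1 ler_pM// ?ler1n// exprn_ege1// ler1n.
have [|||h [hpl hsg hn]] := @hump_limit sg (fun n => f (t n)) sg1.
- by move=> n; exact: fpl.
- by move=> n x; exact: fsg.
- by move=> n; apply: le_trans (M1 n) (ltW (Ht n).2).
have [c _ Hc] := EVT_max (ltW T0) (fc h hpl hsg).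
have fcN : {within `[0, T], continuous (fun t => - tint (fun x => f t x * h x))}.
  by move=> s; apply: cvgN; exact: (fc h hpl hsg s).
have [c' _ Hc'] := EVT_max (ltW T0) fcN.
set A := tint _ in Hc; set B := - tint _ in Hc'.
have bd n : `|tint (fun x => f (t n) x * h x)| <= `|A| + `|B|.
  have tn : t n \in `[0, T] by rewrite in_itv/=; exact: (Ht n).1.
  rewrite ler_norml; apply/andP; split.
    have := Hc' _ tn; have := ler_norm B; have := normr_ge0 A; lra.
  have := Hc _ tn; have := ler_norm A; have := normr_ge0 B; lra.
have H n : n%:R <= 2 * (`|A| + `|B|).
  have h1 := le_trans (hn n) (bd n).
  have h2 : 2^-1 * n%:R <= 2^-1 * (3 ^+ n)^-1 * norm2 (f (t n)).
    rewrite -mulrA; apply: ler_wpM2l => //.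
    rewrite mulrC ler_pdivlMr ?exprn_gt0//; apply: le_trans (ltW (Ht n).2).
    by rewrite /M; apply: ler_wpM2r; rewrite ?exprn_ge0// ler_nat.
  by move: h1 h2; set q := _ * norm2 _; lra.
have := H (Num.bound (2 * (`|A| + `|B|))).
have B0 : 0 <= 2 * (`|A| + `|B|) by rewrite mulr_ge0// addr_ge0.
by rewrite leNgt; have := archi_boundP B0 => ->.
Qed.
End GlidingHump.

(** * Energy balance at a fixed scale *)

Section Approximation.
Context {R : realType}.
Implicit Types (x y z : E3 R) (i j : 'I_3) (f g c : E3 R -> R).

(** As mollification J is a contraction, |f - J f|^2 is at most twice the pairing of f - J f with f.
    On a strip f is integrable and f - J f is uniformly at most L e; outside it the tail of f is
    small in L^2. The threshold depends on f but on no property of the kernel beyond its scale. *)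
Lemma lipschitz_conv_approx f (L d : R) : pl2 f -> 0 <= L ->
  (forall x y, `|f (x + y) - f x| <= L * `|y|) -> 0 < d ->
  exists2 e1 : R, 0 < e1 & forall C e K, mollifier C e K -> 0 < e -> e <= 1 -> e <= e1 ->
    norm2 (fun x => conv K [::] f x - f x) <= d.
Proof.
move=> pf L0 fL d0; have sf := pf.2.
pose q n x := f x - f x * strip (- n%:R) n%:R x.
have strip1 (n : nat) x : `|strip (- n%:R) n%:R x| <= 1.
  by rewrite stripE; case: (_ <= _ <= _); rewrite ?normr1 ?normr0.
have sfs (n : nat) : sqi (fun x => f x * strip (- n%:R) n%:R x).
  by apply: (sqiM_bounded (meas_strip _ _) (strip1 n)).
have sq n : sqi (q n) by exact: sqiB.
have q_lim : tint (fun x => q n x ^+ 2) @[n --> \oo] --> tint (fun=> 0 : R).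
  apply: (@tint_dct _ _ _ (fun x => f x ^+ 2)).
  - by move=> n; apply: measX; exact: (sq n).1.
  - exact: meas_cst.
  - exact: sf.2.
  - move=> n x; rewrite /q stripE normrX; have [_|_] := boolP (_ <= _ <= _).
      by rewrite mulr1 subrr normr0 expr0n/= sqr_ge0.
    by rewrite mulr0 subr0 real_normK ?num_real.
  - move=> x _; apply: cvg_near_cst; near=> n.
    rewrite /q stripE -ler_norml (_ : _ <= _ = true) ?mulr1 ?subrr ?expr0n//.
    near: n; exact: nbhs_infty_ger.
rewrite tint0 in q_lim.
pose M := norm2 f + 1.
have M0 : 0 < M by rewrite ltr_wpDl ?norm2_ge0.
(* Since |f - J f| <= 2 M, a tail of this size contributes d^2 / 4 to the pairing, as does the strip
   by the choice of e; doubling the sum gives d^2. *)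
have eta0 : 0 < d ^+ 2 / (8 * M) by rewrite divr_gt0 ?exprn_gt0 ?mulr_gt0.
have [n hn] : exists n, norm2 (q n) <= d ^+ 2 / (8 * M).
  have [n _ /(_ n (leqnn n)) h] : \forall n \near \oo, `|tint (fun x => q n x ^+ 2)| < (d ^+ 2 / (8 * M)) ^+ 2.
    by apply: (cvgr0_norm_lt _ q_lim); rewrite exprn_gt0.
  exists n; rewrite -(ler_pXn2r (n := 2)) ?nnegrE ?norm2_ge0//; last exact: ltW.
  by rewrite norm2_sqr ltW// (le_lt_trans (ler_norm _)).
pose A := tint (fun x => `|f x * strip (- n%:R) n%:R x|).
have fsi : intg (fun x => f x * strip (- n%:R) n%:R x).
  apply: sqi_intgM => //; apply: (@sqi_bounded_intg _ _ 1); last exact: intg_strip.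
  exact: strip1.
have A0 : 0 <= A by exact: tint_ge0.
have LA : 0 < 4 * (L * A + 1) by rewrite mulr_gt0// ltr_wpDl// mulr_ge0.
exists (d ^+ 2 / (4 * (L * A + 1))); first by rewrite divr_gt0 ?exprn_gt0.
move=> C e K mK e0 e1 ee.
have [sJ nJ] := conv_sqi mK e1 sf.
have near x : `|f x - conv K [::] f x| <= L * e.
  rewrite distrC; apply: (conv_near_le mK) => // y y1 y2 y3.
  apply: (le_trans (fL x (- y))); rewrite normrN; apply: ler_wpM2l => //.
  have -> : `|y| = Num.max (Num.max `|y.1.1| `|y.1.2|) `|y.2| by [].
  by rewrite !ge_max y1 y2 y3.
have sB : sqi (fun x => f x - conv K [::] f x) by exact: sqiB.
rewrite -(ler_pXn2r (n := 2)) ?nnegrE ?norm2_ge0//; last exact: ltW.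
rewrite norm2B norm2_sqr.
have iff := sqi_intgM sf sf; have ijf := sqi_intgM sJ sf; have ijj := sqi_intgM sJ sJ.
have E1 : tint (fun x => (f x - conv K [::] f x) ^+ 2) =
   tint (fun x => conv K [::] f x * conv K [::] f x) - tint (fun x => f x * f x)
   + 2 * tint (fun x => (f x - conv K [::] f x) * f x).
  rewrite -tintZ; last exact: sqi_intgM.
  rewrite -tintB// -tintD; [|exact: intgB|by apply: intgZ; exact: sqi_intgM].
  by apply: eq_tint => x; ring.
have E2 : tint (fun x => (f x - conv K [::] f x) * f x) =
   tint (fun x => (f x - conv K [::] f x) * (f x * strip (- n%:R) n%:R x))
   + tint (fun x => (f x - conv K [::] f x) * q n x).
  rewrite -tintD; [|exact: sqi_intgM|exact: sqi_intgM].
  by apply: eq_tint => x; rewrite /q; ring.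
have h1 : tint (fun x => conv K [::] f x * conv K [::] f x) <= tint (fun x => f x * f x).
  have E0 h : tint (fun x => h x * h x) = norm2 h ^+ 2.
    by rewrite norm2_sqr; apply: eq_tint => x; rewrite expr2.
  by rewrite !E0; apply: lerXn2r; rewrite ?nnegrE ?norm2_ge0.
have h2 : tint (fun x => (f x - conv K [::] f x) * (f x * strip (- n%:R) n%:R x)) <= L * e * A.
  rewrite -tintZ; last exact: intg_norm.
  apply: (le_trans (ler_norm _)); apply: tint_norm_le.
  - exact: sqi_intgM.
  - by apply: intgZ; exact: intg_norm.
  - by move=> x; rewrite normrM; apply: ler_wpM2r.
have h3 : tint (fun x => (f x - conv K [::] f x) * q n x) <= 2 * M * (d ^+ 2 / (8 * M)).
  apply: (le_trans (ler_norm _)); apply: (le_trans (cauchy_schwarz sB (sq n))).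
  apply: ler_pM; rewrite ?norm2_ge0//.
  have sN := sqiN sJ; have := norm2D sf sN.
  rewrite (_ : norm2 (fun x => - conv K [::] f x) = norm2 (conv K [::] f)); last first.
    by congr Num.sqrt; apply: eq_tint => x; rewrite sqrrN.
  by move=> /le_trans; apply; rewrite /M; lra.
have h4 : L * e * A <= d ^+ 2 / 4.
  move: ee; rewrite ler_pdivlMr// => ee.
  have : e * (L * A) <= e * (L * A + 1) by apply: ler_wpM2l; rewrite ?lerDl// ltW.
  by move: ee; set r := d ^+ 2; lra.
have h5 : 2 * M * (d ^+ 2 / (8 * M)) = d ^+ 2 / 4 by field; rewrite gt_eqF.
by rewrite E1 E2; move: h1 h2 h3 h4; rewrite h5; set r := d ^+ 2; lra.
Unshelve. all: by end_near. Qed.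

(** By density and contraction: J u - u splits into J (u - phi), J phi - phi and u - phi, each of
    norm at most d / 3. *)
Lemma H_sigma_conv_approx (u : E3 R -> E3 R) (d : R) : H_sigma u -> 0 < d ->
  exists2 e1 : R, 0 < e1 & forall C e K, mollifier C e K -> 0 < e -> e <= 1 -> e <= e1 -> forall i,
    norm2 (fun x => conv K [::] (ext u i) x - ext u i x) <= d.
Proof.
move=> Hu d0; have d3 : 0 < d / 3 by rewrite divr_gt0.
have [phi [sphi pL uphi]] := H_sigma_approx Hu d3.
have pphi i : pl2 (ext phi i) by exact: ext_pl2.
have pu i : pl2 (ext u i) by exact: (ext_pl2 i Hu.1).
have H i : exists2 e1 : R, 0 < e1 & forall C e K, mollifier C e K -> 0 < e -> e <= 1 -> e <= e1 ->
    norm2 (fun x => conv K [::] (ext phi i) x - ext phi i x) <= d / 3.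
  have [|L L0 HL] := @coord_lipschitz _ (ext phi i).
    by move=> k; have [M _ HM] := ext_lipschitz sphi k; exists M => x h.
  exact: lipschitz_conv_approx HL d3.
have [a a0 Ha] := H 0; have [b b0 Hb] := H 1; have [c c0 Hc] := H 2.
exists (Num.min a (Num.min b c)); first by rewrite !lt_min a0 b0 c0.
move=> C e K mK e0 e1; rewrite !le_min => /and3P[ea eb ec] i.
have hphi : norm2 (fun x => conv K [::] (ext phi i) x - ext phi i x) <= d / 3.
  by move: i; apply: ord3P; [exact: (Ha C e)|exact: (Hb C e)|exact: (Hc C e)].
have sd : sqi (fun x => ext u i x - ext phi i x) by apply: sqiB; [exact: (pu i).2|exact: (pphi i).2].
have [sJ nJ] := conv_sqi mK e1 sd.
have sJp := (conv_sqi mK e1 (pphi i).2).1.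
rewrite (_ : (fun x => conv K [::] (ext u i) x - ext u i x) =
   (fun x => conv K [::] (fun z => ext u i z - ext phi i z) x
     + ((conv K [::] (ext phi i) x - ext phi i x) - (ext u i x - ext phi i x)))); last first.
  by apply/funext => x; rewrite (convB mK _ _ (pu i).2 (pphi i).2); ring.
have s2 : sqi (fun x => conv K [::] (ext phi i) x - ext phi i x) by apply: sqiB => //; exact: (pphi i).2.
apply: (le_trans (norm2D sJ (sqiB s2 sd))).
have sN := sqiN sd; have := norm2D s2 sN.
rewrite (_ : norm2 (fun x => - (ext u i x - ext phi i x)) = norm2 (fun x => ext u i x - ext phi i x)); last first.
  by congr Num.sqrt; apply: eq_tint => x; rewrite sqrrN.
by have := uphi i; lra.
Qed.

(** The transporting field w and the tested field v are kept apart, since v will be frozen in time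
    while w runs. *)
Definition flux K (w v : 'I_3 -> E3 R -> R) : R :=
  \sum_(i < 3) \sum_(j < 3) tint (fun x => w i x * w j x * conv K [:: i] (v j) x).

Lemma tint3_le f g c (B : R) : sqi f -> sqi g -> meas c -> (forall x, `|c x| <= B) ->
  `|tint (fun x => f x * g x * c x)| <= B * (norm2 f * norm2 g).
Proof.
move=> sf sg mc cB; have B0 : 0 <= B by exact: le_trans (cB 0).
rewrite (eq_tint (g := fun x => f x * (g x * c x))); last by move=> x; rewrite mulrA.
have sgc := sqiM_bounded mc cB sg.
apply: (le_trans (cauchy_schwarz sf sgc)); rewrite mulrCA; apply: ler_wpM2l; first exact: norm2_ge0.
rewrite -[X in X * _](ger0_norm B0) -norm2Z//; apply: le_norm2 => //; first exact: sqiZ.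
by move=> x; rewrite !normrM mulrC (ger0_norm B0); apply: ler_wpM2r.
Qed.

Lemma tint3_cvg (f g : nat -> E3 R -> R) f' g' c (B : R) :
  (forall n, sqi (f n)) -> (forall n, sqi (g n)) -> sqi f' -> sqi g' -> meas c -> (forall x, `|c x| <= B) ->
  norm2 (fun x => f n x - f' x) @[n --> \oo] --> (0 : R) ->
  norm2 (fun x => g n x - g' x) @[n --> \oo] --> (0 : R) ->
  tint (fun x => f n x * g n x * c x) @[n --> \oo] --> tint (fun x => f' x * g' x * c x).
Proof.
move=> sf sg sf' sg' mc cB fl gl; apply/subr_cvg0; apply/norm_cvg0P.
pose bnd n := B * (norm2 (fun x => f n x - f' x) * (norm2 (fun x => g n x - g' x) + norm2 g') + norm2 f' * norm2 (fun x => g n x - g' x)).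
apply: (@squeeze_cvgr _ _ _ _ (fun=> 0) bnd).
- near=> n; rewrite normr_ge0/=.
  have s1 : sqi (fun x => f n x - f' x) by exact: sqiB.
  have s2 : sqi (fun x => g n x - g' x) by exact: sqiB.
  have ic (a b : E3 R -> R) : sqi a -> sqi b -> intg (fun x => a x * b x * c x).
    by move=> sa sb; exact: intgM_bounded mc cB (sqi_intgM sa sb).
  have -> : tint (fun x => f n x * g n x * c x) - tint (fun x => f' x * g' x * c x) =
     tint (fun x => (f n x - f' x) * g n x * c x) + tint (fun x => f' x * (g n x - g' x) * c x).
    rewrite -tintB; [|exact: ic..]; rewrite -tintD; [|exact: ic..].
    by apply: eq_tint => x; ring.
  apply: (le_trans (ler_normD _ _)); rewrite /bnd mulrDr; apply: lerD; last exact: tint3_le.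
  apply: (le_trans (tint3_le s1 (sg n) mc cB)); have B0 : 0 <= B by exact: le_trans (cB 0).
  apply: ler_wpM2l => //; apply: ler_wpM2l; first exact: norm2_ge0.
  rewrite (_ : norm2 (g n) = norm2 (fun x => (g n x - g' x) + g' x)); last first.
    by congr norm2; apply/funext => x; rewrite subrK.
  exact: norm2D.
- exact: cvg_cst.
- rewrite (_ : 0 = B * (0 * (0 + norm2 g') + norm2 f' * 0)); last by rewrite mul0r mulr0 addr0 mulr0.
  apply: cvgMl_tmp; apply: cvgD; last exact: cvgMl_tmp.
  by apply: cvgM => //; apply: cvgD => //; exact: cvg_cst.
Unshelve. all: by end_near. Qed.

End Approximation.

Lemma mollifier_sequence (R : realType) : exists2 C : R, 0 < C &
  exists (e : nat -> R) (K : nat -> seq 'I_3 -> E3 R -> R),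
    [/\ forall n, 0 < e n, forall n, e n <= 1, e @ \oo --> (0 : R) &
        forall n, mollifier C (e n) (K n)].
Proof.
have [C C0 HC] := @mollifier_exists R; exists C => //.
pose e (n : nat) : R := (n.+4%:R)^-1.
have e0 n : 0 < e n by rewrite invr_gt0.
have e4 n : e n <= 4^-1 by rewrite lef_pV2 ?posrE// ler_nat.
have /choice[K HK] : forall n, exists K, mollifier C (e n) K by move=> n; exact: HC.
exists e, K; split=> //; first by move=> n; apply: le_trans (e4 n) _; lra.
rewrite (_ : e = (fun n => harmonic (n + 3)%N)); last by apply/funext => n; rewrite /e /harmonic/= addn3.
by have := @cvg_harmonic R; rewrite -(cvg_shiftn 3).
Qed.

(** * Weakly continuous paths of symmetric fields *)

Section TimeFields.
Context {R : realType}.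
Implicit Types (x y z : E3 R) (i j : 'I_3) (t s : R).

(** Time ranges over all of R, so that continuity and measurability are global. [tf_cont] is limited
    to functions of the parity of the component, which is what the half space can test; [tf_approx]
    is pointwise in t, no modulus uniform in time being available. *)
Record time_field (W : R -> 'I_3 -> E3 R -> R) : Prop := TimeField {
  tf_sym : forall t, sym (W t);
  tf_cont : forall i g, pl2 g -> (forall x, g (refl x) = parity i * g x) ->
    continuous (fun t => tint (fun x => W t i x * g x));
  tf_bound : exists N, forall t i, norm2 (W t i) <= N;
  tf_approx : forall t (d : R), 0 < d -> exists2 e1 : R, 0 < e1 &
    forall C e K, mollifier C e K -> 0 < e -> e <= 1 -> e <= e1 ->
      forall i, norm2 (fun x => conv K [::] (W t i) x - W t i x) <= d
}.

Lemma parity_norm i : `|parity i : R| = 1.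
Proof. by rewrite /parity; case: ifP; rewrite ?normrN normr1. Qed.

Variable W : R -> 'I_3 -> E3 R -> R.
Hypothesis tW : time_field W.

Let Wpl t i : pl2 (W t i). Proof. exact: (tf_sym tW t i).1. Qed.
Let Wsq t i : sqi (W t i). Proof. exact: (tf_sym tW t i).1.2. Qed.

Section Kernel.
Variables (C e : R) (K : seq 'I_3 -> E3 R -> R).
Hypothesis mK : mollifier C e K.
Hypothesis e1 : e <= 1.

Lemma conv_time_continuous w i x : continuous (fun t => conv K w (W t i) x).
Proof.
(* The kernel centred at x has no parity. Its part of parity i pairs with [W t i] in the same way,
   since the complementary part pairs to 0. *)
pose g z := 2^-1 * (K w (x - z) + parity i * K w (x - refl z)).
have sK := mol_sub_sqi mK w x.
have pK : periodic (fun z => K w (x - z)) by apply: periodic_sub; exact: (mol_periodic mK).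
have sr : sqi (fun z => K w (x - refl z)) by exact: (@sqi_refl _ (fun z => K w (x - z))).
have gpl : pl2 g.
  apply: pl2Z; apply: pl2D; first by split.
  by apply: pl2Z; split=> //; exact: (@periodic_refl _ _ (fun z => K w (x - z))).
have gpar z : g (refl z) = parity i * g z.
  have h : parity i * parity i = 1 :> R := parity_sqr i.
  rewrite /g reflK [RHS](_ : _ = 2^-1 * (parity i * K w (x - z) + parity i * parity i * K w (x - refl z))); last by ring.
  by rewrite h mul1r addrC.
have -> : (fun t => conv K w (W t i) x) = (fun t => tint (fun z => W t i z * g z)).
  apply/funext => t; have i1 : intg (fun z => K w (x - z) * W t i z) by exact: sqi_intgM.
  have i2 : intg (fun z => K w (x - refl z) * W t i z) by exact: sqi_intgM.
  have E : tint (fun z => K w (x - z) * W t i z) = parity i * tint (fun z => K w (x - refl z) * W t i z).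
    rewrite -(tint_refl i1) -tintZ//; apply: eq_tint => z.
    by rewrite (tf_sym tW t i).2; ring.
  rewrite /conv [RHS](eq_tint (g := fun z => 2^-1 * (K w (x - z) * W t i z + parity i * (K w (x - refl z) * W t i z)))); last first.
    by move=> z; rewrite /g; ring.
  rewrite tintZ; last by apply: intgD => //; exact: intgZ.
  by rewrite tintD ?tintZ -?E//; [lra|exact: intgZ].
exact: (tf_cont tW).
Qed.

Lemma conv_time_meas w i : measurable_fun setT
  (fun z : measurableTypeR R * mE3 R => conv K w (W z.1 i) z.2).
Proof.
apply: (@caratheodory_measurable R _ (mE3 R) (fun t x => conv K w (W t i) x)).
  by move=> x; exact: conv_time_continuous.
move=> t; have h : meas (conv K w (W t i)) by apply: (conv_meas mK).
exact: h.
Qed.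

End Kernel.

(* Joint measurability of the mollified fields passes to their fluxes, and then
   to the flux of W in the limit. *)
Lemma flux_meas C e K v : mollifier C e K -> e <= 1 -> (forall j, sqi (v j)) ->
  measurable_fun setT ((fun t => flux K (W t) v) : measurableTypeR R -> R).
Proof.
move=> mK e1 sv.
have [C' _ [en [Kn [en0 en1 en_lim HKn]]]] := @mollifier_sequence R.
apply: (@measurable_sum _ _ _ _ _ _ (fun i t => \sum_(j < 3) tint (fun x => W t i x * W t j x * conv K [:: i] (v j) x))) => i.
apply: (@measurable_sum _ _ _ _ _ _ (fun j t => tint (fun x => W t i x * W t j x * conv K [:: i] (v j) x))) => j.
have mc : meas (conv K [:: i] (v j)) by apply: (conv_meas mK).
have bc x : `|conv K [:: i] (v j) x| <= norm2 (K [:: i]) * norm2 (v j) by exact: (conv_le mK).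
pose w n t k := conv (Kn n) [::] (W t k).
have sw n t k : sqi (w n t k) by exact: (conv_sqi (HKn n) (en1 n) (Wsq t k)).1.
apply: (@measurable_fun_cvg _ _ _ setT (fun n t => tint (fun x => w n t i x * w n t j x * conv K [:: i] (v j) x))).
- move=> n; apply: (@measurable_Rint_l _ _ (measurableTypeR R) (mE3 R) R torus_measure (fun t x => w n t i x * w n t j x * conv K [:: i] (v j) x)).
    apply: measurable_funM; first by apply: measurable_funM; exact: (conv_time_meas (HKn n) (en1 n)).
    by apply: (@measurableT_comp _ _ _ _ _ _ (conv K [:: i] (v j) : mE3 R -> R) _ snd).
  by move=> t; exact: intgM_bounded mc bc (sqi_intgM (sw n t i) (sw n t j)).
- move=> t _.
  have wl k : norm2 (fun x => w n t k x - W t k x) @[n --> \oo] --> (0 : R).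
    apply/cvgrPdist_le => d d0; have [e' e'0 He'] := tf_approx tW t d0.
    near=> n; rewrite sub0r normrN ger0_norm ?norm2_ge0//.
    apply: (He' C' (en n)) => //; near: n.
    have : \forall n \near \oo, `|en n| <= e' by apply: (cvgr0_norm_le _ en_lim).
    by apply: filterS => n; exact: le_trans (ler_norm _).
  exact: tint3_cvg mc bc (wl i) (wl j).
Unshelve. all: by end_near. Qed.

End TimeFields.

Section TimeMeasure.
Context {R : realType}.

(** Freezing a path outside [0, T] extends its weak continuity to the whole line, as sampling in
    time requires. *)
Definition clamp (T t : R) : R := Num.max 0 (Num.min t T).

Lemma clamp_itv T t : 0 < T -> 0 <= clamp T t <= T.
Proof.
move=> T0; rewrite /clamp le_max lexx/= ge_max ltW//= ge_min.
by rewrite lexx orbT.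
Qed.

Lemma clamp_id T t : 0 <= t <= T -> clamp T t = t.
Proof. by move=> /andP[t0 tT]; rewrite /clamp (min_idPl tT) (max_idPr t0). Qed.

Lemma clamp_continuous T : continuous (clamp T).
Proof.
apply: (@lipschitz_continuous _ R R _ 1) => x y; rewrite mul1r /clamp.
have [a0 b0] : 0 <= `|y| /\ - `|y| <= y <= `|y| by rewrite -ler_norml lexx.
move: b0 => /andP[b0 b1].
rewrite /Num.max /Num.min ler_norml; apply/andP; split;
  case: (ltP (x + y) T) => h1; case: (ltP x T) => h2;
  case: ltP => h3; case: ltP => h4; lra.
Qed.

Lemma time_itv_fin (T : R) : (@lebesgue_measure R `[0%R, T]%classic < +oo)%E.
Proof. by rewrite lebesgue_measure_itv/=; case: ifP => _; rewrite ?ltry// -EFinD ltry. Qed.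

Definition time_measure (T : R) : set (measurableTypeR R) -> \bar R :=
  @mfrestr _ (measurableTypeR R) R `[0%R, T]%classic lebesgue_measure (measurable_itv `[0%R, T]) (time_itv_fin T).

HB.instance Definition _ T := FiniteMeasure.on (time_measure T).

Definition time_meas (F : R -> R) : Prop := measurable_fun setT (F : measurableTypeR R -> R).

Definition time_int (T : R) (F : R -> R) : R := \int[time_measure T]_t F t.

Definition time_intg (T : R) (F : R -> R) : Prop :=
  integ (time_measure T) (F : measurableTypeR R -> R).

Lemma eq_time_int T (F G : R -> R) : F =1 G -> time_int T F = time_int T G.
Proof. by move=> /funext ->. Qed.

Lemma time_measM (F G : R -> R) : time_meas F -> time_meas G -> time_meas (fun t => F t * G t).
Proof. exact: measurable_funM. Qed.

Lemma time_measD (F G : R -> R) : time_meas F -> time_meas G -> time_meas (fun t => F t + G t).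
Proof. exact: measurable_funD. Qed.

Lemma time_measB (F G : R -> R) : time_meas F -> time_meas G -> time_meas (fun t => F t - G t).
Proof. exact: measurable_funB. Qed.

Lemma time_meas_cst (c : R) : time_meas (fun=> c).
Proof. exact: measurable_cst. Qed.

Lemma time_meas_le (s : R) : time_meas (fun t => (t <= s)%R%:R).
Proof.
apply: (measurableT_comp (f := fun b : bool => b%:R : R)) => //.
exact: measurable_fun_ler.
Qed.

Lemma time_intD T (F G : R -> R) : time_intg T F -> time_intg T G ->
  time_int T (fun t => F t + G t) = time_int T F + time_int T G.
Proof. by move=> iF iG; apply: RintegralD. Qed.

Lemma time_intB T (F G : R -> R) : time_intg T F -> time_intg T G ->
  time_int T (fun t => F t - G t) = time_int T F - time_int T G.
Proof. by move=> iF iG; apply: RintegralB. Qed.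

Lemma time_intZ T k (F : R -> R) : time_intg T F ->
  time_int T (fun t => k * F t) = k * time_int T F.
Proof. by move=> iF; apply: RintegralZl. Qed.

Lemma time_int_sum T (I : Type) (r : seq I) (F : I -> R -> R) : (forall i, time_intg T (F i)) ->
  time_int T (fun t => \sum_(i <- r) F i t) = \sum_(i <- r) time_int T (F i).
Proof. exact: Rint_sum. Qed.

Lemma time_bounded_intg T (F : R -> R) (B : R) : time_meas F -> (forall t, `|F t| <= B) -> time_intg T F.
Proof.
move=> mF FB; apply: (@le_integ _ _ _ _ _ (fun=> B)) => //.
exact: finite_measure_integrable_cst.
Qed.

Lemma time_int_cst T (B : R) : 0 < T -> time_int T (fun=> B) = B * T.
Proof.
move=> T0; have H : time_measure T setT = T%:E.
  rewrite /time_measure /mfrestr /mrestr setTI.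
  by rewrite lebesgue_measure_itv/= lte_fin T0 sube0.
by rewrite /time_int Rintegral_cst// [X in fine X]H.
Qed.

Lemma time_int_le T (F G : R -> R) : time_intg T F -> time_intg T G -> (forall t, `|F t| <= G t) ->
  `|time_int T F| <= time_int T G.
Proof. exact: Rint_norm_le. Qed.

Lemma time_int_bound T (F : R -> R) (B : R) : 0 < T -> time_meas F -> (forall t, `|F t| <= B) ->
  `|time_int T F| <= B * T.
Proof.
move=> T0 mF FB; rewrite -(time_int_cst _ T0); apply: time_int_le => //.
  exact: time_bounded_intg FB.
by apply: (@time_bounded_intg _ _ `|B|) => [|t]; [exact: time_meas_cst|].
Qed.

Lemma before_le (t tau a B : R) : `|a| <= B -> `|(tau <= t)%R%:R * a| <= B.
Proof.
move=> aB; have [h|h] := boolP (tau <= t)%R; first by rewrite mul1r.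
by rewrite mul0r normr0; exact: le_trans aB.
Qed.

(** Subintervals become weights under a single finite measure, so integrals up to different times
    can be subtracted under one integral sign. *)
Lemma time_integral (T t : R) (f : R -> R) : t <= T -> time_meas f ->
  \int[lebesgue_measure]_(tau in `[0, t]) f tau = time_int T (fun tau => (tau <= t)%R%:R * f tau).
Proof.
move=> tT mf; rewrite /time_int /Rintegral; congr fine.
have mi : measurable_fun setT (fun tau : measurableTypeR R => ((tau <= t)%R%:R * f tau)%:E).
  by apply/measurable_EFinP; apply: measurable_funM => //; exact: time_meas_le.
have H := @integral_mrestr R _ (measurableTypeR R) lebesgue_measure _ (measurable_itv `[0%R, T]) _ mi.
transitivity (\int[lebesgue_measure]_(tau in `[0%R, T]) ((tau <= t)%R%:R * f tau)%:E)%E; last exact/esym/H.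
rewrite integral_mkcond [RHS]integral_mkcond; apply: eq_integral => x _.
rewrite /patch !mem_setE !in_itv/=.
have [x0|x0] := leP 0 x => //=; have [xt|xt] := leP x t; rewrite /= ?mul1r ?mul0r ?if_same//.
by rewrite (le_trans xt tT).
Qed.

End TimeMeasure.

(** * The weak formulation in terms of the flux *)

Section Flux.
Context {R : realType}.
Implicit Types (x y z : E3 R) (i j : 'I_3) (v w : 'I_3 -> E3 R -> R).
Variables (C e : R) (K : seq 'I_3 -> E3 R -> R).
Hypothesis mK : mollifier C e K.
Hypothesis e1 : e <= 1.

Lemma flux_le w v (N B : R) : (forall i, sqi (w i)) -> (forall j, sqi (v j)) ->
  (forall i, norm2 (w i) <= N) -> (forall i j x, `|conv K [:: i] (v j) x| <= B) ->
  `|flux K w v| <= 9 * (B * (N * N)).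
Proof.
move=> sw sv wN cB.
have N0 : 0 <= N := le_trans (norm2_ge0 _) (wN 0).
have B0 : 0 <= B := le_trans (normr_ge0 _) (cB 0 0 0).
have -> : 9 * (B * (N * N)) = \sum_(i < 3) \sum_(j < 3) B * (N * N).
  by rewrite !big_const_ord !iter_addr_0; ring.
apply: (le_trans (ler_norm_sum _ _ _)); apply: ler_sum => i _.
apply: (le_trans (ler_norm_sum _ _ _)); apply: ler_sum => j _.
apply: (le_trans (tint3_le (sw i) (sw j) _ (cB i j))); first by apply: (conv_meas mK).
by apply: ler_wpM2l => //; apply: ler_pM; rewrite ?norm2_ge0.
Qed.

Lemma flux_term_intg w v i j : (forall i, sqi (w i)) -> (forall j, sqi (v j)) ->
  intg (fun x => w i x * w j x * conv K [:: i] (v j) x).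
Proof. by move=> sw sv; apply: (conv_intg_prod mK) => //; exact: sqi_intgM. Qed.

Lemma fluxB w v v' : (forall i, sqi (w i)) -> (forall j, sqi (v j)) -> (forall j, sqi (v' j)) ->
  flux K w (fun j x => v j x - v' j x) = flux K w v - flux K w v'.
Proof.
move=> sw sv sv'; rewrite /flux -sumrB; apply: eq_bigr => i _.
rewrite -sumrB; apply: eq_bigr => j _.
rewrite -tintB; [|exact: flux_term_intg..].
by apply: eq_tint => x; rewrite (convB mK)//; ring.
Qed.

Definition mollify v i : E3 R -> R := conv K [::] (v i).

Lemma mollify_sym v : sym v -> sym (mollify v).
Proof.
move=> sv i; split; first by apply: (conv_pl2 mK e1); exact: (sv i).1.
by move=> x; apply: (conv_refl mK); [exact: (sv i).1.2|exact: (sv i).2].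
Qed.

Lemma ext_smooth_field v : sym v -> ext (smooth_field K v [::]) = mollify v.
Proof.
move=> sv; apply/funext => i; apply/funext => x.
by rewrite -[RHS](vec_ext i x (mollify_sym sv)).
Qed.

Lemma smooth_field_in_L2 v : sym v -> in_L2 Dplus (smooth_field K v [::]).
Proof. by move=> sv; exact: (vec_in_L2 (mollify_sym sv)). Qed.

Lemma inner_smooth_field f v : in_L2 Dplus f -> sym v ->
  inner Dplus f (smooth_field K v [::]) = 2^-1 * ip (ext f) (mollify v).
Proof. by move=> fL sv; rewrite (inner_ext fL (smooth_field_in_L2 sv)) (ext_smooth_field sv). Qed.

(** Under reflection the factors i and j of the tensor and the entry (i, j) of the gradient all
    change by parities, each of which occurs twice; the integrand is therefore even and the half
    space carries half of the flux. *)
Lemma inner_mx_flux f v : in_L2 Dplus f -> sym v ->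
  inner_mx Dplus (fun x => tensor (f x) (f x)) (gradient (smooth_field K v [::]))
    = 2^-1 * flux K (ext f) v.
Proof.
move=> fL sv; have sf i : sqi (ext f i) by exact: (ext_pl2 i fL).2.
have svj j : sqi (v j) by exact: (sv j).1.2.
pose h x := frobenius (tensor (f x) (f x)) (gradient (smooth_field K v [::]) x).
pose G x := \sum_(i < 3) \sum_(j < 3) ext f i x * ext f j x * conv K [:: i] (v j) x.
have Gi : intg G by apply: intg_sum => i; apply: intg_sum => j; exact: flux_term_intg.
have hE x : h (absr x) = \sum_(i < 3) \sum_(j < 3)
    component (f (absr x)) i * component (f (absr x)) j * conv K [:: i] (v j) (absr x).
  apply: eq_bigr => i _; apply: eq_bigr => j _.
  by rewrite mxE (gradient_smooth_field mK e1 sv _ _ (absr_Dplus x)).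
have mh : meas (fun x => h (absr x)).
  rewrite (funext hE); apply: meas_sum => i; apply: meas_sum => j.
  have [_ mf _] := fL; have mc k : meas (fun x => component (f (absr x)) k).
    exact: (meas_absr (h := fun x => component (f x) k)).
  apply: measM; first exact: measM.
  apply: (meas_absr (h := conv K [:: i] (v j))); apply: measurable_funTS.
  have h' : meas (conv K [:: i] (v j)) by apply: (conv_meas mK).
  exact: h'.
have hG x : x.2 != 0 -> G x = h (absr x).
  move=> x0; rewrite hE; apply: eq_bigr => i _; apply: eq_bigr => j _.
  have -> : conv K [:: i] (v j) x = wt i x.2 * wt j x.2 * conv K [:: i] (v j) (absr x).
    case: (ltgtP 0 x.2) x0 => // x0 _; first by rewrite !wt_pos// !mul1r absr_id// ltW.
    have rx : absr x = refl x by rewrite /absr /refl ltr0_norm.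
    rewrite rx (conv_grad_refl mK i x (svj j) (sv j).2).
    have wn k : wt k x.2 = parity k by rewrite -[x.2]opprK wtN wt_pos ?oppr_gt0// mulr1.
    by rewrite !wn mulrA mulrACA !parity_sqr !mul1r.
  rewrite /ext; have := wt_sqr i x0; have := wt_sqr j x0.
  set a := wt i x.2; set b := wt j x.2 => hb ha.
  rewrite (_ : _ * _ * (_ * _) = (a * a) * (b * b) * (component (f (absr x)) i * component (f (absr x)) j * conv K [:: i] (v j) (absr x))); last by ring.
  by rewrite ha hb !mul1r.
have ih : intg (fun x => h (absr x)) by exact: eq_intg_off hG Gi.
rewrite /inner_mx (half_integral (h := h) ih) -(eq_tint_off (intg_meas Gi) mh hG).
by rewrite /G tint_sum; [congr (_ * _); apply: eq_bigr => i _; rewrite tint_sum// => j; exact: flux_term_intg|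
  move=> i; apply: intg_sum => j; exact: flux_term_intg].
Qed.

End Flux.

Section EnergyFrame.
Context {R : realType}.
Implicit Types (x y z : E3 R) (i j : 'I_3) (t s : R).

(** [ef_weak] tests only against the mollified state at a third time r. The difference of the two
    indicators is the indicator of ]s, t]. *)
Record energy_frame (T : R) (W : R -> 'I_3 -> E3 R -> R) : Prop := EnergyFrame {
  ef_field : time_field W;
  ef_div : forall C e K, mollifier C e K -> 0 < e -> e <= 1 -> forall t x,
    \sum_(i < 3) conv K [:: i] (W t i) x = 0;
  ef_weak : forall C e K, mollifier C e K -> 0 < e -> e <= 1 -> forall r s t,
    0 <= s -> s <= t -> t <= T ->
    ip (W t) (mollify K (W r)) - ip (W s) (mollify K (W r)) =
    time_int T (fun tau => ((tau <= t)%R%:R - (tau <= s)%R%:R) * flux K (W tau) (W r))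
}.

Lemma ip_le (v w : 'I_3 -> E3 R -> R) (N M : R) : (forall i, sqi (v i)) -> (forall i, sqi (w i)) ->
  (forall i, norm2 (v i) <= N) -> (forall i, norm2 (w i) <= M) -> `|ip v w| <= 3 * (N * M).
Proof.
move=> sv sw vN wM.
have -> : 3 * (N * M) = \sum_(i < 3) N * M by rewrite big_const_ord iter_addr_0; ring.
apply: (le_trans (ler_norm_sum _ _ _)); apply: ler_sum => i _.
apply: (le_trans (cauchy_schwarz (sv i) (sw i))).
by apply: ler_pM; rewrite ?norm2_ge0.
Qed.

Lemma ip_mollifyB C e K (v w w' : 'I_3 -> E3 R -> R) : mollifier C e K -> e <= 1 ->
  (forall i, sqi (v i)) -> (forall i, sqi (w i)) -> (forall i, sqi (w' i)) ->
  ip v (mollify K (fun i x => w i x - w' i x)) = ip v (mollify K w) - ip v (mollify K w').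
Proof.
move=> mK e1 sv sw sw'; rewrite /ip -sumrB; apply: eq_bigr => i _.
have sJ k : sqi k -> sqi (conv K [::] k) by move=> sk; exact: (conv_sqi mK e1 sk).1.
rewrite -tintB; [|by apply: sqi_intgM => //; exact: sJ..].
by apply: eq_tint => x; rewrite /mollify (convB mK)//; ring.
Qed.

Variables (T : R) (u : R -> E3 R -> E3 R).
Hypothesis T0 : 0 < T.
Hypothesis wu : weak_solution T u.

Definition ext_path t : 'I_3 -> E3 R -> R := ext (u (clamp T t)).

Let Hu t : H_sigma (u (clamp T t)).
Proof. by have [[H _] _] := wu; apply: H; exact: clamp_itv. Qed.

Let path_sym t : sym (ext_path t). Proof. exact: ext_sym (Hu t).1. Qed.

Let path_sqi t i : sqi (ext_path t i). Proof. exact: (path_sym t i).1.2. Qed.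

(** A function of parity i placed in component i, with zeros elsewhere, is a symmetric field, hence
    the extension of an admissible L^2 test function. *)
Let inner_component i g : pl2 g -> (forall x, g (refl x) = parity i * g x) ->
  {within `[0, T], continuous (fun t => tint (fun x => ext (u t) i x * g x))}.
Proof.
move=> gpl gpar; pose v j := if j == i then g else fun=> 0.
have sv : sym v.
  move=> j; rewrite /v; case: eqVneq => [->|_]; first by split.
  by split=> [|x]; [split; [by []|exact: sqi0]|rewrite mulr0].
have [[Hs Hc] _] := wu; have := Hc _ (vec_in_L2 sv).
have E t : 0 <= t <= T -> inner Dplus (u t) (vec v) = 2^-1 * tint (fun x => ext (u t) i x * g x).
  move=> tT; rewrite inner_ext; [|exact: (Hs t tT).1|exact: vec_in_L2]; congr (_ * _).
  rewrite /ip (bigD1 i)//= [X in _ + X]big1 ?addr0; last first.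
    move=> j ji; rewrite (eq_tint (g := fun=> 0)) ?tint0// => x.
    by rewrite vec_ext// /v (negbTE ji) mulr0.
  by apply: eq_tint => x; rewrite vec_ext// /v eqxx.
move=> /subspace_continuousP c; apply/subspace_continuousP => t tT.
have h : 2 * inner Dplus (u s) (vec v) @[s --> within `[0, T]%classic (nbhs t)] --> 2 * inner Dplus (u t) (vec v).
  by apply: cvgMl_tmp; exact: (c t tT).
have E2 s : `[0, T]%classic s -> 2 * inner Dplus (u s) (vec v) = tint (fun x => ext (u s) i x * g x).
  by rewrite /= in_itv/= => sT; rewrite E// mulrA divff// mul1r.
suff : tint (fun x => ext (u s) i x * g x) @[s --> within `[0, T]%classic (nbhs t)] --> tint (fun x => ext (u t) i x * g x) by [].
rewrite -(E2 t tT); apply: cvg_trans h; apply: near_eq_cvg.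
suff : \forall s \near t, `[0, T]%classic s ->
  2 * inner Dplus (u s) (vec v) = tint (fun x => ext (u s) i x * g x) by [].
by apply: filterE => s; exact: E2.
Qed.

Let path_continuous i g : pl2 g -> (forall x, g (refl x) = parity i * g x) ->
  continuous (fun t => tint (fun x => ext_path t i x * g x)).
Proof.
move=> gpl gpar; have /subspace_continuousP c := inner_component gpl gpar.
have cT s : `[0, T]%classic (clamp T s) by rewrite /= in_itv/= clamp_itv.
move=> t N HN.
have H : \forall s \near clamp T t, `[0, T]%classic s -> N (tint (fun x => ext (u s) i x * g x)).
  by have := c (clamp T t) (cT t) N HN.
have H2 : \forall s \near t, `[0, T]%classic (clamp T s) -> N (tint (fun x => ext (u (clamp T s)) i x * g x)).
  exact: (@clamp_continuous _ T t _ H).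
suff : \forall s \near t, N (tint (fun x => ext_path s i x * g x)) by [].
by apply: filterS H2 => s Hs; exact: (Hs (cT s)).
Qed.

Lemma path_time_field : time_field ext_path.
Proof.
split=> //.
- have H i : exists N : R, forall t, 0 <= t <= T -> norm2 (ext_path t i) <= N.
    apply: (weakly_continuous_bounded T0 (parity_norm i)).
    + by move=> t; exact: (path_sym t i).1.
    + by move=> t x; exact: (path_sym t i).2.
    + by move=> g gpl gpar; apply: continuous_subspaceT; exact: path_continuous.
  have [N0 H0] := H 0; have [N1 H1] := H 1; have [N2 H2] := H 2.
  exists (`|N0| + `|N1| + `|N2|) => t i.
  have -> : ext_path t = ext_path (clamp T t) by rewrite /ext_path (clamp_id (clamp_itv t T0)).
  have := clamp_itv t T0; move: (clamp T t) => s sT.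
  have := normr_ge0 N0; have := normr_ge0 N1; have := normr_ge0 N2.
  have := ler_norm N0; have := ler_norm N1; have := ler_norm N2.
  by move: i; apply: ord3P; [have := H0 s sT|have := H1 s sT|have := H2 s sT]; lra.
- by move=> t d d0; exact: H_sigma_conv_approx.
Qed.

(** The mollified field is independent of time, so the term with the time derivative vanishes. Decay
    of v is assumed here, which covers extensions of Schwartz fields. *)
Let weak_test C e K v (t : R) : mollifier C e K -> 0 < e -> e <= 1 -> sym v ->
  (forall x, \sum_(i < 3) conv K [:: i] (v i) x = 0) ->
  (forall (beta : nat), exists M : R, forall j x, `|v j x| * `|x.2| ^+ beta <= M) ->
  0 <= t <= T ->
  ip (ext_path t) (mollify K v) - ip (ext_path 0) (mollify K v) =
  time_int T (fun tau => (tau <= t)%R%:R * flux K (ext_path tau) v).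
Proof.
move=> mK e0 e1 sv dv decv /andP[t0 tT].
have sv2 j : sqi (v j) by exact: (sv j).1.2.
have H0 : (0 : R) <= 0 <= T by rewrite lexx ltW.
have Ht : 0 <= t <= T by rewrite t0.
have [[Hs _] wk] := wu.
have /= weq := wk t _ Ht (smooth_field_test mK e1 sv dv decv T0).
have in0 (tau : R) : 0 <= tau <= T -> inner Dplus (u tau) (dt T (fun z : E3 R * R => smooth_field K v [::] z.1) tau) = 0.
  move=> tauT; rewrite /inner (@eq_Rintegral _ _ _ _ _ (fun=> 0)); first by rewrite /Rintegral integral0.
  move=> x; rewrite inE => -[_ _ Dx]; rewrite (smooth_field_dt mK e1 sv T0 tauT Dx).
  by rewrite /dot big1// => i _; move: i; apply: ord3P; rewrite mulr0.
have E1 : \int[lebesgue_measure]_(tau in `[0, t]) inner Dplus (u tau) (dt T (fun z : E3 R * R => smooth_field K v [::] z.1) tau) = 0.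
  rewrite (@eq_Rintegral _ _ _ _ _ (fun=> 0)); first by rewrite /Rintegral integral0.
  by move=> tau; rewrite inE/= in_itv/= => /andP[a b]; rewrite in0// a (le_trans b).
rewrite E1 subr0 in weq; rewrite {E1}.
have E2 : \int[lebesgue_measure]_(tau in `[0, t]) inner_mx Dplus (fun x => tensor (u tau x) (u tau x)) (gradient (fun x => smooth_field K v [::] x)) =
    \int[lebesgue_measure]_(tau in `[0, t]) (2^-1 * flux K (ext_path tau) v).
  apply: eq_Rintegral => tau; rewrite inE/= in_itv/= => /andP[a b].
  have tauT : 0 <= tau <= T by rewrite a (le_trans b).
  by rewrite (inner_mx_flux mK e1 (Hs tau tauT).1 sv) /ext_path (clamp_id tauT).
rewrite {}E2 in weq; move: weq.
have [N HN] := tf_bound path_time_field.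
have mf := flux_meas path_time_field mK e1 sv2.
rewrite (time_integral tT); last by apply: time_measM => //; exact: time_meas_cst.
rewrite !(inner_smooth_field mK e1 _ sv); [|exact: (Hs 0 H0).1|exact: (Hs t Ht).1].
rewrite /ext_path (clamp_id H0) (clamp_id Ht).
have cv i j x : `|conv K [:: i] (v j) x| <= \sum_(k < 3) \sum_(l < 3) norm2 (K [:: k]) * norm2 (v l).
  apply: (le_trans (conv_le mK _ _ (sv2 j))); rewrite (bigD1 i)//= (bigD1 j)//=.
  rewrite -addrA lerDl; apply: addr_ge0; first by apply: sumr_ge0 => l _; rewrite mulr_ge0 ?norm2_ge0.
  by apply: sumr_ge0 => k _; apply: sumr_ge0 => l _; rewrite mulr_ge0 ?norm2_ge0.
have fB tau := flux_le mK e1 (path_sqi tau) sv2 (HN tau) cv.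
have ii : time_intg T (fun tau => (tau <= t)%R%:R * flux K (ext_path tau) v).
  apply: (@time_bounded_intg _ _ _ _ _ (fun tau => before_le t tau (fB tau))).
  by apply: time_measM => //; exact: time_meas_le.
rewrite (@eq_time_int _ T _ (fun tau => 2^-1 * ((tau <= t)%R%:R * flux K (ext_path tau) v))); last first.
  by move=> tau; rewrite mulrCA.
rewrite time_intZ//; set I := time_int _ _.
by move: (ip (ext (u t)) _) (ip (ext (u 0)) _) => a b; lra.
Qed.

Lemma schwartz_decay phi : schwartz_n_sigma phi ->
  forall beta : nat, exists M : R, forall j x, `|ext phi j x| * `|x.2| ^+ beta <= M.
Proof.
move=> [[_ _ dec] _ _] beta; have [M HM] := dec [::] beta; exists M => j x.
apply: le_trans (HM (absr x) (absr_Dplus x)); rewrite /absr /= normr_id.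
apply: ler_wpM2r; first exact: exprn_ge0.
rewrite /ext normrM -[leRHS]mul1r; apply: ler_pM => //; first exact: wt_le.
exact: component_le.
Qed.

(** The state at time r has no decay. Replacing it by the extension of a Schwartz field at L^2
    distance d changes the two inner products by at most 3 N d each and the flux by at most 9 B0 N^2
    d, uniformly in time; this is the constant [A], and d is arbitrary. *)
Let path_weak C e K (r t : R) : mollifier C e K -> 0 < e -> e <= 1 -> 0 <= t <= T ->
  ip (ext_path t) (mollify K (ext_path r)) - ip (ext_path 0) (mollify K (ext_path r)) =
  time_int T (fun tau => (tau <= t)%R%:R * flux K (ext_path tau) (ext_path r)).
Proof.
move=> mK e0 e1 tT; have [N HN] := tf_bound path_time_field.
have N0 : 0 <= N := le_trans (norm2_ge0 _) (HN 0 0).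
pose B0 := \sum_(i < 3) norm2 (K [:: i]).
have B00 : 0 <= B0 by apply: sumr_ge0 => i _; exact: norm2_ge0.
set rhs := time_int _ _; set lhs := _ - _.
apply/eqP; rewrite -subr_eq0 -normr_eq0 eq_le normr_ge0 andbT.
pose A := 6 * N + 9 * (B0 * (N * N)) * T.
have A0 : 0 <= A by rewrite /A addr_ge0 ?mulr_ge0// ltW.
suff H (d : R) : 0 < d -> `|lhs - rhs| <= A * d.
  apply/ler_addgt0Pl => d d0; rewrite addr0.
  have A1 : 0 < A + 1 by rewrite ltr_wpDl.
  apply: (le_trans (H (d / (A + 1)) _)); first by rewrite divr_gt0.
  rewrite mulrA ler_pdivrMr// mulrC; apply: ler_wpM2l; first exact: ltW.
  by rewrite lerDl.
move=> d0; have [phi [sphi pL uphi]] := H_sigma_approx (Hu r) d0.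
have sv := ext_sym pL; have sv2 j : sqi (ext phi j) by exact: (sv j).1.2.
have sr j := path_sqi r j.
have wk := weak_test mK e0 e1 sv (fun x => schwartz_div_conv mK e1 x sphi pL) (schwartz_decay sphi) tT.
pose g j x := ext_path r j x - ext phi j x.
have sg j : sqi (g j) by exact: sqiB.
have gd j : norm2 (g j) <= d by exact: uphi.
have sJg j : sqi (mollify K g j) /\ norm2 (mollify K g j) <= d.
  by have [a b] := conv_sqi mK e1 (sg j); split=> //; exact: le_trans b (gd j).
have cg i j x : `|conv K [:: i] (g j) x| <= B0 * d.
  apply: (le_trans (conv_le mK _ _ (sg j))); apply: ler_pM; rewrite ?norm2_ge0//.
  by rewrite /B0 (bigD1 i)//= lerDl; apply: sumr_ge0 => k _; exact: norm2_ge0.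
have mflux v : (forall j, sqi (v j)) -> time_meas (fun tau => (tau <= t)%R%:R * flux K (ext_path tau) v).
  move=> sv'; apply: time_measM; first exact: time_meas_le.
  exact: (flux_meas path_time_field mK e1 sv').
have fgB tau : `|flux K (ext_path tau) g| <= 9 * (B0 * d * (N * N)).
  by apply: (flux_le mK e1 (path_sqi tau) sg (HN tau)).
have ig := @time_bounded_intg _ T _ _ (mflux g sg) (fun tau => before_le t tau (fgB tau)).
have cphi i j x : `|conv K [:: i] (ext phi j) x| <= \sum_(k < 3) \sum_(l < 3) norm2 (K [:: k]) * norm2 (ext phi l).
  apply: (le_trans (conv_le mK _ _ (sv2 j))); rewrite (bigD1 i)//= (bigD1 j)//=.
  rewrite -addrA lerDl; apply: addr_ge0; first by apply: sumr_ge0 => l _; rewrite mulr_ge0 ?norm2_ge0.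
  by apply: sumr_ge0 => k _; apply: sumr_ge0 => l _; rewrite mulr_ge0 ?norm2_ge0.
have fpB tau := flux_le mK e1 (path_sqi tau) sv2 (HN tau) cphi.
have iphi := @time_bounded_intg _ T _ _ (mflux _ sv2) (fun tau => before_le t tau (fpB tau)).
have E : lhs - rhs = ip (ext_path t) (mollify K g) - ip (ext_path 0) (mollify K g)
    - time_int T (fun tau => (tau <= t)%R%:R * flux K (ext_path tau) g).
  have -> : rhs = time_int T (fun tau => (tau <= t)%R%:R * flux K (ext_path tau) g)
     + (ip (ext_path t) (mollify K (ext phi)) - ip (ext_path 0) (mollify K (ext phi))).
    rewrite wk -(time_intD ig iphi); apply: eq_time_int => tau.
    by rewrite -mulrDr /g (fluxB mK e1 (path_sqi tau) sr sv2) subrK.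
  have Eg q : ip (ext_path q) (mollify K g) = ip (ext_path q) (mollify K (ext_path r)) - ip (ext_path q) (mollify K (ext phi)).
    exact: (ip_mollifyB mK e1 (path_sqi q) sr sv2).
  rewrite !Eg.
  rewrite /lhs; move: (time_int T _) (ip (ext_path t) (mollify K (ext_path r))).
  move: (ip (ext_path t) _) (ip (ext_path 0) (mollify K (ext_path r))) (ip (ext_path 0) _) => a b c p q.
  by ring.
have h1 := ip_le (path_sqi t) (fun i => (sJg i).1) (HN t) (fun i => (sJg i).2).
have h2 := ip_le (path_sqi 0) (fun i => (sJg i).1) (HN 0) (fun i => (sJg i).2).
have h3 : `|time_int T (fun tau => (tau <= t)%R%:R * flux K (ext_path tau) g)| <= 9 * (B0 * d * (N * N)) * T.
  by apply: (time_int_bound T0 (mflux g sg)) => tau; apply: before_le; exact: fgB.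
rewrite {}E; move: (ip (ext_path t) _) (ip (ext_path 0) _) (time_int T _) h1 h2 h3 => a b c h1 h2 h3.
apply: (le_trans (ler_normB _ _)); apply: (le_trans (lerD (ler_normB _ _) (lexx _))).
apply: (le_trans (lerD (lerD h1 h2) h3)).
by rewrite /A le_eqVlt; apply/orP; left; apply/eqP; ring.
Qed.

Lemma path_energy_frame : energy_frame T ext_path.
Proof.
split; first exact: path_time_field.
  by move=> C e K mK e0 e1 t x; exact: (H_sigma_div_conv mK e1 x (Hu t)).
move=> C e K mK e0 e1 r s t s0 st tT.
have Ht := path_weak r mK e0 e1 (introT andP (conj (le_trans s0 st) tT)).
have Hs := path_weak r mK e0 e1 (introT andP (conj s0 (le_trans st tT))).
have sr j := path_sqi r j.
have [N HN] := tf_bound path_time_field.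
have cr i j x : `|conv K [:: i] (ext_path r j) x| <= \sum_(k < 3) norm2 (K [:: k]) * N.
  apply: (le_trans (conv_le mK _ _ (sr j))); rewrite (bigD1 i)//=.
  have N0 : 0 <= N := le_trans (norm2_ge0 _) (HN 0 0).
  apply: (@le_trans _ _ (norm2 (K [:: i]) * N)); first by apply: ler_wpM2l; rewrite ?norm2_ge0 ?HN.
  by rewrite lerDl; apply: sumr_ge0 => k _; rewrite mulr_ge0 ?norm2_ge0.
have fB tau := flux_le mK e1 (path_sqi tau) sr (HN tau) cr.
have ii (q : R) : time_intg T (fun tau => (tau <= q)%R%:R * flux K (ext_path tau) (ext_path r)).
  apply: (@time_bounded_intg _ _ _ _ _ (fun tau => before_le q tau (fB tau))).
  apply: time_measM; first exact: time_meas_le.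
  exact: (flux_meas path_time_field mK e1 sr).
transitivity (time_int T (fun tau => (tau <= t)%R%:R * flux K (ext_path tau) (ext_path r))
   - time_int T (fun tau => (tau <= s)%R%:R * flux K (ext_path tau) (ext_path r))).
  rewrite -Ht -Hs; move: (ip (ext_path t) _) (ip (ext_path s) _) (ip (ext_path 0) _) => a b c.
  by ring.
by rewrite -(time_intB (ii t) (ii s)); apply: eq_time_int => tau; rewrite mulrBl.
Qed.

End EnergyFrame.

Section EnergyBalance.
Context {R : realType}.
Implicit Types (x y z : E3 R) (i j : 'I_3) (t s r tau : R).

Lemma time_dct T (F : nat -> R -> R) (G : R -> R) (B : R) :
  (forall n, time_meas (F n)) -> (forall n t, `|F n t| <= B) ->
  (forall t, F n t @[n --> \oo] --> G t) ->
  time_meas G /\ time_int T (F n) @[n --> \oo] --> time_int T G.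
Proof.
move=> mF FB FG.
have mG : time_meas G.
  by apply: (@measurable_fun_cvg _ (measurableTypeR R) R setT F) => // t _; exact: FG.
split=> //; apply: (@Rint_dct _ _ _ (time_measure T) F G (fun=> B)) => //.
  exact: aeW.
exact: finite_measure_integrable_cst.
Qed.

Lemma telescope_sum (h : R -> R) (p : nat -> R) n :
  \sum_(k < n) (h (p k.+1) - h (p k)) = h (p n) - h (p 0).
Proof. by rewrite -(big_mkord xpredT (fun k => h (p k.+1) - h (p k))) telescope_sumr. Qed.

(** Written as a difference, so that the windows of a partition telescope. *)
Definition window s t tau : R := (tau <= t)%R%:R - (tau <= s)%R%:R.

Lemma window_meas s t : time_meas (window s t).
Proof. by apply: time_measB; exact: time_meas_le. Qed.

Lemma windowE s t tau : s <= t -> window s t tau = ((s < tau) && (tau <= t))%R%:R.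
Proof.
move=> st; rewrite /window ltNge; have [h|h] := leP tau s => /=.
  by rewrite (le_trans h st) subrr.
by rewrite subr0.
Qed.

Lemma window_ge0 s t tau : s <= t -> 0 <= window s t tau <= 1.
Proof.
move=> st; rewrite windowE//; have [_|_] := boolP ((s < tau) && (tau <= t)).
  by rewrite ler01 lexx.
by rewrite ler01 lexx.
Qed.

Variables (T : R) (W : R -> 'I_3 -> E3 R -> R).
Hypothesis eW : energy_frame T W.
Let tW := ef_field eW.
Let Wsq t i : sqi (W t i). Proof. exact: (tf_sym tW t i).1.2. Qed.

Variables (C e : R) (K : seq 'I_3 -> E3 R -> R).
Hypothesis mK : mollifier C e K.
Hypothesis e0 : 0 < e.
Hypothesis e1 : e <= 1.

Lemma frame_conv_bound : exists2 B : R, 0 <= B & forall t i j x, `|conv K [:: i] (W t j) x| <= B.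
Proof.
have [N HN] := tf_bound tW; have N0 : 0 <= N := le_trans (norm2_ge0 _) (HN 0 0).
exists (\sum_(k < 3) norm2 (K [:: k]) * N).
  by apply: sumr_ge0 => k _; rewrite mulr_ge0 ?norm2_ge0.
move=> t i j x; apply: (le_trans (conv_le mK _ _ (Wsq t j))); rewrite (bigD1 i)//=.
apply: (@le_trans _ _ (norm2 (K [:: i]) * N)); first by apply: ler_wpM2l; rewrite ?norm2_ge0 ?HN.
by rewrite lerDl; apply: sumr_ge0 => k _; rewrite mulr_ge0 ?norm2_ge0.
Qed.

Lemma frame_flux_bound : exists2 B : R, 0 <= B & forall s t, `|flux K (W s) (W t)| <= B.
Proof.
have [N HN] := tf_bound tW; have [B B0 HB] := frame_conv_bound.
have H s t := flux_le mK e1 (Wsq s) (Wsq t) (HN s) (HB t).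
by exists (9 * (B * (N * N))) => //; exact: le_trans (H 0 0).
Qed.

(** Only the tested slot varies: its mollified gradient is continuous in time at every point and
    uniformly bounded, with the integrable weight |W_i W_j| at time tau fixed. The quadratic slot
    has no such continuity, since weak limits do not pass through products. *)
Lemma flux_continuous tau (d : R) : 0 < d -> exists2 r : R, 0 < r &
  forall s, `|s - tau| <= r -> `|flux K (W tau) (W s) - flux K (W tau) (W tau)| <= d.
Proof.
move=> d0; have [B B0 HB] := frame_conv_bound.
have : flux K (W tau) (W s) @[s --> tau^'] --> flux K (W tau) (W tau).
  apply/cvgr_dnbhsP => k [_ kt].
  apply: cvg_sumr => i; apply: cvg_sumr => j.
  have iW := sqi_intgM (Wsq tau i) (Wsq tau j).
  apply: (@tint_dct _ _ _ (fun x => B * `|W tau i x * W tau j x|)).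
  - by move=> n; apply: intg_meas; exact: (flux_term_intg mK e1 i j (Wsq tau) (Wsq (k n))).
  - by apply: intg_meas; exact: (flux_term_intg mK e1 i j (Wsq tau) (Wsq tau)).
  - by apply: intgZ; exact: intg_norm.
  - by move=> n x; rewrite normrM mulrC; apply: ler_wpM2r.
  - move=> x _; apply: cvgMl_tmp.
    have c := @conv_time_continuous _ W tW C e K mK [:: i] j x tau.
    exact: (cvg_comp k (fun t => conv K [:: i] (W t j) x) kt c).
move=> /cvgrPdist_le/(_ d d0); rewrite near_withinE => /nbhs_ballP[r /= r0 H].
exists (r / 2); first by rewrite divr_gt0.
move=> s hs; have [->|st] := eqVneq s tau; first by rewrite subrr normr0 ltW.
rewrite distrC; apply: H => //; rewrite /ball/= distrC.
by apply: le_lt_trans hs _; rewrite ltr_pdivrMr//; lra.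
Qed.

Let h t := ip (W t) (mollify K (W t)).

Let ip_sym s t : ip (W s) (mollify K (W t)) = ip (W t) (mollify K (W s)).
Proof.
apply: eq_bigr => i _; rewrite /mollify -(conv_adjoint mK e1 (Wsq s i) (Wsq t i)).
by apply: eq_tint => x; rewrite mulrC.
Qed.

(** The mollified pairing is a symmetric bilinear form B, so B(a, a) - B(b, b) = B(a - b, a) + B(a -
    b, b): the increment is tested against both frozen end states. *)
Let step s t : 0 <= s -> s <= t -> t <= T ->
  h t - h s = time_int T (fun tau => window s t tau * (flux K (W tau) (W t) + flux K (W tau) (W s))).
Proof.
move=> s0 st tT; have w r := ef_weak eW mK e0 e1 r s0 st tT.
have [B B0 HB] := frame_flux_bound.
have iw r : time_intg T (fun tau => window s t tau * flux K (W tau) (W r)).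
  apply: (@time_bounded_intg _ _ _ B).
    by apply: time_measM; [exact: window_meas|exact: (flux_meas tW mK e1 (Wsq r))].
  move=> tau; have /andP[a b] := window_ge0 tau st.
  by rewrite normrM (ger0_norm a) -[leRHS]mul1r; apply: ler_pM.
rewrite (@eq_time_int _ T _ (fun tau => window s t tau * flux K (W tau) (W t) + window s t tau * flux K (W tau) (W s))); last first.
  by move=> tau; rewrite mulrDr.
rewrite (time_intD (iw t) (iw s)).
transitivity ((ip (W t) (mollify K (W t)) - ip (W s) (mollify K (W t))) +
  (ip (W t) (mollify K (W s)) - ip (W s) (mollify K (W s)))).
  rewrite (ip_sym t s) /h; move: (ip _ _) (ip _ _) (ip _ _) => a b c; ring.
by congr (_ + _); exact: w.
Qed.

(* A weak solution is only tested against fields frozen in time: W is frozen at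
   the points of a partition of [0, t], which is then refined. *)
Lemma energy_balance t : 0 <= t <= T ->
  time_meas (fun tau => window 0 t tau * flux K (W tau) (W tau)) /\
  h t - h 0 = 2 * time_int T (fun tau => window 0 t tau * flux K (W tau) (W tau)).
Proof.
move=> /andP[t0 tT]; have [B B0 HB] := frame_flux_bound.
pose p (n k : nat) : R := k%:R * (t / n.+1%:R).
have q0 n : 0 <= t / n.+1%:R by rewrite divr_ge0.
have pS n k : p n k <= p n k.+1 by rewrite /p ler_wpM2r// ler_nat.
have pn n : p n n.+1 = t by rewrite /p mulrC divfK.
have p0 n : p n 0 = 0 by rewrite /p mul0r.
have pge0 n k : 0 <= p n k by rewrite /p mulr_ge0.
have ple n k : (k <= n.+1)%N -> p n k <= T.
  by move=> kn; apply: le_trans tT; rewrite -(pn n) /p ler_wpM2r// ler_nat.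
pose F n tau := \sum_(k < n.+1) window (p n k) (p n k.+1) tau *
   (flux K (W tau) (W (p n k.+1)) + flux K (W tau) (W (p n k))).
have wF n k : time_meas (fun tau => window (p n k) (p n k.+1) tau *
   (flux K (W tau) (W (p n k.+1)) + flux K (W tau) (W (p n k)))).
  apply: time_measM; first exact: window_meas.
  by apply: time_measD; [exact: (flux_meas tW mK e1 (Wsq (p n k.+1)))|exact: (flux_meas tW mK e1 (Wsq (p n k)))].
have wn n k tau := window_ge0 tau (pS n k).
have wB n k tau : `|window (p n k) (p n k.+1) tau *
   (flux K (W tau) (W (p n k.+1)) + flux K (W tau) (W (p n k)))| <= window (p n k) (p n k.+1) tau * (2 * B).
  have /andP[a b] := wn n k tau; rewrite normrM (ger0_norm a); apply: ler_wpM2l => //.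
  by apply: (le_trans (ler_normD _ _)); have := HB tau (p n k.+1); have := HB tau (p n k); move: (flux _ _ _) (flux _ _ _) => c d; lra.
have wsum n tau : \sum_(k < n.+1) window (p n k) (p n k.+1) tau = window 0 t tau.
  have := telescope_sum (fun q => (tau <= q)%R%:R) (p n) n.+1; rewrite pn p0; exact.
have FB n tau : `|F n tau| <= 2 * B.
  apply: (le_trans (ler_norm_sum _ _ _)); apply: (@le_trans _ _ (\sum_(k < n.+1) window (p n k) (p n k.+1) tau * (2 * B))).
    by apply: ler_sum => k _; exact: wB.
  rewrite -mulr_suml wsum -[leRHS]mul1r; apply: ler_wpM2r; first by rewrite mulr_ge0.
  by have /andP[] := window_ge0 tau t0.
have mF n : time_meas (F n) by apply: measurable_sum => k; exact: wF.
have FE n : h t - h 0 = time_int T (F n).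
  have := telescope_sum h (p n) n.+1; rewrite pn p0 => <-.
  rewrite time_int_sum; last first.
    move=> k; apply: (@time_bounded_intg _ _ _ (2 * B)) => // tau.
    apply: (le_trans (wB n k tau)); rewrite -[leRHS]mul1r; apply: ler_wpM2r; first by rewrite mulr_ge0.
    by have /andP[] := wn n k tau.
  by apply: eq_bigr => k _; apply: step; [exact: pge0|exact: pS|apply: ple; exact: (ltn_ord k)].
(* At most one window of the partition contains tau, and both ends of it lie within t / (n+1) of
   tau, so each of the two frozen fluxes tends to the flux at tau; hence the factor 2. *)
have Flim tau : F n tau @[n --> \oo] --> window 0 t tau * (2 * flux K (W tau) (W tau)).
  apply/cvgrPdist_le => d d0.
  have d2 : 0 < d / 2 by rewrite divr_gt0.
  have [r r0 Hr] := flux_continuous tau d2.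
  near=> n.
  have tn : t / n.+1%:R <= r.
    rewrite ler_pdivrMr// mulrC -ler_pdivrMr//; apply: (@le_trans _ _ n%:R); last by rewrite ler_nat.
    by near: n; exact: nbhs_infty_ger.
  rewrite distrC -(wsum n) mulr_suml -sumrB.
  apply: (le_trans (ler_norm_sum _ _ _)); apply: (@le_trans _ _ (\sum_(k < n.+1) window (p n k) (p n k.+1) tau * d)); last first.
    rewrite -mulr_suml wsum -[leRHS]mul1r; apply: ler_wpM2r; first exact: ltW.
    by have /andP[] := window_ge0 tau t0.
  apply: ler_sum => k _; rewrite -mulrBr normrM.
  have /andP[a b] := wn n k tau; rewrite (ger0_norm a).
  have [->|w0] := eqVneq (window (p n k) (p n k.+1) tau) 0; first by rewrite !mul0r.
  apply: ler_wpM2l => //.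
  move: w0; rewrite windowE//; have [/andP[h1 h2] _|] := boolP (_ && _); last by rewrite eqxx.
  have pE : p n k.+1 = p n k + t / n.+1%:R by rewrite /p -addn1 natrD mulrDl mul1r.
  have c1 := Hr (p n k) _; have c2 := Hr (p n k.+1) _.
  have {}c1 : `|flux K (W tau) (W (p n k)) - flux K (W tau) (W tau)| <= d / 2.
    apply: c1; move: (p n k) (p n k.+1) (t / n.+1%:R) h1 h2 pE tn => a' b' c' h1 h2 pE tn.
    by rewrite ler_norml; apply/andP; split; lra.
  have {}c2 : `|flux K (W tau) (W (p n k.+1)) - flux K (W tau) (W tau)| <= d / 2.
    apply: c2; move: (p n k) (p n k.+1) (t / n.+1%:R) h1 h2 pE tn => a' b' c' h1 h2 pE tn.
    by rewrite ler_norml; apply/andP; split; lra.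
  move: (flux K (W tau) (W tau)) (flux K (W tau) (W (p n k))) (flux K (W tau) (W (p n k.+1))) c1 c2 => f1 f2 f3 c1 c2.
  have -> : f3 + f2 - 2 * f1 = (f3 - f1) + (f2 - f1) by ring.
  by apply: (le_trans (ler_normD _ _)); lra.
have [mG L] := time_dct T mF FB Flim.
have mG' : time_meas (fun tau => window 0 t tau * flux K (W tau) (W tau)).
  have := time_measM (time_meas_cst 2^-1) mG; congr time_meas; apply/funext => tau.
  move: (flux _ _ _) => f; by field.
split=> //.
have iG : time_intg T (fun tau => window 0 t tau * flux K (W tau) (W tau)).
  apply: (@time_bounded_intg _ _ _ B) => // tau; have /andP[a b] := window_ge0 tau t0.
  by rewrite normrM (ger0_norm a) -[leRHS]mul1r; apply: ler_pM.
rewrite -(time_intZ 2 iG).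
have E : (fun n => time_int T (F n)) = (fun=> h t - h 0) by apply/funext => n; rewrite -FE.
rewrite E in L.
transitivity (time_int T (fun tau => window 0 t tau * (2 * flux K (W tau) (W tau)))).
  by rewrite -(cvg_lim (@norm_hausdorff _ _) L) lim_cst//; exact: norm_hausdorff.
by apply: eq_time_int => tau; move: (flux _ _ _) => f; ring.
Unshelve. all: by end_near. Qed.

End EnergyBalance.

(** * The Duchon-Robert identity *)

Section DuchonRobert.
Context {R : realType}.
Implicit Types (x y z : E3 R) (i j : 'I_3) (f g : E3 R -> R).

Let quarter_le (p q : R) : `|4 * p| <= q -> `|p| <= 4^-1 * q.
Proof. by rewrite normrM ger0_norm// => h; lra. Qed.

Definition incr (w : 'I_3 -> E3 R -> R) y x i : R := w i (x - y) - w i x.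

Definition cube (w : 'I_3 -> E3 R -> R) y x : R := Num.sqrt (\sum_(i < 3) incr w y x i ^+ 2) ^+ 3.

Lemma cubeE w y x : cube w y x = enorm (vec w (x - y) - vec w x) ^+ 3.
Proof.
congr (Num.sqrt _ ^+ 3); apply: eq_bigr => i _.
by rewrite componentB !component_vec expr2.
Qed.

Lemma cube_ge0 w y x : 0 <= cube w y x.
Proof. by rewrite exprn_ge0// sqrtr_ge0. Qed.

Section Fubini.
Variables (C e : R) (K : seq 'I_3 -> E3 R -> R).
Hypothesis mK : mollifier C e K.
Hypothesis e1 : e <= 1.

(** Fubini turns the kernel integrated against a correlation in y into a pairing with the
    convolution. Boundedness of g makes the double integral absolutely convergent, which is where
    the field has to be bounded. *)
Lemma kernel_corr s f g (M : R) : intg f -> pl2 g -> (forall x, `|g x| <= M) ->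
  intg (fun y => K s y * tint (fun x => f x * g (x - y))) /\
  tint (fun y => K s y * tint (fun x => f x * g (x - y))) = tint (fun x => f x * conv K s g x).
Proof.
move=> fi gpl gM; have iK := mol_intg mK s; have mg := gpl.2.1.
pose F x y := f x * (K s y * g (x - y)).
have bKg x : intg (fun y => K s y * g (x - y)).
  by apply: (intgM_bounded (meas_sub x mg) _ iK) => y; exact: gM.
have Fx x : intg (F x) by exact: intgZ.
have fg y : intg (fun x => f x * g (x - y)).
  by apply: (intgM_bounded (meas_shift (- y) mg) _ fi) => x; exact: gM.
have Fy y : intg (F ^~ y).
  by apply: (eq_intg _ (intgZ (K s y) (fg y))) => x; rewrite /F; ring.
have F2 : tintg2 F.
  apply: (@tintg2_le _ _ (fun x => (M * tint (fun y => `|K s y|)) * `|f x|)) => //.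
  - apply: tmeas2M; first by apply: tmeas2_l; exact: intg_meas.
    by apply: tmeas2M; [apply: tmeas2_r; exact: intg_meas iK|exact: tmeas2_sub].
  - by apply: intgZ; exact: intg_norm.
  - move=> x; rewrite mulrAC -tintZ; last exact: intg_norm.
    apply: le_tint; [exact: intg_norm|by apply: intgZ; exact: intg_norm|].
    move=> y; rewrite /F !normrM (_ : _ * `|f x| * _ = `|f x| * (`|K s y| * M)); last by ring.
    by do 2 apply: ler_wpM2l => //.
have E y : tint (F ^~ y) = K s y * tint (fun x => f x * g (x - y)).
  by rewrite -tintZ//; apply: eq_tint => x; rewrite /F; ring.
split; first by apply: (eq_intg _ (tintg2_r F2 Fy)) => y; rewrite E.
rewrite -(eq_tint (f := fun y => tint (F ^~ y))); last exact: E.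
rewrite -tint_Fubini//; apply: eq_tint => x.
by rewrite (conv_yform mK)// -tintZ.
Qed.

(** By oddness of the gradient and invariance under y -> -y, the difference P(y) - P(-y) counts
    twice when paired with the kernel. *)
Lemma kernel_odd i (P : E3 R -> R) : periodic P -> intg (fun y => K [:: i] y * P y) ->
  intg (fun y => K [:: i] y * P (- y)) /\
  tint (fun y => K [:: i] y * P (- y)) = - tint (fun y => K [:: i] y * P y).
Proof.
move=> pP iP.
have p2 : periodic (fun y => K [:: i] y * P y).
  by move=> x k l; rewrite (mol_periodic mK) pP.
have E y : K [:: i] y * P (- y) = - (K [:: i] (- y) * P (- y)).
  by rewrite (mol_grad_odd mK) mulNr opprK.
split.
  by apply: (eq_intg _ (intgN (intg_opp p2 iP))) => y; rewrite E.
by rewrite (eq_tint E) tintN ?(tint_opp p2 iP)//; exact: (intg_opp p2 iP).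
Qed.

End Fubini.

Section Identity.
Variable w : 'I_3 -> E3 R -> R.
Variable M : R.
Hypothesis wpl : forall i, pl2 (w i).
Hypothesis wM : forall i x, `|w i x| <= M.

Let M0 : 0 <= M. Proof. exact: le_trans (normr_ge0 _) (wM 0 0). Qed.
Let wsq i : sqi (w i). Proof. exact: (wpl i).2. Qed.
Let wm i : meas (w i). Proof. exact: (wsq i).1. Qed.
Let ww i j : intg (fun x => w i x * w j x). Proof. exact: sqi_intgM. Qed.

Let wsh y i : pl2 (fun x => w i (x - y)).
Proof. by split; [exact: (periodic_shift _ (wpl i).1)|exact: (sqi_shift _ (wpl i).1 (wsq i))]. Qed.

Lemma incr_sqi y i : sqi (fun x => incr w y x i).
Proof. by apply: sqiB => //; exact: (wsh y i).2. Qed.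

Lemma incr_le y x i : `|incr w y x i| <= 2 * M.
Proof.
by apply: (le_trans (ler_normB _ _)); have := wM i (x - y); have := wM i x; lra.
Qed.

Lemma incr_meas2 i : tmeas2 (fun y x => incr w y x i).
Proof.
apply: (@tmeas2D _ (fun y x => w i (x - y)) (fun _ x => - w i x)).
  by apply: (tmeas2_swap (F := fun x y => w i (x - y))); exact: tmeas2_sub.
by apply: (tmeas2_r (f := fun x => - w i x)); exact: measN.
Qed.

Lemma cube_meas2 : tmeas2 (cube w).
Proof.
have m2 : tmeas2 (fun y x => \sum_(i < 3) incr w y x i ^+ 2).
  by apply: measurable_sum => i; apply: measurable_funX; exact: incr_meas2.
apply: measurable_funX.
apply: (measurableT_comp (f := @Num.sqrt R)) => //.
by apply: continuous_measurable_fun; exact: sqrt_continuous.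
Qed.

Let sumsq_le y x : Num.sqrt (\sum_(i < 3) incr w y x i ^+ 2) <= 6 * M.
Proof.
have h0 : 0 <= \sum_(i < 3) incr w y x i ^+ 2 by apply: sumr_ge0 => i _; exact: sqr_ge0.
rewrite -(ler_pXn2r (n := 2)) ?nnegrE ?sqrtr_ge0 ?mulr_ge0// sqr_sqrtr//.
apply: (@le_trans _ _ (\sum_(i < 3) (2 * M) ^+ 2)).
  apply: ler_sum => i _; rewrite -real_normK ?num_real//; apply: lerXn2r; rewrite ?nnegrE ?mulr_ge0//.
  exact: incr_le.
by rewrite big_const_ord iter_addr_0; have := sqr_ge0 M; rewrite !exprMn; lra.
Qed.

Lemma cube_le_sq y x : cube w y x <= 6 * M * \sum_(i < 3) incr w y x i ^+ 2.
Proof.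
have h0 : 0 <= \sum_(i < 3) incr w y x i ^+ 2 by apply: sumr_ge0 => i _; exact: sqr_ge0.
rewrite /cube exprS sqr_sqrtr//; apply: ler_wpM2r => //.
Qed.

Let sum_intg y : intg (fun x => \sum_(i < 3) incr w y x i ^+ 2).
Proof. by apply: intg_sum => i; exact: (incr_sqi y i).2. Qed.

Lemma cube_intg y : intg (cube w y).
Proof.
apply: (le_intg _ _ (intgZ (6 * M) (sum_intg y))).
  exact: (meas2_r y cube_meas2).
by move=> x; rewrite ger0_norm ?cube_ge0//; exact: cube_le_sq.
Qed.

Lemma tint_cube_le y : tint (cube w y) <= 6 * M * (4 * sqnorm w).
Proof.
apply: (@le_trans _ _ (tint (fun x => 6 * M * \sum_(i < 3) incr w y x i ^+ 2))).
  by apply: le_tint; [exact: cube_intg|exact: intgZ|exact: cube_le_sq].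
rewrite tintZ//; apply: ler_wpM2l; first by rewrite mulr_ge0.
rewrite tint_sum; last by move=> i; exact: (incr_sqi y i).2.
rewrite /sqnorm mulr_sumr; apply: ler_sum => i _.
rewrite -norm2_sqr; have -> : 4 * norm2 (w i) ^+ 2 = (2 * norm2 (w i)) ^+ 2 by ring.
apply: lerXn2r; rewrite ?nnegrE ?norm2_ge0 ?mulr_ge0 ?norm2_ge0//.
have := norm2D (wsh y i).2 (sqiN (wsq i)).
have -> : norm2 (fun x => - w i x) = norm2 (w i) by congr Num.sqrt; apply: eq_tint => x; rewrite sqrrN.
have -> : norm2 (fun x => w i (x - y)) = norm2 (w i) by exact: (norm2_shift (- y) (wpl i).1 (wsq i)).
by rewrite /incr; lra.
Qed.

Lemma meas_tint_cube : meas (fun y => tint (cube w y)).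
Proof. exact: (meas_tint_l cube_meas2 cube_intg). Qed.

Let sq x : R := \sum_(j < 3) w j x * w j x.
(** Component i of the third-order structure function. It expands into correlations of the quadratic
    quantities |w|^2 and w_i w_j with the shifted field, which are [P] and [Q] below. *)
Let a i y : R := tint (fun x => incr w y x i * \sum_(j < 3) incr w y x j ^+ 2).
Let P i y : R := tint (fun x => sq x * w i (x - y)).
Let Q i j y : R := tint (fun x => w i x * w j x * w j (x - y)).

Let isq : intg sq. Proof. by apply: intg_sum => j. Qed.

Let prod_intg y f i : intg f -> intg (fun x => f x * w i (x - y)).
Proof. by move=> fi; apply: intgM_bounded fi => //; exact: (wsh y i).2.1. Qed.

Let a_le i y : `|a i y| <= tint (cube w y).
Proof.
apply: tint_norm_le; last first.
- move=> x; have h0 : 0 <= \sum_(i < 3) incr w y x i ^+ 2 by apply: sumr_ge0 => k _; exact: sqr_ge0.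
  rewrite normrM (ger0_norm h0) /cube exprS sqr_sqrtr//; apply: ler_wpM2r => //.
  rewrite -sqrtr_sqr; apply: ler_wsqrtr; rewrite (bigD1 i)//= lerDl.
  by apply: sumr_ge0 => k _; exact: sqr_ge0.
- exact: cube_intg.
- apply: (eq_intg (f := fun x => (\sum_(j < 3) incr w y x j ^+ 2) * incr w y x i)); first by move=> x; rewrite mulrC.
  by apply: (intgM_bounded (incr_sqi y i).1 (incr_le y ^~ i)).
Qed.

Let periodic_corr f i : periodic (fun y => tint (fun x => f x * w i (x - y))).
Proof.
move=> y k l; apply: eq_tint => x; congr (_ * _).
by rewrite -[RHS]((wpl i).1 _ (- k) (- l)) opprD addrA; congr (w i (_ + (_, _, _))); rewrite /= ?intrN ?oppr0.
Qed.

Let shift_tint y f : periodic f -> intg f -> tint (fun x => f (x - y)) = tint f.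
Proof. exact: tint_shift. Qed.

Let sq_periodic : periodic sq.
Proof. by move=> x k l; apply: eq_bigr => j _; rewrite (wpl j).1. Qed.

(* Translation invariance in x at a fixed increment y *)
Let a_expand i y : a i y = (P i y - P i (- y)) + 2 * \sum_(j < 3) (Q i j y - Q i j (- y)).
Proof.
have pi := (wpl i).1.
have i1 : intg (fun x => sq x * w i x) by apply: intgM_bounded isq.
have p1 : periodic (fun x => sq x * w i x) by move=> x k l; rewrite sq_periodic pi.
have t1 : tint (fun x => sq (x - y) * w i (x - y)) = tint (fun x => sq x * w i x) := shift_tint y p1 i1.
have i1' : intg (fun x => sq (x - y) * w i (x - y)) := intg_shift (- y) p1 i1.
have i2 : intg (fun x => sq x * w i (x + y)) by have := prod_intg (- y) i isq; rewrite opprK.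
have p2 : periodic (fun x => sq x * w i (x + y)).
  by move=> x k l; rewrite sq_periodic addrAC pi.
have t2 : tint (fun x => sq (x - y) * w i x) = P i (- y).
  rewrite /P opprK -(shift_tint y p2 i2); apply: eq_tint => x.
  by rewrite subrK.
have i2' : intg (fun x => sq (x - y) * w i x).
  by apply: (eq_intg _ (intg_shift (- y) p2 i2)) => x; rewrite subrK.
have i3 j : intg (fun x => w i x * w j x * w j (x + y)) by have := prod_intg (- y) j (ww i j); rewrite opprK.
have p3 j : periodic (fun x => w i x * w j x * w j (x + y)).
  by move=> x k l; rewrite pi (wpl j).1 [x + _ + y]addrAC (wpl j).1.
have t3 j : tint (fun x => w i (x - y) * w j (x - y) * w j x) = Q i j (- y).
  rewrite /Q opprK -(shift_tint y (p3 j) (i3 j)); apply: eq_tint => x.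
  by rewrite subrK.
have i3' j : intg (fun x => w i (x - y) * w j (x - y) * w j x).
  by apply: (eq_intg _ (intg_shift (- y) (p3 j) (i3 j))) => x; rewrite subrK.
have i4 := prod_intg y i isq; have i5 j := prod_intg y j (ww i j).
rewrite /a (eq_tint (g := fun x => (sq (x - y) * w i (x - y) - sq x * w i x)
    + ((sq x * w i (x - y) - sq (x - y) * w i x)
    + 2 * \sum_(j < 3) (w i x * w j x * w j (x - y) - w i (x - y) * w j (x - y) * w j x)))); last first.
  move=> x; rewrite /incr /sq !big_ord_recl !big_ord0; ring.
have i6 : intg (fun x => \sum_(j < 3) (w i x * w j x * w j (x - y) - w i (x - y) * w j (x - y) * w j x)).
  by apply: intg_sum => j; exact: intgB.
rewrite tintD; [|exact: intgB|by apply: intgD; [exact: intgB|exact: intgZ]].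
rewrite tintB// t1 subrr add0r tintD; [|exact: intgB|exact: intgZ].
rewrite tintB// t2 tintZ// tint_sum; last by move=> j; exact: intgB.
congr (_ + 2 * _); apply: eq_bigr => j _.
by rewrite tintB// t3.
Qed.

(* Duchon-Robert identity: integrated against the odd kernels [K [:: i]], the
   expansion of [|incr|^2 incr_i] leaves four times the flux, since [w] is
   divergence free. *)
Lemma flux_cube C e K : mollifier C e K -> e <= 1 ->
  (forall x, \sum_(i < 3) conv K [:: i] (w i) x = 0) ->
  `|flux K w w| <= 4^-1 * \sum_(i < 3) tint (fun y => `|K [:: i] y| * tint (cube w y)).
Proof.
move=> mK e1 dw.
have ic i : intg (fun y => `|K [:: i] y| * tint (cube w y)).
  apply: (intgM_bounded (C := 6 * M * (4 * sqnorm w)) meas_tint_cube); last first.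
    by apply: intg_norm; exact: (mol_intg mK).
  by move=> y; rewrite ger0_norm ?tint_cube_le// tint_ge0// => x; exact: cube_ge0.
have KP i := kernel_corr mK [:: i] isq (wpl i) (wM i).
have KQ i j := kernel_corr mK [:: i] (ww i j) (wpl j) (wM j).
have KP' i := kernel_odd mK (@periodic_corr sq i) (KP i).1.
have KQ' i j := kernel_odd mK (@periodic_corr (fun x => w i x * w j x) j) (KQ i j).1.
(* Oddness doubles every difference, which gives the coefficient 2 for [P] and 2 times 2 for [Q].
   Summed over i the [P] terms pair |w|^2 with the mollified divergence and disappear. *)
have Ka i : tint (fun y => K [:: i] y * a i y) =
    2 * tint (fun x => sq x * conv K [:: i] (w i) x)
    + 4 * \sum_(j < 3) tint (fun x => w i x * w j x * conv K [:: i] (w j) x).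
  rewrite (eq_tint (g := fun y => (K [:: i] y * P i y - K [:: i] y * P i (- y))
     + 2 * \sum_(j < 3) (K [:: i] y * Q i j y - K [:: i] y * Q i j (- y)))); last first.
    by move=> y; rewrite a_expand !big_ord_recl !big_ord0; ring.
  have iS : intg (fun y => \sum_(j < 3) (K [:: i] y * Q i j y - K [:: i] y * Q i j (- y))).
    by apply: intg_sum => j; apply: intgB; [exact: (KQ i j).1|exact: (KQ' i j).1].
  rewrite tintD; [|by apply: intgB; [exact: (KP i).1|exact: (KP' i).1]|exact: intgZ].
  rewrite tintB; [|exact: (KP i).1|exact: (KP' i).1].
  rewrite tintZ// tint_sum; last first.
    by move=> j; apply: intgB; [exact: (KQ i j).1|exact: (KQ' i j).1].
  rewrite (KP' i).2 (KP i).2 opprK.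
  rewrite (eq_bigr (fun j => 2 * tint (fun x => w i x * w j x * conv K [:: i] (w j) x))); last first.
    move=> j _; rewrite tintB; [|exact: (KQ i j).1|exact: (KQ' i j).1].
    by rewrite (KQ' i j).2 (KQ i j).2 opprK; move: (tint _) => q; ring.
  rewrite -mulr_sumr; move: (tint _) (\sum_(_ < _) _) => p q; ring.
have S0 : \sum_(i < 3) tint (fun x => sq x * conv K [:: i] (w i) x) = 0.
  rewrite -tint_sum; last first.
    by move=> i; exact: (conv_intg_prod mK).
  rewrite (eq_tint (g := fun=> 0)) ?tint0// => x.
  by rewrite -mulr_sumr dw mulr0.
have Sa : \sum_(i < 3) tint (fun y => K [:: i] y * a i y) = 4 * flux K w w.
  transitivity (\sum_(i < 3) (2 * tint (fun x => sq x * conv K [:: i] (w i) x)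
    + 4 * \sum_(j < 3) tint (fun x => w i x * w j x * conv K [:: i] (w j) x))).
    by apply: eq_bigr => i _; exact: Ka.
  by rewrite big_split/= -mulr_sumr S0 mulr0 add0r -mulr_sumr.
have ia i : intg (fun y => K [:: i] y * a i y).
  apply: (le_intg _ _ (ic i)); last first.
    by move=> y; rewrite normrM; apply: ler_wpM2l => //; exact: a_le.
  apply: measM; first exact: (mol_meas mK).
  apply: (meas_tint_l (F := fun y x => incr w y x i * \sum_(j < 3) incr w y x j ^+ 2)).
    apply: tmeas2M; first exact: incr_meas2.
    by apply: measurable_sum => j; apply: measurable_funX; exact: incr_meas2.
  move=> y; apply: (eq_intg (f := fun x => (\sum_(j < 3) incr w y x j ^+ 2) * incr w y x i)); first by move=> x; rewrite mulrC.
  by apply: (intgM_bounded (incr_sqi y i).1 (incr_le y ^~ i)).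
apply: quarter_le; rewrite -Sa; apply: (le_trans (ler_norm_sum _ _ _)); apply: ler_sum => i _.
by apply: tint_norm_le => // y; rewrite normrM; apply: ler_wpM2l => //; exact: a_le.
Qed.

End Identity.
End DuchonRobert.

(** * Cubes of increments under mollification *)

Section Splitting.
Context {R : realType}.
Local Notation mu := (@torus_measure R).
Implicit Types (x y z : E3 R) (i j : 'I_3) (v : 'I_3 -> E3 R -> R).

Definition norm3 (q : 'I_3 -> R) : R := Num.sqrt (\sum_(i < 3) q i ^+ 2).

(* The tangent plane inequality for the convex function |.|^3. *)
Lemma cube_tangent (m p : 'I_3 -> R) :
  norm3 m ^+ 3 + 3 * norm3 m * \sum_(i < 3) m i * (p i - m i) <= norm3 p ^+ 3.
Proof.
set n := norm3.
have sq q : n q ^+ 2 = \sum_(i < 3) q i ^+ 2.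
  by rewrite sqr_sqrtr// sumr_ge0// => i _; exact: sqr_ge0.
have nm0 : 0 <= n m by exact: sqrtr_ge0.
have np0 : 0 <= n p by exact: sqrtr_ge0.
have cs : \sum_(i < 3) m i * p i <= n m * n p.
  apply: (le_trans (ler_norm _)).
  rewrite -(ler_pXn2r (n := 2)) ?nnegrE ?mulr_ge0// real_normK ?num_real// exprMn !sq.
  rewrite !big_ord_recl !big_ord0 !addr0.
  set a := m _; set b := m _; set c := m _; set a' := p _; set b' := p _; set c' := p _.
  have h1 := sqr_ge0 (a * b' - b * a'); have h2 := sqr_ge0 (a * c' - c * a'); have h3 := sqr_ge0 (b * c' - c * b').
  rewrite -subr_ge0.
  rewrite (_ : _ - _ = (a * b' - b * a') ^+ 2 + (a * c' - c * a') ^+ 2 + (b * c' - c * b') ^+ 2); last by ring.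
  by rewrite !addr_ge0.
have -> : \sum_(i < 3) m i * (p i - m i) = \sum_(i < 3) m i * p i - n m ^+ 2.
  by rewrite sq -sumrB; apply: eq_bigr => i _; rewrite mulrBr expr2.
move: (\sum_(i < 3) m i * p i) cs => s cs.
have h : 3 * n m * s <= 3 * n m * (n m * n p) by apply: ler_wpM2l => //; rewrite mulr_ge0.
(* Cauchy-Schwarz has reduced the claim to the norms, where it is the tangent inequality for the
   cube on the half line: q^3 - 3 m^2 q + 2 m^3 = (q - m)^2 (q + 2 m). *)
have k : 0 <= (n p - n m) ^+ 2 * (n p + 2 * n m) by rewrite mulr_ge0 ?sqr_ge0// addr_ge0// mulr_ge0.
have k2 : (n p - n m) ^+ 2 * (n p + 2 * n m) = n p ^+ 3 + 2 * n m ^+ 3 - 3 * n m * (n m * n p) by ring.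
move: h k; rewrite k2 mulrBr; have -> : 3 * n m * n m ^+ 2 = 3 * n m ^+ 3 by ring.
move: (n m ^+ 3) (n p ^+ 3) (3 * n m * s) (3 * n m * _) => q r t u; lra.
Qed.

Section Mollified.
Variables (C e : R) (K : seq 'I_3 -> E3 R -> R).
Hypothesis mK : mollifier C e K.
Hypothesis e1 : e <= 1.
Variable v : 'I_3 -> E3 R -> R.
Hypothesis sv : sym v.
Let w := mollify K v.

Let vpl i : pl2 (v i). Proof. exact: (sv i).1. Qed.
Let vsq i : sqi (v i). Proof. exact: (vpl i).2. Qed.

Lemma mollify_bound : exists2 M : R, 0 <= M & forall i x, `|w i x| <= M.
Proof.
exists (norm2 (K [::]) * \sum_(i < 3) norm2 (v i)).
  by rewrite mulr_ge0 ?norm2_ge0// sumr_ge0// => i _; exact: norm2_ge0.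
move=> i x; apply: (le_trans (conv_le mK _ _ (vsq i))).
apply: ler_wpM2l; first exact: norm2_ge0.
by rewrite (bigD1 i)//= lerDl; apply: sumr_ge0 => k _; exact: norm2_ge0.
Qed.

Lemma incr_mollify y x i : intg (fun z => K [::] z * incr v y (x - z) i) /\
  incr w y x i = tint (fun z => K [::] z * incr v y (x - z) i).
Proof.
have iz p : intg (fun z => K [::] z * v i (p - z)).
  apply: sqi_intgM; first exact: (mol_sqi mK).
  split; first exact: (meas_sub p (vsq i).1).
  apply: (@intg_sub _ (fun z => v i z ^+ 2) p); last exact: (vsq i).2.
  by move=> z k l; rewrite (vpl i).1.
have E z : K [::] z * v i (x - y - z) - K [::] z * v i (x - z) = K [::] z * incr v y (x - z) i.
  by rewrite /incr -mulrBr [x - z - y]addrAC.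
split; first by apply: (eq_intg E); exact: intgB.
rewrite {1}/incr /w /mollify !(conv_yform mK)// -tintB//.
exact: eq_tint.
Qed.

Let cube_meas y : meas (cube v y).
Proof.
apply: measX; apply: (measurableT_comp (f := @Num.sqrt R)).
  by apply: continuous_measurable_fun; exact: sqrt_continuous.
apply: meas_sum => i; apply: measX; apply: measB; last exact: (vsq i).1.
exact: (meas_shift (- y) (vsq i).1).
Qed.

Let cube_periodic y : periodic (cube v y).
Proof.
move=> x k l; congr (Num.sqrt _ ^+ 3); apply: eq_bigr => i _.
by rewrite /incr [x + _ - y]addrAC !(vpl i).1.
Qed.

Let F y x z : R := K [::] z * cube v y (x - z).

(** The right side may be infinite, and then there is nothing to show. Otherwise the tangent
    inequality at the mean is integrated against the probability kernel, and its linear term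
    cancels. *)
Lemma cube_jensen y x : ((cube w y x)%:E <= \int[mu]_z (F y x z)%:E)%E.
Proof.
have F0 z : 0 <= F y x z by rewrite mulr_ge0 ?(mol_ge0 mK) ?cube_ge0.
have mF : meas (F y x) by apply: measM; [exact: (mol_meas mK)|exact: meas_sub].
have [Foo|] := boolP (\int[mu]_z (F y x z)%:E < +oo)%E; last first.
  by rewrite -leNgt leye_eq => /eqP ->; exact: leey.
have iF : intg (F y x) by exact: integ_ge0_lty.
rewrite -(Rint_fineK iF) lee_fin.
pose m i := incr w y x i; pose n := norm3 m.
have ii i := (incr_mollify y x i).1; have iK := mol_intg mK [::].
pose G z := n ^+ 3 * K [::] z + 3 * n * \sum_(i < 3) (m i * (K [::] z * incr v y (x - z) i) - m i ^+ 2 * K [::] z).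
have it i : intg (fun z => m i * (K [::] z * incr v y (x - z) i) - m i ^+ 2 * K [::] z).
  by apply: intgB; apply: intgZ.
have iS : intg (fun z => \sum_(i < 3) (m i * (K [::] z * incr v y (x - z) i) - m i ^+ 2 * K [::] z)).
  exact: intg_sum.
have iG : intg G by apply: intgD; exact: intgZ.
have -> : cube w y x = tint G.
  rewrite /G tintD; [|exact: intgZ|exact: intgZ].
  rewrite (tintZ _ iK) (tintZ _ iS) tint_sum// (mol_tint mK) mulr1 big1 ?mulr0 ?addr0//.
  move=> i _; rewrite tintB; [|exact: intgZ|exact: intgZ].
  by rewrite (tintZ _ (ii i)) (tintZ _ iK) -(incr_mollify y x i).2 (mol_tint mK) mulr1 expr2 subrr.
apply: le_tint => // z; rewrite /G /F.
have h : n ^+ 3 + 3 * n * _ <= cube v y (x - z) := cube_tangent m (fun i => incr v y (x - z) i).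
have -> : n ^+ 3 * K [::] z + 3 * n * (\sum_(i < 3) (m i * (K [::] z * incr v y (x - z) i) - m i ^+ 2 * K [::] z)) =
   K [::] z * (n ^+ 3 + 3 * n * \sum_(i < 3) m i * (incr v y (x - z) i - m i)).
  by rewrite !big_ord_recl !big_ord0; ring.
by apply: ler_wpM2l; first exact: (mol_ge0 mK).
Qed.

(** After Tonelli the integrand is shifted by a point z of the support, with |z_3| <= e. The margin
    e in the cutoff absorbs this shift, and the kernel has mass 1. *)
Lemma cube_upper y (a : R) :
  (\int[mu]_x (((a + e < x.2)%R)%:R * cube w y x)%:E
    <= \int[mu]_x (((a < x.2)%R)%:R * cube v y x)%:E)%E.
Proof.
have mi (b : R) : meas (fun x => ((b < x.2)%R)%:R).
  apply: (measurableT_comp (f := fun b : bool => b%:R : R)) => //.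
  by apply: measurable_fun_ltr => //; exact: measurable_snd.
have mcw : meas (cube w y).
  have [M _ HM] := mollify_bound.
  by apply: (meas2_r y (cube_meas2 (w := w) (fun i => ((mollify_sym mK e1 sv i).1)))).
pose H x z : R := ((a + e < x.2)%R)%:R * F y x z.
have H0 x z : 0 <= H x z by rewrite mulr_ge0 ?ler0n// mulr_ge0 ?(mol_ge0 mK) ?cube_ge0.
have mH : measurable_fun setT (fun p : mE3 R * mE3 R => (H p.1 p.2)%:E).
  apply/measurable_EFinP; apply: (@tmeas2M _ (fun x _ => ((a + e < x.2)%R)%:R)); first exact: tmeas2_l.
  by apply: tmeas2M; [apply: tmeas2_r; exact: (mol_meas mK)|exact: tmeas2_sub].
pose U := (\int[mu]_x (((a < x.2)%R)%:R * cube v y x)%:E)%E.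
have U0 : (0 <= U)%E by apply: integral_ge0 => x _; rewrite lee_fin mulr_ge0 ?cube_ge0.
apply: (@le_trans _ _ (\int[mu]_x \int[mu]_z (H x z)%:E)%E).
  apply: ge0_le_lower_integral => [x _|x _].
    by rewrite lee_fin mulr_ge0 ?cube_ge0.
  rewrite /H; have [_|_] := boolP (a + e < x.2)%R; last first.
    by rewrite mul0r; apply: integral_ge0 => z _; rewrite mul0r.
  have -> : (fun z => (true%:R * F y x z)%:E) = (fun z => (F y x z)%:E).
    by apply/funext => z; rewrite mul1r.
  by rewrite mul1r; exact: cube_jensen.
rewrite (fubini_tonelli _ mH); last by move=> [x z]; rewrite lee_fin.
apply: (@le_trans _ _ (\int[mu]_z ((K [::] z)%:E * U))%E); last first.
  have [Uoo|] := boolP (U < +oo)%E; last by rewrite -leNgt leye_eq -/U => /eqP ->; exact: leey.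
  rewrite ge0_integralZr//; last first.
  - by move=> z _; rewrite lee_fin (mol_ge0 mK).
  - by apply/measurable_EFinP; exact: (mol_meas mK).
  have := mol_tint mK; rewrite /tint => tK.
  by rewrite -(Rint_fineK (mol_intg mK [::])) tK mul1e.
apply: ge0_le_lower_integral => [z _|z _]; first by apply: integral_ge0 => x _; rewrite lee_fin.
have [K0|K0] := eqVneq (K [::] z) 0.
  rewrite K0 mul0e (eq_integral (fun=> 0%E)) ?integral0// => x _.
  by rewrite /H /F K0 mul0r mulr0.
have z3 : `|z.2| <= e by have [k [l []]] := mol_supp mK K0.
move: z3; rewrite ler_norml => /andP[z3 z3'].
pose I x : R := ((a < x.2)%R)%:R * cube v y x.
have mI : meas I by exact: measM.
have I0 x : 0 <= I x by rewrite mulr_ge0 ?cube_ge0.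
have pI : periodic (fun x => (I x)%:E).
  by move=> x k l; rewrite /I cube_periodic /= addr0.
rewrite -[U](@ge0_integral_shift _ (fun x => (I x)%:E) (- z) pI); last 2 first.
- exact/measurable_EFinP.
- by move=> x; rewrite lee_fin.
rewrite -ge0_integralZl//; last 3 first.
- by apply/measurable_EFinP; exact: (meas_shift (- z) mI).
- by move=> x _; rewrite lee_fin.
- by rewrite lee_fin (mol_ge0 mK).
apply: ge0_le_lower_integral => [x _|x _]; first by rewrite lee_fin.
rewrite -EFinM lee_fin /H /F /I mulrCA; apply: ler_wpM2l; first exact: (mol_ge0 mK).
have [h|h] := boolP (a + e < x.2)%R; last by rewrite mul0r mulr_ge0 ?cube_ge0.
by rewrite (_ : (a < (x - z).2)%R = true)//=; lra.
Qed.

Lemma cube_refl y x : cube w y (refl x) = cube w (refl y) x.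
Proof.
congr (Num.sqrt _ ^+ 3); apply: eq_bigr => i _.
have sw q : w i (refl q) = parity i * w i q := (mollify_sym mK e1 sv i).2 q.
rewrite /incr (_ : refl x - y = refl (x - refl y)); last by rewrite reflD reflN reflK.
by rewrite !sw -mulrBr exprMn expr2 parity_sqr mul1r.
Qed.

Lemma cube_strip_le y x (om r : R) : 0 <= om ->
  (forall i z, `|z.2| <= r -> `|incr v y z i| <= om) -> `|x.2| + e <= r ->
  cube w y x <= 8 * om ^+ 3.
Proof.
move=> om0 osc xr.
have wi i : `|incr w y x i| <= om.
  have [ii ->] := incr_mollify y x i; have iK := mol_intg mK [::].
  rewrite -[leRHS]mulr1 -(mol_tint mK) -tintZ//.
  apply: tint_norm_le => //; first exact: intgZ.
  move=> z; rewrite normrM (ger0_norm (mol_ge0 mK _)) [leRHS]mulrC.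
  have [->|K0] := eqVneq (K [::] z) 0; first by rewrite !mul0r.
  apply: ler_wpM2l; first exact: (mol_ge0 mK).
  have z3 : `|z.2| <= e by have [k [l []]] := mol_supp mK K0.
  apply: osc; apply: le_trans xr; apply: (le_trans (ler_normB _ _)).
  by rewrite lerD2l.
(* Three components of size at most om have Euclidean norm at most sqrt(3) om, which is rounded up
   to 2 om. *)
have -> : 8 * om ^+ 3 = (2 * om) ^+ 3 by ring.
apply: lerXn2r; rewrite ?nnegrE ?sqrtr_ge0 ?mulr_ge0//.
rewrite -(ler_pXn2r (n := 2)) ?nnegrE ?sqrtr_ge0 ?mulr_ge0// sqr_sqrtr; last first.
  by apply: sumr_ge0 => i _; exact: sqr_ge0.
apply: (@le_trans _ _ (\sum_(i < 3) om ^+ 2)).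
  apply: ler_sum => i _; rewrite -real_normK ?num_real//.
  by apply: lerXn2r; rewrite ?nnegrE.
by rewrite big_const_ord iter_addr_0 exprMn; have := sqr_ge0 om; lra.
Qed.

End Mollified.

End Splitting.

(** * Averages of the increments in space and time *)

Section TimeFlux.
Context {R : realType}.
Local Notation mu := (@torus_measure R).
Local Notation leb := (@lebesgue_measure R).
Implicit Types (x y z : E3 R) (i j : 'I_3) (t s r tau : R) (chi : E3 R -> R).

Variable W : R -> 'I_3 -> E3 R -> R.
Hypothesis tW : time_field W.
Variables (C e : R) (K : seq 'I_3 -> E3 R -> R).
Hypothesis mK : mollifier C e K.
Hypothesis e1 : e <= 1.
Variables (C' d : R) (K' : seq 'I_3 -> E3 R -> R).
Hypothesis mK' : mollifier C' d K'.
Hypothesis d1 : d <= 1.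

Definition path_mollify tau := mollify K' (W tau).
Local Notation w := path_mollify.

Let Wpl t i : pl2 (W t i). Proof. exact: (tf_sym tW t i).1. Qed.
Let Wsq t i : sqi (W t i). Proof. exact: (Wpl t i).2. Qed.
Let wpl t i : pl2 (w t i). Proof. exact: (mollify_sym mK' d1 (tf_sym tW t) i).1. Qed.

Let T3 := (measurableTypeR R * mE3 R)%type.

Let joint_tint (F : T3 -> E3 R -> R) : measurable_fun setT (fun z : T3 * mE3 R => F z.1 z.2) ->
  (forall p : T3, intg (F p)) -> measurable_fun setT (fun p : T3 => tint (F p)).
Proof. exact: measurable_Rint_l. Qed.

Let time_tint (F : R -> E3 R -> R) : measurable_fun setT (fun z : T3 => F z.1 z.2) ->
  (forall t, intg (F t)) -> time_meas (fun t => tint (F t)).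
Proof. exact: (@measurable_Rint_l _ _ (measurableTypeR R) (mE3 R) R mu F). Qed.

Let mw i : measurable_fun setT (fun z : T3 => w z.1 i z.2).
Proof. exact: (conv_time_meas tW mK' d1 [::] i). Qed.

Let sub3 : measurable_fun setT (fun z : T3 * mE3 R => (z.1.1, z.2 - z.1.2) : T3).
Proof.
apply: measurable_fun_pair; first exact: (measurableT_comp measurable_fst measurable_fst).
have m2 : measurable_fun setT (fun z : T3 * mE3 R => (z.2, z.1.2) : mE3 R * mE3 R).
  by apply: measurable_fun_pair => //; exact: (measurableT_comp measurable_snd measurable_fst).
apply: (measurableT_comp (f := fun p : mE3 R * mE3 R => p.1 - p.2) _ m2).
have c (h : mE3 R -> R) : measurable_fun setT h -> (forall p q : E3 R, h (p - q) = h p - h q) ->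
    measurable_fun setT (fun p : mE3 R * mE3 R => h (p.1 - p.2)).
  move=> mh hB.
  have -> : (fun p : mE3 R * mE3 R => h (p.1 - p.2)) = (fun p => h p.1 - h p.2) by apply/funext => p; rewrite hB.
  by apply: measurable_funB; apply: measurableT_comp.
have [c1 c2 c3] := @meas_coord R.
have -> : (fun p : mE3 R * mE3 R => p.1 - p.2 : mE3 R) =
    (fun p => ((p.1 - p.2).1.1, (p.1 - p.2).1.2, (p.1 - p.2).2)).
  by apply/funext => -[[[? ?] ?] [[? ?] ?]].
apply: measurable_fun_pair; last exact: (c (fun q => q.2) c3).
by apply: measurable_fun_pair; [exact: (c (fun q => q.1.1) c1)|exact: (c (fun q => q.1.2) c2)].
Qed.

Let sel3 : measurable_fun setT (fun z : T3 * mE3 R => (z.1.1, z.2) : T3).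
Proof.
by apply: measurable_fun_pair => //; exact: (measurableT_comp measurable_fst measurable_fst).
Qed.

Let cube3 : measurable_fun setT (fun z : T3 * mE3 R => cube (w z.1.1) z.1.2 z.2).
Proof.
apply: measurable_funX; apply: (measurableT_comp (f := @Num.sqrt R)).
  by apply: continuous_measurable_fun; exact: sqrt_continuous.
apply: measurable_sum => i; apply: measurable_funX; apply: measurable_funB.
  exact: (measurableT_comp (f := fun z : T3 => w z.1 i z.2) (mw i) sub3).
exact: (measurableT_comp (f := fun z : T3 => w z.1 i z.2) (mw i) sel3).
Qed.

Let bounds : exists M N : R, [/\ 0 <= M, 0 <= N, forall t i x, `|w t i x| <= M &
  forall t, sqnorm (w t) <= N].
Proof.
have [N0 HN0] := tf_bound tW; pose N := Num.max 0 N0.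
have N_ge0 : 0 <= N by rewrite le_max lexx.
have HN t i : norm2 (W t i) <= N by apply: (le_trans (HN0 t i)); rewrite le_max lexx orbT.
exists (norm2 (K' [::]) * N), (\sum_(i < 3) N ^+ 2); split.
- by rewrite mulr_ge0 ?norm2_ge0.
- by apply: sumr_ge0 => i _; exact: sqr_ge0.
- move=> t i x; apply: (le_trans (conv_le mK' _ _ (Wsq t i))).
  by apply: ler_wpM2l; first exact: norm2_ge0.
- move=> t; apply: ler_sum => i _; apply: lerXn2r; rewrite ?nnegrE ?norm2_ge0//.
  exact: le_trans (conv_sqi mK' d1 (Wsq t i)).2 (HN t i).
Qed.

(** The localized third-order structure function of the field mollified at the second scale. It
    stays a function of the increment y because both hypotheses on u are used at fixed y. *)
Definition increments_in chi tau y : R := tint (fun x => chi x * cube (w tau) y x).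
Local Notation D := increments_in.

Section Cutoff.
Variable chi : E3 R -> R.
Hypothesis mchi : meas chi.
Hypothesis chi01 : forall x, 0 <= chi x <= 1.

Let chi0 x : 0 <= chi x. Proof. by have /andP[] := chi01 x. Qed.
Let chi1 x : chi x <= 1. Proof. by have /andP[] := chi01 x. Qed.

Lemma cutoff_cube_intg tau y : intg (fun x => chi x * cube (w tau) y x).
Proof.
have [M [N [_ _ HM _]]] := bounds.
apply: (eq_intg (f := fun x => cube (w tau) y x * chi x)); first by move=> x; rewrite mulrC.
apply: (@intgM_bounded _ _ _ 1) => //; first by move=> x; rewrite ger0_norm.
exact: (cube_intg (wpl tau) (HM tau)).
Qed.

Lemma increments_ge0 tau y : 0 <= D chi tau y.
Proof. by apply: tint_ge0 => x; rewrite mulr_ge0// cube_ge0. Qed.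

Lemma increments_bound : exists2 B : R, 0 <= B & forall tau y, D chi tau y <= B.
Proof.
have [M [N [M0 N0 HM HN]]] := bounds.
exists (6 * M * (4 * N)); first by rewrite !mulr_ge0.
move=> tau y; apply: (@le_trans _ _ (tint (cube (w tau) y))).
  apply: le_tint => [||x]; [exact: cutoff_cube_intg|exact: (cube_intg (wpl tau) (HM tau))|].
  by rewrite -[leRHS]mul1r; apply: ler_wpM2r => //; exact: cube_ge0.
apply: (le_trans (tint_cube_le (wpl tau) (HM tau) y)).
by apply: ler_wpM2l; rewrite ?mulr_ge0// ler_wpM2l.
Qed.

Lemma increments_meas2 : measurable_fun setT (fun z : T3 => D chi z.1 z.2).
Proof.
apply: (joint_tint (F := fun p x => chi x * cube (w p.1) p.2 x)).
  by apply: measurable_funM => //; apply: measurableT_comp.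
by move=> [tau y]; exact: cutoff_cube_intg.
Qed.

Lemma increments_meas_time y : time_meas (fun tau => D chi tau y).
Proof. exact: (meas2_l y increments_meas2). Qed.

Lemma increments_meas tau : meas (D chi tau).
Proof. exact: (meas2_r tau increments_meas2). Qed.

Lemma increments_periodic tau : periodic (D chi tau).
Proof.
move=> y k l; apply: eq_tint => x; congr (_ * (Num.sqrt _ ^+ 3)); apply: eq_bigr => i _.
congr ((_ - _) ^+ 2).
move: (w tau i) (wpl tau i).1 => f pf.
by rewrite -[RHS](pf _ (- k) (- l)) opprD addrA; congr (f (_ + (_, _, _))); rewrite /= ?intrN ?oppr0.
Qed.

Definition averaged_increments i tau : R := tint (fun y => `|K [:: i] y| * D chi tau y).
Local Notation P := averaged_increments.

Let Ki i : intg (fun y => `|K [:: i] y|). Proof. by apply: intg_norm; exact: (mol_intg mK). Qed.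

Let KD_intg i tau : intg (fun y => `|K [:: i] y| * D chi tau y).
Proof.
have [B B0 HB] := increments_bound.
by apply: (intgM_bounded (increments_meas tau) _ (Ki i)) => y; rewrite ger0_norm ?increments_ge0//; exact: HB.
Qed.

Lemma averaged_ge0 i tau : 0 <= P i tau.
Proof. by apply: tint_ge0 => y; rewrite mulr_ge0// increments_ge0. Qed.

Let KD_meas2 i : measurable_fun setT (fun z : T3 => `|K [:: i] z.2| * D chi z.1 z.2).
Proof.
apply: measurable_funM; last exact: increments_meas2.
by apply: (measurableT_comp (f := fun y : mE3 R => `|K [:: i] y|)) => //; exact: intg_meas (Ki i).
Qed.

Lemma averaged_meas i : time_meas (P i).
Proof.
exact: (time_tint (KD_meas2 i) (KD_intg i)).
Qed.

Let supp_le i (g : E3 R -> R) (c : R) : periodic g ->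
  (forall y, `|y.1.1| <= e -> `|y.1.2| <= e -> `|y.2| <= e -> g y <= c) ->
  forall y, `|K [:: i] y| * g y <= c * `|K [:: i] y|.
Proof.
move=> pg gc y; have [->|K0] := eqVneq (K [:: i] y) 0; first by rewrite normr0 mul0r mulr0.
rewrite mulrC; apply: ler_wpM2r => //.
have [y' [h1 h2 h3 h]] := mol_supp_reduce mK K0.
have [E _] := h _ g pg 0.
by rewrite -[y]add0r E add0r; exact: gc.
Qed.

Lemma averaged_le i tau (c : R) : 0 <= c ->
  (forall y, `|y.1.1| <= e -> `|y.1.2| <= e -> `|y.2| <= e -> D chi tau y <= c) ->
  P i tau <= C / e * c.
Proof.
move=> c0 Dc; apply: (@le_trans _ _ (c * tint (fun y => `|K [:: i] y|))).
  rewrite -tintZ//; apply: le_tint; [exact: KD_intg|exact: intgZ|].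
  exact: (supp_le i (@increments_periodic tau) Dc).
by rewrite mulrC; apply: ler_wpM2r => //; exact: (mol_grad mK).
Qed.

Lemma averaged_bound i : exists2 B : R, 0 <= B & forall tau, `|P i tau| <= B.
Proof.
have [B B0 HB] := increments_bound; exists (B * tint (fun y => `|K [:: i] y|)).
  by rewrite mulr_ge0//; apply: tint_ge0.
move=> tau; rewrite ger0_norm ?averaged_ge0// -tintZ//.
apply: le_tint; [exact: KD_intg|exact: intgZ|].
by move=> y; rewrite mulrC; apply: ler_wpM2r.
Qed.

Variable T : R.
Hypothesis T0 : 0 < T.

Let D_intg_time y : time_intg T (fun tau => D chi tau y).
Proof.
have [B B0 HB] := increments_bound.
by apply: (@time_bounded_intg _ T _ B (increments_meas_time y)) => t; rewrite ger0_norm ?increments_ge0.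
Qed.

(** Time integration is moved inside the average over y, because the bulk condition controls only
    time integrals at a fixed increment. The boundary layer uses [averaged_le] instead, where the
    control holds at each time. *)
Lemma averaged_time_le i (c : R) : 0 <= c ->
  (forall y, `|y.1.1| <= e -> `|y.1.2| <= e -> `|y.2| <= e -> time_int T (fun tau => D chi tau y) <= c) ->
  time_int T (P i) <= C / e * c.
Proof.
move=> c0 Dc.
have [B B0 HB] := increments_bound.
have ii tau := KD_intg i tau.
have it y : time_intg T (fun tau => `|K [:: i] y| * D chi tau y) by apply: integZ; exact: D_intg_time.
have i2 : integ2 (time_measure T) mu (fun tau y => `|K [:: i] y| * D chi tau y).
  apply: (@integ2_le _ _ _ _ _ _ _ _ (fun=> B * tint (fun y => `|K [:: i] y|))) => //.
  - exact: KD_meas2.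
  - exact: (@time_bounded_intg _ T _ `|B * tint (fun y => `|K [:: i] y|)| (time_meas_cst _)).
  - move=> tau; rewrite -tintZ//; apply: le_tint; [exact: intg_norm|exact: intgZ|].
    move=> y; rewrite ger0_norm; last by rewrite mulr_ge0// increments_ge0.
    by rewrite mulrC; apply: ler_wpM2r.
have E : time_int T (P i) = tint (fun y => time_int T (fun tau => `|K [:: i] y| * D chi tau y)).
  exact: (RFubini i2 ii it).
have pD : periodic (fun y => time_int T (fun tau => D chi tau y)).
  by move=> y k l; apply: eq_time_int => tau; rewrite increments_periodic.
have E2 y : time_int T (fun tau => `|K [:: i] y| * D chi tau y) = `|K [:: i] y| * time_int T (fun tau => D chi tau y).
  by apply: time_intZ; exact: D_intg_time.
have iy : intg (fun y => time_int T (fun tau => `|K [:: i] y| * D chi tau y)).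
  exact: (integ2_Rint_r i2 it).
rewrite E; apply: (@le_trans _ _ (c * tint (fun y => `|K [:: i] y|))).
  rewrite -tintZ//; apply: le_tint => [||y]; [exact: iy|exact: intgZ|].
  by rewrite E2; exact: (supp_le i pD Dc y).
by rewrite mulrC; apply: ler_wpM2r => //; exact: (mol_grad mK).
Qed.

End Cutoff.

(** Commuting the two convolutions writes the gradient as an average of gradients of the once
    mollified path, which are jointly measurable by continuity in time; averaging preserves this. *)
Lemma flux_mollified_meas : time_meas (fun tau => flux K (w tau) (w tau)).
Proof.
have [M [N [M0 N0 HM HN]]] := bounds.
have mc i j : measurable_fun setT (fun z : T3 => conv K [:: i] (w z.1 j) z.2).
  have -> : (fun z : T3 => conv K [:: i] (w z.1 j) z.2) =
      (fun p : T3 => tint (fun y => K' [::] y * conv K [:: i] (W p.1 j) (p.2 - y))).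
    by apply/funext => z; exact: (conv_comm _ _ mK mK').
  apply: (joint_tint (F := fun p y => K' [::] y * conv K [:: i] (W p.1 j) (p.2 - y))).
    apply: measurable_funM; first by apply: measurableT_comp => //; exact: (mol_meas mK').
    have sub' : measurable_fun setT (fun z : T3 * mE3 R => (z.1.1, z.1.2 - z.2) : T3).
      apply: (measurableT_comp (f := fun z : T3 * mE3 R => (z.1.1, z.2 - z.1.2) : T3)
        (g := fun z : T3 * mE3 R => ((z.1.1, z.2), z.1.2) : T3 * mE3 R) sub3).
      apply: measurable_fun_pair; last exact: (measurableT_comp measurable_snd measurable_fst).
      exact: sel3.
    exact: (measurableT_comp (f := fun z : T3 => conv K [:: i] (W z.1 j) z.2) (conv_time_meas tW mK e1 [:: i] j) sub').
  move=> [tau x]; apply: (intgM_bounded (C := norm2 (K [:: i]) * norm2 (W tau j)) _ _ (mol_intg mK' [::])).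
    by apply: meas_sub; exact: (conv_meas mK).
  by move=> y; exact: (conv_le mK).
apply: measurable_sum => i; apply: measurable_sum => j.
apply: (time_tint (F := fun tau x => w tau i x * w tau j x * conv K [:: i] (w tau j) x)).
  by apply: measurable_funM; [apply: measurable_funM|]; [exact: mw|exact: mw|exact: mc].
by move=> tau; apply: (flux_term_intg mK e1) => k; exact: (wpl tau k).2.
Qed.

End TimeFlux.

(** * The interior *)

Section OuterPart.
Context {R : realType}.
Local Notation mu := (@torus_measure R).
Local Notation leb := (@lebesgue_measure R).
Implicit Types (x y z : E3 R) (i j : 'I_3) (t s r tau : R).

Definition upper (a : R) x : R := (a < x.2)%R%:R.
Definition lower (a : R) x : R := (x.2 < - a)%R%:R.
Definition middle (a : R) x : R := (`|x.2| <= a)%R%:R.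

Let bool01 (b : bool) : 0 <= (b%:R : R) <= 1. Proof. by rewrite ler0n lern1 leq_b1. Qed.

Let mbool (b : E3 R -> bool) : measurable_fun setT (b : mE3 R -> bool) -> meas (fun x => (b x)%:R).
Proof. by move=> mb; apply: (measurableT_comp (f := fun b : bool => b%:R : R)). Qed.

Lemma upper_cutoff a : meas (upper a) /\ forall x, 0 <= upper a x <= 1.
Proof.
split=> [|x]; last exact: bool01.
by apply: mbool; apply: measurable_fun_ltr => //; exact: measurable_snd.
Qed.

Lemma lower_cutoff a : meas (lower a) /\ forall x, 0 <= lower a x <= 1.
Proof.
split=> [|x]; last exact: bool01.
by apply: mbool; apply: measurable_fun_ltr => //; exact: measurable_snd.
Qed.

Lemma middle_cutoff a : meas (middle a) /\ forall x, 0 <= middle a x <= 1.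
Proof.
split=> [|x]; last exact: bool01.
apply: mbool; apply: measurable_fun_ler => //.
by apply: measurableT_comp => //; exact: measurable_snd.
Qed.

Lemma cutoff_partition (a : R) x : 0 <= a -> upper a x + lower a x + middle a x = 1.
Proof.
move=> a0; rewrite /upper /lower /middle ler_norml.
have [h1|h1] := boolP (a < x.2); have [h2|h2] := boolP (x.2 < - a);
  have [h3|h3] := boolP (- a <= x.2 <= a); rewrite ?addr0 ?add0r//; lra.
Qed.

Lemma enormN y : enorm (- y) = enorm y.
Proof.
congr Num.sqrt; apply: eq_bigr => i _.
by rewrite -sub0r componentB (_ : component (0 : E3 R) i = 0) ?sub0r ?mulrNN//; move: i; apply: ord3P.
Qed.

Lemma enorm_le2 y (e : R) : `|y.1.1| <= e -> `|y.1.2| <= e -> `|y.2| <= e -> enorm y <= 2 * e.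
Proof.
move=> h1 h2 h3; have e0 : 0 <= e := le_trans (normr_ge0 _) h1.
rewrite -(ler_pXn2r (n := 2)) ?nnegrE ?enorm_ge0 ?mulr_ge0// enorm_sqr.
have q (c : R) : `|c| <= e -> c * c <= e ^+ 2.
  by move=> h; rewrite -expr2 -real_normK ?num_real//; apply: lerXn2r; rewrite ?nnegrE.
rewrite /dot !big_ord_recl big_ord0 /component /=.
have := q _ h1; have := q _ h2; have := q _ h3; have := sqr_ge0 e.
rewrite exprMn /tnth /=; move: (e ^+ 2) => E; lra.
Qed.

(** When x_3 > |y| both x and x - y lie strictly above the plane, where the extension coincides with
    the field; the bulk condition therefore speaks about increments of the extension. *)
Lemma torus_increment_integral (f : E3 R -> E3 R) y : in_L2 Dplus f ->
  (\int[mu]_x (upper (enorm y) x * cube (ext f) y x)%:E =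
   \int[volume]_(x in cell (above (enorm y))) (enorm (f (x - y) - f x) ^+ 3)%:E)%E.
Proof.
move=> fL; have pl i := ext_pl2 i fL.
have mc : meas (cube (ext f) y).
  apply: measX; apply: (measurableT_comp (f := @Num.sqrt R)).
    by apply: continuous_measurable_fun; exact: sqrt_continuous.
  apply: meas_sum => i; apply: measX; apply: measB; last exact: (pl i).2.1.
  exact: (meas_shift (- y) (pl i).2.1).
have mA : measurable (above (enorm y) : set (mE3 R)).
  have := @measurable_snd _ _ (measurableTypeR R * measurableTypeR R)%type (measurableTypeR R) measurableT `]enorm y, +oo[%classic.
  rewrite setTI; have -> : snd @^-1` `]enorm y, +oo[%classic = (above (enorm y) : set (mE3 R)).
    by apply/seteqP; split=> x; rewrite /above /= in_itv/= andbT.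
  by apply; exact: measurable_itv.
transitivity (\int[mu]_(x in above (enorm y)) (cube (ext f) y x)%:E)%E.
  rewrite [RHS]integral_mkcond; apply: eq_integral => x _.
  rewrite patchE /upper; have [h|h] := boolP (enorm y < x.2).
    by rewrite mul1r mem_set.
  by rewrite mul0r memNset// /above/=; apply/negP.
have mcA : measurable_fun (above (enorm y) : set (mE3 R)) (fun x : mE3 R => (cube (ext f) y x)%:E).
  by apply/measurable_EFinP; apply: measurable_funS mc.
apply: (etrans (esym (volume_torus mA mcA))); apply: eq_integral => x /set_mem[_ _] xa.
have hx : `|y.2| < x.2 := le_lt_trans (component_le y 2) xa.
have x0 : 0 < x.2 := le_lt_trans (normr_ge0 _) hx.
have xy0 : 0 < (x - y).2 by have := ler_norm y.2; rewrite /=; lra.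
by rewrite cubeE; congr (enorm _ ^+ 3)%:E; apply: component_inj => i;
  rewrite !componentB !component_vec !ext_pos.
Qed.

Variables (T : R) (u : R -> E3 R -> E3 R).
Hypothesis T0 : 0 < T.
Hypothesis wu : weak_solution T u.
Local Notation W := (ext_path T u).

Let tW : time_field W := ef_field (path_energy_frame T0 wu).

Section Kernels.
Variables (C e : R) (K : seq 'I_3 -> E3 R -> R).
Hypothesis mK : mollifier C e K.
Hypothesis e0 : 0 < e.
Hypothesis e1 : e <= 1.
Variables (d : R) (K' : seq 'I_3 -> E3 R -> R).
Hypothesis mK' : mollifier C d K'.
Hypothesis d1 : d <= 1.
Hypothesis de : d <= e.
Local Notation w := (path_mollify W K').
Local Notation D chi := (increments_in W K' chi).
Local Notation P chi := (averaged_increments W K K' chi).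

Let wpl t i : pl2 (w t i). Proof. exact: (mollify_sym mK' d1 (tf_sym tW t) i).1. Qed.

(** The cutoff is 3 e = 2 e + e: a vector y with coordinates at most e has length at most 2 e, and
    the second mollification moves x_3 by at most d <= e. Above it the cubes fall into the region of
    the bulk condition. The latter is applied to -y since increments are taken at x - y. *)
Lemma upper_increments_le y (k : R) : `|y.1.1| <= e -> `|y.1.2| <= e -> `|y.2| <= e ->
  0 <= k -> (y != 0 -> (bulk_average T u (- y)%R <= k%:E)%E) ->
  time_int T (fun tau => D (upper (3 * e)) tau y) <= 2 * e * k.
Proof.
move=> y1 y2 y3 k0 Hk.
have a2 := enorm_le2 y1 y2 y3.
have [mc c01] := upper_cutoff (3 * e).
have Dm := increments_meas_time tW mK' d1 mc c01 y.
have D0 tau : 0 <= D (upper (3 * e)) tau y := increments_ge0 W K' c01 tau y.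
have [B B0 HB] := increments_bound tW mK' d1 mc c01.
have iD : time_intg T (fun tau => D (upper (3 * e)) tau y).
  by apply: (@time_bounded_intg _ T _ B Dm) => t; rewrite ger0_norm.
have [yE|yN] := eqVneq y 0.
  rewrite (@eq_time_int _ T _ (fun=> 0)) ?time_int_cst ?mul0r ?mulr_ge0//; last first.
    move=> tau; rewrite /increments_in -[RHS](@tint0 R); apply: eq_tint => x.
    by rewrite /cube big1 ?sqrtr0 ?expr0n ?mulr0// => i _; rewrite /incr yE subr0 subrr expr0n.
  by rewrite ltW.
have a0 : 0 < enorm y.
  rewrite lt0r enorm_ge0 andbT; apply: contra_neq yN => y0.
  apply: component_inj => i; rewrite (_ : component (0 : E3 R) i = 0); last by move: i; apply: ord3P.
  by apply/eqP; rewrite -normr_le0 -y0; exact: component_le.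
have key : ((time_int T (fun tau => D (upper (3 * e)) tau y))%:E <= (enorm y * k)%:E)%E.
  rewrite EFinM -lee_pdivrMl//; apply: le_trans (Hk yN).
  rewrite /bulk_average enormN; apply: lee_wpmul2l; first by rewrite lee_fin invr_ge0 ltW.
  rewrite (Rint_fineK iD).
  have -> : (\int[time_measure T]_t (D (upper (3 * e)) t y)%:E =
     \int[leb]_(t in `[0%R, T]) (D (upper (3 * e)) t y)%:E)%E.
    by apply: (@integral_mrestr R _ (measurableTypeR R)); exact/measurable_EFinP.
  (* The spatial integral of the increments of u is not known to be measurable in time, so the
     comparison is one of lower integrals. *)
  apply: ge0_le_lower_integral => t; first by rewrite lee_fin.
  rewrite /= in_itv/= => tT.
  have uL : in_L2 Dplus (u t) by case: (wu.1.1 t tT).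
  rewrite -(torus_increment_integral y uL).
  rewrite /increments_in /tint (Rint_fineK (cutoff_cube_intg tW mK' d1 mc c01 t y)).
  apply: le_trans (cube_upper mK' d1 (ext_sym uL) y (enorm y)).
  apply: ge0_le_lower_integral => x _.
    by have /andP[h _] := c01 x; rewrite lee_fin mulr_ge0// cube_ge0.
  rewrite lee_fin /path_mollify /ext_path (clamp_id tT); apply: ler_wpM2r; first exact: cube_ge0.
  rewrite /upper; have [h|h] := boolP (3 * e < x.2); last by rewrite ler0n.
  have -> : (enorm y + d < x.2)%R = true by have := de; move: a2 h => /=; lra.
  by [].
move: key; rewrite lee_fin => key; apply: (le_trans key).
by apply: ler_wpM2r.
Qed.

Lemma lower_increments tau y : D (lower (3 * e)) tau y = D (upper (3 * e)) tau (refl y).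
Proof.
have [mc c01] := lower_cutoff (3 * e).
rewrite /increments_in -tint_refl; last exact: (cutoff_cube_intg tW mK' d1 mc c01).
apply: eq_tint => x.
rewrite (cube_refl mK' d1 (tf_sym tW tau)); congr (_ * _).
by rewrite /lower /upper /= ltrN2.
Qed.

(** Commuting the convolutions gives the mollified field the divergence constraint of W, so the
    Duchon-Robert bound applies; the three cutoffs then form a partition of unity. *)
Lemma flux_split tau : `|flux K (w tau) (w tau)| <= 4^-1 * \sum_(i < 3)
   (P (upper (3 * e)) i tau + P (lower (3 * e)) i tau + P (middle (3 * e)) i tau).
Proof.
have [M _ HM] := mollify_bound mK' (tf_sym tW tau).
have dw x : \sum_(i < 3) conv K [:: i] (w tau i) x = 0.
  have E i : conv K [:: i] (w tau i) x = tint (fun y => K' [::] y * conv K [:: i] (W tau i) (x - y)).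
    by apply: (conv_comm _ _ mK mK') => //; exact: (tf_sym tW tau i).1.
  rewrite (eq_bigr _ (fun i _ => E i)) -tint_sum; last first.
    move=> i; apply: (intgM_bounded (C := norm2 (K [:: i]) * norm2 (W tau i)) _ _ (mol_intg mK' [::])).
      by apply: meas_sub; apply: (conv_meas mK) => //; exact: (tf_sym tW tau i).1.2.
    by move=> y; apply: (conv_le mK); exact: (tf_sym tW tau i).1.2.
  rewrite (eq_tint (g := fun=> 0)) ?tint0// => y.
  by rewrite -mulr_sumr (ef_div (path_energy_frame T0 wu) mK) ?mulr0.
apply: (le_trans (flux_cube (wpl tau) HM mK e1 dw)).
apply: ler_wpM2l; first by rewrite invr_ge0.
apply: ler_sum => i _.
have [mu1 u01] := upper_cutoff (3 * e); have [ml l01] := lower_cutoff (3 * e); have [mm m01] := middle_cutoff (3 * e).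
have ii chi (mc : meas chi) (c01 : forall x, 0 <= chi x <= 1) : intg (fun y => `|K [:: i] y| * D chi tau y).
  have [B B0 HB] := increments_bound tW mK' d1 mc c01.
  apply: (intgM_bounded (C := B) (increments_meas tW mK' d1 mc c01 tau)); last first.
    by apply: intg_norm; exact: (mol_intg mK).
  by move=> y; rewrite ger0_norm ?(increments_ge0 W K' c01 tau y).
rewrite /averaged_increments -tintD; [|exact: ii|exact: ii].
rewrite -tintD; [|by apply: intgD; exact: ii|exact: ii].
rewrite le_eqVlt; apply/orP; left; apply/eqP; apply: eq_tint => y.
rewrite -!mulrDr; congr (_ * _); rewrite /increments_in.
have ci chi (mc : meas chi) (c01 : forall x, 0 <= chi x <= 1) := cutoff_cube_intg tW mK' d1 mc c01 tau y.
rewrite -tintD; [|exact: ci|exact: ci].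
rewrite -tintD; [|by apply: intgD; exact: ci|exact: ci].
apply: eq_tint => x; rewrite -!mulrDl cutoff_partition ?mul1r//.
by rewrite mulr_ge0// ltW.
Qed.

Lemma outer_averaged_le (k : R) : 0 <= k ->
  (forall y, `|y| <= e -> y != 0 -> (bulk_average T u y <= k%:E)%E) ->
  forall i, time_int T (P (upper (3 * e)) i) <= 2 * C * k /\ time_int T (P (lower (3 * e)) i) <= 2 * C * k.
Proof.
move=> k0 Hk i.
have U y : `|y.1.1| <= e -> `|y.1.2| <= e -> `|y.2| <= e -> time_int T (fun tau => D (upper (3 * e)) tau y) <= 2 * e * k.
  move=> y1 y2 y3; apply: upper_increments_le => // y0; apply: Hk; last by rewrite oppr_eq0.
  by rewrite normrN; apply: norm_vec_le; apply: ord3P.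
have E : 2 * C * k = C / e * (2 * e * k) by field; rewrite gt_eqF.
have ek : 0 <= 2 * e * k by rewrite !mulr_ge0// ltW.
have [mu1 u01] := upper_cutoff (3 * e); have [ml l01] := lower_cutoff (3 * e).
rewrite E; split.
  exact: (averaged_time_le tW mK mK' d1 mu1 u01 i ek U).
apply: (averaged_time_le tW mK mK' d1 ml l01 i ek) => y y1 y2 y3.
rewrite (@eq_time_int _ T _ (fun tau => D (upper (3 * e)) tau (refl y))); last by move=> tau; exact: lower_increments.
by apply: U; rewrite //= normrN.
Qed.

End Kernels.

Lemma bulk_small (k : R) : bulk_condition T u -> 0 < k ->
  exists2 r : R, 0 < r & forall y, `|y| <= r -> y != 0 -> (bulk_average T u y <= k%:E)%E.
Proof.
move=> bu k0.
have k0' : (0 : R) < (fun=> k) (0 : R) by [].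
have := bu _ (nbhs_open_ereal_lt k0').
rewrite /nbhs/= /dnbhs /within/= => /nbhs_normP[r /= r0 Hr].
exists (r / 2); first by rewrite divr_gt0.
move=> y yr y0; apply/ltW/Hr => //=.
by rewrite sub0r normrN; apply: le_lt_trans yr _; rewrite ltr_pdivrMr// ltr_pMr// ltr1n.
Qed.

End OuterPart.

(** * The boundary layer *)

Section BoundaryTrace.
Context {R : realType}.
Local Notation mu := (@torus_measure R).
Implicit Types (x y z : E3 R) (i j : 'I_3) (f g : E3 R -> R).

Let ae_sub (P Q : mE3 R -> Prop) : (forall x, P x -> Q x) -> {ae mu, forall x, P x} -> {ae mu, forall x, Q x}.
Proof. by move=> PQ; apply: negligibleS => x; apply: contra_not; exact: PQ. Qed.

Lemma eq_tint_ae f g : meas f -> meas g -> {ae mu, forall x, f x = g x} -> tint f = tint g.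
Proof.
move=> mf mg fg; rewrite /tint /Rintegral; congr fine.
apply: ae_eq_integral => //; [exact/measurable_EFinP|exact/measurable_EFinP|].
by apply: ae_sub fg => x fgx _; rewrite /= fgx.
Qed.

Lemma eq_intg_ae f g : meas g -> {ae mu, forall x, f x = g x} -> intg f -> intg g.
Proof.
move=> mg fg /integrableP[mf foo]; apply/integrableP; split; first exact/measurable_EFinP.
rewrite (_ : (\int[_]_(x in _) _ = \int[mu]_x `|(EFin \o f) x|)%E)//.
apply: ae_eq_integral => //.
- by apply: measurableT_comp => //; exact/measurable_EFinP.
- exact: measurableT_comp.
- by apply: ae_sub fg => x fgx _; rewrite /= fgx.
Qed.

(** Periodicity reduces the base point to a compact cell. Near-covering is used rather than uniform
    continuity on the cell because x + y may leave it. *)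
Lemma periodic_uniformly_continuous f (L eta : R) : continuous f -> periodic f -> 0 < eta ->
  exists2 r : R, 0 < r & forall x y, `|x.2| <= L -> `|y| <= r -> `|f (x + y) - f x| <= eta.
Proof.
move=> cf pf eta0.
pose B : set (E3 R) := `[0, 1]%classic `*` `[0, 1]%classic `*` `[- L, L]%classic.
have cB : compact B.
  by apply: compact_setX; [apply: compact_setX|]; exact: segment_compact.
have ncB : near_covering B by exact/compact_near_coveringP.
have [|r /= r0 Hr] := (@nbhs_normP _ _ _ _).1 (ncB _ (nbhs (0 : E3 R)) (fun y x => `|f (x + y) - f x| <= eta) _ _).
  move=> x _.
  have c2 : {for (x, 0 : E3 R), continuous (fun q : E3 R * E3 R => f (q.1 + q.2) - f q.1)}.
    apply: continuousB.
      apply: continuous_comp; last exact: cf.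
      by apply: continuousD; [exact: cvg_fst|exact: cvg_snd].
    by apply: continuous_comp; [exact: cvg_fst|exact: cf].
  have := c2 _ (@nbhsx_ballx _ _ _ eta eta0).
  rewrite /= addr0 subrr => hq.
  apply: (@filterS _ (nbhs ((x, 0) : E3 R * E3 R)) _ _ _ _ hq) => q /=.
  rewrite /ball /= sub0r normrN; exact: ltW.
exists (r / 2); first by rewrite divr_gt0.
move=> x y xL yr.
have yr' : `|0 - y| < r.
  by rewrite sub0r normrN; apply: le_lt_trans yr _; rewrite ltr_pdivrMr// ltr_pMr// ltr1n.
have [k Hk] := frac_int x.1.1; have [l Hl] := frac_int x.1.2.
have Bx : B (x + (k%:~R, l%:~R, 0)).
  by split; [split|]; rewrite /= in_itv/= -?Hk -?Hl ?frac_ge0 ?(ltW (frac_lt1 _))// addr0 -ler_norml.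
have := Hr y yr' _ Bx.
by rewrite addrAC !pf.
Qed.

(** A step across 0 starts and ends within its own length of 0; this places both points near the
    boundary, where the normal component is small. *)
Lemma sign_change (a b : R) : Num.sg (a + b) != Num.sg a -> `|a| <= `|b| /\ `|a + b| <= `|b|.
Proof.
have [a0|a0|->] := ltgtP a 0; last by rewrite add0r normr0.
- rewrite (ltr0_sg a0) => sb.
  have ab0 : 0 <= a + b by rewrite leNgt; apply: contra sb => ?; rewrite ltr0_sg.
  by rewrite (ltr0_norm a0) (ger0_norm ab0) (@ger0_norm _ b); [split|]; lra.
- rewrite (gtr0_sg a0) => sb.
  have ab0 : a + b <= 0 by rewrite leNgt; apply: contra sb => ?; rewrite gtr0_sg.
  by rewrite (gtr0_norm a0) (ler0_norm ab0) (@ler0_norm _ b); [split|]; lra.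
Qed.

Variables (V p : 'I_3 -> E3 R -> R) (r0 : R).
Hypothesis sV : sym V.
Hypothesis r0_gt0 : 0 < r0.
Hypothesis pc : forall i, continuous (p i).
Hypothesis pp : forall i, periodic (p i).
Hypothesis pe : forall i x, p i (refl x) = p i x.
Hypothesis Vp : {ae mu, forall x, `|(x : E3 R).2| <= r0 -> forall i, V i x = wt i x.2 * p i x}.
Hypothesis divV : forall C e K, mollifier C e K -> 0 < e -> e <= 1 -> forall x,
  \sum_(i < 3) conv K [:: i] (V i) x = 0.

(* A change on a null set, invisible to mollification. *)
Definition boundary_version i x : R :=
  middle r0 x * (wt i x.2 * p i x) + (1 - middle r0 x) * V i x.
Local Notation V' := boundary_version.

Lemma boundary_versionE i x : `|x.2| <= r0 -> V' i x = wt i x.2 * p i x.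
Proof. by move=> xr; rewrite /V' /middle xr subrr mul0r addr0 mul1r. Qed.

Lemma boundary_version_ae : {ae mu, forall x, forall i, V i x = V' i x}.
Proof.
apply: ae_sub Vp => x h i; rewrite /V' /middle.
have [xr|xr] := boolP (`|x.2| <= r0); first by rewrite (h xr) subrr mul0r addr0 mul1r.
by rewrite mul0r subr0 mul1r add0r.
Qed.

Let V'meas i : meas (V' i).
Proof.
have mm := (middle_cutoff r0).1.
apply: measD; apply: measM => //.
- by apply: measM; [exact: meas_wt|exact: continuous_meas].
- by apply: measB => //; exact: meas_cst.
- exact: (sV i).1.2.1.
Qed.

Lemma boundary_version_sym : sym V'.
Proof.
move=> i; split; [split; [|split]|].
- by move=> x k l; rewrite /V' /middle pp (sV i).1.1 /= addr0.
- exact: V'meas.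
- apply: (eq_intg_ae (measX 2 (@V'meas i)) _ (sV i).1.2.2).
  by apply: ae_sub boundary_version_ae => x ->.
- move=> x; rewrite /V' pe (sV i).2 /middle /= normrN wtN; ring.
Qed.

Lemma boundary_version_conv C e K s i x : mollifier C e K -> conv K s (V' i) x = conv K s (V i) x.
Proof.
move=> mK; have mKx : meas (fun z => K s (x - z)) by apply: meas_sub; exact: (mol_meas mK).
apply: eq_tint_ae.
- exact: measM.
- by apply: measM => //; exact: (sV i).1.2.1.
- by apply: ae_sub boundary_version_ae => z ->.
Qed.

Let V'pl i : pl2 (V' i). Proof. exact: (boundary_version_sym i).1. Qed.

(* The divergence of the mollified field at a boundary point sees the jump of
   the odd extension of the normal component with weight of order [1/e]. *)
Lemma normal_trace x : x.2 = 0 -> p 2 x = 0.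
Proof.
move=> x0.
have [C C0 [en [Kn [en0 en1 en_lim HK]]]] := mollifier_sequence R.
suff H (eta : R) : 0 < eta -> `|p 2 x| <= 2 * C ^+ 2 * eta.
  apply/eqP; rewrite -normr_le0; apply/ler_addgt0Pl => d d0; rewrite addr0.
  have c0 : 0 < 2 * C ^+ 2 by rewrite mulr_gt0// exprn_gt0.
  by apply: (le_trans (H (d / (2 * C ^+ 2)) _)); [rewrite divr_gt0|rewrite mulrC divfK// gt_eqF].
move=> eta0.
have [r r_gt0 Hr] : exists2 r : R, 0 < r & forall i y, `|y| <= r -> `|p i (x + y) - p i x| <= eta.
  have h i := periodic_uniformly_continuous `|x.2| (@pc i) (@pp i) eta0.
  have [r1 r10 H1] := h 0; have [r2 r20 H2] := h 1; have [r3 r30 H3] := h 2.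
  exists (Num.min r1 (Num.min r2 r3)); first by rewrite !lt_min r10 r20.
  by move=> i y; rewrite !le_min => /and3P[h1 h2 h3]; move: i; apply: ord3P; [exact: H1|exact: H2|exact: H3].
have [n Hn] : exists n, en n <= Num.min r r0.
  have m0 : 0 < Num.min r r0 by rewrite lt_min r_gt0.
  have [N _ HN] := (cvgr0_norm_le _ en_lim) _ m0.
  by exists N; apply: (le_trans (ler_norm _)); exact: (HN N (leqnn N)).
move: Hn; rewrite le_min => /andP[nr nr0].
set e := en n in nr nr0; have e0 : 0 < e := en0 n; have e1 : e <= 1 := en1 n.
pose K := Kn n; have mK : mollifier C e K := HK n.
pose f i z : R := V' i z - wt i z.2 * p i x.
have mf i : meas (f i).
  by apply: measB => //; apply: measM; [exact: meas_wt|exact: meas_cst].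
have pf i : periodic (f i) by move=> z k l; rewrite /f (V'pl i).1 /= addr0.
have iV i : intg (fun y => K [:: i] y * V' i (x - y)).
  apply: sqi_intgM; first exact: (mol_sqi mK).
  split; first exact: (meas_sub x (V'meas i)).
  apply: (@intg_sub _ (fun z => V' i z ^+ 2) x); last exact: (V'pl i).2.2.
  by move=> z k l; rewrite (V'pl i).1.
have iw i : intg (fun y => K [:: i] y * wt i (- y.2)).
  apply: (intgM_bounded (C := 1)) (mol_intg mK _); last by move=> y; exact: wt_le.
  have -> : (fun y : E3 R => wt i (- y.2)) = (fun y => wt i (0 - y).2).
    by apply/funext => y; rewrite /= sub0r.
  exact: (meas_sub 0 (meas_wt i)).
have fE i y : K [:: i] y * f i (x - y) = K [:: i] y * V' i (x - y) - p i x * (K [:: i] y * wt i (- y.2)).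
  by rewrite /f /= x0 sub0r; ring.
have Tf i : `|tint (fun y => K [:: i] y * f i (x - y))| <= eta * (C / e).
  apply: (@le_trans _ _ (eta * tint (fun y => `|K [:: i] y|))); last first.
    by apply: ler_wpM2l; [exact: ltW|exact: (mol_grad mK)].
  have iK := intg_norm (mol_intg mK [:: i]).
  rewrite -tintZ//; apply: tint_norm_le.
  - by apply: (eq_intg (fun y => esym (fE i y))); apply: intgB => //; exact: intgZ.
  - exact: intgZ.
  move=> y; rewrite normrM; have [->|K0] := eqVneq (K [:: i] y) 0; first by rewrite normr0 mul0r mulr0.
  rewrite mulrC; apply: ler_wpM2r => //.
  have [y' [h1 h2 h3 h]] := mol_supp_reduce mK K0.
  have [_ ->] := h _ _ (pf i) x.
  have y'e : `|y'| <= e by apply: norm_vec_le; apply: ord3P.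
  rewrite /f boundary_versionE; last by rewrite /= x0 sub0r normrN (le_trans h3).
  rewrite -mulrBr normrM -[leRHS]mul1r; apply: ler_pM => //; first exact: wt_le.
  by apply: Hr; rewrite normrN (le_trans y'e).
have tK i : tint (K [:: i]) = 0.
  have h := tint_opp (mol_periodic mK [:: i]) (mol_intg mK [:: i]).
  have : tint (fun y => K [:: i] (- y)) = - tint (K [:: i]).
    by rewrite -tintN; [apply: eq_tint => y; exact: (mol_grad_odd mK)|exact: (mol_intg mK)].
  by rewrite h; move: (tint _) => q; lra.
pose A := tint (fun y => ((y.2 <= 0)%R)%:R * K [:: 2] y).
have A_ge : C^-1 / e <= A := mol_trace mK.
have mb : meas (fun y : E3 R => ((y.2 <= 0)%R)%:R).
  apply: (measurableT_comp (f := fun b : bool => b%:R : R)) => //.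
  by apply: measurable_fun_ler => //; exact: measurable_snd.
have ib : intg (fun y => ((y.2 <= 0)%R)%:R * K [:: 2] y).
  apply: (eq_intg (f := fun y => K [:: 2] y * ((y.2 <= 0)%R)%:R)); first by move=> y; rewrite mulrC.
  apply: (@intgM_bounded _ _ _ 1 mb) (mol_intg mK _).
  by move=> y; rewrite normr_nat lern1 leq_b1.
(* The gradient of the kernel has mean zero, so constant tangential components contribute nothing,
   and a sign function contributes twice the integral over the lower half space. *)
have tw i : tint (fun y => K [:: i] y * wt i (- y.2)) = (i == 2)%:R * (2 * A).
  have [->|i2] := eqVneq i 2; last first.
    rewrite mul0r -(tK i); apply: eq_tint => y.
    by rewrite /wt (negbTE i2) mulr1.
  rewrite mul1r (@eq_tint_off _ _ (fun y => 2 * (((y.2 <= 0)%R)%:R * K [:: 2] y) - K [:: 2] y)).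
  - rewrite tintB; [|exact: intgZ|exact: (mol_intg mK)].
    by rewrite tintZ// tK subr0.
  - exact: intg_meas (iw 2).
  - by apply: measB; [apply: measZ; exact: intg_meas ib|exact: (mol_meas mK)].
  - move=> y y0; rewrite /wt /= sgrN; have [h|h|h] := ltgtP y.2 0; last by rewrite h eqxx in y0.
    + by rewrite ltr0_sg//=; ring.
    + by rewrite gtr0_sg//=; ring.
have S : \sum_(i < 3) tint (fun y => K [:: i] y * f i (x - y)) = - (p 2 x * (2 * A)).
  have E i : tint (fun y => K [:: i] y * f i (x - y)) = conv K [:: i] (V i) x - p i x * ((i == 2)%:R * (2 * A)).
    rewrite (eq_tint (fE i)) tintB//; last exact: intgZ.
    by rewrite tintZ// tw -(boundary_version_conv [:: i] i x mK) (conv_yform mK _ _ (V'pl i)).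
  rewrite (eq_bigr _ (fun i _ => E i)) sumrB (divV mK)// sub0r; congr (- _).
  rewrite (bigD1 2)//= mul1r big1 ?addr0// => k k2.
  by rewrite (negbTE k2) mul0r mulr0.
(* The remainder costs at most eta C / e per component, while A >= 1 / (C e): the scale cancels and
   |p_3(x)| is at most 3/2 C^2 eta. *)
have : `|p 2 x| * (2 * A) <= 3 * (eta * (C / e)).
  have A0 : 0 <= A by apply: le_trans A_ge; rewrite divr_ge0 ?invr_ge0// ltW.
  rewrite -[2 * A]ger0_norm ?mulr_ge0// -normrM -normrN -S.
  apply: (le_trans (ler_norm_sum _ _ _)); apply: (le_trans (ler_sum _ (fun i _ => Tf i))).
  by rewrite big_const_ord iter_addr_0 mulr_natl.
move=> h.
have h2 : `|p 2 x| * (2 * (C^-1 / e)) <= 3 * (eta * (C / e)).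
  by apply: le_trans h; apply: ler_wpM2l => //; rewrite ler_pM2l.
have : `|p 2 x| * (2 * (C^-1 / e)) * (e * C / 2) <= 3 * (eta * (C / e)) * (e * C / 2).
  by apply: ler_wpM2r h2; rewrite divr_ge0// mulr_ge0// ltW.
have -> : `|p 2 x| * (2 * (C^-1 / e)) * (e * C / 2) = `|p 2 x| by field; rewrite !gt_eqF.
have -> : 3 * (eta * (C / e)) * (e * C / 2) = 3 / 2 * (C ^+ 2 * eta) by field; rewrite !gt_eqF.
have : 0 <= C ^+ 2 * eta by rewrite mulr_ge0 ?sqr_ge0// ltW.
rewrite -[2 * _ * _]mulrA; move: (C ^+ 2 * eta) `|p 2 x| => q q'; lra.
Qed.

(** On one side of the plane this is uniform continuity of p. Across it only the normal component
    jumps sign, and then both points are within |y| of the plane, where comparison with the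
    vanishing trace bounds each value by eta / 2. *)
Lemma boundary_version_oscillation (eta : R) : 0 < eta ->
  exists2 r : R, 0 < r & forall i x y, `|x.2| <= r0 -> `|(x + y).2| <= r0 -> `|y| <= r ->
    `|V' i (x + y) - V' i x| <= eta.
Proof.
move=> eta0; have eta20 : 0 < eta / 2 by rewrite divr_gt0.
have h i := periodic_uniformly_continuous r0 (@pc i) (@pp i) eta20.
have [r1 r10 H1] := h 0; have [r2 r20 H2] := h 1; have [r3 r30 H3] := h 2.
exists (Num.min r1 (Num.min r2 r3)); first by rewrite !lt_min r10 r20.
move=> i x y xr xyr; rewrite !le_min => /and3P[h1 h2 h3].
have Hp k z : `|z.2| <= r0 -> forall h, `|h| <= `|y| -> `|p k (z + h) - p k z| <= eta / 2.
  move=> zr q qy; move: k; apply: ord3P; [apply: H1|apply: H2|apply: H3] => //; exact: le_trans qy _.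
have small z : `|z.2| <= r0 -> `|z.2| <= `|y| -> `|p 2 z| <= eta / 2.
  move=> zr zy; have := Hp 2 z zr (0, 0, - z.2).
  rewrite (@normal_trace (z + _)); last by rewrite /= subrr.
  rewrite sub0r normrN; apply; apply: norm_vec_le; apply: ord3P; rewrite /component /tnth/= ?normr0// normrN//.
rewrite !boundary_versionE//.
have [sE|sN] := eqVneq (wt i (x + y).2) (wt i x.2).
  rewrite sE -mulrBr normrM -[leRHS]mul1r; apply: ler_pM => //; first exact: wt_le.
  by apply: (le_trans (Hp i x xr y (lexx _))); lra.
have i2 : i = 2.
  by apply/eqP; apply: contraNT sN => ni; rewrite /wt (negbTE ni).
rewrite i2 in sN *.
have [_ _ y2] := norm_coord y.
have [s1 s2] : `|x.2| <= `|y| /\ `|(x + y).2| <= `|y|.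
  suff : `|x.2| <= `|y.2| /\ `|(x + y).2| <= `|y.2| by move=> [? ?]; split; apply: le_trans y2.
  by move: sN; rewrite /wt eqxx; exact: sign_change.
have b1 z : `|z.2| <= r0 -> `|z.2| <= `|y| -> `|wt 2 z.2 * p 2 z| <= eta / 2.
  by move=> zr zy; rewrite normrM -[leRHS]mul1r; apply: ler_pM => //; [exact: wt_le|exact: small].
apply: (le_trans (ler_normB _ _)); have := b1 _ xyr s2; have := b1 _ xr s1; lra.
Qed.

Section Strip.
Variables (C e d : R) (K : seq 'I_3 -> E3 R -> R).
Hypothesis mK : mollifier C d K.
Hypothesis e0 : 0 < e.
Hypothesis e1 : e <= 1.
Hypothesis er0 : 5 * e <= r0.
Hypothesis de : d <= e.

(** Starting from |x_3| <= 3 e, the second mollification and the increment y each move the height by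
    at most e, hence 5 e <= r0. The constant is 8 from the cube of the Euclidean norm times the
    height 6 of the strip in units of e. *)
Lemma strip_cube_le (om : R) y : 0 <= om ->
  `|y.1.1| <= e -> `|y.1.2| <= e -> `|y.2| <= e ->
  (forall i x, `|x.2| <= r0 -> `|(x - y).2| <= r0 -> `|V' i (x - y) - V' i x| <= om) ->
  tint (fun x => middle (3 * e) x * cube (mollify K V) y x) <= 48 * e * om ^+ 3.
Proof.
move=> om0 y1 y2 y3 H.
have mE : middle (3 * e) = strip (- (3 * e)) (3 * e).
  by apply/funext => x; rewrite stripE /middle ler_norml.
have wE : mollify K V = mollify K V'.
  by apply/funext => i; apply/funext => x; rewrite /mollify (boundary_version_conv _ _ _ mK).
have Q x : middle (3 * e) x * cube (mollify K V) y x <= 8 * om ^+ 3 * strip (- (3 * e)) (3 * e) x.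
  rewrite mE mulrC stripE; have [h|h] := boolP (- (3 * e) <= x.2 <= 3 * e); last by rewrite !mulr0.
  rewrite !mulr1 wE; move: h; rewrite -ler_norml => h.
  apply: (cube_strip_le mK boundary_version_sym (r := 4 * e) om0).
    move=> i z z4; apply: H; first by have := er0; have := e0; lra.
    by apply: (le_trans (ler_normB _ _)); have := er0; lra.
  by have := de; lra.
have -> : 48 * e * om ^+ 3 = 8 * om ^+ 3 * tint (strip (- (3 * e)) (3 * e)).
  by rewrite tint_strip; [ring|have := e0; lra].
rewrite -tintZ; last exact: intg_strip.
apply: le_tint => //; last by apply: intgZ; exact: intg_strip.
have d1 : d <= 1 := le_trans de e1.
have [M _ HM] := mollify_bound mK sV.
apply: (eq_intg (f := fun x => cube (mollify K V) y x * middle (3 * e) x)); first by move=> x; rewrite mulrC.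
apply: (@intgM_bounded _ _ _ 1); first exact: (middle_cutoff _).1.
  by move=> x; have /andP[h1 h2] := (middle_cutoff (3 * e)).2 x; rewrite ger0_norm.
by apply: (cube_intg _ HM) => i; exact: (mollify_sym mK d1 sV i).1.
Qed.

End Strip.

End BoundaryTrace.

Section AlmostEverywhere.
Context {R : realType}.
Local Notation mu := (@torus_measure R).
Local Notation leb := (@lebesgue_measure R).
Implicit Types (x y z : E3 R) (i j : 'I_3) (t s r tau : R).

(** Folding onto the half space pulls a null set back to a subset of itself and its mirror image,
    and the reflection preserves the measure. *)
Lemma ae_absr (P : E3 R -> Prop) : {ae volume, forall x, P x} -> {ae mu, forall x, P (absr x)}.
Proof.
move=> [A [mA A0 PA]].
have mu0 : mu A = 0%E.
  rewrite torus_measureE//; apply: (subset_measure0 _ mA _ A0) => //.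
  by apply: measurableI => //; apply: measurableX => //; apply: measurableX; exact: measurable_itv.
have [mr pr] := @torus_preserving_refl R.
have mrA : measurable (refl @^-1` A : set (mE3 R)) by rewrite -[_ @^-1` _]setTI; exact: mr.
have nA : mu.-negligible A by exists A; split.
have nrA : mu.-negligible (refl @^-1` A).
  by exists (refl @^-1` A); split; [exact: mrA|rewrite (pr A mA)|].
apply: negligibleS (negligibleU nA nrA) => x /= nPx; have [x0|x0] := leP 0 x.2.
  by left; apply: PA => /=; rewrite absr_id// in nPx.
right; apply: PA => /=; move: nPx; congr (~ P _).
by rewrite /absr ltr0_norm.
Qed.

(* [g] need not be measurable: the supremum of the [F n] serves as majorant. *)
Lemma time_dct_lower T (F : nat -> R -> R) (g : R -> \bar R) :
  (forall n, time_meas (F n)) -> (forall n, time_intg T (F n)) -> (forall n t, 0 <= F n t) ->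
  (forall t, 0 <= g t)%E -> (\int[leb]_(t in `[0%R, T]) g t < +oo)%E ->
  {ae leb, forall t, 0 <= t <= T ->
     F n t @[n --> \oo] --> (0 : R) /\ forall n, ((F n t)%:E <= g t)%E} ->
  time_int T (F n) @[n --> \oo] --> (0 : R).
Proof.
move=> mF iF F0 g0 gfin [A [mA A0 HA]].
pose D : set (measurableTypeR R) := `[0%R, T]%classic.
have mD : measurable D by exact: measurable_itv.
have mFE n : measurable_fun setT (fun t : measurableTypeR R => (F n t)%:E).
  by apply/measurable_EFinP; exact: mF.
pose h (t : measurableTypeR R) : \bar R := (esups (fun n => (F n t)%:E) 0%N * (\1_(~` A) t)%:E)%E.
have good t : D t -> ~ A t -> F n t @[n --> \oo] --> (0 : R) /\ forall n, ((F n t)%:E <= g t)%E.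
  rewrite /D /= in_itv/= => tT nA; apply: contrapT => hn; apply: nA; apply: HA => /=.
  by move=> H; apply: hn; exact: H.
have sup_ge n t : ((F n t)%:E <= esups (fun n => (F n t)%:E) 0%N)%E.
  by apply: ereal_sup_ubound; exists n.
have mh : measurable_fun D h.
  apply: measurable_funTS; apply: emeasurable_funM.
    exact: (measurable_fun_esups mFE 0%N).
  by apply/measurable_EFinP; apply: measurable_indic; exact: measurableC.
have hg t : D t -> (0 <= h t <= g t)%E.
  move=> Dt; rewrite /h indicE; have [tA|tA] := boolP (t \in ~` A); last by rewrite mule0 lexx g0.
  have [_ Fg] := good t Dt (set_mem tA).
  rewrite mule1 (le_trans _ (sup_ge 0%N t)) ?lee_fin//=.
  by apply: ge_ereal_sup => _ [n _ <-]; exact: Fg.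
have ih : leb.-integrable D h.
  apply/integrableP; split=> //.
  apply: le_lt_trans gfin; apply: ge0_le_lower_integral => [t _|t Dt]; first exact: abse_ge0.
  by have /andP[h0 hg'] := hg t Dt; rewrite gee0_abs.
have ae_notA : {ae leb, forall t, ~ A t}.
  by exists A; split=> // t /=; exact: contrapT.
have ae1 : {ae leb, forall t, D t -> (F n t)%:E @[n --> \oo] --> 0%E}.
  apply: negligibleS ae_notA => t; apply: contra_not => nA Dt.
  by apply/fine_cvgP; split; [apply: nearW|exact: (good t Dt nA).1].
have ae2 : {ae leb, forall t, forall n, D t -> (`|(F n t)%:E| <= h t)%E}.
  apply: negligibleS ae_notA => t; apply: contra_not => nA n Dt.
  by rewrite /h indicE mem_set// mule1 gee0_abs ?lee_fin//; exact: sup_ge.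
have [_ _] := @dominated_convergence _ _ _ leb D mD (fun n t => (F n t)%:E) (fun=> 0%E) h
    (fun n => measurable_funTS (mFE n)) (measurable_cst _) ae1 ih ae2.
rewrite integral0 => /fine_cvgP[_] /=.
apply: cvg_trans; apply: near_eq_cvg; apply: nearW => n /=.
rewrite /time_int /Rintegral; congr fine.
by apply/esym; apply: (@integral_mrestr R _ (measurableTypeR R)).
Qed.

End AlmostEverywhere.

Section BoundaryLayer.
Context {R : realType}.
Local Notation mu := (@torus_measure R).
Local Notation leb := (@lebesgue_measure R).
Implicit Types (x y z : E3 R) (i j : 'I_3) (t s r tau : R).

Section Profile.
Variables (delta : R) (g : E3 R -> E3 R).
Hypothesis delta0 : 0 < delta.
Hypothesis gC : in_C0 (slab delta) g.

(** Precomposing with this retraction onto the slab extends a continuous function on it to the whole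
    space, evenly in x_3 and constantly beyond height delta. *)
Let clip x : E3 R := (x.1.1, x.1.2, Num.min `|x.2| delta).

Definition profile i x : R := component (g (clip x)) i.

Let clip_slab x : slab delta (clip x).
Proof. by rewrite /slab /clip /= le_min normr_ge0 ltW//= ge_min lexx orbT. Qed.

Lemma profile_continuous i : continuous (profile i).
Proof.
have clip_cont : continuous clip.
  have h1 : continuous (fun x : E3 R => x.1.1).
    by move=> x; apply: (@continuous_comp _ _ _ fst fst); exact: cvg_fst.
  have h2 : continuous (fun x : E3 R => x.1.2).
    by move=> x; apply: (@continuous_comp _ _ _ fst snd); [exact: cvg_fst|exact: cvg_snd].
  have h3 : continuous (fun x : E3 R => Num.min `|x.2| delta).
    move=> x; apply: (@continuous_min _ _ (fun x : E3 R => `|x.2|) (fun=> delta)); last exact: cvg_cst.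
    by apply: cvg_norm; exact: cvg_snd.
  by move=> x; exact: (cvg_pair (cvg_pair (h1 x) (h2 x)) (h3 x)).
have /subspace_continuousP h := within_comp (A := setT) gC.2 clip_cont (fun x _ => clip_slab x).
move=> x; apply: (cvg_component (F := nbhs x)).
move=> B HB; have hB : nbhs x (fun q => setT q -> B (g (clip q))) := h x I B HB.
by apply: filterS hB => q; exact.
Qed.

Lemma profile_periodic i : periodic (profile i).
Proof.
suff h : periodic (fun x => g (clip x)) by move=> x k l; rewrite /profile h.
apply: torus_periodicP => x _.
have E k : (k == 0) || (k == 1) -> clip (x + unit_vec k) = clip x + unit_vec k.
  by case: (x) => -[a b] c; case/orP => /eqP ->; rewrite /clip/unit_vec/=; congr (_, _, _); rewrite /= !addr0.
by rewrite !E//; exact: gC.1 (clip_slab x).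
Qed.

Lemma profile_refl i x : profile i (refl x) = profile i x.
Proof. by rewrite /profile /clip /refl /= normrN. Qed.

Lemma profile_le (M : R) i x : (C0norm (slab delta) g <= M%:E)%E -> `|profile i x| <= M.
Proof.
move=> gM; apply: (le_trans (component_le _ _)); rewrite -lee_fin; apply: le_trans gM.
by apply: ereal_sup_ubound; exists (clip x).
Qed.

Lemma ext_profile f : {ae volume, forall x, slab delta x -> f x = g x} ->
  {ae mu, forall x, `|(x : E3 R).2| <= delta -> forall i, ext f i x = wt i x.2 * profile i x}.
Proof.
move=> /ae_absr; apply: negligibleS => x; apply: contra_not => h xd i.
have hs : slab delta (absr x) by rewrite /slab /absr /= normr_ge0.
rewrite /ext (h hs) /profile; congr (_ * component (g _) i).
by rewrite /absr /clip; congr (_, _, _); rewrite /=; apply/esym/min_idPl.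
Qed.

End Profile.

Variables (T : R) (u : R -> E3 R -> E3 R).
Hypothesis T0 : 0 < T.
Hypothesis wu : weak_solution T u.
Local Notation W := (ext_path T u).

Let tW : time_field W := ef_field (path_energy_frame T0 wu).

Variables (delta : R) (v : R -> E3 R -> E3 R).
Hypothesis delta0 : 0 < delta.

Section FixedTime.
Variable t : R.
Hypothesis tT : 0 <= t <= T.
Hypothesis vC : in_C0 (slab delta) (v t).
Hypothesis uv : {ae volume, forall x, slab delta x -> u t x = v t x}.

Let p := profile delta (v t).

Let sV : sym (W t). Proof. exact: tf_sym tW t. Qed.

Let Vp : {ae mu, forall x, `|(x : E3 R).2| <= delta -> forall i, W t i x = wt i x.2 * p i x}.
Proof. by rewrite /ext_path (clamp_id tT); exact: ext_profile. Qed.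

Let divV C e K : mollifier C e K -> 0 < e -> e <= 1 -> forall x, \sum_(i < 3) conv K [:: i] (W t i) x = 0.
Proof. by move=> mK e0 e1 x; exact: (ef_div (path_energy_frame T0 wu) mK e0 e1). Qed.

Let V' := boundary_version (W t) p delta.

Let increments_le C e d K (om : R) y : mollifier C d K -> 0 < e -> e <= 1 -> 5 * e <= delta -> d <= e -> 0 <= om ->
  `|y.1.1| <= e -> `|y.1.2| <= e -> `|y.2| <= e ->
  (forall i x, `|x.2| <= delta -> `|(x - y).2| <= delta -> `|V' i (x - y) - V' i x| <= om) ->
  increments_in W K (middle (3 * e)) t y <= 48 * e * om ^+ 3.
Proof.
move=> mK e0 e1 ed de om0 y1 y2 y3 H.
exact: (strip_cube_le sV (profile_continuous delta0 vC) (profile_periodic delta0 vC) (profile_refl _ _) Vp mK e0 e1 ed de om0 y1 y2 y3 H).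
Qed.

Lemma layer_increments_small (eta : R) : 0 < eta -> exists2 r : R, 0 < r &
  forall C e d K y, mollifier C d K -> 0 < e -> e <= 1 -> 5 * e <= delta -> e <= r -> d <= e ->
  `|y.1.1| <= e -> `|y.1.2| <= e -> `|y.2| <= e ->
  increments_in W K (middle (3 * e)) t y <= 48 * e * eta ^+ 3.
Proof.
move=> eta0.
have [r r0 Hr] := boundary_version_oscillation sV delta0 (profile_continuous delta0 vC)
  (profile_periodic delta0 vC) (profile_refl _ _) Vp divV eta0.
exists r => // C e d K y mK e0 e1 ed er de y1 y2 y3.
apply: (increments_le mK e0 e1 ed de (ltW eta0) y1 y2 y3) => i x x1 x2.
apply: Hr => //; rewrite normrN; apply: le_trans er.
by apply: norm_vec_le; apply: ord3P.
Qed.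

(** The modulus of continuity of v(t) is not uniform in t. This cruder estimate by the C^0 norm
    provides the majorant for dominated convergence in time. *)
Lemma layer_increments_bounded (M : R) C e d K y : (C0norm (slab delta) (v t) <= M%:E)%E ->
  mollifier C d K -> 0 < e -> e <= 1 -> 5 * e <= delta -> d <= e ->
  `|y.1.1| <= e -> `|y.1.2| <= e -> `|y.2| <= e ->
  increments_in W K (middle (3 * e)) t y <= 48 * e * (2 * M) ^+ 3.
Proof.
move=> vM mK e0 e1 ed de y1 y2 y3.
have pM i x : `|p i x| <= M by exact: profile_le.
have M0 : 0 <= M := le_trans (normr_ge0 _) (pM 0 0).
apply: (increments_le mK e0 e1 ed de _ y1 y2 y3); first by rewrite mulr_ge0.
move=> i x x1 x2; rewrite /V' !boundary_versionE//.
have b q : `|wt i q.2 * p i q| <= M.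
  by rewrite normrM -[leRHS]mul1r; apply: ler_pM => //; exact: wt_le.
apply: (le_trans (ler_normB _ _)).
by have := b x; have := b (x - y); rewrite /p; lra.
Qed.

End FixedTime.

Variables (C : R) (e d : nat -> R) (K K' : nat -> seq 'I_3 -> E3 R -> R).
Hypothesis C0 : 0 < C.
Hypothesis mK : forall n, mollifier C (e n) (K n).
Hypothesis e0 : forall n, 0 < e n.
Hypothesis e1 : forall n, e n <= 1.
Hypothesis e_lim : e @ \oo --> (0 : R).
Hypothesis mK' : forall n, mollifier C (d n) (K' n).
Hypothesis de : forall n, d n <= e n.

Definition layer_sum n t : R :=
  \sum_(i < 3) averaged_increments W (K n) (K' n) (middle (3 * e n)) i t.

Let d1 n : d n <= 1. Proof. exact: le_trans (de n) (e1 n). Qed.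

Let mid n := middle_cutoff (3 * e n).

Let layer_meas n : time_meas (layer_sum n).
Proof.
by apply: measurable_sum => i; exact: (averaged_meas tW (mK n) (mK' n) (@d1 n) (mid n).1 (mid n).2 i).
Qed.

Let layer_ge0 n t : 0 <= layer_sum n t.
Proof. by apply: sumr_ge0 => i _; exact: (averaged_ge0 _ _ _ (mid n).2). Qed.

Let term_intg n i : time_intg T (averaged_increments W (K n) (K' n) (middle (3 * e n)) i).
Proof.
have [B B0 HB] := averaged_bound tW (mK n) (mK' n) (@d1 n) (mid n).1 (mid n).2 i.
exact: (@time_bounded_intg _ T _ B (averaged_meas tW (mK n) (mK' n) (@d1 n) (mid n).1 (mid n).2 i) HB).
Qed.

Let layer_intg n : time_intg T (layer_sum n).
Proof. by apply: integ_sum => i; exact: term_intg. Qed.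

Let layer_le n t (om : R) : 0 <= om ->
  (forall y, `|y.1.1| <= e n -> `|y.1.2| <= e n -> `|y.2| <= e n ->
    increments_in W (K' n) (middle (3 * e n)) t y <= 48 * e n * om ^+ 3) ->
  layer_sum n t <= 144 * C * om ^+ 3.
Proof.
move=> om0 H; have c0 : 0 <= 48 * e n * om ^+ 3 by rewrite mulr_ge0 ?exprn_ge0// mulr_ge0// ltW.
apply: (@le_trans _ _ (\sum_(i < 3) C / e n * (48 * e n * om ^+ 3))).
  by apply: ler_sum => i _; apply: (averaged_le tW (mK n) (mK' n) (@d1 n) (mid n).1 (mid n).2).
rewrite big_const_ord iter_addr_0 -mulr_natl le_eqVlt; apply/orP; left; apply/eqP.
by field; rewrite gt_eqF.
Qed.

Lemma layer_vanishes : in_L3_C0 T (slab delta) v ->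
  {ae leb, forall t, 0 <= t <= T -> {ae volume, forall x, slab delta x -> u t x = v t x}} ->
  time_int T (layer_sum n) @[n --> \oo] --> (0 : R).
Proof.
move=> [vC _ vfin] uv.
have dlt5 : 0 < delta / 5 by rewrite divr_gt0.
(* The strip estimate asks for 5 e <= delta; the finitely many coarser scales are skipped by the
   shift N. *)
have [N _ HN] := (cvgr0_norm_le _ e_lim) _ dlt5.
have e5 n : 5 * e (n + N)%N <= delta.
  have := HN (n + N)%N (leq_addl n N); rewrite /= (ger0_norm (ltW (e0 _))) => h.
  by move: h; rewrite ler_pdivlMr// mulrC.
(* The crude bound on the layer is 144 C (2 M)^3, with 144 = 3 * 48 for the three directions;
   scaling by c makes the cube of the C^0 norm itself the majorant. *)
pose c : R := (8 * (144 * C))^-1.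
have c0 : 0 < c by rewrite invr_gt0 pmulr_rgt0// pmulr_rgt0 ?ltr0n.
have lim : time_int T (fun t => c * layer_sum (n + N)%N t) @[n --> \oo] --> (0 : R).
  apply: (@time_dct_lower _ T _ (fun t => (C0norm (slab delta) (v t) `^ 3)%E)) => //.
  - by move=> n; apply: time_measM; [exact: time_meas_cst|exact: layer_meas].
  - by move=> n; apply: integZ; exact: layer_intg.
  - by move=> n t; rewrite mulr_ge0 ?layer_ge0// ltW.
  - by move=> t; exact: poweR_ge0.
  apply: negligibleS uv => t /=; apply: contra_not => uvt tT; have {}uvt := uvt tT.
  have vt := vC t tT; split.
    apply/cvgr0Pnorm_le => eps eps0.
    (* Capping eta at 1 gives eta^3 <= eta <= eps. *)
    pose eta := Num.min 1 eps; have eta0 : 0 < eta by rewrite lt_min ltr01.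
    have eta1 : eta <= 1 by rewrite ge_min lexx.
    have eta_eps : eta <= eps by rewrite ge_min lexx orbT.
    have [r r0 Hr] := layer_increments_small tT vt uvt eta0.
    have [N' _ HN'] := (cvgr0_norm_le _ e_lim) _ r0.
    exists N' => // n /= nN'.
    have er : e (n + N)%N <= r.
      apply: le_trans (ler_norm _) _; apply: HN' => /=.
      by rewrite (leq_trans nN')// leq_addr.
    rewrite ger0_norm; last by rewrite mulr_ge0 ?layer_ge0// ltW.
    have L : layer_sum (n + N)%N t <= 144 * C * eta ^+ 3.
      by apply: layer_le => [|y y1 y2 y3]; [exact: ltW|exact: (Hr C _ (d (n + N)%N))].
    apply: (@le_trans _ _ (c * (144 * C * eta ^+ 3))); first by rewrite ler_pM2l.
    have -> : c * (144 * C * eta ^+ 3) = 8^-1 * eta ^+ 3 by rewrite /c; field; rewrite gt_eqF.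
    have e3 : eta ^+ 3 <= eta.
      rewrite exprS -[leRHS]mulr1 ler_pM2l//; apply: exprn_ile1 => //; exact: ltW.
    by have := exprn_gt0 3 eta0; lra.
  move=> n.
  have n0 : (0 <= C0norm (slab delta) (v t))%E.
    have s0 : slab delta (0 : E3 R) by rewrite /slab /= lexx ltW.
    apply: (@le_trans _ _ (enorm (v t 0))%:E); first by rewrite lee_fin enorm_ge0.
    by apply: ereal_sup_ubound; exists 0.
  case E : (C0norm (slab delta) (v t)) n0 => [M| |]// M0; last by rewrite poweRyr ?leey ?pnatr_eq0.
  rewrite lee_fin in M0.
  rewrite poweR_EFin lee_fin powR_mulrn//.
  have L : layer_sum (n + N)%N t <= 144 * C * (2 * M) ^+ 3.
    apply: layer_le => [|y y1 y2 y3]; first by rewrite mulr_ge0.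
    by apply: (layer_increments_bounded tT vt uvt _ (mK' (n + N)%N)) => //; rewrite E.
  have -> : M ^+ 3 = c * (144 * C * (2 * M) ^+ 3) by rewrite /c; field; rewrite gt_eqF.
  by rewrite ler_pM2l.
have lim2 : time_int T (layer_sum (n + N)%N) @[n --> \oo] --> (0 : R).
  have -> : (fun n => time_int T (layer_sum (n + N)%N)) = (fun n => c^-1 * time_int T (fun t => c * layer_sum (n + N)%N t)).
    by apply/funext => n; rewrite time_intZ ?mulKf// gt_eqF.
  by rewrite -(mulr0 c^-1); apply: cvgMl_tmp.
have gen (q : nat -> R) : q (n + N)%N @[n --> \oo] --> (0 : R) -> q @ \oo --> (0 : R).
  by rewrite cvg_shiftn.
exact: (gen (fun n => time_int T (layer_sum n)) lim2).
Qed.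

End BoundaryLayer.

(** * Energy conservation *)

Section Conservation.
Context {R : realType}.
Local Notation mu := (@torus_measure R).
Implicit Types (x y z : E3 R) (i j : 'I_3) (t s r tau : R).

Lemma cvg_scale0 (a : R) (q : nat -> R) : q @ \oo --> (0 : R) -> (fun n => a * q n) @ \oo --> (0 : R).
Proof. by move=> q0; rewrite -(mulr0 a); apply: cvgMl_tmp. Qed.

Let budget (a b c h q : R) : 0 < q -> a <= 4 / 3 * q + q / 3 -> b <= 4^-1 * a -> c <= h -> h <= q / 3 ->
  c + b <= q.
Proof. lra. Qed.

Variables (T : R) (u : R -> E3 R -> E3 R).
Hypothesis T0 : 0 < T.
Hypothesis wu : weak_solution T u.
Local Notation W := (ext_path T u).

Let eW : energy_frame T W := path_energy_frame T0 wu.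
Let tW : time_field W := ef_field eW.

Let Wsq t i : sqi (W t i). Proof. exact: (tf_sym tW t i).1.2. Qed.

Variables (C : R) (en : nat -> R) (Kn : nat -> seq 'I_3 -> E3 R -> R).
Hypothesis C0 : 0 < C.
Hypothesis en0 : forall n, 0 < en n.
Hypothesis en1 : forall n, en n <= 1.
Hypothesis en_lim : en @ \oo --> (0 : R).
Hypothesis mKn : forall n, mollifier C (en n) (Kn n).

Let wsq m t i : sqi (path_mollify W (Kn m) t i).
Proof. exact: (mollify_sym (mKn m) (en1 m) (tf_sym tW t) i).1.2. Qed.

Let mollify_cvg t i : norm2 (fun x => path_mollify W (Kn m) t i x - W t i x) @[m --> \oo] --> (0 : R).
Proof.
apply/cvgr0Pnorm_le => d d0.
have [e1 e10 He1] := tf_approx tW t d0.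
have [N _ HN] := (cvgr0_norm_le _ en_lim) _ e10.
exists N => // n /= nN; rewrite ger0_norm ?norm2_ge0//.
by apply: (He1 _ _ _ (mKn n)) => //; apply: le_trans (ler_norm _) _; exact: HN.
Qed.

Lemma ip_mollify_cvg t : ip (W t) (mollify (Kn n) (W t)) @[n --> \oo] --> sqnorm (W t).
Proof.
rewrite -ip_sqnorm; apply: cvg_sumr => i.
apply/cvgrPdist_le => d d0.
have c0 : norm2 (W t i) * norm2 (fun x => path_mollify W (Kn m) t i x - W t i x) @[m --> \oo] --> (0 : R).
  exact: (cvg_scale0 _ (@mollify_cvg t i)).
have [N _ HN] := (cvgr0_norm_le _ c0) _ d0.
exists N => // n nN; rewrite distrC -tintB; [|exact: sqi_intgM (Wsq t i) (wsq n t i)|exact: sqi_intgM].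
rewrite (eq_tint (g := fun x => W t i x * (path_mollify W (Kn n) t i x - W t i x))); last first.
  by move=> x; rewrite mulrBr.
apply: (le_trans (cauchy_schwarz (Wsq t i) (sqiB (wsq n t i) (Wsq t i)))).
by apply: le_trans (ler_norm _) _; exact: (HN n nN).
Qed.

Section FixedKernel.
Variables (e : R) (K : seq 'I_3 -> E3 R -> R).
Hypothesis mK : mollifier C e K.
Hypothesis e1 : e <= 1.

Let k : R := \sum_(i < 3) norm2 (K [:: i]).
Let k0 : 0 <= k. Proof. by apply: sumr_ge0 => i _; exact: norm2_ge0. Qed.

Let conv_bound (f : E3 R -> R) (N : R) i x : sqi f -> norm2 f <= N -> `|conv K [:: i] f x| <= k * N.
Proof.
move=> sf fN; apply: (le_trans (conv_le mK _ _ sf)).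
apply: ler_pM; rewrite ?norm2_ge0// /k (bigD1 i)//= lerDl.
by apply: sumr_ge0 => j _; exact: norm2_ge0.
Qed.

(** The tested slot is split as the limit plus an error. With the limit in it, the gradient is a
    fixed bounded weight and products converge in L^1; the error is small because a fixed kernel
    bounds the gradient by the L^2 norm. *)
Let flux_mollified_cvg tau :
  flux K (path_mollify W (Kn m) tau) (path_mollify W (Kn m) tau) @[m --> \oo] --> flux K (W tau) (W tau).
Proof.
have [N0 HN0] := tf_bound tW; pose N := Num.max 0 N0.
have N_ge0 : 0 <= N by rewrite le_max lexx.
have HN i : norm2 (W tau i) <= N by apply: (le_trans (HN0 tau i)); rewrite le_max lexx orbT.
pose w m := path_mollify W (Kn m) tau.
pose dw m i x := w m i x - W tau i x.
have sdw m i : sqi (dw m i) by exact: (sqiB (wsq m tau i) (Wsq tau i)).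
have wN m i : norm2 (w m i) <= N by apply: le_trans (HN i); exact: (conv_sqi (mKn m) (en1 m) (Wsq tau i)).2.
pose D m := \sum_(i < 3) norm2 (dw m i).
have D0 : D @ \oo --> (0 : R).
  have -> : (0 : R) = \sum_(i < 3) 0 by rewrite big1.
  by apply: cvg_sumr => i; exact: mollify_cvg.
have main : (fun m => flux K (w m) (W tau)) @ \oo --> flux K (W tau) (W tau).
  apply: cvg_sumr => i; apply: cvg_sumr => j.
  apply: (@tint3_cvg _ _ _ _ _ _ (k * N)) => //; try exact: mollify_cvg.
  - by move=> m; exact: wsq.
  - by move=> m; exact: wsq.
  - exact: (conv_meas mK).
  - by move=> x; exact: conv_bound.
have rest : (fun m => flux K (w m) (dw m)) @ \oo --> (0 : R).
  have b m : `|flux K (w m) (dw m)| <= 9 * (k * D m * (N * N)).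
    apply: (flux_le mK e1) => // [i|i j x]; first exact: wsq.
    apply: conv_bound => //.
    rewrite /D (bigD1 j)//= lerDl.
    by apply: sumr_ge0 => l _; exact: norm2_ge0.
  have lim : 9 * k * (N * N) * D m @[m --> \oo] --> (0 : R).
    exact: (cvg_scale0 _ D0).
  apply/cvgr0Pnorm_le => d d0; have [M _ HM] := (cvgr0_norm_le _ lim) _ d0.
  exists M => // m mM; apply: (le_trans (b m)); apply: le_trans (HM m mM); apply: le_trans (ler_norm _).
  by rewrite le_eqVlt; apply/orP; left; apply/eqP; ring.
have -> : (fun m => flux K (path_mollify W (Kn m) tau) (path_mollify W (Kn m) tau)) =
    (fun m => flux K (w m) (W tau) + flux K (w m) (dw m)).
  apply/funext => m.
  have E : flux K (w m) (dw m) = flux K (w m) (w m) - flux K (w m) (W tau).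
    by apply: (fluxB mK e1) => i //; exact: wsq.
  by rewrite E addrC subrK.
by rewrite -[X in _ --> X]addr0; apply: cvgD.
Qed.

(** The dominating constant depends on the kernel K but not on the second scale m: this fixes the
    order of the two limits, m being sent to infinity for each K. *)
Lemma time_flux_mollified_cvg t : 0 <= t ->
  time_int T (fun tau => window 0 t tau * flux K (path_mollify W (Kn m) tau) (path_mollify W (Kn m) tau))
    @[m --> \oo] --> time_int T (fun tau => window 0 t tau * flux K (W tau) (W tau)).
Proof.
move=> t0; have [N0 HN0] := tf_bound tW; pose N := Num.max 0 N0.
have N_ge0 : 0 <= N by rewrite le_max lexx.
have HN tau i : norm2 (W tau i) <= N by apply: (le_trans (HN0 tau i)); rewrite le_max lexx orbT.
apply: (time_dct T (B := 9 * (k * N * (N * N))) _ _ _).2 => [m|m tau|tau].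
- by apply: time_measM; [exact: window_meas|exact: (flux_mollified_meas tW mK e1 (mKn m) (en1 m))].
- have wN i : norm2 (path_mollify W (Kn m) tau i) <= N.
    by apply: le_trans (HN tau i); exact: (conv_sqi (mKn m) (en1 m) (Wsq tau i)).2.
  have b : `|flux K (path_mollify W (Kn m) tau) (path_mollify W (Kn m) tau)| <= 9 * (k * N * (N * N)).
    apply: (flux_le mK e1) => // i j x.
    by apply: conv_bound => //; exact: wsq.
  have /andP[h0 h1] := window_ge0 tau t0.
  by rewrite normrM (ger0_norm h0) -[leRHS]mul1r; apply: ler_pM.
- by apply: cvgMl_tmp; exact: flux_mollified_cvg.
Qed.

End FixedKernel.

Hypothesis bulk : bulk_condition T u.
Variables (delta : R) (v : R -> E3 R -> E3 R).
Hypothesis delta0 : 0 < delta.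
Hypothesis v3 : in_L3_C0 T (slab delta) v.
Hypothesis uv : {ae (@lebesgue_measure R), forall t, 0 <= t <= T ->
  {ae volume, forall x, slab delta x -> u t x = v t x}}.

Lemma flux_vanishes t : 0 <= t ->
  time_int T (fun tau => window 0 t tau * flux (Kn n) (W tau) (W tau)) @[n --> \oo] --> (0 : R).
Proof.
move=> t0.
pose F n m := time_int T (fun tau => window 0 t tau * flux (Kn n) (path_mollify W (Kn m) tau) (path_mollify W (Kn m) tau)).
pose G n := time_int T (fun tau => window 0 t tau * flux (Kn n) (W tau) (W tau)).
(* A diagonal choice: the second scale is taken below the first and so fine that replacing W by its
   mollification changes the integrated flux by at most 1/(n+1). *)
have pick n : exists m, en m <= en n /\ `|G n - F n m| <= n.+1%:R^-1.
  have n0 : 0 < n.+1%:R^-1 :> R by rewrite invr_gt0.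
  have /cvgrPdist_le/(_ _ n0)[N1 _ H1] := time_flux_mollified_cvg (mKn n) (en1 n) t0.
  have [N2 _ H2] := (cvgr0_norm_le _ en_lim) _ (en0 n).
  exists (N1 + N2)%N; split.
    by apply: le_trans (ler_norm _) _; apply: H2; rewrite /= leq_addl.
  by apply: H1; rewrite /= leq_addr.
have [m Hm] := choice pick.
have de n : en (m n) <= en n := (Hm n).1.
pose w n tau := path_mollify W (Kn (m n)) tau.
pose Q n := layer_sum T u en Kn (fun n => Kn (m n)) n.
have Q_lim : time_int T (Q n) @[n --> \oo] --> (0 : R).
  exact: (layer_vanishes T0 wu delta0 C0 mKn en0 en1 en_lim (fun n => mKn (m n)) de v3 uv).
pose P chi n i tau := averaged_increments W (Kn n) (Kn (m n)) chi i tau.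
have Pm chi n i (mc : meas chi) (c01 : forall x, 0 <= chi x <= 1) : time_meas (P chi n i).
  exact: (averaged_meas tW (mKn n) (mKn (m n)) (en1 _) mc c01 i).
have Pi chi n i (mc : meas chi) (c01 : forall x, 0 <= chi x <= 1) : time_intg T (P chi n i).
  have [B B0 HB] := averaged_bound tW (mKn n) (mKn (m n)) (en1 _) mc c01 i.
  exact: (@time_bounded_intg _ T _ B (Pm chi n i mc c01) HB).
have up n := upper_cutoff (3 * en n); have lo n := lower_cutoff (3 * en n); have mi n := middle_cutoff (3 * en n).
pose S n tau := \sum_(i < 3) (P (upper (3 * en n)) n i tau + P (lower (3 * en n)) n i tau + P (middle (3 * en n)) n i tau).
have split_int n : time_intg T (S n) /\ time_int T (S n) =
    \sum_(i < 3) (time_int T (P (upper (3 * en n)) n i) + time_int T (P (lower (3 * en n)) n i)) + time_int T (Q n).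
  have iu i := Pi _ n i (up n).1 (up n).2; have il i := Pi _ n i (lo n).1 (lo n).2.
  have im i := Pi _ n i (mi n).1 (mi n).2.
  have iul i := integD (iu i) (il i); have iall i := integD (iul i) (im i).
  split; first exact: integ_sum.
  rewrite /S time_int_sum// /Q /layer_sum time_int_sum// -big_split/=; apply: eq_bigr => i _.
  by rewrite (time_intD (iul i) (im i)) (time_intD (iu i) (il i)).
have F_le n : `|F n (m n)| <= 4^-1 * time_int T (S n).
  have [iS _] := split_int n.
  rewrite -time_intZ//; apply: time_int_le.
  - have fm := flux_mollified_meas tW (mKn n) (en1 n) (mKn (m n)) (en1 (m n)).
    apply: (@le_integ _ _ _ (time_measure T) _ (fun tau => 4^-1 * S n tau)); last exact: integZ.
      by apply: time_measM => //; exact: window_meas.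
    move=> tau; have /andP[h0 h1] := window_ge0 tau t0.
    rewrite normrM (ger0_norm h0) -[leRHS]mul1r; apply: ler_pM => //.
    exact: (flux_split T0 wu (mKn n) (en0 n) (en1 n) (mKn (m n)) (en1 (m n))).
  - exact: integZ.
  - move=> tau; have /andP[h0 h1] := window_ge0 tau t0.
    rewrite normrM (ger0_norm h0) -[leRHS]mul1r; apply: ler_pM => //.
    exact: (flux_split T0 wu (mKn n) (en0 n) (en1 n) (mKn (m n)) (en1 (m n))).
apply/cvgr0Pnorm_le => eps eps0.
(* The six outer terms cost 12 C kap = 4/3 eps and the layer eps / 3. A quarter of their sum
   together with the eps / 3 of the diagonal choice is 3/4 eps. *)
pose kap := eps / (9 * C).
have kap0 : 0 < kap by rewrite divr_gt0// mulr_gt0.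
have [r r0 Hr] := bulk_small bulk kap0.
have [N1 _ HN1] := (cvgr0_norm_le _ en_lim) _ r0.
have eps3 : 0 < eps / 3 by rewrite divr_gt0.
have [N2 _ HN2] := (cvgr0_norm_le _ Q_lim) _ eps3.
have [N3 _ HN3] := (cvgr0_norm_le _ (@cvg_harmonic R)) _ eps3.
exists (N1 + N2 + N3)%N => // n /= nN.
have er : en n <= r.
  by apply: le_trans (ler_norm _) _; apply: HN1 => /=; apply: leq_trans nN; rewrite -addnA leq_addr.
have Qe : `|time_int T (Q n)| <= eps / 3.
  by apply: HN2 => /=; apply: leq_trans nN; rewrite addnAC leq_addl.
have he : n.+1%:R^-1 <= eps / 3.
  by apply: le_trans (ler_norm _) _; apply: (HN3 n); rewrite /=; apply: leq_trans nN; rewrite leq_addl.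
have out i := outer_averaged_le T0 wu (mKn n) (en0 n) (mKn (m n)) (en1 (m n)) (de n) (ltW kap0)
  (fun y ye => Hr y (le_trans ye er)) i.
have Se : time_int T (S n) <= 12 * C * kap + eps / 3.
  rewrite (split_int n).2; apply: lerD; last by apply: le_trans (ler_norm _) _.
  apply: (@le_trans _ _ (\sum_(i < 3) (2 * C * kap + 2 * C * kap))).
    by apply: ler_sum => i _; apply: lerD; [exact: (out i).1|exact: (out i).2].
  by rewrite big_const_ord iter_addr_0 -mulr_natl le_eqVlt; apply/orP; left; apply/eqP; ring.
have kE : 12 * C * kap = 4 / 3 * eps by rewrite /kap; field; rewrite gt_eqF.
have Fe := F_le n; have GF := (Hm n).2.
have key : `|G n| <= `|G n - F n (m n)| + `|F n (m n)|.
  by rewrite -{1}(subrK (F n (m n)) (G n)); exact: ler_normD.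
apply: (le_trans key); rewrite kE in Se.
exact: (budget eps0 Se Fe GF he).
Qed.

(** The mollified energies are compared at the times t and 0 alone, so convergence of the
    mollification at each fixed time is enough on the left of the balance, and the vanishing flux
    settles the right. *)
Lemma sqnorm_conserved t : 0 <= t <= T -> sqnorm (W t) = sqnorm (W 0).
Proof.
move=> tT; have t0 : 0 <= t by have /andP[] := tT.
have L1 : ip (W t) (mollify (Kn n) (W t)) - ip (W 0) (mollify (Kn n) (W 0)) @[n --> \oo] --> sqnorm (W t) - sqnorm (W 0).
  by apply: cvgB; exact: ip_mollify_cvg.
have L2 : ip (W t) (mollify (Kn n) (W t)) - ip (W 0) (mollify (Kn n) (W 0)) @[n --> \oo] --> (0 : R).
  have -> : (fun n => ip (W t) (mollify (Kn n) (W t)) - ip (W 0) (mollify (Kn n) (W 0))) =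
      (fun n => 2 * time_int T (fun tau => window 0 t tau * flux (Kn n) (W tau) (W tau))).
    by apply/funext => n; exact: (energy_balance eW (mKn n) (en0 n) (en1 n) tT).2.
  exact: (cvg_scale0 2 (flux_vanishes t0)).
by apply/eqP; rewrite -subr_eq0; apply/eqP; exact: (cvg_unique _ L1 L2).
Qed.

End Conservation.

Theorem theorem9 (R : realType) (T : R) (u : R -> E3 R -> E3 R) :
  0 < T ->
  weak_solution T u ->
  bulk_condition T u ->
  (exists2 delta : R, 0 < delta & continuous_near_boundary T delta u) ->
  forall t : R, 0 <= t <= T -> L2norm Dplus (u t) = L2norm Dplus (u 0).
Proof.
move=> T0 wu bulk [delta delta0 [v [v3 uv]]] t tT.
have [C C0 [en [Kn [en0 en1 en_lim mKn]]]] := mollifier_sequence R.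
have T00 : 0 <= (0 : R) <= T by rewrite lexx ltW.
have H := sqnorm_conserved T0 wu C0 en0 en1 en_lim mKn bulk delta0 v3 uv tT.
rewrite (L2norm_ext (wu.1.1 t tT).1) (L2norm_ext (wu.1.1 0 T00).1).
by move: H; rewrite /ext_path (clamp_id tT) (clamp_id T00) => ->.
Qed.
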